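(* Let $\varepsilon\neq0$ and let $\mathbf u=\mathbf z+\mathbf v\in H^2(\mathbb R)\oplus H^2_{\rm per}(0,T)$ be a nondegenerate multipulse solution (as described in the context) of $A_\varepsilon\mathbf u+\mathcal N_\varepsilon(\mathbf u,\cdot)=0$. Then there exists $N\in\mathbb N$ such that for all $n\in\mathbb N$ with $n\ge N$ there exists an $nT$-periodic solution $\mathbf u_n$ of $A_\varepsilon\mathbf u+\mathcal N_\varepsilon(\mathbf u,\cdot)=0$ given by $$\mathbf u_n(x)=\chi_n(x)\mathbf u(x)+(1-\chi_n(x))\mathbf v(x)+\mathbf a_n(x),\qquad x\in[-\tfrac n2T,\tfrac n2T),$$ where $\{\mathbf a_n\}_n$ is a sequence with $\mathbf a_n\in H^2_{\rm per}(0,nT)$ satisfying $\|\mathbf a_n\|_{H^2_{\rm per}(0,nT)}\to0$ as $n\to\infty$. If $\mathbf u$ is strongly spectrally stable, then so is $\mathbf u_n$. Moreover, if $\mathbf u$ is spectrally unstable, then so is $\mathbf u_n$.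
   Context: Let $T,d,a,m>0$, $f\in C^1(\mathbb R)$ real-valued, $T$-periodic and odd, $g\in C^1(\mathbb R)$ real-valued, $T$-periodic and even. Klausmeier system for $\mathbf u=(w,p)^\top\in\mathbb R^2$: $\partial_t\mathbf u=A_\varepsilon\mathbf u+\mathcal N_\varepsilon(\mathbf u,x)$ with $$A_\varepsilon=\begin{pmatrix}\partial_x^2+\varepsilon f\partial_x&0\\0&d^2\partial_x^2\end{pmatrix},\qquad\mathcal N_\varepsilon\Big(\begin{pmatrix}w\\ p\end{pmatrix},x\Big)=\begin{pmatrix}\varepsilon g(x)w-w-wp^2+a\\-mp+wp^2\end{pmatrix}.$$ For $\underline{\mathbf u}\in L^\infty(\mathbb R,\mathbb R^2)$, $L_\varepsilon(\underline{\mathbf u})=A_\varepsilon+\partial_{\mathbf u}\mathcal N_\varepsilon(\underline{\mathbf u},\cdot)$ on (complex $2$-vector-valued) $L^2(\mathbb R)$ with domain $H^2(\mathbb R)$. $\underline{\mathbf u}$ is: nondegenerate if $L_\varepsilon(\underline{\mathbf u})$ is invertible; strongly spectrally stable if $\sigma(L_\varepsilon(\underline{\mathbf u}))\subset\{\operatorname{Re}\lambda\le-\varrho\}$ for some $\varrho>0$; spectrally unstable if some $\lambda\in\sigma(L_\varepsilon(\underline{\mathbf u}))$ has $\operatorname{Re}\lambda>0$; spectrally stable with simple eigenvalue $0$ if $\sigma(L_\varepsilon(\underline{\mathbf u}))\subset\{\operatorname{Re}\lambda\le-\varrho\}\cup\{0\}$ for some $\varrho>0$ and $0$ is an eigenvalue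 of algebraic multiplicity one. $H^2_{\rm per}(0,L)$: $L$-periodic, locally $H^2$ functions with the $H^2(0,L)$-norm. Primary pulses. Let $\mathbf u_0=\mathbf z_0+\mathbf v_0\in H^2(\mathbb R)\oplus\mathbb R^2$ be an even solution of $A_0\mathbf u+\mathcal N_0(\mathbf u,\cdot)=0$, spectrally stable with simple eigenvalue $0$, such that $\mathcal M=\int_{\mathbb R}(f'\partial_x\mathbf u_{01}+g'\mathbf u_{01})\Psi_{{\rm ad}1}\,dx\ne0$, where $\Psi_{\rm ad}\in H^2(\mathbb R)$ spans $\ker L_0(\mathbf u_0)^*$ with $\langle\partial_x\mathbf u_0,\Psi_{\rm ad}\rangle_{L^2}=1$ (subscript $1$: first component). Then there are $C,\varepsilon_0,\eta>0$ such that for $0<|\varepsilon|<\varepsilon_0$ there is a nondegenerate even solution $\mathbf u(\varepsilon)=\mathbf z(\varepsilon)+\mathbf v(\varepsilon)\in H^2(\mathbb R)\oplus H^2_{\rm per}(0,T)$ of $A_\varepsilon\mathbf u+\mathcal N_\varepsilon(\mathbf u,\cdot)=0$ with $\|\mathbf u(\varepsilon)-\mathbf u_0\|_{L^\infty}\le C|\varepsilon|$, $\|\mathbf v(\varepsilon)-\mathbf v_0\|_{H^2_{\rm per}(0,T)}\le C|\varepsilon|$ and $\sigma(L_\varepsilon(\mathbf u(\varepsilon)))\subset\{\operatorname{Re}\lambda\le-\eta\}\cup\{\lambda_0(\varepsilon)\}$, $\lambda_0(\varepsilon)=-\varepsilon\mathcal M+\mathcal O(\varepsilon^2)$ being a real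 simple eigenvalue. Multipulses. For fixed such $\varepsilon$ and $M\in\mathbb N$, there is $N_0$ such that for each $\tilde n\ge N_0$ there is a nondegenerate solution $\mathbf a_{\tilde n}+\sum_{j=1}^M\chi_{j,\tilde n}\mathbf u(\varepsilon)(\cdot-j\tilde nT)$ of the stationary equation with $\mathbf a_{\tilde n}\in H^2(\mathbb R)$, $\|\mathbf a_{\tilde n}\|_{H^2}\to0$ as $\tilde n\to\infty$; here $\chi_{j,\tilde n}$, $j=1,\dots,M$, is a smooth partition of unity with $n$-uniformly bounded $W^{2,\infty}$-norms, $\chi_{1,\tilde n}$ supported on $(-\infty,\frac32\tilde nT+1)$, $\chi_{M,\tilde n}$ on $((M-\frac12)\tilde nT-1,\infty)$, $\chi_{j,\tilde n}$ on $((j-\frac12)\tilde nT-1,(j+\frac12)\tilde nT+1)$ for $2\le j\le M-1$ (and $\chi_{1,\tilde n}\equiv1$ if $M=1$). The multipulse $\mathbf u$ of the claim is one of these solutions (fixed $M$, $\tilde n$); its periodic background is $\mathbf v=\mathbf v(\varepsilon)$. For each (sufficiently large) $n$, $\chi_n:\mathbb R\to[0,1]$ is a smooth $nT$-periodic cut-off with $\|\chi_n\|_{W^{2,\infty}}\le1$ (maximum of sup norms of derivatives of order $\le2$), $\chi_n=1$ on $[-\frac n6T,\frac n6T]$, $\chi_n=0$ on $[-\frac n2T,-\frac n3T]\cup[\frac n3T,\frac n2T]$. *)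

(* Defs.v *)
From HB Require Import structures.
From mathcomp Require Import all_boot all_order all_algebra.
From mathcomp Require Import all_classical all_reals all_analysis.
From mathcomp Require Import complex.

Set Implicit Arguments.
Unset Strict Implicit.
Unset Printing Implicit Defensive.

Import Order.TTheory GRing.Theory Num.Theory.
Import numFieldNormedType.Exports.

Local Open Scope classical_set_scope.
Local Open Scope ring_scope.
Local Open Scope complex_scope.

(* Elements of R^2 and C^2 are pairs, fields are functions on the line.  An
   element of H^2 (or of H^2_loc) is represented by its continuous
   representative, so that pointwise identities between such functions are
   meaningful; identities in L^2 are stated almost everywhere. *)

Section FunctionSpaces.
Variable R : realType.
Local Notation mu := (@lebesgue_measure R).

Definition C1 (h : R -> R) : Prop :=
  (forall x, derivable h x 1) /\ continuous (derive1 h).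

Definition smooth (h : R -> R) : Prop :=
  forall k x, derivable (derive1n k h) x 1.

Definition even_fun (V : Type) (h : R -> V) : Prop := forall x, h (- x) = h x.

Definition odd_fun (h : R -> R) : Prop := forall x, h (- x) = - h x.

(* Test functions of class C^1_c, as is customary on the line; C^oo_c gives the
   same notion by mollification. *)
Definition is_weak_derivative (h k : R -> R) : Prop :=
  [/\ locally_integrable setT h, locally_integrable setT k &
      forall phi : R -> R, C1 phi ->
        (exists r : R, forall x : R, r < `|x| -> phi x = 0) ->
        \int[mu]_x (h x * derive1 phi x) = - \int[mu]_x (k x * phi x)].

Definition weakly_derivable (h : R -> R) : Prop :=
  exists k, is_weak_derivative h k.

(* The weak derivative is unique up to a null set; wD picks a version, and is
   the zero function when there is none. *)
Definition wD (h : R -> R) : R -> R :=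
  xget (fun=> 0) [set k | is_weak_derivative h k].

Definition L2 (D : set R) (h : R -> R) : Prop :=
  measurable_fun D h /\ mu.-integrable D (fun x => (h x ^+ 2)%:E).

Definition twice_weakly_derivable (h : R -> R) : Prop :=
  [/\ continuous h, weakly_derivable h & weakly_derivable (wD h)].

Definition H2 (D : set R) (h : R -> R) : Prop :=
  [/\ twice_weakly_derivable h, L2 D h, L2 D (wD h) & L2 D (wD (wD h))].

Definition all2c (P : (R -> R) -> Prop) (u : R -> R * R) : Prop :=
  P (fun x => (u x).1) /\ P (fun x => (u x).2).

Definition H2line (u : R -> R * R) : Prop := all2c (H2 setT) u.

(* H^2_per(0,L): L-periodic functions which are twice weakly differentiable on
   the whole line (also across the points of L Z). *)
Definition H2per (L : R) (u : R -> R * R) : Prop :=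
  periodic u L /\ all2c (H2 `]0, L[%classic) u.

Definition wDv (u : R -> R * R) (x : R) : R * R :=
  (wD (fun y => (u y).1) x, wD (fun y => (u y).2) x).

Definition sqnorm (v : R * R) : R := v.1 ^+ 2 + v.2 ^+ 2.

Definition H2norm (D : set R) (u : R -> R * R) : R :=
  Num.sqrt (\int[mu]_(x in D)
    (sqnorm (u x) + sqnorm (wDv u x) + sqnorm (wDv (wDv u) x))).

Definition H2per_norm (L : R) (u : R -> R * R) : R := H2norm `]0, L[%classic u.

Definition all4c (P : (R -> R) -> Prop) (phi : R -> R[i] * R[i]) : Prop :=
  [/\ P (fun x => complex.Re (phi x).1), P (fun x => complex.Im (phi x).1),
      P (fun x => complex.Re (phi x).2) & P (fun x => complex.Im (phi x).2)].

Definition cL2 (phi : R -> R[i] * R[i]) : Prop := all4c (L2 setT) phi.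

Definition cH2 (phi : R -> R[i] * R[i]) : Prop := all4c (H2 setT) phi.

Definition cwD (h : R -> R[i]) (x : R) : R[i] :=
  wD (fun y => complex.Re (h y)) x +i* wD (fun y => complex.Im (h y)) x.

Definition cintegral (h : R -> R[i]) : R[i] :=
  (\int[mu]_x complex.Re (h x)) +i* (\int[mu]_x complex.Im (h x)).

Definition cdot (phi psi : R -> R[i] * R[i]) : R[i] :=
  cintegral (fun x => (phi x).1 * ((psi x).1)^* + (phi x).2 * ((psi x).2)^*).

Definition cL2norm (phi : R -> R[i] * R[i]) : R :=
  Num.sqrt (\int[mu]_x
    (complex.Re (phi x).1 ^+ 2 + complex.Im (phi x).1 ^+ 2
     + (complex.Re (phi x).2 ^+ 2 + complex.Im (phi x).2 ^+ 2))).

Definition complexify (u : R -> R * R) (x : R) : R[i] * R[i] :=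
  ((u x).1%:C, (u x).2%:C).

End FunctionSpaces.

(* Spectral theory of an operator A on L^2(R, C^2) with domain H^2(R, C^2). *)

Section Spectrum.
Variable R : realType.
Local Notation mu := (@lebesgue_measure R).
Local Notation field := (R -> R[i] * R[i]).
Variable A : field -> field.

Definition shifted (lam : R[i]) (phi : field) (x : R) : R[i] * R[i] :=
  ((A phi x).1 - lam * (phi x).1, (A phi x).2 - lam * (phi x).2).

(* A - lam : H^2 -> L^2 is bijective, with inverse bounded on L^2. *)
Definition resolvent_set (lam : R[i]) : Prop :=
  [/\ forall psi, cL2 psi -> exists2 phi, cH2 phi &
        {ae mu, forall x, shifted lam phi x = psi x},
      forall phi, cH2 phi -> {ae mu, forall x, shifted lam phi x = (0, 0)} ->
        forall x, phi x = (0, 0) &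
      exists K : R, forall phi, cH2 phi ->
        cL2norm phi <= K * cL2norm (shifted lam phi)].

Definition spectrum (lam : R[i]) : Prop := ~ resolvent_set lam.

Definition invertible : Prop := resolvent_set 0.

(* ker (A - lam)^k, with its natural domain *)
Fixpoint gen_kernel (lam : R[i]) (k : nat) (phi : field) : Prop :=
  if k is k'.+1 then
    cH2 phi /\ exists2 psi, gen_kernel lam k' psi &
      {ae mu, forall x, shifted lam phi x = psi x}
  else forall x, phi x = (0, 0).

(* The union of the spaces ker (A - lam)^k is one-dimensional. *)
Definition simple_eigenvalue (lam : R[i]) : Prop :=
  exists phi0 : field,
    [/\ exists k, gen_kernel lam k phi0,
        exists x, phi0 x <> (0, 0) &
        forall k phi, gen_kernel lam k phi -> exists c : R[i],
          forall x, phi x = (c * (phi0 x).1, c * (phi0 x).2)].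

(* psi lies in the domain of the adjoint of A and A^* psi = 0. *)
Definition adjoint_kernel (psi : field) : Prop :=
  cL2 psi /\ forall phi, cH2 phi -> cdot (A phi) psi = 0.

Definition strongly_spectrally_stable : Prop :=
  exists2 rho : R, 0 < rho &
    forall lam, spectrum lam -> complex.Re lam <= - rho.

Definition spectrally_unstable : Prop :=
  exists2 lam, spectrum lam & 0 < complex.Re lam.

Definition stable_with_simple_zero : Prop :=
  (exists2 rho : R, 0 < rho &
     forall lam, spectrum lam -> complex.Re lam <= - rho \/ lam = 0)
  /\ simple_eigenvalue 0.

End Spectrum.

Record klausmeier (R : realType) := Klausmeier {
  kT : R; kd : R; ka : R; km : R;
  kf : R -> R; kg : R -> R;
  kT_gt0 : 0 < kT; kd_gt0 : 0 < kd; ka_gt0 : 0 < ka; km_gt0 : 0 < km;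
  kf_C1 : C1 kf; kf_per : periodic kf kT; kf_odd : odd_fun kf;
  kg_C1 : C1 kg; kg_per : periodic kg kT; kg_even : even_fun kg
}.

Section Klausmeier.
Variables (R : realType) (K : klausmeier R).
Local Notation mu := (@lebesgue_measure R).
Local Notation T := (kT K).
Local Notation d := (kd K).
Local Notation a := (ka K).
Local Notation m := (km K).
Local Notation f := (kf K).
Local Notation g := (kg K).

Definition linear_part (eps : R) (u : R -> R * R) (x : R) : R * R :=
  let w y := (u y).1 in let p y := (u y).2 in
  (wD (wD w) x + eps * f x * wD w x, d ^+ 2 * wD (wD p) x).

Definition reaction (eps : R) (v : R * R) (x : R) : R * R :=
  let: (w, p) := v in
  (eps * g x * w - w - w * p ^+ 2 + a, - m * p + w * p ^+ 2).

Definition stationary (eps : R) (u : R -> R * R) : Prop :=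
  all2c (@twice_weakly_derivable R) u /\
  {ae mu, forall x, linear_part eps u x + reaction eps (u x) x = 0}.

Definition clinear_part (eps : R) (phi : R -> R[i] * R[i]) (x : R) :
    R[i] * R[i] :=
  let w y := (phi y).1 in let p y := (phi y).2 in
  (cwD (cwD w) x + (eps * f x)%:C * cwD w x, (d ^+ 2)%:C * cwD (cwD p) x).

(* Entry (i, j) of the Jacobian matrix of v |-> reaction eps v x. *)
Definition dreaction11 eps (v : R * R) x : R :=
  derive1 (fun s : R => (reaction eps (s, v.2) x).1) v.1.
Definition dreaction12 eps (v : R * R) x : R :=
  derive1 (fun s : R => (reaction eps (v.1, s) x).1) v.2.
Definition dreaction21 eps (v : R * R) x : R :=
  derive1 (fun s : R => (reaction eps (s, v.2) x).2) v.1.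
Definition dreaction22 eps (v : R * R) x : R :=
  derive1 (fun s : R => (reaction eps (v.1, s) x).2) v.2.

Definition linearization (eps : R) (u : R -> R * R)
    (phi : R -> R[i] * R[i]) (x : R) : R[i] * R[i] :=
  clinear_part eps phi x +
  ((dreaction11 eps (u x) x)%:C * (phi x).1
     + (dreaction12 eps (u x) x)%:C * (phi x).2,
   (dreaction21 eps (u x) x)%:C * (phi x).1
     + (dreaction22 eps (u x) x)%:C * (phi x).2).

Definition nondegenerate (eps : R) (u : R -> R * R) : Prop :=
  invertible (linearization eps u).

(* Psi is complex-valued a priori; as the linearization has real coefficients,
   the normalization below forces it to be real. *)
Definition melnikov (u0 : R -> R * R) (Psi : R -> R[i] * R[i]) : R[i] :=
  cintegral (fun x =>
    (derive1 f x * (wDv u0 x).1 + derive1 g x * (u0 x).1)%:C * (Psi x).1).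

Record primary_pulse (z0 : R -> R * R) (v0 : R * R) (u0 : R -> R * R)
    (Psi : R -> R[i] * R[i]) : Prop := PrimaryPulse {
  pp_H2 : H2line z0;
  pp_split : forall x, u0 x = z0 x + v0;
  pp_even : even_fun u0;
  pp_stationary : stationary 0 u0;
  pp_stable : stable_with_simple_zero (linearization 0 u0);
  pp_adjoint_H2 : cH2 Psi;
  pp_adjoint_kernel : adjoint_kernel (linearization 0 u0) Psi;
  pp_adjoint_span : forall psi, adjoint_kernel (linearization 0 u0) psi ->
    exists c : R[i],
      {ae mu, forall x, psi x = (c * (Psi x).1, c * (Psi x).2)};
  pp_adjoint_norm : cdot (complexify (wDv u0)) Psi = 1;
  pp_melnikov : melnikov u0 Psi != 0
}.

Record primary_branch (v0 : R * R) (u0 : R -> R * R) (Psi : R -> R[i] * R[i])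
    (C eps0 eta : R) (Z V U : R -> R -> R * R) (lam0 : R -> R) : Prop :=
  PrimaryBranch {
  pb_C_gt0 : 0 < C;
  pb_eps0_gt0 : 0 < eps0;
  pb_eta_gt0 : 0 < eta;
  pb_H2 : forall e, 0 < `|e| < eps0 -> H2line (Z e);
  pb_H2per : forall e, 0 < `|e| < eps0 -> H2per T (V e);
  pb_split : forall e, 0 < `|e| < eps0 -> forall x, U e x = Z e x + V e x;
  pb_even : forall e, 0 < `|e| < eps0 -> even_fun (U e);
  pb_stationary : forall e, 0 < `|e| < eps0 -> stationary e (U e);
  pb_nondegenerate : forall e, 0 < `|e| < eps0 -> nondegenerate e (U e);
  pb_close : forall e, 0 < `|e| < eps0 ->
    forall x, `|U e x - u0 x| <= C * `|e|;
  pb_background : forall e, 0 < `|e| < eps0 ->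
    H2per_norm T (fun x => V e x - v0) <= C * `|e|;
  pb_spectrum : forall e, 0 < `|e| < eps0 ->
    forall lam, spectrum (linearization e (U e)) lam ->
      complex.Re lam <= - eta \/ lam = (lam0 e)%:C;
  pb_simple : forall e, 0 < `|e| < eps0 ->
    simple_eigenvalue (linearization e (U e)) (lam0 e)%:C;
  pb_expansion : exists B delta : R, 0 < delta /\
    forall e, 0 < `|e| < eps0 -> `|e| < delta ->
      `|(lam0 e)%:C - (- e%:C * melnikov u0 Psi)| <= (B * e ^+ 2)%:C
}.

(* chi j n is the j-th member (1 <= j <= M) of the partition of unity at
   spacing n T. *)
Record pulse_partition (M N0 : nat) (chi : nat -> nat -> R -> R) : Prop :=
  PulsePartition {
  pu_smooth : forall n j, (N0 <= n)%N -> (1 <= j <= M)%N -> smooth (chi j n);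
  pu_ge0 : forall n j, (N0 <= n)%N -> (1 <= j <= M)%N ->
    forall x, 0 <= chi j n x;
  pu_sum : forall n, (N0 <= n)%N ->
    forall x, \sum_(1 <= j < M.+1) chi j n x = 1;
  pu_bound : exists B : R, forall n j k, (N0 <= n)%N -> (1 <= j <= M)%N ->
    (k <= 2)%N -> forall x, `|derive1n k (chi j n) x| <= B;
  pu_first : (1 < M)%N -> forall n, (N0 <= n)%N -> forall x,
    chi 1%N n x != 0 -> x < 3 / 2 * n%:R * T + 1;
  pu_last : (1 < M)%N -> forall n, (N0 <= n)%N -> forall x,
    chi M n x != 0 -> (M%:R - 2^-1) * n%:R * T - 1 < x;
  pu_middle : forall n j, (N0 <= n)%N -> (2 <= j)%N -> (j < M)%N -> forall x,
    chi j n x != 0 ->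
    (j%:R - 2^-1) * n%:R * T - 1 < x < (j%:R + 2^-1) * n%:R * T + 1
}.

Definition multipulse (M : nat) (U : R -> R * R)
    (b : nat -> R -> R * R) (chi : nat -> nat -> R -> R)
    (n : nat) (x : R) : R * R :=
  b n x + \sum_(1 <= j < M.+1) chi j n x *: U (x - (j * n)%:R * T).

Record multipulse_family (eps : R) (U : R -> R * R) (M N0 : nat)
    (b : nat -> R -> R * R) (chi : nat -> nat -> R -> R) : Prop :=
  MultipulseFamily {
  mp_M_gt0 : (0 < M)%N;
  mp_partition : pulse_partition M N0 chi;
  mp_H2 : forall n, (N0 <= n)%N -> H2line (b n);
  mp_small : (fun n => H2norm setT (b n)) @ \oo --> (0 : R);
  mp_stationary : forall n, (N0 <= n)%N ->
    stationary eps (multipulse M U b chi n);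
  mp_nondegenerate : forall n, (N0 <= n)%N ->
    nondegenerate eps (multipulse M U b chi n)
}.

Record periodic_cutoff (n : nat) (chi : R -> R) : Prop := PeriodicCutoff {
  pc_range : forall x, 0 <= chi x <= 1;
  pc_smooth : smooth chi;
  pc_periodic : periodic chi (n%:R * T);
  pc_bound : forall k, (k <= 2)%N -> forall x, `|derive1n k chi x| <= 1;
  pc_one : forall x, `|x| <= n%:R / 6 * T -> chi x = 1;
  pc_zero : forall x, n%:R / 3 * T <= `|x| <= n%:R / 2 * T -> chi x = 0
}.

End Klausmeier.

(* Main.v *)
Require Import Defs.
From mathcomp Require Import all_boot all_order all_algebra.
From mathcomp Require Import all_classical all_reals all_analysis.
From mathcomp Require Import measurable_realfun complex zify ring lra.

Import Order.TTheory GRing.Theory Num.Theory.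
Import numFieldNormedType.Exports.
Local Open Scope classical_set_scope.
Local Open Scope ring_scope.

Set Implicit Arguments.
Unset Strict Implicit.
Unset Printing Implicit Defensive.

(** If the linearization L(w) is invertible and w' looks, on long windows, like translates of w, then
    L(w') is invertible: the translated inverses of L(w), cut off and summed, form a parametrix with
    small error.
    The same parametrix acts on nT-periodic right-hand sides. Applied to the profile that interpolates
    between u and its periodic background v, whose residual tends to 0 in L^2, it makes the equation for
    a_n a contraction.

    On windows of fixed length, u_n and u are close to translates of each other, so that resolvent
    bounds pass from u to u_n and back. Stability follows because the resolvent of L(u) is bounded
    uniformly on a half-plane, by compactness and an energy estimate for large parameters.

    For instability, v is a limit of translates of the primary pulse, so that L(v) - lambda is
    invertible for all lambda in the right half-plane except possibly lambda_0. As u - v vanishes at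
    infinity, L(u) - lambda differs there from an invertible operator by one of finite rank (sampling
    at finitely many nodes), and the spectrum of L(u) is the zero set of a holomorphic determinant;
    hence some unstable spectral point is isolated. If L(u_n) had no unstable spectrum, the maximum
    principle on a small square around that point would bound the resolvent of L(u_n) at its center
    uniformly in n, and the point would belong to the resolvent set of L(u). *)

(** The obstacle is that [un n] need not approach [u] in norm on the line; only the picture in
    bounded windows converges, up to translation by periods. Hence the transfer results fix the
    window radius, the tolerance and the new constant from the old constant and from bounds on the
    leading and first-order coefficients alone. This makes them uniform in [n] and in the spectral
    parameter, and usable in both directions. Fixed points are sought for the datum fed to the
    parametrix, not for the solution: a datum needs only measurability and a squared norm, and
    regularity comes from the parametrix. Squared norms contract by 1/16; the linear error and the
    nonlinearity contribute 1/64 each, and a sum costs a factor 2. For instability, a resolvent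
    bound of [un n] at the unstable point of [u] could blow up with [n]. The maximum principle
    excludes this: the bound on the boundary of the square comes from [u], while the bound inside
    the square may depend on [n] without entering the result. *)

(** * Nonnegative integrals and null sets on the line *)

Section NonnegativeIntegrals.
Variable R : realType.
Local Notation mu := (@lebesgue_measure R).
Implicit Types (g h k : R -> R) (D : set R).

Definition mf g := measurable_fun [set: R] g.

(** Extended-real values let monotonicity, additivity and monotone convergence hold for nonnegative
    integrands without integrability hypotheses. *)
Definition qi D g : \bar R := (\int[mu]_(x in D) (g x)%:E)%E.

Lemma mf_EFin D g : mf g -> measurable_fun D (EFin \o g).
Proof. by move=> mg; apply/measurable_EFinP; apply: measurable_funTS. Qed.

Lemma mf_cont g : continuous g -> mf g.
Proof. by move=> cg; exact: continuous_measurable_fun. Qed.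

Lemma mf_shift g (c : R) : mf g -> mf (fun x => g (x + c)).
Proof.
move=> mg; apply: (measurableT_comp mg).
by apply: mf_cont => x; apply: cvgD; [exact: cvg_id|exact: cvg_cst].
Qed.

(** Lebesgue measure is determined by its values on half-open intervals, where translation
    invariance is a computation. *)
Lemma pushforward_shift (c : R) (A : set R) : measurable A ->
  pushforward mu (fun x : R => (x + c : measurableTypeR R)) A = mu A.
Proof.
have mS : measurable_fun [set: R] (fun x : R => (x + c : measurableTypeR R)).
  by apply: mf_cont => x; apply: cvgD; [exact: cvg_id|exact: cvg_cst].
move=> mA; apply/esym/(@lebesgue_measure_unique _ (pushforward mu (fun x : R => (x + c : measurableTypeR R)))) => //= _ [[a b]] _ <-.
rewrite /pushforward.
have -> : (fun x : R => x + c) @^-1` `]a, b]%classic = `]a - c, b - c]%classic.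
  by apply/seteqP; split => x /=; rewrite !in_itv/= ltrBlDr lerBrDr.
rewrite !lebesgue_measure_itv/= !lte_fin ltrD2r.
by case: ifP => // _; rewrite -!EFinB; congr (_%:E); ring.
Qed.

Lemma ae_imp (P Q : R -> Prop) : {ae mu, forall x, P x} ->
  (forall x, P x -> Q x) -> {ae mu, forall x, Q x}.
Proof.
move=> [N [mN N0 sN]] PQ; exists N; split => // x nQ.
by apply: sN => /= Px; apply: nQ; exact: PQ.
Qed.

Lemma ae_and (P Q : R -> Prop) : {ae mu, forall x, P x} ->
  {ae mu, forall x, Q x} -> {ae mu, forall x, P x /\ Q x}.
Proof.
move=> [N [mN N0 sN]] [M [mM M0 sM]]; exists (N `|` M).
split; [exact: measurableU|exact: null_set_setU|].
move=> x /= /not_andP[nP|nQ]; [left; exact: sN|right; exact: sM].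
Qed.

Lemma ae_nat (P : nat -> R -> Prop) : (forall n, {ae mu, forall x, P n x}) ->
  {ae mu, forall x, forall n, P n x}.
Proof.
move=> H; have := negligible_bigcup H; apply: negligibleS => x /= nP.
by move/existsNP : nP => [n nPn]; exists n.
Qed.

Lemma ae_all (P : R -> Prop) : (forall x, P x) -> {ae mu, forall x, P x}.
Proof.
move=> H; exists set0; split => // x nP; exfalso; exact: nP.
Qed.

Lemma ae_shift (P : R -> Prop) (c : R) : {ae mu, forall x, P x} ->
  {ae mu, forall x, P (x + c)}.
Proof.
have mS : measurable_fun [set: R] (fun x : R => (x + c : measurableTypeR R)).
  by apply: mf_cont => x; apply: cvgD; [exact: cvg_id|exact: cvg_cst].
move=> [N [mN N0 sN]]; exists ((fun x => x + c) @^-1` N); split.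
- by rewrite -[X in measurable X]setTI; exact: mS.
- by rewrite -[RHS]N0 -[RHS](pushforward_shift c mN).
- by move=> x /= h; apply: sN.
Qed.

Lemma qi_ge0 D g : (forall x, 0 <= g x) -> (0 <= qi D g)%E.
Proof. by move=> g0; apply: integral_ge0 => x _; rewrite lee_fin. Qed.

Lemma qi_le D g h : measurable D -> mf g -> mf h -> (forall x, 0 <= g x) ->
  (forall x, D x -> g x <= h x) -> (qi D g <= qi D h)%E.
Proof.
move=> mD mg mh g0 gh; apply: ge0_le_integral => //.
all: try exact: mf_EFin.
all: try by move=> x Dx; rewrite lee_fin ?gh.
Qed.

Lemma qi_le_ae D g h : measurable D -> mf g -> mf h -> (forall x, 0 <= g x) ->
  (forall x, 0 <= h x) ->
  {ae mu, forall x, D x -> g x <= h x} -> (qi D g <= qi D h)%E.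
Proof.
move=> mD mg mh g0 h0 gh; apply: ae_ge0_le_integral => //.
all: try exact: mf_EFin.
all: try by move=> x _; rewrite lee_fin.
Qed.

Lemma qi_eq D g h : (forall x, D x -> g x = h x) -> qi D g = qi D h.
Proof. by move=> gh; apply: eq_integral => x; rewrite inE => /gh ->. Qed.

Lemma qi_eq_ae D g h : measurable D -> mf g -> mf h -> (forall x, 0 <= g x) ->
  (forall x, 0 <= h x) ->
  {ae mu, forall x, g x = h x} -> qi D g = qi D h.
Proof.
move=> mD mg mh g0 h0 gh; apply/eqP; rewrite eq_le.
by rewrite !qi_le_ae//; apply: (ae_imp gh) => x ->.
Qed.

Lemma qiD D g h : measurable D -> mf g -> mf h -> (forall x, 0 <= g x) ->
  (forall x, 0 <= h x) -> qi D (fun x => g x + h x) = (qi D g + qi D h)%E.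
Proof.
move=> mD mg mh g0 h0; rewrite /qi -ge0_integralD//.
all: try exact: mf_EFin.
all: try by move=> x _; rewrite lee_fin.
Qed.

Lemma qi_sum (I : Type) (s : seq I) D (g : I -> R -> R) : measurable D ->
  (forall i, mf (g i)) -> (forall i x, 0 <= g i x) ->
  qi D (fun x => \sum_(i <- s) g i x) = (\sum_(i <- s) qi D (g i))%E.
Proof.
move=> mD mg g0; rewrite /qi -ge0_integral_sum//.
- by apply: eq_integral => x _; rewrite sumEFin.
- by move=> i; exact: mf_EFin.
- by move=> i x _; rewrite lee_fin.
Qed.

Lemma qiZ D g (c : R) : measurable D -> mf g -> (forall x, 0 <= g x) ->
  0 <= c -> qi D (fun x => c * g x) = (c%:E * qi D g)%E.
Proof.
move=> mD mg g0 c0; rewrite /qi -ge0_integralZl_EFin//.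
all: try exact: mf_EFin.
all: try by move=> x _; rewrite lee_fin.
Qed.

Lemma qi_sub D D' g : measurable D -> measurable D' -> mf g ->
  (forall x, 0 <= g x) -> D `<=` D' -> (qi D g <= qi D' g)%E.
Proof.
move=> mD mD' mg g0 DD; apply: ge0_subset_integral => //; first exact: mf_EFin.
by move=> x _; rewrite lee_fin.
Qed.

Lemma qi_subT D g : measurable D -> mf g -> (forall x, 0 <= g x) ->
  (qi D g <= qi setT g)%E.
Proof. by move=> *; apply: qi_sub. Qed.

Lemma qi_cat (a b c : R) g : a <= b -> b <= c -> mf g -> (forall x, 0 <= g x) ->
  qi `[a, c[ g = (qi `[a, b[ g + qi `[b, c[ g)%E.
Proof.
move=> ab bc mg g0; rewrite /qi.
rewrite (@itv_bndbnd_setU _ _ (BLeft a) (BLeft b) (BLeft c)) ?bnd_simp//.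
rewrite ge0_integral_setU//.
all: try exact: mf_EFin.
all: try by move=> x _; rewrite lee_fin.
apply/disj_setPS => y [/=]; rewrite !in_itv/= => /andP[_ yb] /andP[by_ _].
  by move: yb; rewrite ltNge by_.
Qed.

Lemma qi_oc (a b : R) g : mf g -> qi `[a, b] g = qi `[a, b[ g.
Proof.
move=> mg; rewrite /qi -(@integral_itv_bndo_bndc _ (BLeft a) b)//.
exact: mf_EFin.
Qed.

Lemma qi_shift D g (c : R) : measurable D -> mf g -> (forall x, 0 <= g x) ->
  qi ((fun x => x + c) @^-1` D) (fun x => g (x + c)) = qi D g.
Proof.
move=> mD mg g0.
have mS : measurable_fun [set: measurableTypeR R]
    (fun x : measurableTypeR R => (x + c : measurableTypeR R)).
  by apply: mf_cont => x; apply: cvgD; [exact: cvg_id|exact: cvg_cst].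
rewrite /qi -[LHS](ge0_integral_pushforward mS mu mD (f := EFin \o g)).
- by apply: eq_measure_integral => A mA _; exact: pushforward_shift.
- exact: mf_EFin.
- by move=> x _ /=; rewrite lee_fin.
Qed.

Lemma qi_shiftT g (c : R) : mf g -> (forall x, 0 <= g x) ->
  qi setT (fun x => g (x + c)) = qi setT g.
Proof. by move=> mg g0; rewrite -[RHS](qi_shift c)// preimage_setT. Qed.

Lemma qi_shift_itv g (a b c : R) : mf g -> (forall x, 0 <= g x) ->
  qi `[a, b[ (fun x => g (x + c)) = qi `[a + c, b + c[ g.
Proof.
move=> mg g0; rewrite -[RHS](qi_shift c)//; congr (qi _ _).
by apply/seteqP; split => x /=; rewrite !in_itv/= lerD2r ltrD2r.
Qed.

Definition box (n : nat) : set R := `[- n%:R, n%:R[%classic.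

(** Monotone convergence along the boxes: a bound on the line may be checked on bounded sets, where
    boundary terms and finite sums are available. *)
Lemma qi_setT_le g (M : \bar R) : mf g -> (forall x, 0 <= g x) ->
  (forall n : nat, (qi (box n) g <= M)%E) -> (qi setT g <= M)%E.
Proof.
move=> mg g0 H.
have U : \bigcup_n box n = [set: R].
  apply/seteqP; split => // x _; exists (Num.truncn `|x|).+1 => //=.
  by have := truncnS_gt `|x|; rewrite /box/= in_itv/= ltr_norml => /andP[/ltW -> ->].
have nd : nondecreasing_seq box.
  move=> m n mn; apply/subsetPset => x; rewrite /box/= !in_itv/= => /andP[h1 h2].
  have : (m%:R : R) <= n%:R by rewrite ler_nat.
  by move=> ?; apply/andP; split; lra.
have C : qi (box n) g @[n --> \oo] --> qi setT g.
  rewrite -U; apply: ge0_nondecreasing_set_cvg_integral => //.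
  - by move=> i; exact: measurable_itv.
  - by move=> i; exact: (mf_EFin mg).
  - by move=> i x _; rewrite lee_fin.
rewrite -(cvg_lim _ C)//; apply: lime_le; first exact: cvgP C.
by apply: nearW => n; exact: H.
Qed.

End NonnegativeIntegrals.

(** * Locally integrable functions and their primitives *)

Section Primitives.
Variable R : realType.
Local Notation mu := (@lebesgue_measure R).
Implicit Types (g h k : R -> R) (D : set R).

Definition lint k : Prop :=
  mf k /\ forall a b : R, (qi `[a, b[ (fun x => `|k x|)%R < +oo)%E.

Definition itg (a b : R) k : R := \int[mu]_(x in `[a, b]) k x.

(** Local absolute continuity with density [k]. This is the working form of the weak derivative: it
    implies it, and is implied by it after a change of [h] on a null set. *)
Definition prim h k : Prop :=
  lint k /\ forall a b, a <= b -> h b - h a = itg a b k.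

Lemma near_dist (x e : R) (P : R -> Prop) : 0 < e ->
  (forall y, `|y - x| < e -> P y) -> \forall y \near x, P y.
Proof. by move=> e0 H; exists e => //= y; rewrite /ball_/= distrC; exact: H. Qed.

Lemma mf_norm k : mf k -> mf (fun x => `|k x|).
Proof. by move=> mk; apply: (measurableT_comp _ mk). Qed.

Lemma mfD g k : mf g -> mf k -> mf (fun x => g x + k x).
Proof. by move=> mg mk; exact: measurable_funD. Qed.

Lemma mfM g k : mf g -> mf k -> mf (fun x => g x * k x).
Proof. by move=> mg mk; exact: measurable_funM. Qed.

Lemma mfN k : mf k -> mf (fun x => - k x).
Proof. by move=> mk; apply: (measurableT_comp _ mk). Qed.

Lemma mfB g k : mf g -> mf k -> mf (fun x => g x - k x).
Proof. by move=> mg mk; exact: measurable_funB. Qed.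

Lemma mf_cst (c : R) : mf (fun=> c).
Proof. exact: measurable_cst. Qed.

Lemma mfX k n : mf k -> mf (fun x => k x ^+ n).
Proof. by move=> mk; exact: measurable_funX. Qed.

Lemma mf_sum (I : Type) (s : seq I) (k : I -> R -> R) :
  (forall i, mf (k i)) -> mf (fun x => \sum_(i <- s) k i x).
Proof.
move=> mk; elim: s => [|i s IH].
  by under eq_fun do rewrite big_nil; exact: mf_cst.
by under eq_fun do rewrite big_cons; apply: mfD.
Qed.

Lemma lint_fin k (a b : R) : lint k -> (qi `[a, b] (fun x => `|k x|)%R < +oo)%E.
Proof. by move=> [mk kf]; rewrite qi_oc//; exact: mf_norm. Qed.

Lemma lint_int k (a b : R) : lint k -> mu.-integrable `[a, b] (EFin \o k).
Proof.
move=> lk; apply/integrableP; split; first by apply: mf_EFin; case: lk.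
exact: (lint_fin a b lk).
Qed.

Lemma int_lint k : mf k -> (forall n : nat, (qi (box n) (fun x => `|k x|)%R < +oo)%E) ->
  lint k.
Proof.
move=> mk H; split => // a b.
pose n := (Num.truncn (`|a| + `|b|)).+1.
apply: le_lt_trans (H n); apply: (qi_sub _ _ (mf_norm mk)) => //.
  exact: measurable_itv.
have := truncnS_gt (`|a| + `|b|); rewrite -/n => hn x.
rewrite /box/= !in_itv/= => /andP[ax xb].
have := ler_norm b; have := lerNnormlW (lexx `|a|).
have : 0 <= `|b| by []. have : 0 <= `|a| by [].
by move=> *; apply/andP; split; lra.
Qed.

Lemma lint_norm k : lint k -> lint (fun x => `|k x|).
Proof.
move=> [mk kf]; split; first exact: mf_norm.
move=> a b; rewrite (qi_eq (h := fun x => `|k x|)) => [|x _]; last exact: normr_id.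
exact: kf.
Qed.

Lemma lintD g k : lint g -> lint k -> lint (fun x => g x + k x).
Proof.
move=> [mg gf] [mk kf]; split; first exact: mfD.
move=> a b; apply: (@le_lt_trans _ _ (qi `[a, b[ (fun x => `|g x| + `|k x|))).
  apply: qi_le => //; [|apply: mfD; exact: mf_norm|].
    by apply: mf_norm; exact: mfD.
  by move=> x _; exact: ler_normD.
by rewrite qiD//; [exact: lte_add_pinfty|exact: mf_norm|exact: mf_norm].
Qed.

Lemma lintZ k (c : R) : lint k -> lint (fun x => c * k x).
Proof.
move=> [mk kf]; split; first by apply: mfM => //; exact: mf_cst.
move=> a b; rewrite (qi_eq (h := fun x => `|c| * `|k x|)) => [|x _]; last exact: normrM.
rewrite qiZ//; last exact: mf_norm.
have := kf a b; have := @qi_ge0 R `[a, b[ (fun x => `|k x|) (fun x => normr_ge0 _).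
by case: (qi _ _) => // r r0 _; rewrite -EFinM ltry.
Qed.

Lemma lintN k : lint k -> lint (fun x => - k x).
Proof.
move=> lk; have := lintZ (-1) lk.
by under eq_fun do rewrite mulN1r.
Qed.

Lemma lintB g k : lint g -> lint k -> lint (fun x => g x - k x).
Proof. by move=> lg lk; apply: lintD => //; exact: lintN. Qed.

Lemma lint_cst (c : R) : lint (fun=> c).
Proof.
split; first exact: mf_cst.
move=> a b; rewrite /qi integral_cst//= lebesgue_measure_itv/=.
by case: ifP => _; rewrite ?mule0// -EFinB -EFinM ltry.
Qed.

Lemma continuous_bound g (a b : R) : continuous g ->
  exists2 C, 0 <= C & forall x, a <= x <= b -> `|g x| <= C.
Proof.
move=> cg; have [ab|ba] := leP a b; last first.
  by exists 0 => // x /andP[ax xb]; lra.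
have cn : {within `[a, b], continuous (fun x => `|g x|)}.
  by apply: continuous_subspaceT => x; apply: continuous_comp (cg x) _; exact: norm_continuous.
by have [c _ H] := EVT_max ab cn; exists `|g c|.
Qed.

Lemma lintM g k : continuous g -> lint k -> lint (fun x => g x * k x).
Proof.
move=> cg [mk kf]; split; first by apply: mfM => //; exact: mf_cont.
move=> a b; have [C C0 HC] := @continuous_bound g a b cg.
apply: (@le_lt_trans _ _ (qi `[a, b[ (fun x => C * `|k x|))).
  apply: qi_le => //.
  - by apply: mf_norm; apply: mfM => //; exact: mf_cont.
  - by apply: mfM; [exact: mf_cst|exact: mf_norm].
  move=> x; rewrite /= in_itv/= normrM => /andP[ax /ltW xb].
  by apply: ler_wpM2r => //; apply: HC; rewrite ax.
rewrite qiZ//; last exact: mf_norm.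
have := kf a b; have := @qi_ge0 R `[a, b[ (fun x => `|k x|) (fun x => normr_ge0 _).
by case: (qi _ _) => // r r0 _; rewrite -EFinM ltry.
Qed.

Lemma lint_cont g : continuous g -> lint g.
Proof.
move=> cg; have := lintM cg (lint_cst 1).
by under eq_fun do rewrite mulr1.
Qed.

Lemma lint_shift k (c : R) : lint k -> lint (fun x => k (x + c)).
Proof.
move=> [mk kf]; split; first exact: mf_shift.
by move=> a b; rewrite (@qi_shift_itv _ (fun x => `|k x|))//; exact: mf_norm.
Qed.

Lemma lint_loc k : lint k -> locally_integrable setT k.
Proof.
move=> lk; split; [by case: lk|exact: openT|] => A _ cA.
have [M [_ HM]] := compact_bounded cA.
have bA x : A x -> - (`|M| + 1) <= x <= `|M| + 1.
  move=> Ax; have := HM (`|M| + 1); rewrite (le_lt_trans (ler_norm M)) ?ltrDl//.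
  by move=> /(_ isT x Ax) /=; rewrite ler_norml.
apply: le_lt_trans (lint_fin (- (`|M| + 1)) (`|M| + 1) lk).
apply: (@qi_sub R A `[- (`|M| + 1), `|M| + 1] (fun x => `|k x|)) => //.
- exact: compact_measurable.
- by apply: mf_norm; case: lk.
Qed.

Lemma loc_lint k : locally_integrable setT k -> lint k.
Proof.
move=> [mk _ H]; split => // a b; rewrite -qi_oc; last exact: mf_norm.
by apply: H => //; exact: segment_compact.
Qed.

Lemma itg_cat k (a b c : R) : lint k -> a <= b -> b <= c ->
  itg a c k = itg a b k + itg b c k.
Proof.
move=> lk ab bc; rewrite /itg.
have := @Rintegral_itvB R k (BLeft a) (BRight c) b (lint_int a c lk).
rewrite !bnd_simp => /(_ ab bc) /eqP; rewrite subr_eq => /eqP ->.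
rewrite addrC Rintegral_itv_obnd_cbnd//.
apply: integrableS (lint_int b c lk) => // x; rewrite /= !in_itv/=.
by move=> /andP[/ltW -> ->].
Qed.

Lemma itgD g k (a b : R) : lint g -> lint k ->
  itg a b (fun x => g x + k x) = itg a b g + itg a b k.
Proof. by move=> lg lk; apply: RintegralD => //; exact: lint_int. Qed.

Lemma itgZ k (c a b : R) : lint k -> itg a b (fun x => c * k x) = c * itg a b k.
Proof. by move=> lk; apply: RintegralZl => //; exact: lint_int. Qed.

Lemma itgB g k (a b : R) : lint g -> lint k ->
  itg a b (fun x => g x - k x) = itg a b g - itg a b k.
Proof. by move=> lg lk; apply: RintegralB => //; exact: lint_int. Qed.

Lemma itg_le g k (a b : R) : lint g -> lint k ->
  (forall x, a <= x <= b -> g x <= k x) -> itg a b g <= itg a b k.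
Proof.
move=> lg lk gk; by apply: le_Rintegral => //; exact: lint_int.
Qed.

Lemma itg_norm k (a b : R) : lint k -> `|itg a b k| <= itg a b (fun x => `|k x|).
Proof. by move=> lk; apply: le_normr_Rintegral => //; exact: lint_int. Qed.

Lemma itg_ge0 k (a b : R) : (forall x, 0 <= k x) -> 0 <= itg a b k.
Proof. by move=> k0; apply: Rintegral_ge0. Qed.

Lemma itg_cst (c a b : R) : a <= b -> itg a b (fun=> c) = c * (b - a).
Proof.
move=> ab; rewrite /itg Rintegral_cst//= lebesgue_measure_itv/= lte_fin.
by case: ltP => //= ba; rewrite (@le_anti _ _ a b) ?ab// subrr.
Qed.

Lemma itg_eq g k (a b : R) : (forall x, a <= x <= b -> g x = k x) ->
  itg a b g = itg a b k.
Proof.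
by move=> gk; apply: eq_Rintegral => x; rewrite inE/= in_itv/=; exact: gk.
Qed.

Lemma itg_qi k (a b : R) : lint k -> (forall x, 0 <= k x) ->
  (itg a b k)%:E = qi `[a, b[ k.
Proof.
move=> lk k0; rewrite -qi_oc; last by case: lk.
rewrite /itg /Rintegral fineK// ge0_fin_numE ?integral_ge0//.
  have := lint_fin a b lk; rewrite (qi_eq (h := k)) => // x _.
  exact: ger0_norm.
by move=> x _; rewrite lee_fin.
Qed.

Lemma itg_ae g k (a b : R) : mf g -> mf k -> {ae mu, forall x, g x = k x} ->
  itg a b g = itg a b k.
Proof.
move=> mg mk gk; rewrite /itg /Rintegral; congr fine.
apply: ae_eq_integral => //; [exact: mf_EFin..|].
by apply: (ae_imp gk) => x -> _.
Qed.

Lemma prim_exists k (c : R) : lint k -> exists2 h, prim h k & h 0 = c.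
Proof.
move=> lk; pose h x := c + if 0 <= x then itg 0 x k else - itg x 0 k.
have i0 (a : R) : itg a a k = 0 by rewrite /itg set_itv1 Rintegral_set1.
exists h; last by rewrite /h lexx i0 addr0.
split => // a b ab; rewrite /h.
have [a0|a0] := leP 0 a; have [b0|b0] := leP 0 b.
- by rewrite (itg_cat lk a0 ab); lra.
- lra.
- by rewrite (itg_cat lk (ltW a0) b0); lra.
- by rewrite (itg_cat lk ab (ltW b0)); lra.
Qed.

Lemma primD h1 k1 h2 k2 : prim h1 k1 -> prim h2 k2 ->
  prim (fun x => h1 x + h2 x) (fun x => k1 x + k2 x).
Proof.
move=> [l1 H1] [l2 H2]; split; first exact: lintD.
by move=> a b ab; rewrite itgD// -H1// -H2//; ring.
Qed.

Lemma primZ h k (c : R) : prim h k -> prim (fun x => c * h x) (fun x => c * k x).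
Proof.
move=> [l1 H1]; split; first exact: lintZ.
by move=> a b ab; rewrite itgZ// -H1//; ring.
Qed.

Lemma primB h1 k1 h2 k2 : prim h1 k1 -> prim h2 k2 ->
  prim (fun x => h1 x - h2 x) (fun x => k1 x - k2 x).
Proof.
move=> [l1 H1] [l2 H2]; split; first exact: lintB.
by move=> a b ab; rewrite itgB// -H1// -H2//; ring.
Qed.

Lemma prim_cst (c : R) : prim (fun=> c) (fun=> 0).
Proof.
split; first exact: lint_cst.
by move=> a b ab; rewrite itg_cst// mul0r subrr.
Qed.

Lemma prim_ae h k k' : prim h k -> mf k' -> {ae mu, forall x, k x = k' x} ->
  prim h k'.
Proof.
move=> [[mk kf] H] mk' kk; split; last first.
  by move=> a b ab; rewrite H//; exact: itg_ae.
split => // a b; apply: le_lt_trans (kf a b).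
by apply: qi_le_ae => //; [exact: mf_norm..|]; apply: (ae_imp kk) => x ->.
Qed.

Lemma prim_le h k (a b : R) : prim h k -> a <= b ->
  `|h b - h a| <= itg a b (fun x => `|k x|).
Proof. by move=> [lk H] ab; rewrite H//; exact: itg_norm. Qed.

Lemma prim_cont h k : prim h k -> continuous h.
Proof.
move=> [lk H] x.
have cx := parameterized_integral_continuous (_ : x - 1 <= x + 1) (lint_int (x - 1) (x + 1) lk).
have {cx} : {within `[x - 1, x + 1], continuous (fun y => itg (x - 1) y k)}.
  by apply: cx; lra.
have lt1 : x - 1 < x + 1 by lra.
move=> /(continuous_within_itvP _ lt1) [+ _ _] => /(_ x).
rewrite in_itv/= => /(_ _) cx.
have {}cx : itg (x - 1) y k @[y --> x] --> itg (x - 1) x k by apply: cx; lra.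
rewrite /continuous_at.
have -> : h x = h (x - 1) + itg (x - 1) x k by rewrite -H; lra.
apply: (@cvg_trans _ ((h (x - 1) + itg (x - 1) y k) @[y --> x])); last first.
  exact: (cvgD (cvg_cst _) cx).
apply: near_eq_cvg; near=> y; rewrite -H; first by ring.
near: y; apply: (@near_dist _ 1) => // y.
by rewrite ltr_norml => /andP[? ?]; lra.
Unshelve. all: by end_near. Qed.

Lemma prim_shift h k (c : R) : prim h k ->
  prim (fun x => h (x + c)) (fun x => k (x + c)).
Proof.
move=> hk; have [lk H] := hk; split; first exact: lint_shift.
have [P PP _] := prim_exists 0 (lint_norm lk).
move=> a b ab; rewrite H ?lerD2r//.
(* Translation invariance is available for nonnegative integrands, hence the splitting of 2k into
   |k| + k minus |k| - k. *)
pose kp := fun x => (`|k x| + k x); pose kn := fun x => (`|k x| - k x).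
have lp : lint kp by apply: lintD => //; exact: lint_norm.
have ln : lint kn by apply: lintB => //; exact: lint_norm.
have p0 x : 0 <= kp x by rewrite /kp; have := lerNnormlW (lexx `|k x|); lra.
have n0 x : 0 <= kn x by rewrite /kn; have := ler_norm (k x); lra.
have sh g : lint g -> (forall x, 0 <= g x) ->
    itg a b (fun x => g (x + c)) = itg (a + c) (b + c) g.
  move=> lg g0; apply: EFin_inj; rewrite itg_qi//; last exact: lint_shift.
  by rewrite itg_qi//; apply: qi_shift_itv => //; case: lg.
have e x : k x = 2^-1 * (kp x - kn x) by rewrite /kp /kn; lra.
rewrite (@itg_eq (fun x => k (x + c)) (fun x => 2^-1 * (kp (x + c) - kn (x + c)))); last first.
  by move=> x _; exact: e.
rewrite (@itg_eq k (fun x => 2^-1 * (kp x - kn x))); last by move=> x _; exact: e.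
have lps : lint (fun x => kp (x + c)) by exact: lint_shift.
have lns : lint (fun x => kn (x + c)) by exact: lint_shift.
rewrite !itgZ; [|exact: lintB..].
by rewrite (itgB _ _ lp ln) (itgB _ _ lps lns) !sh.
Qed.

Lemma prim_C1 h k : (forall x, is_derive x (1 : R) h (k x)) -> continuous k ->
  prim h k.
Proof.
move=> dh ck; split; first exact: lint_cont.
move=> a b; rewrite le_eqVlt => /predU1P[->|ab].
  by rewrite subrr /itg set_itv1 Rintegral_set1.
have ch : continuous h.
  by move=> x; apply: differentiable_continuous; apply/derivable1_diffP.
have := @continuous_FTC2 R k h a b ab (continuous_subspaceT ck).
rewrite /itg /Rintegral => -> //.
  split; first by move=> x _.
  - by apply: cvg_at_right_filter; exact: ch.
  - by apply: cvg_at_left_filter; exact: ch.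
by move=> x _; rewrite derive1E derive_val.
Qed.

(** The bound on increments is of second order: over N equal pieces the right-hand sides telescope
    to (b - a)(G b - G a)/N, which tends to 0. *)
Lemma subdivision_eq (q G : R -> R) (a b : R) : a <= b ->
  (forall x y, a <= x -> x <= y -> y <= b ->
    `|q y - q x| <= (y - x) * (G y - G x)) -> q a = q b.
Proof.
move=> ab H.
have key (N : nat) : (0 < N)%N -> `|q b - q a| <= (b - a) * (G b - G a) / N%:R.
  move=> N0; have N1 : 0 < N%:R :> R by rewrite ltr0n.
  pose t := (b - a) / N%:R; pose x (i : nat) := a + i%:R * t.
  have t0 : 0 <= t by rewrite /t divr_ge0// ?subr_ge0//; lra.
  have xN : x N = b by rewrite /x /t; field; rewrite gt_eqF.
  have ind i : (i <= N)%N -> `|q (x i) - q a| <= t * (G (x i) - G a).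
    elim: i => [|i IH] iN; first by rewrite /x mul0r addr0 !subrr normr0 mulr0.
    have /IH {}IH : (i <= N)%N by exact: ltnW.
    have xS : x i.+1 - x i = t by rewrite /x -natr1; ring.
    have xi : a <= x i by rewrite /x lerDl mulr_ge0.
    have xi1 : x i.+1 <= b.
      by rewrite -xN /x lerD2l ler_wpM2r// ler_nat.
    have := H _ _ xi _ xi1; rewrite xS => /(_ _) H1.
    have {}H1 : `|q (x i.+1) - q (x i)| <= t * (G (x i.+1) - G (x i)) by apply: H1; lra.
    have -> : q (x i.+1) - q a = (q (x i.+1) - q (x i)) + (q (x i) - q a) by ring.
    by apply: (le_trans (ler_normD _ _)); apply: (le_trans (lerD H1 IH)); lra.
  have := ind N (leqnn N); rewrite xN; move/le_trans; apply.
  by rewrite /t mulrAC.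
apply/eqP; rewrite eq_sym -subr_eq0 -normr_le0; apply/ler_addgt0Pr => e e0.
rewrite add0r; set X := (b - a) * (G b - G a) in key.
have := truncnS_gt (`|X| / e); set N := (Num.truncn _).+1 => hN.
apply: (le_trans (key N isT)); rewrite ler_pdivrMr ?ltr0n//.
move: hN; rewrite ltr_pdivrMr// => hN.
by have := ler_norm X; lra.
Qed.

(** The density [k] need not be continuous, so the product rule is not pointwise. Instead, the
    difference between the product and a primitive of the expected density is shown to have
    second-order increments, measured by a primitive [A] of |k|, and is then constant by
    [subdivision_eq]. *)
Lemma prim_mul h k (p p1 : R -> R) : prim h k ->
  (forall x, is_derive x (1 : R) p (p1 x)) -> continuous p1 ->
  prim (fun x => p x * h x) (fun x => p1 x * h x + p x * k x).
Proof.
move=> hk dp cp1; have ch := prim_cont hk; have [lk H] := hk.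
have pp := prim_C1 dp cp1; have cp := prim_cont pp; have [lp1 Hp] := pp.
have lkk : lint (fun x => p1 x * h x + p x * k x).
  apply: lintD; last exact: lintM.
  by apply: lint_cont => x; apply: cvgM; [exact: cp1|exact: ch].
have [P [_ HP] _] := prim_exists 0 lkk.
have [A [lA HA] _] := prim_exists 0 (lint_norm lk).
split => // a b ab; rewrite -HP//.
have [C C0 HC] := @continuous_bound p1 a b cp1.
suff : p a * h a - P a = p b * h b - P b by lra.
apply: (@subdivision_eq (fun x => p x * h x - P x) (fun x => 2 * C * A x) a b ab).
move=> x y ax xy yb.
have pb s : x <= s -> s <= y -> `|p y - p s| <= C * (y - x).
  move=> xs sy; rewrite Hp//; apply: (le_trans (itg_norm _ _ lp1)).
  apply: (@le_trans _ _ (itg s y (fun=> C))).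
    apply: itg_le; [exact: lint_norm|exact: lint_cst|].
    by move=> z /andP[sz zy]; apply: HC; apply/andP; split; lra.
  by rewrite itg_cst//; apply: ler_wpM2l => //; lra.
have hb s : x <= s -> s <= y -> `|h s - h x| <= A y - A x.
  move=> xs sy; apply: (le_trans (prim_le hk xs)).
  rewrite -HA//; have := HA s y sy.
  by have := @itg_ge0 (fun x => `|k x|) s y (fun x => normr_ge0 _); lra.
have l1 : lint (fun s => p y * k s) by exact: lintZ.
have l2 : lint (fun s => h x * p1 s) by exact: lintZ.
have -> : (p y * h y - P y) - (p x * h x - P x) =
    itg x y (fun s => (p y * k s + h x * p1 s) - (p1 s * h s + p s * k s)).
  rewrite (itgB _ _ (lintD l1 l2) lkk) (itgD _ _ l1 l2) (itgZ _ _ _ lk) (itgZ _ _ _ lp1).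
  by rewrite -H// -Hp// -HP//; ring.
have l3 : lint (fun s => p y * k s + h x * p1 s - (p1 s * h s + p s * k s)).
  by apply: lintB => //; exact: lintD.
apply: (le_trans (itg_norm _ _ l3)).
have -> : (y - x) * (2 * C * A y - 2 * C * A x) =
    C * (y - x) * itg x y (fun s => `|k s|) + C * (A y - A x) * (y - x).
  by rewrite -HA//; ring.
rewrite -(itg_cst (C * (A y - A x)) xy) -(itgZ (C * (y - x)) x y (lint_norm lk)).
have l4 : lint (fun s => C * (y - x) * `|k s|) by apply: lintZ; exact: lint_norm.
rewrite -(itgD _ _ l4 (lint_cst _)).
apply: itg_le; [exact: lint_norm|by apply: lintD => //; exact: lint_cst|].
move=> s /andP[xs sy].
(* Each product carries one small factor: [p y - p s] is at most C(y - x), and [h s - h x] at most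
   [A y - A x]. Integration supplies the other one. *)
have -> : p y * k s + h x * p1 s - (p1 s * h s + p s * k s) =
   (p y - p s) * k s - p1 s * (h s - h x) by ring.
apply: (le_trans (ler_normB _ _)); rewrite !normrM; apply: lerD.
  by apply: ler_wpM2r => //; exact: pb.
by apply: ler_pM => //; [apply: HC; apply/andP; split; lra|exact: hb].
Qed.

(** Both clauses of [prim] concern bounded intervals; measurability of [k] on the line holds because
    it is the pointwise limit of its local models. *)
Lemma prim_box h k : (forall n : nat, exists h' k', prim h' k' /\
    forall x, box n x -> h x = h' x /\ k x = k' x) -> prim h k.
Proof.
move=> H.
have bb (x : R) (n : nat) : `|x| < n%:R -> box n x.
  by rewrite /box/= in_itv/= ltr_norml => /andP[/ltW -> ->].
have bx (x : R) : exists n, box n x.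
  exists (Num.truncn `|x|).+1; apply: bb; exact: truncnS_gt.
have /choice[K HK] : forall n : nat, exists k', lint k' /\ forall x, box n x -> k x = k' x.
  by move=> n; have [h' [k' [[lk _] e]]] := H n; exists k'; split => // x /e[].
have lk : lint k.
  apply: int_lint => [|n].
    apply: (@measurable_fun_cvg _ _ _ _ K) => [m|x _]; first by have [[]] := HK m.
    apply: (@cvg_trans _ (k x @[n --> \oo])); last exact: cvg_cst.
    apply: near_eq_cvg; exists (Num.truncn `|x|).+1 => //= n hn.
    apply: (proj2 (HK n)); apply: bb; apply: lt_le_trans (truncnS_gt _) _.
    by rewrite ler_nat.
  have [[mK KK] e] := HK n; rewrite (qi_eq (h := fun x => `|K n x|)); last first.
    by move=> x /e ->.
  exact: KK.
split => // a b ab.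
pose n := (Num.truncn (`|a| + `|b|)).+1.
have hn := truncnS_gt (`|a| + `|b|); rewrite -/n in hn.
have inb x : a <= x <= b -> box n x.
  move=> /andP[ax xb]; apply: bb; apply: le_lt_trans hn; rewrite ler_norml.
  have := ler_norm b; have := lerNnormlW (lexx `|a|).
  have : 0 <= `|b| by []. have : 0 <= `|a| by [].
  by move=> *; apply/andP; split; lra.
have [h' [k' [[lk' H'] e]]] := H n.
rewrite (proj1 (e b _)) ?(proj1 (e a _)); [|apply: inb; lra..].
by rewrite H'//; apply: itg_eq => x /inb/e[].
Qed.

(** Lebesgue differentiation applies to the integral from a fixed base point. The countably many
    base points -n are used together, so that each x lies to the right of one of them. *)
Lemma prim_ae_derive h k : prim h k ->
  {ae mu, forall x, is_derive x (1 : R) h (k x)}.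
Proof.
move=> [lk H].
have F n := @FTC1 R k (BLeft (- n%:R)) (fun y => lint_int (- n%:R) y lk) (lint_loc lk).
have := ae_nat F; move=> /ae_imp; apply => x Hx.
pose n := (Num.truncn `|x|).+1.
have hn : - n%:R < x.
  by have := truncnS_gt `|x|; rewrite -/n; have := lerNnormlW (lexx `|x|); lra.
have [|d e] := Hx n; first by rewrite /= lte_fin.
have D : is_derive x (1 : R) (fun y => itg (- n%:R) y k) (k x).
  by split; [exact: d|rewrite -derive1E; exact: e].
have D2 : is_derive x (1 : R) (fun y => h (- n%:R) + itg (- n%:R) y k) (0 + k x).
  by apply: is_deriveD.
rewrite add0r in D2; apply: near_eq_is_derive D2.
near=> y; rewrite -H; first by ring.
near: y; apply: (@near_dist _ (x + n%:R)) => [|y]; first lra.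
by rewrite ltr_norml => /andP[? ?]; lra.
Unshelve. all: by end_near. Qed.

Lemma prim_uniq h k k' : prim h k -> prim h k' -> {ae mu, forall x, k x = k' x}.
Proof.
move=> /prim_ae_derive H /prim_ae_derive H'.
apply: (ae_imp (ae_and H H')) => x [[_ d] [_ d']].
by rewrite -d -d'.
Qed.

End Primitives.

(** * Weak derivatives and the class H^2_loc *)

Section WeakDerivatives.
Variable R : realType.
Local Notation mu := (@lebesgue_measure R).
Implicit Types (g h k : R -> R) (D : set R).

Lemma prim_derive h k : prim h k -> continuous k ->
  forall x, is_derive x (1 : R) h (k x).
Proof.
move=> [lk H] ck x.
have x1 : x < x + 1 by lra.
have x2 : ((x - 1)%:E < x%:E)%E by rewrite lte_fin; lra.
have [d e] := @continuous_FTC1 R k (BLeft (x - 1)) x (x + 1) x1 (lint_int (x - 1) (x + 1) lk) x2 (ck x).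
have D : is_derive x (1 : R) (fun y => itg (x - 1) y k) (k x).
  by split; [exact: d|rewrite -derive1E; exact: e].
have D2 : is_derive x (1 : R) (fun y => h (x - 1) + itg (x - 1) y k) (0 + k x).
  by apply: is_deriveD.
rewrite add0r in D2; apply: near_eq_is_derive D2.
apply: (@near_dist _ _ 1) => // y; rewrite ltr_norml => /andP[? ?].
by rewrite -H; lra.
Qed.

Lemma is_derive_uniq (f : R -> R) (x a b : R) :
  is_derive x (1 : R) f a -> is_derive x (1 : R) f b -> a = b.
Proof. by move=> [_ <-] [_ <-]. Qed.

Lemma is_derive_shift (f : R -> R) (x c a : R) :
  is_derive (x + c) (1 : R) f a -> is_derive x (1 : R) (fun y => f (y + c)) a.
Proof.
move=> fa; have d : is_derive x (1 : R) (fun y : R => y + c) (1 + 0).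
  by apply: is_deriveD.
have := @is_derive1_comp R f (fun y : R => y + c) x a (1 + 0) fa d.
by rewrite addr0 mulr1.
Qed.

(** Almost equal functions share their primitives, and a continuous density is recovered from a
    primitive by differentiation at every point. *)
Lemma continuous_ae_eq g h : continuous g -> continuous h ->
  {ae mu, forall x, g x = h x} -> forall x, g x = h x.
Proof.
move=> cg ch gh x.
have [G PG _] := prim_exists 0 (lint_cont cg).
have PG' := prim_ae PG (mf_cont ch) gh.
exact: is_derive_uniq (prim_derive PG cg x) (prim_derive PG' ch x).
Qed.

Lemma ae_exists (P : R -> Prop) : {ae mu, forall x, P x} -> exists x, P x.
Proof.
move=> [N [mN N0 sN]]; apply: contrapT => /forallNP nP.
have : (mu `[0%R, 1%R]%classic <= mu N)%E.
  apply: le_measure; rewrite ?inE//.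
  by move=> x _; apply: sN => /= Px; exact: (nP x).
by rewrite N0 lebesgue_measure_itv/= lte_fin ltr01 -EFinB subr0 lee_fin ler10.
Qed.

Lemma Rintegral_itg (r : R) (f : R -> R) : (forall x : R, r < `|x| -> f x = 0) ->
  \int[mu]_x f x = itg (- r) r f.
Proof.
move=> f0; rewrite /itg [RHS]Rintegral_mkcond; apply: eq_Rintegral => x _.
rewrite patchE; case: ifPn => //; rewrite notin_setE/= in_itv/= => xr.
apply: f0; rewrite ltNge ler_norml; exact/negP.
Qed.

(** Integration by parts is the product rule [prim_mul] on an interval at whose ends the test
    function vanishes. *)
Lemma weak_prim h k : prim h k -> is_weak_derivative h k.
Proof.
move=> hk; have [lk _] := hk; have ch := prim_cont hk; split.
- by apply: lint_loc; exact: lint_cont.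
- exact: lint_loc.
(* The given radius may be negative, and [phi] is only known to vanish beyond it; the enlarged
   radius makes both boundary terms zero. *)
move=> phi [dphi cphi] [r0 Hr0]; pose r := `|r0| + 1.
have Hr x : r <= `|x| -> phi x = 0.
  by move=> rx; apply: Hr0; have := ler_norm r0; rewrite /r in rx *; lra.
have Dphi x : is_derive x (1 : R) phi (derive1 phi x).
  by split; [exact: dphi|rewrite derive1E].
have Hr' x : r < `|x| -> derive1 phi x = 0.
  move=> rx; apply: is_derive_uniq (Dphi x) _.
  apply: (@near_eq_is_derive _ _ _ (fun=> 0)).
  apply: (@near_dist _ _ (`|x| - r)) => [|y yx]; first lra.
  apply/esym/Hr; have := ler_normD y (x - y); rewrite (_ : y + (x - y) = x); last ring.
  by rewrite (distrC x); lra.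
have lH : lint (fun x => h x * derive1 phi x).
  by apply: lint_cont => x; apply: cvgM; [exact: ch|exact: cphi].
have cp : continuous phi by exact: prim_cont (prim_C1 Dphi cphi).
have lK : lint (fun x => phi x * k x) by exact: lintM.
rewrite (@Rintegral_itg r) => [|x rx]; last by rewrite Hr' ?mulr0.
rewrite (@Rintegral_itg r) => [|x rx]; last by rewrite Hr ?mulr0// ltW.
have [lpm Hpm] := prim_mul hk Dphi cphi.
have r0' : - r <= r by rewrite /r; have := normr_ge0 r0; lra.
have rn : `|r| = r by rewrite ger0_norm// /r; have := normr_ge0 r0; lra.
have := Hpm _ _ r0'; rewrite !Hr ?normrN ?rn// !mul0r subr0.
rewrite itgD//; last by apply: lint_cont => x; apply: cvgM; [exact: cphi|exact: ch].
rewrite (@itg_eq _ (fun x => h x * derive1 phi x) (fun x => derive1 phi x * h x)) => [|x _]; last exact: mulrC.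
rewrite (@itg_eq _ (fun x => k x * phi x) (fun x => phi x * k x)) => [|x _]; last exact: mulrC.
lra.
Qed.

Definition clamp01 (t : R) : R := (`|t| - `|t - 1| + 1) / 2.

Lemma clamp01_le0 t : t <= 0 -> clamp01 t = 0.
Proof. by move=> t0; rewrite /clamp01 !ler0_norm; lra. Qed.

Lemma clamp01_ge1 t : 1 <= t -> clamp01 t = 1.
Proof. by move=> t0; rewrite /clamp01 !ger0_norm; lra. Qed.

Lemma clamp01_01 t : 0 <= clamp01 t <= 1.
Proof.
have [t0|t0] := leP t 0; first by rewrite clamp01_le0// lexx ler01.
have [t1|t1] := leP 1 t; first by rewrite clamp01_ge1// lexx ler01.
by rewrite /clamp01 ger0_norm ?ler0_norm; lra.
Qed.

Lemma clamp01_cont : continuous clamp01.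
Proof.
move=> t; apply: cvgM; last exact: cvg_cst.
apply: cvgD; last exact: cvg_cst.
apply: cvgB; first exact: norm_continuous.
apply: (@continuous_comp _ _ _ (fun t : R => t - 1) (fun t : R => `|t|)).
  by apply: cvgB; [exact: cvg_id|exact: cvg_cst].
exact: norm_continuous.
Qed.

(** A continuous approximation of the indicator of [a, b], with ramps of length [e] starting at [a]
    and at [b]; its primitives are admissible C^1 functions. *)
Definition trapezoid (a b e t : R) : R :=
  clamp01 ((t - a) / e) - clamp01 ((t - b) / e).

Lemma trapezoid_cont (a b e : R) : continuous (trapezoid a b e).
Proof.
have H c : continuous (fun t : R => clamp01 ((t - c) / e)).
  move=> t; apply: (@continuous_comp _ _ _ (fun t : R => (t - c) / e) clamp01).
    apply: cvgM; last exact: cvg_cst.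
    by apply: cvgB; [exact: cvg_id|exact: cvg_cst].
  exact: clamp01_cont.
by move=> t; apply: cvgB; exact: H.
Qed.

Lemma trapezoid_out (a b e t : R) : 0 < e -> a <= b -> t <= a \/ b + e <= t ->
  trapezoid a b e t = 0.
Proof.
move=> e0 ab [ta|bt]; rewrite /trapezoid.
  by rewrite !clamp01_le0 ?subrr// pmulr_lle0 ?invr_gt0//; lra.
by rewrite !clamp01_ge1 ?subrr// ler_pdivlMr//; lra.
Qed.

Lemma trapezoid_itg g (a b e r : R) : lint g -> 0 < e -> a + e <= b ->
  - r <= a -> b + e <= r ->
  `|itg (- r) r (fun t => g t * trapezoid a b e t) - itg a b g| <=
  itg a (a + e) (fun t => `|g t|) + itg b (b + e) (fun t => `|g t|).
Proof.
move=> lg e0 aeb ra br.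
have lT : lint (fun t => g t * trapezoid a b e t).
  have := lintM (@trapezoid_cont a b e) lg.
  by congr lint; apply/funext => x; rewrite mulrC.
have zero c d : (forall t, c <= t <= d -> trapezoid a b e t = 0) ->
    itg c d (fun t => g t * trapezoid a b e t) = 0.
  move=> H; rewrite (@itg_eq _ _ (fun=> 0 * 0)) => [|x /H ->]; last by rewrite mulr0 mul0r.
  by rewrite itgZ ?mul0r//; exact: lint_cst.
have T1 t : `|trapezoid a b e t| <= 1.
  have /andP[? ?] := clamp01_01 ((t - a) / e); have /andP[? ?] := clamp01_01 ((t - b) / e).
  by rewrite /trapezoid ler_norml; apply/andP; split; lra.
rewrite (@itg_cat _ _ (- r) a r)//; last lra.
rewrite zero ?add0r; last by move=> t /andP[_ ta]; apply: trapezoid_out => //; [lra|left].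
rewrite (@itg_cat _ _ a (a + e) r)//; [|lra|lra].
rewrite (@itg_cat _ _ (a + e) b r)//; last lra.
rewrite (@itg_cat _ _ b (b + e) r)//; last lra.
rewrite (zero (b + e) r) ?addr0; last by move=> t /andP[bt _]; apply: trapezoid_out => //; [lra|right].
have -> : itg (a + e) b (fun t => g t * trapezoid a b e t) = itg (a + e) b g.
  apply: itg_eq => t /andP[at_ tb]; rewrite /trapezoid clamp01_ge1 ?clamp01_le0 ?subr0 ?mulr1//.
    by rewrite pmulr_lle0 ?invr_gt0//; lra.
  by rewrite ler_pdivlMr//; lra.
rewrite (@itg_cat _ g a (a + e) b)//; last lra.
set X := itg a (a + e) _; set Y := itg b (b + e) _; set Z := itg a (a + e) g.
have -> : X + (itg (a + e) b g + Y) - (Z + itg (a + e) b g) = (X - Z) + Y by ring.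
apply: (le_trans (ler_normD _ _)); apply: lerD.
  rewrite /X /Z -itgB//.
  have lB : lint (fun x => g x * trapezoid a b e x - g x) by exact: lintB.
  apply: (le_trans (itg_norm _ _ lB)).
  apply: itg_le; [exact: lint_norm|exact: lint_norm|] => t /andP[ta tb].
  rewrite -{2}(mulr1 (g t)) -mulrBr normrM ler_piMr//.
  have /andP[? ?] := clamp01_01 ((t - a) / e).
  rewrite /trapezoid (_ : clamp01 ((t - b) / e) = 0); first by rewrite ler_norml; apply/andP; split; lra.
  by rewrite clamp01_le0// pmulr_lle0 ?invr_gt0//; lra.
apply: (le_trans (itg_norm _ _ lT)).
apply: itg_le; [exact: lint_norm|exact: lint_norm|] => t _.
by rewrite normrM ler_piMr.
Qed.

(** Testing with a function whose derivative is an indicator minus its translate shows that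
    translated intervals carry equal integrals of [g]. The ramps of length [e] cost integrals of |g|
    over short intervals, which vanish as [e] tends to 0. *)
Lemma weak0_translation g (G : R -> R) (a b s : R) : prim G g ->
  (forall phi : R -> R, C1 phi -> (exists r : R, forall x : R, r < `|x| -> phi x = 0) ->
    \int[mu]_x (g x * derive1 phi x) = 0) ->
  a < b -> G (b + s) - G (a + s) = G b - G a.
Proof.
move=> GG W ab; have [lg HG] := GG.
have [A PA _] := prim_exists 0 (lint_norm lg); have [lA HA] := PA.
pose r := `|a| + `|b| + `|s| + (b - a) + 1.
have [ha hb hs] : [/\ - `|a| <= a <= `|a|, - `|b| <= b <= `|b| & - `|s| <= s <= `|s|].
  by rewrite -!ler_norml !lexx.
have key e : 0 < e -> e <= b - a -> `|(G (b + s) - G (a + s)) - (G b - G a)| <=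
    (A (a + e) - A a) + (A (b + e) - A b) + (A (a + s + e) - A (a + s)) + (A (b + s + e) - A (b + s)).
  move=> e0 eb.
  have cT := @trapezoid_cont a b e.
  have [P PP _] := prim_exists 0 (lint_cont cT).
  (* [P] is constant on either side of the trapezoid, so subtracting its translate cancels the
     constants and leaves a compactly supported test function. *)
  pose phi t := P t - P (t - s).
  have dphi t : is_derive t (1 : R) phi (trapezoid a b e t - trapezoid a b e (t - s)).
    apply: is_deriveB; first exact: prim_derive PP cT t.
    by apply: is_derive_shift; exact: prim_derive PP cT _.
  have ephi : derive1 phi = fun t => trapezoid a b e t - trapezoid a b e (t - s).
    by apply/funext => t; rewrite derive1E; have [_ ->] := dphi t.
  have Pconst c d : c <= d -> (forall t, c <= t <= d -> t <= a \/ b + e <= t) -> P d = P c.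
    move=> cd H; apply/eqP; rewrite -subr_eq0; have [_ ->]// := PP.
    rewrite (@itg_eq _ _ (fun=> 0)) => [|t /H]; last by apply: trapezoid_out; lra.
    by rewrite itg_cst// mul0r.
  have c1 : C1 phi.
    split=> [t|]; first by have [] := dphi t.
    rewrite ephi => t; apply: cvgB; first exact: cT.
    apply: (@continuous_comp _ _ _ (fun t : R => t - s) (trapezoid a b e)); last exact: cT.
    by apply: cvgB; [exact: cvg_id|exact: cvg_cst].
  have supp x : r < `|x| -> phi x = 0.
    move=> rx; rewrite /phi; apply/eqP; rewrite subr_eq0; apply/eqP.
    have [x0|x0] := leP 0 x.
      rewrite ger0_norm// /r in rx; transitivity (P (Num.min x (x - s))).
        apply: Pconst; rewrite ?ge_min ?lexx// => t /andP[+ _].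
        by rewrite ge_min => /orP[] ?; right; lra.
      apply/esym/Pconst; rewrite ?ge_min ?lexx ?orbT// => t /andP[+ _].
      by rewrite ge_min => /orP[] ?; right; lra.
    rewrite ltr0_norm// /r in rx; transitivity (P (Num.max x (x - s))).
      apply/esym/Pconst; rewrite ?le_max ?lexx// => t /andP[_ +].
      by rewrite le_max => /orP[] ?; left; lra.
    apply: Pconst; rewrite ?le_max ?lexx ?orbT// => t /andP[_ +].
    by rewrite le_max => /orP[] ?; left; lra.
  have := W phi c1 (ex_intro _ r supp).
  have esupp x : r < `|x| -> derive1 phi x = 0.
    move=> rx; rewrite ephi; have hx : - `|x| <= x <= `|x| by rewrite -ler_norml.
    have [x0|x0] := leP 0 x.
      rewrite ger0_norm// /r in rx; rewrite !trapezoid_out ?subrr//; by [lra|right; lra].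
    rewrite ltr0_norm// /r in rx; rewrite !trapezoid_out ?subrr//; by [lra|left; lra].
  rewrite (@Rintegral_itg r) => [|x /esupp ->]; last by rewrite mulr0.
  rewrite ephi.
  have tr t : trapezoid a b e (t - s) = trapezoid (a + s) (b + s) e t.
    by rewrite /trapezoid; congr (clamp01 (_ / _) - clamp01 (_ / _)); ring.
  rewrite (@itg_eq _ _ (fun t => g t * trapezoid a b e t - g t * trapezoid (a + s) (b + s) e t)); last first.
    by move=> t _; rewrite tr mulrBr.
  have lT c d : lint (fun t => g t * trapezoid c d e t).
    have := lintM (@trapezoid_cont c d e) lg.
    by congr lint; apply/funext => x; rewrite mulrC.
  rewrite itgB// => /eqP; rewrite subr_eq0 => /eqP E.
  have := @trapezoid_itg g a b e r lg e0; rewrite -!HA -?HG ?E; [|lra..].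
  have := @trapezoid_itg g (a + s) (b + s) e r lg e0; rewrite -!HA -?HG; [|lra..].
  set I := itg _ _ _.
  move=> /(_ _ _ _) H1 /(_ _ _ _) H2.
  have {}H1 := H1 ltac:(lra) ltac:(rewrite /r; lra) ltac:(rewrite /r; lra).
  have {}H2 := H2 ltac:(lra) ltac:(rewrite /r; lra) ltac:(rewrite /r; lra).
  have -> : G (b + s) - G (a + s) - (G b - G a) =
     (I - (G b - G a)) - (I - (G (b + s) - G (a + s))) by ring.
  by apply: (le_trans (ler_normB _ _)); lra.
have cA := prim_cont PA.
apply/eqP; rewrite -subr_eq0 -normr_le0; apply/ler_addgt0Pr => d d0; rewrite add0r.
have nb c : \forall e \near (0 : R), A (c + e) - A c < d / 4.
  have : A (c + e) @[e --> (0 : R)] --> A c.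
    have := cA (c + 0); rewrite addr0 => cc.
    apply: (@cvg_comp _ _ _ (fun e : R => c + e) A _ (nbhs c)) => //.
    have : (fun e : R => c + e) @ (0 : R) --> c + 0 by apply: cvgD; [exact: cvg_cst|exact: cvg_id].
    by rewrite addr0.
  move=> /cvgrPdist_lt /(_ (d / 4)) /(_ _); have d4 : 0 < d / 4 by lra.
  move=> /(_ d4); apply: filterS => e; rewrite distrC; apply: le_lt_trans; exact: ler_norm.
have : \forall e \near (0 : R), [/\ A (a + e) - A a < d / 4, A (b + e) - A b < d / 4,
   A (a + s + e) - A (a + s) < d / 4 & A (b + s + e) - A (b + s) < d / 4].
  near=> e; split; near: e; exact: nb.
move=> [e0 /= e00 He]; pose e := Num.min (e0 / 2) (b - a).
have e_gt0 : 0 < e by rewrite lt_min; apply/andP; split; lra.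
have := key e e_gt0; rewrite {1}/e ge_min lexx orbT => /(_ isT).
have [] := He e; last by lra.
by rewrite /ball_/= sub0r normrN gtr0_norm// /e gt_min; apply/orP; left; lra.
Unshelve. all: by end_near. Qed.

(** By translation, increments of the primitive [G] depend only on the length of the interval. As
    [G] is differentiable at one point, it is differentiable everywhere with the same slope. *)
Lemma weak0_const g : lint g ->
  (forall phi : R -> R, C1 phi -> (exists r : R, forall x : R, r < `|x| -> phi x = 0) ->
    \int[mu]_x (g x * derive1 phi x) = 0) ->
  exists c : R, {ae mu, forall x, g x = c}.
Proof.
move=> lg W; have [G PG G0] := prim_exists 0 lg.
have [x0 d0] := ae_exists (prim_ae_derive PG).
have T x y : G (x + y) - G y = G x - G 0.
  have [x0'|x0'] := ltP 0 x.
    by have := weak0_translation y PG W x0'; rewrite add0r.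
  have [->|xn] := eqVneq x 0; first by rewrite add0r !subrr.
  have xl : x < 0 by rewrite lt_neqAle xn.
  by have := weak0_translation y PG W xl; rewrite add0r; lra.
have dG x : is_derive x (1 : R) G (g x0).
  have -> : G = fun y => (G (x - x0) - G 0) + G (y + (x0 - x)).
    by apply/funext => y; have := T (x - x0) (y + (x0 - x)); rewrite (_ : x - x0 + (y + (x0 - x)) = y); [lra|ring].
  rewrite -[X in is_derive _ _ _ X]add0r; apply: is_deriveD.
  by apply: is_derive_shift; rewrite addrC subrK.
exists (g x0); apply: prim_uniq PG _.
by apply: prim_C1 => //; exact: cst_continuous.
Qed.

Lemma weak_lint h k : is_weak_derivative h k -> lint h /\ lint k.
Proof. by move=> [/loc_lint lh /loc_lint lk _]. Qed.

(** The difference of [h] and a primitive of [k] has weak derivative zero and is almost everywhere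
    constant by [weak0_const]. *)
Lemma weak_diff h k : is_weak_derivative h k ->
  exists2 g, prim g k & {ae mu, forall x, h x = g x}.
Proof.
move=> W; have [lh lk] := weak_lint W.
have [P PP _] := prim_exists 0 lk; have [lP _] := (weak_lint (weak_prim PP)).
have [|c Hc] := @weak0_const (fun x => h x - P x) (lintB lh lP).
  move=> phi c1 [r Hr]; have [_ _ Wh] := W; have [_ _ WP] := weak_prim PP.
  have Dphi x : is_derive x (1 : R) phi (derive1 phi x).
    by split; [exact: (proj1 c1)|rewrite derive1E].
  have Hr' (x : R) : r + 1 < `|x| -> derive1 phi x = 0.
    move=> rx; apply: is_derive_uniq (Dphi x) _.
    apply: (@near_eq_is_derive _ _ _ (fun=> 0)).
    apply: (@near_dist _ _ 1) => // y yx.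
    apply/esym/Hr; have := ler_normD y (x - y); rewrite (_ : y + (x - y) = x); last ring.
    by rewrite (distrC x); lra.
  have lT f : lint f -> lint (fun x => f x * derive1 phi x).
    move=> lf; have := lintM (proj2 c1) lf.
    by congr lint; apply/funext => x; rewrite mulrC.
  have E f : \int[mu]_x (f x * derive1 phi x) = itg (- (r + 1)) (r + 1) (fun x => f x * derive1 phi x).
    by apply: Rintegral_itg => x /Hr' ->; rewrite mulr0.
  rewrite E (@itg_eq _ _ (fun x => h x * derive1 phi x - P x * derive1 phi x)); last by move=> x _; rewrite mulrBl.
  rewrite itgB; [|exact: lT|exact: lT].
  by rewrite -!E Wh ?WP ?subrr//; exists r.
exists (fun x => c + P x); last by apply: (ae_imp Hc) => x; lra.
have := primD (prim_cst c) PP.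
by congr prim; apply/funext => x; rewrite add0r.
Qed.

Lemma weak_uniq h k k' : is_weak_derivative h k -> is_weak_derivative h k' ->
  {ae mu, forall x, k x = k' x}.
Proof.
move=> /weak_diff[g pg hg] /weak_diff[g' pg' hg'].
apply: (prim_uniq pg); suff -> : g = g' by [].
apply/funext; apply: continuous_ae_eq; [exact: prim_cont pg|exact: prim_cont pg'|].
by apply: (ae_imp (ae_and hg hg')) => x [<- <-].
Qed.

Lemma weak_ae h h' k : is_weak_derivative h k -> lint h' ->
  {ae mu, forall x, h x = h' x} -> is_weak_derivative h' k.
Proof.
move=> W lh' hh; have [lh lk] := weak_lint W; split; [exact: lint_loc|exact: lint_loc|].
move=> phi c1 Hr; have [_ _ <-] // := W.
have m f : lint f -> mf (fun x => f x * derive1 phi x).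
  by move=> [mf_ _]; apply: mfM => //; apply: mf_cont; exact: (proj2 c1).
rewrite /Rintegral; congr fine; apply: ae_eq_integral => //.
- by apply: (mf_EFin (m _ _)).
- by apply: (mf_EFin (m _ _)).
by apply: (ae_imp hh) => x -> _.
Qed.

Lemma wD_weak h : weakly_derivable h -> is_weak_derivative h (wD h).
Proof. by move=> H; exact: (@xgetPex _ (fun=> 0) [set k | is_weak_derivative h k] H). Qed.

Lemma wD_ae h k : is_weak_derivative h k -> {ae mu, forall x, wD h x = k x}.
Proof. by move=> W; exact: (weak_uniq (wD_weak (ex_intro _ _ W)) W). Qed.

(** H^2_loc regularity with chosen versions: a classical first derivative, and a second one that
    matters only up to null sets. *)
Definition D2 h h1 h2 : Prop :=
  (forall x, is_derive x (1 : R) h (h1 x)) /\ prim h1 h2.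

Lemma twd_D2 h : twice_weakly_derivable h -> exists h1 h2,
  [/\ D2 h h1 h2, {ae mu, forall x, wD h x = h1 x} &
     {ae mu, forall x, wD (wD h) x = h2 x}].
Proof.
move=> [ch /wD_weak W1 /wD_weak W2].
have [h1 p1 e1] := weak_diff W2; have [g pg hg] := weak_diff W1.
have hE : h = g by apply/funext; apply: continuous_ae_eq => //; exact: prim_cont pg.
exists h1, (wD (wD h)); split => //; last exact: ae_all.
split => //; rewrite hE; apply: prim_derive; last exact: prim_cont p1.
apply: prim_ae pg _ e1; apply: mf_cont; exact: prim_cont p1.
Qed.

Lemma D2_prim h h1 h2 : D2 h h1 h2 -> prim h h1.
Proof. by move=> [d p]; apply: prim_C1 => //; exact: prim_cont p. Qed.

Lemma D2_twd h h1 h2 : D2 h h1 h2 ->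
  [/\ twice_weakly_derivable h, {ae mu, forall x, wD h x = h1 x} &
     {ae mu, forall x, wD (wD h) x = h2 x}].
Proof.
move=> dh; have [d p] := dh; have p0 := D2_prim dh.
have W1 := weak_prim p0; have W2 := weak_prim p; have e1 := wD_ae W1.
have W2' : is_weak_derivative (wD h) h2.
  apply: weak_ae W2 _ _; last by apply: (ae_imp e1) => x ->.
  by have [_ ?] := weak_lint (wD_weak (ex_intro _ _ W1)).
split => //; last exact: wD_ae.
by split; [exact: prim_cont p0|exists h1|exists h2].
Qed.

Lemma L2_qi D h : measurable D -> mf h -> (qi D (fun x => h x ^+ 2)%R < +oo)%E -> L2 D h.
Proof.
move=> mD mh hf; split; first exact: measurable_funTS.
apply/integrableP; split; first by apply: mf_EFin; exact: mfX.
apply: le_lt_trans hf; rewrite /qi; under eq_integral do rewrite gee0_abs ?lee_fin ?sqr_ge0//.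
exact: lexx.
Qed.

Lemma qi_L2 D h : L2 D h -> (qi D (fun x => h x ^+ 2)%R < +oo)%E.
Proof.
move=> [mh /integrableP[_]]; apply: le_lt_trans; rewrite /qi.
by under [leRHS]eq_integral do rewrite gee0_abs ?lee_fin ?sqr_ge0//.
Qed.

End WeakDerivatives.

(** * A C^2 bump function from cubic splines *)

Section Bump.
Variable R : realType.
Local Notation mu := (@lebesgue_measure R).
Implicit Types (g h k : R -> R).

Definition pos (t : R) : R := (`|t| + t) / 2.

Lemma pos_le0 t : t <= 0 -> pos t = 0.
Proof. by move=> t0; rewrite /pos ler0_norm; lra. Qed.

Lemma pos_ge0 t : 0 <= t -> pos t = t.
Proof. by move=> t0; rewrite /pos ger0_norm; lra. Qed.

Lemma cont_shift g (c : R) : continuous g -> continuous (fun t => g (t + c)).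
Proof.
move=> cg t; apply: (@continuous_comp _ _ _ (fun t : R => t + c) g); last exact: cg.
by apply: cvgD; [exact: cvg_id|exact: cvg_cst].
Qed.

Lemma pos_cont : continuous pos.
Proof.
move=> t; apply: cvgM; last exact: cvg_cst.
by apply: cvgD; [exact: norm_continuous|exact: cvg_id].
Qed.

Lemma contX g n : continuous g -> continuous (fun t => g t ^+ n).
Proof.
move=> cg t; elim: n => [|n IH]; first exact: cvg_cst.
rewrite /continuous_at exprS; under eq_fun do rewrite exprS.
by apply: cvgM; [exact: cg|exact: IH].
Qed.

Lemma is_deriveZ' (f : R -> R) (c x a : R) : is_derive x (1 : R) f a ->
  is_derive x (1 : R) (fun y => c * f y) (c * a).
Proof. by move=> d; exact: (is_deriveZ c d). Qed.

Lemma is_deriveM' (f g : R -> R) (x a b : R) : is_derive x (1 : R) f a ->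
  is_derive x (1 : R) g b -> is_derive x (1 : R) (fun y => f y * g y) (a * g x + f x * b).
Proof.
by move=> d e; rewrite addrC (mulrC a); exact: (is_deriveM d e).
Qed.

Lemma is_deriveX' n (x : R) :
  is_derive x (1 : R) (fun t : R => t ^+ n.+1) (n.+1%:R * x ^+ n).
Proof.
elim: n => [|n IH]; first by rewrite expr0 mulr1; exact: is_derive_id.
have := is_deriveM' (is_derive_id x (1 : R)) IH.
rewrite (_ : 1 * _ + _ = n.+2%:R * x ^+ n.+1) => [|].
  by congr is_derive.
by rewrite -(natr1 n.+1) exprS; ring.
Qed.

Lemma is_derive_posX n (t : R) :
  is_derive t (1 : R) (fun t => pos t ^+ n.+2) (n.+2%:R * pos t ^+ n.+1).
Proof.
have cP : continuous (fun t => n.+2%:R * pos t ^+ n.+1).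
  by move=> x; apply: cvgM; [exact: cvg_cst|apply: contX; exact: pos_cont].
have lP := lint_cont cP.
have PX : prim (fun t : R => t ^+ n.+2) (fun t => n.+2%:R * t ^+ n.+1).
  apply: prim_C1 => [x|]; first exact: is_deriveX'.
  by move=> x; apply: cvgM; [exact: cvg_cst|apply: (@contX (@id R)) => y; exact: cvg_id].
apply: (prim_derive _ cP); split => // a b ab.
have [_ HX] := PX.
have neg x y : x <= y -> y <= 0 -> pos y ^+ n.+2 - pos x ^+ n.+2 = itg x y (fun t => n.+2%:R * pos t ^+ n.+1).
  move=> xy y0; rewrite !pos_le0//; last lra.
  rewrite (@itg_eq _ _ (fun=> 0)) => [|z /andP[_ zy]]; first by rewrite itg_cst// mul0r subrr.
  by rewrite pos_le0 ?expr0n ?mulr0//; lra.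
have psv x y : x <= y -> 0 <= x -> pos y ^+ n.+2 - pos x ^+ n.+2 = itg x y (fun t => n.+2%:R * pos t ^+ n.+1).
  move=> xy x0; rewrite !pos_ge0//; last lra.
  by rewrite HX//; apply: itg_eq => z /andP[xz _]; rewrite pos_ge0//; lra.
have [b0|b0] := leP b 0; first exact: neg.
have [a0|a0] := leP 0 a; first exact: psv.
rewrite (itg_cat lP (ltW a0) (ltW b0)) -neg -?psv//; [lra|lra..].
Qed.

(** The weights 1, -2, 2, -1 at the nodes 0, 1/4, 3/4, 1 annihilate polynomials of degree at most 2.
    For n = 3 this is therefore a C^2 step: zero for negative t, and constant, equal to 3/16, from t
    = 1 on. *)
Definition sstep n (t : R) : R :=
  pos t ^+ n - 2 * pos (t - 4^-1) ^+ n + 2 * pos (t - 3 / 4) ^+ n - pos (t - 1) ^+ n.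

Lemma sstep_cont n : continuous (sstep n).
Proof.
have c x : continuous (fun t => pos (t - x) ^+ n).
  by apply: contX; apply: cont_shift; exact: pos_cont.
move=> t; apply: cvgB; last exact: c.
apply: cvgD; last by apply: cvgM; [exact: cvg_cst|exact: c].
apply: cvgB; last by apply: cvgM; [exact: cvg_cst|exact: c].
by apply: contX; exact: pos_cont.
Qed.

Lemma is_derive_sstep n (t : R) :
  is_derive t (1 : R) (sstep n.+2) (n.+2%:R * sstep n.+1 t).
Proof.
have c x : is_derive t (1 : R) (fun t => pos (t - x) ^+ n.+2) (n.+2%:R * pos (t - x) ^+ n.+1).
  by apply: (@is_derive_shift _ (fun t => pos t ^+ n.+2)); exact: is_derive_posX.
rewrite (_ : _ * sstep _ _ = n.+2%:R * pos t ^+ n.+1 - 2 * (n.+2%:R * pos (t - 4^-1) ^+ n.+1) +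
   2 * (n.+2%:R * pos (t - 3 / 4) ^+ n.+1) - n.+2%:R * pos (t - 1) ^+ n.+1); last by rewrite /sstep; ring.
exact: (is_deriveB (is_deriveD (is_deriveB (is_derive_posX n t)
  (is_deriveZ' 2 (c 4^-1))) (is_deriveZ' 2 (c (3 / 4)))) (c 1)).
Qed.

Lemma sstep_le0 n t : t <= 0 -> sstep n.+1 t = 0.
Proof.
by move=> t0; rewrite /sstep !pos_le0 ?expr0n/=; lra.
Qed.

Lemma sstep_ge1 t : 1 <= t -> [/\ sstep 3 t = 3 / 16, sstep 2 t = 0 & sstep 1 t = 0].
Proof. by move=> t1; rewrite /sstep !pos_ge0; try lra; split; field. Qed.

(** Equal to one on a unit cell and supported in that cell and its two neighbours, so that at each
    point at most three integer translates are nonzero. *)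
Record bump_spec (b b1 b2 : R -> R) (C : R) : Prop := BumpSpec {
  bump_d1 : forall x, is_derive x (1 : R) b (b1 x);
  bump_d2 : forall x, is_derive x (1 : R) b1 (b2 x);
  bump_c2 : continuous b2;
  bump_one : forall x, 0 <= x <= 1 -> b x = 1 /\ b1 x = 0;
  bump_supp : forall x, x <= -1 \/ 2 <= x -> [/\ b x = 0, b1 x = 0 & b2 x = 0];
  bump_C : 0 <= C;
  bump_bound : forall x, [/\ `|b x| <= C, `|b1 x| <= C & `|b2 x| <= C]
}.

Lemma bump_exists : exists b b1 b2 C, bump_spec b b1 b2 C.
Proof.
pose S n (x : R) := sstep n (x + 1) - sstep n (x - 1).
have cS n : continuous (S n).
  by move=> x; apply: cvgB; apply: cont_shift; exact: sstep_cont.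
have dS n x : is_derive x (1 : R) (S n.+2) (n.+2%:R * S n.+1 x).
  rewrite mulrBr; apply: is_deriveB.
    by apply: (@is_derive_shift _ (sstep n.+2)); exact: is_derive_sstep.
  by apply: (@is_derive_shift _ (sstep n.+2)); exact: is_derive_sstep.
have supp x : x <= -1 \/ 2 <= x -> [/\ S 3 x = 0, S 2 x = 0 & S 1 x = 0].
  move=> [x1|x2]; rewrite /S; first by rewrite !sstep_le0 ?subrr//; lra.
  have [|-> -> ->] := @sstep_ge1 (x + 1); first lra.
  have [|-> -> ->] := @sstep_ge1 (x - 1); first lra.
  by rewrite !subrr.
pose b n (k : R) x := k * S n x.
have cb n (k : R) : continuous (b n k).
  by move=> x; apply: cvgM; [exact: cvg_cst|exact: cS].
have [C1 C10 H1] := continuous_bound (-1) 2 (cb 3 (16 / 3)).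
have [C2 C20 H2] := continuous_bound (-1) 2 (cb 2 16).
have [C3 C30 H3] := continuous_bound (-1) 2 (cb 1 32).
(* The factor 16/3 normalizes the height 3/16; differentiation multiplies it by 3 and then by 2. *)
exists (b 3 (16 / 3)), (b 2 16), (b 1 32), (C1 + C2 + C3); split.
- move=> x; rewrite (_ : b 2 16 x = 16 / 3 * (3 * S 2 x)); last by rewrite /b; field.
  by apply: is_deriveZ'; exact: dS.
- move=> x; rewrite (_ : b 1 32 x = 16 * (2 * S 1 x)); last by rewrite /b; ring.
  by apply: is_deriveZ'; exact: dS.
- exact: cb.
- move=> x /andP[x0 x1]; rewrite /b /S !(@sstep_le0 _ (x - 1)); try lra.
  by have [|-> -> _] := @sstep_ge1 (x + 1); [lra|split; field].
- by move=> x /supp[e1 e2 e3]; rewrite /b e1 e2 e3 !mulr0.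
- lra.
move=> x; have [x1|x1] := leP x (-1).
  by rewrite /b; have [|-> -> ->] := supp x; [left|rewrite !mulr0 normr0; split; lra].
have [x2|x2] := leP 2 x.
  by rewrite /b; have [|-> -> ->] := supp x; [right|rewrite !mulr0 normr0; split; lra].
have xx : -1 <= x <= 2 by rewrite !ltW.
by split; [have := H1 x xx|have := H2 x xx|have := H3 x xx]; lra.
Qed.

Lemma bump_scale (l c : R) b b1 b2 C : 0 < l -> bump_spec b b1 b2 C ->
  let p x := b (l^-1 * x + c) in
  let p1 x := l^-1 * b1 (l^-1 * x + c) in
  let p2 x := l^-1 * (l^-1 * b2 (l^-1 * x + c)) in
  [/\ forall x, is_derive x (1 : R) p (p1 x), forall x, is_derive x (1 : R) p1 (p2 x) &
      continuous p2].
Proof.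
move=> l0 H /=.
have d x : is_derive x (1 : R) (fun x => l^-1 * x + c) (l^-1).
  have := is_deriveD (is_deriveZ' l^-1 (is_derive_id x (1 : R))) (is_derive_cst c x (1 : R)).
  by rewrite addr0 mulr1.
have cd : continuous (fun x => l^-1 * x + c).
  by move=> x; apply: cvgD; [apply: cvgM; [exact: cvg_cst|exact: cvg_id]|exact: cvg_cst].
have cb2 : continuous (fun x => b2 (l^-1 * x + c)).
  by move=> y; apply: (@continuous_comp _ _ _ (fun x => l^-1 * x + c) b2); [exact: cd|exact: (bump_c2 H)].
split.
- by move=> x; rewrite mulrC; exact: (is_derive1_comp (bump_d1 H _) (d x)).
- move=> x; apply: (is_deriveZ' (f := fun x => b1 (l^-1 * x + c))); rewrite mulrC.
  exact: (is_derive1_comp (bump_d2 H _) (d x)).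
- move=> x; apply: cvgM; first exact: cvg_cst.
  apply: cvgM; first exact: cvg_cst.
  exact: cb2.
Qed.

End Bump.

(** * Energy identities and one-dimensional Sobolev inequalities *)

Section Energy.
Variable R : realType.
Local Notation mu := (@lebesgue_measure R).
Implicit Types (g h k : R -> R).

(** A lower bound [e] on arbitrarily long intervals would make the integral infinite. The points
    found serve as cut points with negligible boundary terms. *)
Lemma qi_small_point g (e : R) : mf g -> (forall x, 0 <= g x) ->
  (qi setT g < +oo)%E -> 0 < e ->
  forall n : nat, (exists2 x, n%:R <= x & g x <= e) /\ (exists2 y, y <= - n%:R & g y <= e).
Proof.
move=> mg g0 gf e0 n.
have key (a : R) (m : nat) : (forall x, a <= x < a + m%:R -> e < g x) ->
    ((e * m%:R)%:E <= qi setT g)%E.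
  move=> H; apply: (@le_trans _ _ (qi `[a, a + m%:R[ g)); last first.
    by apply: qi_subT.
  have -> : (e * m%:R)%:E = qi `[a, a + m%:R[ (fun=> e).
    rewrite /qi integral_cst//= lebesgue_measure_itv/= lte_fin.
    case: ifPn; first by rewrite -EFinB -EFinM => _; congr (_%:E); ring.
    rewrite -leNgt gerDl => m0; have -> : m%:R = 0 :> R by apply/le_anti; rewrite m0 ler0n.
    by rewrite mulr0 mule0.
  apply: qi_le => //; [exact: mf_cst|by move=> x; exact: ltW|].
  by move=> x; rewrite /= in_itv/= => /H/ltW.
have [m Hm] : exists m : nat, (qi setT g < (e * m%:R)%:E)%E.
  have : (0 <= qi setT g)%E by exact: qi_ge0.
  case: (qi setT g) gf => // r _ r0; exists (Num.truncn (r / e)).+1.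
  rewrite lte_fin mulrC -ltr_pdivrMr//; exact: truncnS_gt.
split; apply: contrapT => nx.
  have := key n%:R m; rewrite leNgt Hm => /(_ _)/negP; apply => // x /andP[nx1 _].
  by rewrite ltNge; apply/negP => ?; apply: nx; exists x.
have := key (- n%:R - m%:R) m; rewrite leNgt Hm => /(_ _)/negP; apply => // x /andP[_ xn].
by rewrite ltNge; apply/negP => ?; apply: nx; exists x => //; lra.
Qed.

(** This is how energy identities are integrated over the line: the flux [E] is dominated by an
    integrable [Q], so the interval can be ended at points where [Q] is small and the boundary terms
    disappear in the limit. *)
Lemma flux (E e Q A G : R -> R) : prim E e -> mf Q -> (forall x, 0 <= Q x) ->
  (qi setT Q < +oo)%E -> (forall x, `|E x| <= Q x) -> mf A -> (forall x, 0 <= A x) ->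
  mf G -> (forall x, 0 <= G x) -> {ae mu, forall x, A x <= e x + G x} ->
  (qi setT A <= qi setT G)%E.
Proof.
move=> PE mQ Q0 Qf EQ mA A0 mG G0 AG; have [le HE] := PE; have [me _] := le.
apply: qi_setT_le => // n; apply/lee_addgt0Pr => d d0.
have d2 : 0 < d / 2 by lra.
have [[x nx Qx] [y yn Qy]] := qi_small_point mQ Q0 Qf d2 n.
have yx : y <= x by have : (0 : R) <= n%:R by []; lra.
apply: (@le_trans _ _ (qi `[y, x[ A)).
  apply: qi_sub => //; first exact: measurable_itv.
  move=> z; rewrite /box/= !in_itv/= => /andP[? ?]; apply/andP; split; lra.
(* The density [e] has no sign; |e| is added to both sides so that only nonnegative integrals are
   compared, and is cancelled afterwards. *)
have lE : lint (fun z => e z + `|e z|) by apply: lintD => //; exact: lint_norm.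
have E0 z : 0 <= e z + `|e z| by have := lerNnormlW (lexx `|e z|); lra.
have H : (qi `[y, x[ A + qi `[y, x[ (fun z => `|e z|)%R <=
    qi `[y, x[ (fun z => e z + `|e z|)%R + qi `[y, x[ G)%E.
  rewrite -qiD//; last exact: mf_norm.
  rewrite -qiD//; last by case: lE.
  apply: qi_le_ae => //.
  - by apply: mfD => //; exact: mf_norm.
  - by apply: mfD => //; case: lE.
  - by move=> z; exact: addr_ge0.
  - by move=> z; exact: addr_ge0.
  by apply: (ae_imp AG) => z Az _; lra.
have GT : (qi `[y, x[ G <= qi setT G)%E by exact: qi_subT.
move: H; rewrite -(itg_qi y x lE E0) -(itg_qi y x (lint_norm le) (fun z => normr_ge0 (e z))).
rewrite (itgD y x le (lint_norm le)).
set t := itg y x (fun z => `|e z|); set s := itg y x e.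
set qa := qi _ A; set qg := qi `[y, x[ G => H.
have {}H : (qa <= s%:E + qg)%E.
  rewrite -(@leeD2rE _ t%:E)//; apply: (le_trans H).
  by rewrite [(s + t)%:E]EFinD addeAC.
apply: (le_trans H); rewrite addeC; apply: leeD => //; rewrite /s.
rewrite lee_fin -HE//; have := EQ x; have := EQ y; rewrite !ler_norml => /andP[? ?] /andP[? ?].
lra.
Qed.

(** Cauchy-Schwarz, obtained by integrating the square of |h| minus its mean. *)
Lemma sq_itg_len (h : R -> R) (x L : R) : continuous h -> 0 < L ->
  itg x (x + L) (fun y => `|h y|) ^+ 2 <= L * itg x (x + L) (fun y => h y ^+ 2).
Proof.
move=> ch L0; set m := itg _ _ _; have xL : x <= x + L by lra.
have l1 : lint (fun y => 2 * (m / L) * `|h y|) by apply: lintZ; apply: lint_norm; exact: lint_cont.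
have l2 : lint (fun y => h y ^+ 2) by apply: lint_cont; exact: contX.
have : itg x (x + L) (fun y => 2 * (m / L) * `|h y| - (m / L) ^+ 2) <= itg x (x + L) (fun y => h y ^+ 2).
  apply: itg_le => //; first by apply: lintB => //; exact: lint_cst.
  move=> y _; rewrite -(real_normK (num_real (h y))).
  by have := sqr_ge0 (`|h y| - m / L); rewrite sqrrB; lra.
rewrite itgB//; last exact: lint_cst.
rewrite itgZ ?itg_cst//; last by apply: lint_norm; exact: lint_cont.
rewrite -/m -(ler_pM2l L0) => h1; apply: le_trans h1.
by rewrite (_ : L * _ = m ^+ 2)//; field; rewrite gt_eqF.
Qed.

(** The value at x differs from the value at any y of the unit interval by at most the integral of
    |h'|; the squared inequality is averaged over y. *)
Lemma sobolev h h1 (x : R) : prim h h1 -> continuous h1 ->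
  h x ^+ 2 <= 2 * itg x (x + 1) (fun y => h y ^+ 2 + h1 y ^+ 2).
Proof.
move=> ph c1; have ch := prim_cont ph; have [l1 H1] := ph.
have x1 : x <= x + 1 by lra.
set m := itg x (x + 1) (fun y => `|h1 y|).
have m2 := sq_itg_len x c1 ltr01; rewrite -/m mul1r in m2.
have l2 : lint (fun y => h y ^+ 2) by apply: lint_cont; exact: contX.
have l3 : lint (fun y => h1 y ^+ 2) by apply: lint_cont; exact: contX.
have pt y : x <= y <= x + 1 -> h x ^+ 2 <= 2 * h y ^+ 2 + 2 * m ^+ 2.
  move=> /andP[xy yx].
  have a1 : `|h y - h x| <= m.
    apply: (le_trans (prim_le ph xy)); rewrite /m (@itg_cat _ _ x y (x + 1))//; last exact: lint_norm.
    by rewrite lerDl itg_ge0.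
  have : (h y - h x) ^+ 2 <= m ^+ 2.
    by rewrite -real_normK ?num_real// lerXn2r// nnegrE// /m itg_ge0.
  have : 0 <= (2 * h y - h x) ^+ 2 by exact: sqr_ge0.
  rewrite !sqrrB; set a := h x; set b := h y; nra.
have : itg x (x + 1) (fun=> h x ^+ 2) <= itg x (x + 1) (fun y => 2 * h y ^+ 2 + 2 * m ^+ 2).
  apply: itg_le => //; [exact: lint_cst|apply: lintD; [exact: lintZ|exact: lint_cst]].
rewrite (itgD _ _ (lintZ 2 l2) (lint_cst _)) (itgZ _ _ _ l2) (itgD _ _ l2 l3) !itg_cst//; lra.
Qed.

End Energy.

(** * Square-integrable fields, completeness and contractions *)

Section FieldsL2.
Variables (R : realType) (I : finType).
Local Notation mu := (@lebesgue_measure R).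
Local Notation fld := (I -> R -> R).
Implicit Types (F G : fld) (D : set R).

Definition sq F (x : R) : R := \sum_i F i x ^+ 2.
Definition mfF F : Prop := forall i, mf (F i).
(** The squared norm. Estimates stay in squared form throughout, at the price of a factor 2 for each
    sum. *)
Definition q D F : \bar R := qi D (sq F).
Definition fadd F G : fld := fun i x => F i x + G i x.
Definition fsub F G : fld := fun i x => F i x - G i x.
Definition fscale (c : R) F : fld := fun i x => c * F i x.
Definition fzero : fld := fun _ _ => 0.
Definition perF (L : R) F : Prop := forall i x, F i (x + L) = F i x.

Lemma sq_ge0 F x : 0 <= sq F x.
Proof. by apply: sumr_ge0 => i _; exact: sqr_ge0. Qed.

Lemma mf_sq F : mfF F -> mf (sq F).
Proof. by move=> mF; apply: mf_sum => i; exact: mfX. Qed.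

Lemma mf_fadd F G : mfF F -> mfF G -> mfF (fadd F G).
Proof. by move=> mF mG i; exact: mfD. Qed.

Lemma mf_fsub F G : mfF F -> mfF G -> mfF (fsub F G).
Proof. by move=> mF mG i; exact: mfB. Qed.

Lemma mf_fscale c F : mfF F -> mfF (fscale c F).
Proof. by move=> mF i; apply: mfM => //; exact: mf_cst. Qed.

Lemma mf_fzero : mfF fzero.
Proof. by move=> i; exact: mf_cst. Qed.

Lemma sq_fadd F G x : sq (fadd F G) x <= 2 * sq F x + 2 * sq G x.
Proof.
rewrite /sq !mulr_sumr -big_split/=; apply: ler_sum => i _; rewrite /fadd.
have := sqr_ge0 (F i x - G i x); rewrite sqrrB sqrrD; lra.
Qed.

Lemma sq_fsub F G x : sq (fsub F G) x <= 2 * sq F x + 2 * sq G x.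
Proof.
rewrite /sq !mulr_sumr -big_split/=; apply: ler_sum => i _; rewrite /fsub.
have := sqr_ge0 (F i x + G i x); rewrite sqrrB sqrrD; lra.
Qed.

Lemma sq_fscale c F x : sq (fscale c F) x = c ^+ 2 * sq F x.
Proof. by rewrite /sq mulr_sumr; apply: eq_bigr => i _; rewrite exprMn. Qed.

Lemma sq_fzero x : sq fzero x = 0.
Proof. by rewrite /sq big1// => i _; rewrite expr0n. Qed.

Lemma sq_ge1 F i x : F i x ^+ 2 <= sq F x.
Proof.
rewrite /sq (bigD1 i)//= lerDl; apply: sumr_ge0 => j _; exact: sqr_ge0.
Qed.

Lemma q_ge0 D F : (0 <= q D F)%E.
Proof. by apply: qi_ge0 => x; exact: sq_ge0. Qed.

Lemma q_le2 D F G H (a b : R) : measurable D -> mfF F -> mfF G -> mfF H ->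
  0 <= a -> 0 <= b -> {ae mu, forall x, D x -> sq F x <= a * sq G x + b * sq H x} ->
  (q D F <= a%:E * q D G + b%:E * q D H)%E.
Proof.
move=> mD mF mG mH a0 b0 le.
rewrite /q -!qiZ//; [|exact: mf_sq|exact: sq_ge0|exact: mf_sq|exact: sq_ge0].
rewrite -qiD//.
- apply: qi_le_ae => //; [exact: mf_sq| |exact: sq_ge0|].
    by apply: mfD; apply: mfM; [exact: mf_cst|exact: mf_sq|exact: mf_cst|exact: mf_sq].
  by move=> x; apply: addr_ge0; apply: mulr_ge0 => //; exact: sq_ge0.
- by apply: mfM; [exact: mf_cst|exact: mf_sq].
- by apply: mfM; [exact: mf_cst|exact: mf_sq].
- by move=> x; apply: mulr_ge0 => //; exact: sq_ge0.
- by move=> x; apply: mulr_ge0 => //; exact: sq_ge0.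
Qed.

Lemma q_le1 D F G (a : R) : measurable D -> mfF F -> mfF G ->
  0 <= a -> {ae mu, forall x, D x -> sq F x <= a * sq G x} ->
  (q D F <= a%:E * q D G)%E.
Proof.
move=> mD mF mG a0 le; apply: (@le_trans _ _ (a%:E * q D G + 0%:E * q D G)%E).
  apply: q_le2 => //; apply: (ae_imp le) => x h Dx; rewrite mul0r addr0; exact: h.
by rewrite mul0e adde0.
Qed.

Lemma q_fadd D F G : measurable D -> mfF F -> mfF G ->
  (q D (fadd F G) <= 2%:E * q D F + 2%:E * q D G)%E.
Proof.
move=> mD mF mG; apply: q_le2 => //; first exact: mf_fadd.
by apply: ae_all => x _; exact: sq_fadd.
Qed.

Lemma q_fsub D F G : measurable D -> mfF F -> mfF G ->
  (q D (fsub F G) <= 2%:E * q D F + 2%:E * q D G)%E.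
Proof.
move=> mD mF mG; apply: q_le2 => //; first exact: mf_fsub.
by apply: ae_all => x _; exact: sq_fsub.
Qed.

Lemma q_fscale D F c : measurable D -> mfF F ->
  (q D (fscale c F) = (c ^+ 2)%:E * q D F)%E.
Proof.
move=> mD mF; rewrite /q -qiZ//; [|exact: mf_sq|exact: sq_ge0|exact: sqr_ge0].
by apply: qi_eq => x _; rewrite sq_fscale.
Qed.

Lemma q_ae D F G : measurable D -> mfF F -> mfF G ->
  {ae mu, forall x, forall i, F i x = G i x} -> q D F = q D G.
Proof.
move=> mD mF mG e; apply: qi_eq_ae => //; [exact: mf_sq|exact: mf_sq|exact: sq_ge0|exact: sq_ge0|].
by apply: (ae_imp e) => x h; apply: eq_bigr => i _; rewrite h.
Qed.

Lemma q_eq D F G : (forall x, D x -> forall i, F i x = G i x) -> q D F = q D G.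
Proof. by move=> e; apply: qi_eq => x Dx; apply: eq_bigr => i _; rewrite e. Qed.

Lemma q_sub D D' F : measurable D -> measurable D' -> mfF F -> D `<=` D' ->
  (q D F <= q D' F)%E.
Proof. by move=> mD mD' mF; apply: qi_sub => //; [exact: mf_sq|exact: sq_ge0]. Qed.

Lemma q0_ae F : mfF F -> q setT F = 0%E -> {ae mu, forall x, forall i, F i x = 0}.
Proof.
move=> mF F0.
have := @integral_abs_eq0 _ _ _ mu.
have H : ae_eq mu setT (fun x => (sq F x)%:E) (cst 0%E).
  apply/(ae_eq_integral_abs mu measurableT (mf_EFin (mf_sq mF))).
  by rewrite -[RHS]F0; apply: eq_integral => x _; rewrite /= ger0_norm// sq_ge0.
move=> _; apply: (ae_imp H) => x /(_ Logic.I) [] e i.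
by apply/eqP; rewrite -sqrf_eq0; apply/eqP/le_anti; rewrite sqr_ge0 andbT -e sq_ge1.
Qed.

(* The weights 2^j make the increments absolutely summable almost everywhere. *)
Lemma telescope_sq (f : nat -> R) (m n : nat) : (m <= n)%N ->
  (f n - f m) ^+ 2 <= 2 * (2^-1) ^+ m *
    \sum_(m <= j < n) 2 ^+ j * (f j.+1 - f j) ^+ 2.
Proof.
move=> mn; move: (n - m)%N {-2}n mn (erefl (n - m)%N) => k {}n.
elim: k m n => [|k IH] m n mn e.
  have -> : n = m by apply/eqP; rewrite eqn_leq mn -subn_eq0 -e.
  by rewrite subrr expr0n/= big_geq// mulr0.
have mn' : (m < n)%N by rewrite -subn_gt0 -e.
have {}IH := IH m.+1 n mn' _; have {}IH := IH ltac:(by rewrite subnS -e).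
rewrite big_ltn// mulrDr.
set S := \sum_(m.+1 <= j < n) _ in IH *.
have -> : 2 * 2^-1 ^+ m * (2 ^+ m * (f m.+1 - f m) ^+ 2) = 2 * (f m.+1 - f m) ^+ 2.
  have p : (2 : R)^-1 ^+ m * 2 ^+ m = 1 by rewrite -exprMn mulVf// expr1n.
  by rewrite mulrA -(mulrA 2) p mulr1.
have := sqr_ge0 ((f n - f m.+1) - (f m.+1 - f m)).
rewrite (exprS _ m) in IH; set w := 2^-1 ^+ m in IH *.
have -> : f n - f m = (f n - f m.+1) + (f m.+1 - f m) by ring.
set a := f n - f m.+1 in IH *; set b := f m.+1 - f m.
clearbody a b w S; rewrite sqrrB sqrrD; lra.
Qed.

Lemma telescope_fld (Fk : nat -> fld) (m n : nat) x : (m <= n)%N ->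
  sq (fsub (Fk n) (Fk m)) x <= 2 * (2^-1) ^+ m *
    \sum_(m <= j < n) 2 ^+ j * sq (fsub (Fk j.+1) (Fk j)) x.
Proof.
move=> mn; rewrite (eq_bigr (fun j => \sum_i 2 ^+ j * fsub (Fk j.+1) (Fk j) i x ^+ 2)); last first.
  by move=> j _; rewrite mulr_sumr.
rewrite exchange_big/= mulr_sumr; apply: ler_sum => i _.
exact: (@telescope_sq (fun n => Fk n i x)).
Qed.

Lemma geo_sum (n : nat) : \sum_(0 <= j < n) (2^-1 : R) ^+ j <= 2.
Proof.
suff -> : \sum_(0 <= j < n) (2^-1 : R) ^+ j = 2 - 2 * 2^-1 ^+ n.
  by have : 0 <= (2^-1 : R) ^+ n by []; lra.
elim: n => [|n IH]; first by rewrite big_geq// expr0; lra.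
by rewrite big_nat_recr//= IH exprS; lra.
Qed.

Lemma half_pow_lt (e : R) : 0 < e -> exists m : nat, (2^-1 : R) ^+ m < e.
Proof.
move=> e0; exists (Num.truncn e^-1).+1.
have h := truncnS_gt e^-1; set m := (Num.truncn _).+1 in h *.
have : (m%:R : R) <= 2 ^+ m by rewrite -natrX ler_nat ltnW// ltn_expl.
rewrite exprVn => h2; rewrite invf_plt ?posrE ?exprn_gt0//; exact: lt_le_trans h h2.
Qed.

Lemma squeeze_cvg (f : nat -> R) (B : R) : 0 <= B ->
  (forall m n, (m <= n)%N -> (f n - f m) ^+ 2 <= (2^-1) ^+ m * B) ->
  exists2 l : R, f n @[n --> \oo] --> l & forall m, (l - f m) ^+ 2 <= (2^-1) ^+ m * B.
Proof.
move=> B0 H.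
have cf : cvg (f n @[n --> \oo]).
  apply/cauchy_cvgP/cauchy_exP => e e0.
  have [m hm] : exists m : nat, (2^-1 : R) ^+ m * (B + 1) < e ^+ 2.
    have [m hm] := @half_pow_lt (e ^+ 2 / (B + 1)) ltac:(by apply: divr_gt0; [exact: exprn_gt0|lra]).
    by exists m; rewrite -ltr_pdivlMr//; lra.
  exists (f m); exists m => // n /= mn; rewrite /ball/= distrC.
  rewrite -(@ltr_pXn2r _ 2)// ?nnegrE ?ltW// real_normK ?num_real//.
  apply: (le_lt_trans (H m n mn)); apply: le_lt_trans hm.
  by apply: ler_wpM2l => //; lra.
exists (lim (f n @[n --> \oo])) => // m.
have c2 : (f n - f m) ^+ 2 @[n --> \oo] --> (lim (f n @[n --> \oo]) - f m) ^+ 2.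
  by rewrite expr2; under eq_fun do rewrite expr2; apply: cvgM; (apply: cvgB; [exact: cf|exact: cvg_cst]).
rewrite -(cvg_lim _ c2)//; apply: limr_le; first exact: cvgP c2.
by exists m => // n /= mn; exact: H.
Qed.

Lemma cvg_sumR (s : seq I) (f : nat -> I -> R) (l : I -> R) :
  (forall i, f n i @[n --> \oo] --> l i) ->
  \sum_(i <- s) f n i @[n --> \oo] --> \sum_(i <- s) l i.
Proof.
move=> H; elim: s => [|i s IH].
  by rewrite big_nil; under eq_fun do rewrite big_nil; exact: cvg_cst.
rewrite big_cons; under eq_fun do rewrite big_cons.
by apply: cvgD; [exact: H|exact: IH].
Qed.

(** Riesz-Fischer for increments of ratio 1/16. Weighted by 2^k they are still summable, so the
    sequence converges almost everywhere, with a tail bound that gives the constant 4. *)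
Lemma L2_limit D (Fk : nat -> fld) (r : R) : measurable D -> 0 <= r ->
  (forall k, mfF (Fk k)) ->
  (forall k, (q D (fsub (Fk k.+1) (Fk k)) <= ((16^-1) ^+ k * r)%:E)%E) ->
  exists F, [/\ mfF F, forall L, (forall k, perF L (Fk k)) -> perF L F &
    forall m, (q D (fsub F (Fk m)) <= (4 * (2^-1) ^+ m * r)%:E)%E].
Proof.
move=> mD r0 mFk dk.
pose u (j : nat) (x : R) : R := 2 ^+ j * sq (fsub (Fk j.+1) (Fk j)) x.
have u0 j x : 0 <= u j x by rewrite mulr_ge0// sq_ge0.
have mu_ j : mf (u j) by apply: mfM; [exact: mf_cst|apply: mf_sq; exact: mf_fsub].
pose G x : \bar R := (\sum_(j <oo) (u j x)%:E)%E.
have mG : measurable_fun D G.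
  by apply: ge0_emeasurable_sum => [j x _ _|j _]; [rewrite lee_fin|exact: mf_EFin].
have G0 x : (0 <= G x)%E by apply: nneseries_ge0 => n _ _; rewrite lee_fin.
have IG : (\int[mu]_(x in D) G x <= (2 * r)%:E)%E.
  rewrite /G integral_nneseries//; [|by move=> j; exact: mf_EFin|by move=> j x _; rewrite lee_fin].
  apply: lime_le.
    by apply: is_cvg_nneseries => n _ _; apply: integral_ge0 => x _; rewrite lee_fin.
  apply: nearW => n; apply: (@le_trans _ _ (\sum_(0 <= j < n) ((2^-1) ^+ j * r)%:E)%E); last first.
    rewrite sumEFin lee_fin -mulr_suml; apply: ler_wpM2r => //; exact: geo_sum.
  apply: lee_sum => j _.
  have -> : (\int[mu]_(x in D) (u j x)%:E = (2 ^+ j)%:E * q D (fsub (Fk j.+1) (Fk j)))%E.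
    rewrite /q -qiZ//; [apply: mf_sq; exact: mf_fsub|exact: sq_ge0].
  apply: (@le_trans _ _ ((2 ^+ j)%:E * ((16^-1) ^+ j * r)%:E)%E).
    by apply: lee_wpmul2l => //; rewrite lee_fin exprn_ge0.
  rewrite -EFinM lee_fin mulrA -exprMn; apply: ler_wpM2r => //.
  by rewrite lerXn2r// ?nnegrE; lra.
(* The upper limit is defined at every point and is measurable, and it inherits periodicity
   pointwise, also where the sequence diverges. *)
pose F : fld := fun i x => fine (limn_esup (fun k => (Fk k i x)%:E)).
have mFF : mfF F.
  move=> i; apply: (measurableT_comp (fine_measurable measurableT)) => //.
  by apply: (measurable_fun_limn_esup (f := fun k x => (Fk k i x)%:E)) => k; exact: (mf_EFin (mFk k i)).
exists F; split => //.
  by move=> L PL i x; rewrite /F; under eq_fun do rewrite PL.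
move=> m.
have fin : {ae mu, forall x, D x -> G x \is a fin_num}.
  apply: integrable_ae => //; apply/integrableP; split => //.
  under eq_integral do rewrite gee0_abs//; exact: le_lt_trans IG (ltry _).
have pt : {ae mu, forall x, D x -> ((sq (fsub F (Fk m)) x)%:E <= (2 * (2^-1) ^+ m)%:E * G x)%E}.
  apply: (ae_imp fin) => x Gfin Dx; have {Gfin} := Gfin Dx.
  have Gp n : ((\sum_(0 <= j < n) u j x)%:E <= G x)%E.
    rewrite -sumEFin; apply: nneseries_lim_ge => j _ _; rewrite lee_fin; exact: u0.
  case E: (G x) Gp (G0 x) => [B| |]// Gp; rewrite lee_fin => B0 _.
  have Gp' n : \sum_(0 <= j < n) u j x <= B by rewrite -lee_fin.
  have key m' n : (m' <= n)%N -> sq (fsub (Fk n) (Fk m')) x <= (2^-1) ^+ m' * (2 * B).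
    move=> mn; apply: (@le_trans _ _ (2 * (2^-1) ^+ m' * \sum_(m' <= j < n) u j x)).
      exact: telescope_fld.
    rewrite (mulrC 2) -mulrA; apply: ler_wpM2l => //; rewrite ler_pM2l//.
    apply: le_trans (Gp' n); rewrite (big_cat_nat (n := m') (m := 0%N))//= lerDr.
    by apply: sumr_ge0 => j _; exact: u0.
  have lim_i i : exists2 l, (Fk n i x) @[n --> \oo] --> l & l = F i x.
    have [|l cl _] := @squeeze_cvg (fun n => Fk n i x) (2 * B) ltac:(lra).
      by move=> m' n mn; apply: le_trans (key _ _ mn); exact: (@sq_ge1 (fsub (Fk n) (Fk m')) i x).
    exists l => //; rewrite /F.
    have ce : (Fk n i x)%:E @[n --> \oo] --> l%:E by apply: cvg_EFin => //; exact: nearW.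
    by rewrite is_cvg_limn_esupE; [rewrite (cvg_lim _ ce)|exact: cvgP ce].
  rewrite -EFinM lee_fin.
  have csq : sq (fsub (Fk n) (Fk m)) x @[n --> \oo] --> sq (fsub F (Fk m)) x.
    apply: cvg_sumR => i; rewrite /fsub expr2; under eq_fun do rewrite expr2.
    have [l cl <-] := lim_i i.
    by apply: cvgM; (apply: cvgB; [exact: cl|exact: cvg_cst]).
  rewrite -(cvg_lim _ csq)//; apply: limr_le; first exact: cvgP csq.
  by exists m => // n /= mn; apply: (le_trans (key _ _ mn)); rewrite mulrCA mulrA.
apply: (@le_trans _ _ (\int[mu]_(x in D) ((2 * (2^-1) ^+ m)%:E * G x))%E).
  apply: ae_ge0_le_integral => //.
  - by move=> x _; rewrite lee_fin sq_ge0.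
  - by apply: mf_EFin; apply: mf_sq; exact: mf_fsub.
  - by move=> x _; apply: mule_ge0; rewrite // lee_fin mulr_ge0.
  - by apply: measurable_funeM.
rewrite ge0_integralZl_EFin//.
apply: (@le_trans _ _ ((2 * 2^-1 ^+ m)%:E * (2 * r)%:E)%E).
  by apply: lee_wpmul2l => //; rewrite lee_fin mulr_ge0.
by rewrite -EFinM lee_fin; lra.
Qed.

Definition inball D (L r : R) F : Prop :=
  [/\ mfF F, perF L F & (q D F <= (4 * r)%:E)%E].

(** Banach iteration from zero, in squared norms. The contraction is required only on the ball of
    radius 4r, which the iterates never leave, by the same weighted telescoping. The conclusion is
    equality almost everywhere, hence the vanishing of [q]. *)
Lemma fixpoint D (L r : R) (Phi : fld -> fld) : measurable D -> 0 <= r ->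
  (forall F, inball D L r F -> mfF (Phi F) /\ perF L (Phi F)) ->
  (forall F G, inball D L r F -> inball D L r G ->
    (q D (fsub (Phi F) (Phi G)) <= (16^-1)%:E * q D (fsub F G))%E) ->
  (q D (Phi fzero) <= r%:E)%E ->
  exists2 F, inball D L r F & q D (fsub (Phi F) F) = 0%E.
Proof.
move=> mD r0 HP HC H0; pose Fk k := iter k Phi fzero.
have z0 : inball D L r fzero.
  split; [exact: mf_fzero|by []|].
  rewrite /q (@qi_eq _ _ _ (fun=> 0)) => [|x _]; last exact: sq_fzero.
  by rewrite /qi integral0 lee_fin mulr_ge0.
have P k : inball D L r (Fk k) /\
    (q D (fsub (Fk k.+1) (Fk k)) <= ((16^-1) ^+ k * r)%:E)%E.
  (* Strong induction: the k-th iterate lies in the ball because of all earlier increments, and its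
     own increment is estimated because it lies in the ball. *)
  elim/ltn_ind: k => k IH.
  have mk j : (j <= k)%N -> mfF (Fk j) /\ perF L (Fk j).
    case: j => [|j] jk; first by case: z0.
    by apply: HP; have [] := IH j jk.
  have bk : inball D L r (Fk k).
    have [mk1 pk1] := mk k (leqnn k); split => //.
    pose S := fun x => \sum_(0 <= j < k) 2 * (2 ^+ j * sq (fsub (Fk j.+1) (Fk j)) x).
    have mt j : (j < k)%N -> mf (fun x => 2 * (2 ^+ j * sq (fsub (Fk j.+1) (Fk j)) x)).
      move=> jk; apply: mfM; first exact: mf_cst.
      apply: mfM; first exact: mf_cst.
      by apply: mf_sq; apply: mf_fsub; [exact: (mk j.+1 jk).1|exact: (mk j (ltnW jk)).1].
    have t0 j x : 0 <= 2 * (2 ^+ j * sq (fsub (Fk j.+1) (Fk j)) x).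
      by rewrite !mulr_ge0// ?sq_ge0.
    pose tt (j : 'I_k) x := 2 * (2 ^+ j * sq (fsub (Fk j.+1) (Fk j)) x).
    apply: (@le_trans _ _ (qi D (fun x => \sum_j tt j x))).
      apply: qi_le => //; [exact: mf_sq|by apply: mf_sum => j; exact: mt|exact: sq_ge0|].
      move=> x _; rewrite /tt -mulr_sumr.
      have := @telescope_fld Fk 0 k x (leq0n k); rewrite expr0 mulr1 big_mkord.
      rewrite (_ : sq _ x = sq (Fk k) x)//; apply: eq_bigr => i _.
      by rewrite /fsub/= subr0.
    rewrite qi_sum//; [|by move=> j; exact: mt|by move=> j x; exact: t0].
    apply: (@le_trans _ _ (\sum_(j < k) (2 * ((2^-1) ^+ j * r))%:E)%E); last first.
      rewrite sumEFin lee_fin -mulr_sumr -mulr_suml.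
      have := @geo_sum k; rewrite big_mkord => g2.
      by rewrite mulrA; apply: ler_wpM2r => //; lra.
    apply: lee_sum => j _; have [_ dj] := IH j (ltn_ord j).
    have -> : (qi D (tt j) = (2 * 2 ^+ j)%:E * q D (fsub (Fk j.+1) (Fk j)))%E.
      rewrite /q -qiZ//; [by apply: qi_eq => x _; rewrite /tt mulrA| |exact: sq_ge0].
      by apply: mf_sq; apply: mf_fsub; [exact: (mk j.+1 (ltn_ord j)).1|exact: (mk j (ltnW (ltn_ord j))).1].
    apply: (@le_trans _ _ ((2 * 2 ^+ j)%:E * ((16^-1) ^+ j * r)%:E)%E).
      by apply: lee_wpmul2l => //; rewrite lee_fin mulr_ge0.
    rewrite -EFinM lee_fin -!mulrA ler_pM2l// mulrA -exprMn; apply: ler_wpM2r => //.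
    by rewrite lerXn2r// ?nnegrE; lra.
  split => //; case: k IH mk bk => [_ _ _|k IH mk bk].
    rewrite expr0 mul1r; apply: le_trans H0; rewrite (@q_eq D _ (Phi fzero))// => x _ i.
    by rewrite /fsub/= subr0.
  have [bk' dk] := IH k (ltnSn k).
  apply: (le_trans (HC _ _ bk bk')); rewrite exprS -mulrA EFinM.
  by apply: lee_wpmul2l => //; rewrite lee_fin.
have [F [mF pF cF]] := @L2_limit D Fk r mD r0 (fun k => let: conj (And3 m _ _) _ := P k in m) (fun k => proj2 (P k)).
have bF : inball D L r F.
  split => //; first by apply: pF => k; have [[]] := P k.
  have := cF 0%N; rewrite expr0 mulr1 (@q_eq D _ F)// => x _ i.
  by rewrite /fsub /Fk/= subr0.
exists F => //.
have mPF := (HP _ bF).1.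
apply/eqP; rewrite eq_le q_ge0 andbT; apply/lee_addgt0Pr => e e0; rewrite add0e.
have [m hm] := @half_pow_lt (e / (20 * (r + 1))) ltac:(by apply: divr_gt0 => //; lra).
have [bm _] := P m; have [bm1 _] := P m.+1; have mm := let: And3 h _ _ := bm in h.
have mm1 := let: And3 h _ _ := bm1 in h.
have h1 : (q D (fsub (Phi F) (Fk m.+1)) <= (4 * (2^-1) ^+ m * r)%:E)%E.
  apply: (le_trans (HC _ _ bF bm)); apply: le_trans (cF m).
  rewrite -[leRHS]mul1e; apply: lee_wpmul2r; [exact: q_ge0|rewrite lee_fin; lra].
have h2 := cF m.+1.
apply: (@le_trans _ _ (2%:E * (4 * (2^-1) ^+ m * r)%:E + 2%:E * (4 * (2^-1) ^+ m.+1 * r)%:E)%E).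
  rewrite (@q_eq D _ (fsub (fsub (Phi F) (Fk m.+1)) (fsub F (Fk m.+1)))) => [|x _ i]; last first.
    by rewrite /fsub; ring.
  apply: (le_trans (q_fsub _ _ _)) => //; [exact: mf_fsub|exact: mf_fsub|].
  by apply: leeD; apply: lee_wpmul2l.
rewrite -!EFinM -EFinD lee_fin exprS.
have w0 : 0 <= (2^-1 : R) ^+ m by [].
rewrite ltr_pdivlMr in hm; last lra.
set w := 2^-1 ^+ m in w0 hm *; nra.
Qed.

End FieldsL2.

(** * Fields carrying two derivatives *)

Section Jets.
Variables (R : realType) (I : finType).
Local Notation mu := (@lebesgue_measure R).
Local Notation fld := (I -> R -> R).
Implicit Types (F G : fld).

(** A field packed with versions of its first two derivatives: differential operators become
    pointwise expressions, and regularity is the separate predicate [jetok]. *)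
Record jet := Jet { j0 : fld; j1 : fld; j2 : fld }.
Implicit Types (J : jet).

Definition jetok J : Prop := forall i, D2 (j0 J i) (j1 J i) (j2 J i).
Definition jzero : jet := Jet (@fzero R I) (@fzero R I) (@fzero R I).
Definition jadd J J' : jet :=
  Jet (fadd (j0 J) (j0 J')) (fadd (j1 J) (j1 J')) (fadd (j2 J) (j2 J')).
Definition jsub J J' : jet :=
  Jet (fsub (j0 J) (j0 J')) (fsub (j1 J) (j1 J')) (fsub (j2 J) (j2 J')).
Definition jscale (c : R) J : jet :=
  Jet (fscale c (j0 J)) (fscale c (j1 J)) (fscale c (j2 J)).
Definition jshift (s : R) J : jet :=
  Jet (fun i x => j0 J i (x + s)) (fun i x => j1 J i (x + s)) (fun i x => j2 J i (x + s)).
Definition jmul (p p1 p2 : R -> R) J : jet :=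
  Jet (fun i x => p x * j0 J i x) (fun i x => p1 x * j0 J i x + p x * j1 J i x)
    (fun i x => p2 x * j0 J i x + 2 * (p1 x * j1 J i x) + p x * j2 J i x).

Definition L2jet J : Prop :=
  [/\ jetok J, (q setT (j0 J) < +oo)%E, (q setT (j1 J) < +oo)%E & (q setT (j2 J) < +oo)%E].

Lemma D2_cont (h h1 h2 : R -> R) : D2 h h1 h2 -> continuous h /\ continuous h1.
Proof. by move=> dh; split; [exact: prim_cont (D2_prim dh)|exact: prim_cont dh.2]. Qed.

Lemma jet_mf J : jetok J -> [/\ mfF (j0 J), mfF (j1 J) & mfF (j2 J)].
Proof.
move=> ok; split => i; have dh := ok i; have [c0 c1] := D2_cont dh.
- exact: mf_cont.
- exact: mf_cont.
- by have [_ [[]]] := dh.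
Qed.

Lemma D2_zero : D2 (fun=> 0 : R) (fun=> 0) (fun=> 0).
Proof. by split; [move=> x; exact: is_derive_cst|exact: prim_cst]. Qed.

Lemma jzero_ok : jetok jzero.
Proof. by move=> i; exact: D2_zero. Qed.

Lemma jadd_ok J J' : jetok J -> jetok J' -> jetok (jadd J J').
Proof.
move=> ok ok' i; have [d p] := ok i; have [d' p'] := ok' i; split; last exact: primD.
by move=> x; exact: (is_deriveD (d x) (d' x)).
Qed.

Lemma jsub_ok J J' : jetok J -> jetok J' -> jetok (jsub J J').
Proof.
move=> ok ok' i; have [d p] := ok i; have [d' p'] := ok' i; split; last exact: primB.
by move=> x; exact: (is_deriveB (d x) (d' x)).
Qed.

Lemma jscale_ok c J : jetok J -> jetok (jscale c J).
Proof.
move=> ok i; have [d p] := ok i; split; last exact: primZ.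
by move=> x; exact: (is_deriveZ' c (d x)).
Qed.

Lemma jshift_ok s J : jetok J -> jetok (jshift s J).
Proof.
move=> ok i; have [d p] := ok i; split; last exact: prim_shift.
by move=> x; exact: (is_derive_shift (d (x + s))).
Qed.

Lemma D2_mul (p p1 p2 h h1 h2 : R -> R) : D2 p p1 p2 -> D2 h h1 h2 ->
  D2 (fun x => p x * h x) (fun x => p1 x * h x + p x * h1 x)
     (fun x => p2 x * h x + 2 * (p1 x * h1 x) + p x * h2 x).
Proof.
move=> dp dh; have [d1 P1] := dp; have [d2 H1] := dh.
have [_ cp1] := D2_cont dp; have [_ ch1] := D2_cont dh.
split; first by move=> x; exact: (is_deriveM' (d1 x) (d2 x)).
have A := prim_mul P1 d2 ch1; have B := prim_mul H1 d1 cp1.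
have := primD A B; congr prim; apply/funext => x; ring.
Qed.

Lemma jmul_ok p p1 p2 J : D2 p p1 p2 -> jetok J -> jetok (jmul p p1 p2 J).
Proof. by move=> dp ok i; exact: D2_mul. Qed.

Lemma D2_box (h h1 h2 : R -> R) : (forall n : nat, exists h' h1' h2', D2 h' h1' h2' /\
    forall x, box n x -> [/\ h x = h' x, h1 x = h1' x & h2 x = h2' x]) -> D2 h h1 h2.
Proof.
move=> H; split.
  move=> x; have hn := truncnS_gt (`|x| + 1); set n := (Num.truncn _).+1 in hn.
  have [h' [h1' [h2' [[d _] e]]]] := H n.
  have inb y : `|y - x| < 1 -> box n y.
    move=> yx; rewrite /box/= in_itv/=.
    have : `|y| < n%:R.
      have := ler_normD x (y - x); rewrite (_ : x + (y - x) = y); [lra|ring].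
    by rewrite ltr_norml => /andP[/ltW -> ->].
  have [|_ -> _] := e x; first by apply: inb; rewrite subrr normr0.
  apply: near_eq_is_derive (d x); apply: (@near_dist _ _ 1) => // y /inb/e[-> _ _].
  by [].
apply: prim_box => n; have [h' [h1' [h2' [[_ P] e]]]] := H n.
by exists h1', h2'; split => // x /e[].
Qed.

Lemma L2jet_zero : L2jet jzero.
Proof.
have z : q setT (@fzero R I) = 0%E.
  by rewrite /q (@qi_eq _ _ _ (fun=> 0)) => [|x _]; [rewrite /qi integral0|exact: sq_fzero].
by split; [exact: jzero_ok|rewrite z ltry..].
Qed.

Lemma fin2 (x y : \bar R) (a b : R) : (0 <= x)%E -> (0 <= y)%E -> (x < +oo)%E -> (y < +oo)%E ->
  (a%:E * x + b%:E * y < +oo)%E.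
Proof. by case: x => // x _; case: y => // y _ _ _; rewrite -!EFinM -EFinD ltry. Qed.

Lemma L2jet_add J J' : L2jet J -> L2jet J' -> L2jet (jadd J J').
Proof.
move=> [ok a b c] [ok' a' b' c']; have [m0 m1 m2] := jet_mf ok; have [n0 n1 n2] := jet_mf ok'.
split; first exact: jadd_ok.
- by apply: le_lt_trans (q_fadd _ m0 n0) _ => //; apply: fin2 => //; exact: q_ge0.
- by apply: le_lt_trans (q_fadd _ m1 n1) _ => //; apply: fin2 => //; exact: q_ge0.
- by apply: le_lt_trans (q_fadd _ m2 n2) _ => //; apply: fin2 => //; exact: q_ge0.
Qed.

Lemma L2jet_sub J J' : L2jet J -> L2jet J' -> L2jet (jsub J J').
Proof.
move=> [ok a b c] [ok' a' b' c']; have [m0 m1 m2] := jet_mf ok; have [n0 n1 n2] := jet_mf ok'.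
split; first exact: jsub_ok.
- by apply: le_lt_trans (q_fsub _ m0 n0) _ => //; apply: fin2 => //; exact: q_ge0.
- by apply: le_lt_trans (q_fsub _ m1 n1) _ => //; apply: fin2 => //; exact: q_ge0.
- by apply: le_lt_trans (q_fsub _ m2 n2) _ => //; apply: fin2 => //; exact: q_ge0.
Qed.

Lemma q_shiftT F s : mfF F -> q setT (fun i x => F i (x + s)) = q setT F.
Proof. by move=> mF; rewrite /q -(qi_shiftT s (mf_sq mF) (sq_ge0 F)). Qed.

Lemma L2jet_shift s J : L2jet J -> L2jet (jshift s J).
Proof.
move=> [ok a b c]; have [m0 m1 m2] := jet_mf ok.
by split; [exact: jshift_ok|rewrite q_shiftT..].
Qed.

Lemma L2jet_scale (c : R) J : L2jet J -> L2jet (jscale c J).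
Proof.
move=> [ok a b e]; have [m0 m1 m2] := jet_mf ok; split; first exact: jscale_ok.
- by rewrite q_fscale//; case: (q _ _) a (q_ge0 setT (j0 J)) => // r _ _; rewrite -EFinM ltry.
- by rewrite q_fscale//; case: (q _ _) b (q_ge0 setT (j1 J)) => // r _ _; rewrite -EFinM ltry.
- by rewrite q_fscale//; case: (q _ _) e (q_ge0 setT (j2 J)) => // r _ _; rewrite -EFinM ltry.
Qed.

Lemma sq_mul_le (p : R) (C : R) F x : `|p| <= C -> \sum_i (p * F i x) ^+ 2 <= C ^+ 2 * sq F x.
Proof.
move=> pC; rewrite /sq mulr_sumr; apply: ler_sum => i _; rewrite exprMn ler_wpM2r ?sqr_ge0//.
by rewrite -real_normK ?num_real// lerXn2r// nnegrE//; exact: le_trans pC.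
Qed.

Lemma q_fin2 F G (H : fld) (a b : R) : mfF F -> mfF G -> mfF H ->
  0 <= a -> 0 <= b -> (forall x, sq F x <= a * sq G x + b * sq H x) ->
  (q setT G < +oo)%E -> (q setT H < +oo)%E -> (q setT F < +oo)%E.
Proof.
move=> mF mG mH a0 b0 le fG fH.
have K : (q setT F <= a%:E * q setT G + b%:E * q setT H)%E.
  by apply: q_le2 => //; apply: ae_all => x _; exact: le.
by apply: (le_lt_trans K); apply: fin2 => //; exact: q_ge0.
Qed.

Lemma L2jet_mul p p1 p2 (C : R) J : D2 p p1 p2 ->
  (forall x, [/\ `|p x| <= C, `|p1 x| <= C & `|p2 x| <= C]) -> L2jet J ->
  L2jet (jmul p p1 p2 J).
Proof.
move=> dp bp [ok a b c]; have [m0 m1 m2] := jet_mf ok.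
have ok' := jmul_ok dp ok; have [n0 n1 n2] := jet_mf ok'.
have sqD (u v : R) : (u + v) ^+ 2 <= 2 * u ^+ 2 + 2 * v ^+ 2.
  by have := sqr_ge0 (u - v); rewrite sqrrB sqrrD; lra.
have C20 : 0 <= C ^+ 2 by exact: sqr_ge0.
have C22 : 0 <= 2 * C ^+ 2 by lra.
have C28 : 0 <= 8 * C ^+ 2 by lra.
split => //.
- apply: le_lt_trans (@q_le1 _ _ setT _ (j0 J) (C ^+ 2) _ _ _ _ _) _ => //.
    by apply: ae_all => x _; apply: sq_mul_le; have [] := bp x.
  by case: (q _ _) a (q_ge0 setT (j0 J)) => // r _ _; rewrite -EFinM ltry.
- apply: (@q_fin2 _ (j0 J) (j1 J) (2 * C ^+ 2) (2 * C ^+ 2)) => // x.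
  have [b0 b1 b2] := bp x.
  apply: (@le_trans _ _ (2 * (\sum_i (p1 x * j0 J i x) ^+ 2) + 2 * (\sum_i (p x * j1 J i x) ^+ 2))).
      by rewrite !mulr_sumr -big_split/=; apply: ler_sum => i _; exact: sqD.
  by have := sq_mul_le (j0 J) x b1; have := sq_mul_le (j1 J) x b0; lra.
pose K := fadd (fun i x => p2 x * j0 J i x) (fun i x => 2 * (p1 x * j1 J i x)).
have mK : mfF K.
  have [dd1 [[mp2 _] _]] := dp; have [cp cp1] := D2_cont dp.
  apply: mf_fadd => i; first by apply: mfM.
  by apply: mfM; [exact: mf_cst|apply: mfM => //; exact: mf_cont].
have fK : (q setT K < +oo)%E.
  apply: (@q_fin2 _ (j0 J) (j1 J) (2 * C ^+ 2) (8 * C ^+ 2)) => // x.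
  have [b0 b1 b2] := bp x.
  apply: (@le_trans _ _ (2 * (\sum_i (p2 x * j0 J i x) ^+ 2) + 8 * (\sum_i (p1 x * j1 J i x) ^+ 2))).
      rewrite !mulr_sumr -big_split/=; apply: ler_sum => i _; rewrite /K /fadd.
      by have := sqD (p2 x * j0 J i x) (2 * (p1 x * j1 J i x)); rewrite [X in _ <= _ + 2 * X]exprMn; lra.
  by have := sq_mul_le (j0 J) x b2; have := sq_mul_le (j1 J) x b1; lra.
apply: (@q_fin2 _ K (j2 J) 2 (2 * C ^+ 2)) => // x.
have [b0 b1 b2] := bp x.
apply: (@le_trans _ _ (2 * sq K x + 2 * (\sum_i (p x * j2 J i x) ^+ 2))).
    by rewrite !mulr_sumr -big_split/=; apply: ler_sum => i _; exact: sqD.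
by have := sq_mul_le (j2 J) x b0; lra.
Qed.

(** * Cells of length l and locally finite sums over the integers *)

Section LocallyFiniteSums.
Variable (l : R).
Hypothesis l0 : 0 < l.

Definition cell (j : int) : set R := `[j%:~R * l, (j%:~R + 1) * l[%classic.
Definition ico (a b : R) : set R := `[a, b[%classic.

Definition cidx (x : R) : int := Num.floor (x / l).

Lemma cellP j x : cell j x <-> cidx x = j.
Proof.
rewrite /cell/= in_itv/= /cidx; split.
  move=> /andP[h1 h2]; apply/eqP; rewrite -[_ == _]/(_ == _); apply/eqP.
  apply: floor_def; rewrite ler_pdivlMr// ltr_pdivrMr// h1 intrD; exact: h2.
move=> <-; have := floor_itv (x / l); rewrite ler_pdivlMr// ltr_pdivrMr// intrD.
by [].
Qed.

Lemma cell_cidx x : cell (cidx x) x.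
Proof. exact/cellP. Qed.

Definition tsupp (T : int -> jet) : Prop := forall j x,
  x <= (j%:~R - 1) * l \/ (j%:~R + 2) * l <= x ->
  forall i, [/\ j0 (T j) i x = 0, j1 (T j) i x = 0 & j2 (T j) i x = 0].

Definition sum3 (g : int -> R) (j : int) : R := g (j - 1) + g j + g (j + 1).

(** The sum over all integers. Under [tsupp] the terms that do not vanish at x have index within one
    of the cell of x, so three terms suffice; differentiability across cell ends is the content of
    [lsum_ok]. *)
Definition lsum (T : int -> jet) : jet :=
  Jet (fun i x => sum3 (fun j => j0 (T j) i x) (cidx x))
      (fun i x => sum3 (fun j => j1 (T j) i x) (cidx x))
      (fun i x => sum3 (fun j => j2 (T j) i x) (cidx x)).

Lemma big_sum3 (g : int -> R) (j : int) (m : nat) :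
  (`|j| < m)%N -> (forall k, k != j - 1 -> k != j -> k != j + 1 -> g k = 0) ->
  \sum_(0 <= k < (m + m).+1) g (k%:Z - m%:Z) = sum3 g j.
Proof.
move=> jm g0; rewrite -(big_map (fun k : nat => k%:Z - m%:Z) xpredT g).
set s := map _ _.
have us : uniq s.
  rewrite map_inj_uniq ?iota_uniq// => a b /eqP.
  by rewrite (inj_eq (addIr _)) => /eqP [].
have ms k : (`|k| <= m)%N -> k \in s.
  move=> km; apply/mapP; exists (absz (k + m%:Z)); last by lia.
  by rewrite mem_index_iota; lia.
rewrite (bigID (mem [:: j - 1; j; j + 1]))/= [X in _ + X]big1 ?addr0; last first.
  by move=> k; rewrite !inE !negb_or => /and3P[h1 h2 h3]; exact: g0.
transitivity (\sum_(i <- [:: j - 1; j; j + 1]) g i); last by rewrite !big_cons big_nil addr0 addrA.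
rewrite -big_filter; apply: perm_big; apply: uniq_perm; first exact: filter_uniq.
  by rewrite /= !inE; apply/and3P; split => //; lia.
move=> k; rewrite mem_filter; apply/andP/idP => [[]//|kk]; split => //.
by apply: ms; move: kk; rewrite !inE => /or3P[]/eqP->; lia.
Qed.

(** On each box the moving three-term sums agree with a single finite sum of jets, and regularity is
    local by [D2_box]. *)
Lemma lsum_ok T : (forall j, jetok (T j)) -> tsupp T -> jetok (lsum T).
Proof.
move=> Tok Ts i; apply: D2_box => n.
have [m hm] : exists m : nat, forall x, box n x -> (`|cidx x| < m)%N.
  exists (Num.truncn (n%:R / l)).+3 => x; rewrite /box/= in_itv/= => /andP[h1 h2].
  have := floor_itv (x / l); rewrite -/(cidx x) => /andP[f1 f2].
  have := truncnS_gt (n%:R / l) => f3.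
  have g1 : x / l < n%:R / l by rewrite ltr_pM2r ?invr_gt0.
  have g2 : - (n%:R / l) <= x / l by rewrite -mulNr ler_pM2r ?invr_gt0.
  set t := (Num.truncn _) in f3 *; set z := cidx x in f1 f2 *.
  have z1 : (z%:~R : R) < (t.+1%:Z)%:~R by apply: le_lt_trans f1 _; lra.
  have z2 : ((- t.+2%:Z)%:~R : R) < z%:~R.
    rewrite intrN /=; rewrite intrD in f2; have : (t.+2%:Z%:~R : R) = t.+1%:R + 1 by rewrite -[LHS]/(t.+2%:R) -natr1.
    by move=> ->; lra.
  by move: z1 z2; rewrite !ltr_int; lia.
pose Sm := \big[jadd/jzero]_(0 <= k < (m + m).+1) T (k%:Z - m%:Z).
have Smok : jetok Sm.
  rewrite /Sm; elim/big_ind: _ => //; [exact: jzero_ok|by move=> *; exact: jadd_ok].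
have SmE x : [/\ j0 Sm i x = \sum_(0 <= k < (m + m).+1) j0 (T (k%:Z - m%:Z)) i x,
    j1 Sm i x = \sum_(0 <= k < (m + m).+1) j1 (T (k%:Z - m%:Z)) i x &
    j2 Sm i x = \sum_(0 <= k < (m + m).+1) j2 (T (k%:Z - m%:Z)) i x].
  rewrite /Sm; elim: (index_iota _ _) => [|k s [e0 e1 e2]]; first by rewrite !big_nil.
  by rewrite !big_cons /= /fadd e0 e1 e2.
exists (j0 Sm i), (j1 Sm i), (j2 Sm i); split => // x bx.
have [-> -> ->] := SmE x.
have out k : k != cidx x - 1 -> k != cidx x -> k != cidx x + 1 ->
    x <= (k%:~R - 1) * l \/ (k%:~R + 2) * l <= x.
  move=> k1 k2 k3; have := cell_cidx x; rewrite /cell/= in_itv/= => /andP[h1 h2].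
  set j := cidx x in k1 k2 k3 h1 h2.
  have [kj|kj] : (k <= j - 2)%R \/ (j + 2 <= k)%R by lia.
    right; apply: le_trans h1; rewrite ler_pM2r//.
    have : (k%:~R : R) <= (j - 2)%:~R by rewrite ler_int.
    by rewrite intrB; lra.
  left; apply: le_trans (ltW h2) _; rewrite ler_pM2r//.
  have : ((j + 2)%:~R : R) <= k%:~R by rewrite ler_int.
  by rewrite intrD; lra.
have hx := hm x bx.
split; rewrite [RHS](@big_sum3 (fun k => _ (T k) i x) (cidx x))// => k k1 k2 k3;
  by have [] := Ts k x (out k k1 k2 k3) i.
Qed.

Lemma cell_meas j : measurable (cell j).
Proof. exact: measurable_itv. Qed.

Lemma qi_cells (f : R -> R) (a : int) (n : nat) : mf f -> (forall x, 0 <= f x) ->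
  (\sum_(0 <= k < n) qi (cell (a + k%:Z)%R) f)%E = qi (ico (a%:~R * l) ((a%:~R + n%:R) * l)) f.
Proof.
move=> m_f f0; elim: n => [|n IH].
  rewrite big_geq//; apply/esym.
  by rewrite addr0 /ico set_itvE /qi integral_set0.
have h1 : a%:~R * l <= (a%:~R + n%:R) * l by rewrite ler_pM2r// lerDl.
have h2 : (a%:~R + n%:R) * l <= (a%:~R + n.+1%:R) * l by rewrite ler_pM2r// lerD2l ler_nat.
rewrite big_nat_recr//= IH /ico (qi_cat h1 h2 m_f f0); congr (_ + qi _ f)%E.
by rewrite /cell intrD -[n.+1%:R]natr1 addrA.
Qed.

(** The left neighbours of n consecutive cells fill the same interval shifted by one cell, and
    likewise on the right; summation turns local three-cell bounds into bounds on long intervals. *)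
Lemma cell_sum3 (f g : R -> R) (c : R) (a : int) (n : nat) : mf f -> mf g ->
  (forall x, 0 <= f x) -> (forall x, 0 <= g x) -> 0 <= c ->
  (forall j, (qi (cell j) g <= c%:E * (qi (cell (j - 1)%R) f + qi (cell j) f + qi (cell (j + 1)%R) f))%E) ->
  (qi (ico (a%:~R * l) ((a%:~R + n%:R) * l)) g <=
   c%:E * (qi (ico ((a%:~R - 1) * l) ((a%:~R - 1 + n%:R) * l)) f +
     qi (ico (a%:~R * l) ((a%:~R + n%:R) * l)) f + qi (ico ((a%:~R + 1) * l) ((a%:~R + 1 + n%:R) * l)) f))%E.
Proof.
move=> m_f m_g f0 g0 c0 H; rewrite -!qi_cells//.
have e1 : (a%:~R - 1 : R) = (a - 1)%:~R by rewrite intrB.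
have e2 : (a%:~R + 1 : R) = (a + 1)%:~R by rewrite intrD.
rewrite e1 e2 -!qi_cells// -!big_split/=.
rewrite ge0_sume_distrr => [|k _]; last by do 2 (apply: adde_ge0; last exact: qi_ge0); exact: qi_ge0.
apply: lee_sum => k _; apply: le_trans (H _) _; rewrite (_ : (a + k%:Z - 1 = a - 1 + k%:Z)%R); last by lia.
by rewrite (_ : (a + k%:Z + 1 = a + 1 + k%:Z)%R); last by lia.
Qed.

Lemma mule3 (x : \bar R) : (0 <= x)%E -> (3%:E * x = x + x + x)%E.
Proof.
case: x => [r _| _|//]; first by rewrite -EFinM -!EFinD; congr (_%:E); ring.
by rewrite gt0_muley// lte_fin.
Qed.

Lemma cell_sum_line (f g : R -> R) (c : R) : mf f -> mf g ->
  (forall x, 0 <= f x) -> (forall x, 0 <= g x) -> 0 <= c ->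
  (forall j, (qi (cell j) g <= c%:E * (qi (cell (j - 1)%R) f + qi (cell j) f + qi (cell (j + 1)%R) f))%E) ->
  (qi setT g <= (3 * c)%:E * qi setT f)%E.
Proof.
move=> m_f m_g f0 g0 c0 H; apply: qi_setT_le => // n.
pose m := (Num.truncn (n%:R / l)).+1.
have hm : n%:R <= m%:R * l by rewrite -ler_pdivrMr//; apply/ltW; exact: truncnS_gt.
have := @cell_sum3 f g c (- m%:Z) (m + m) m_f m_g f0 g0 c0 H; set rhs := (X in (_ <= X)%E) => K.
apply: (@le_trans _ _ rhs).
  apply: le_trans K; apply: qi_sub => //; [exact: measurable_itv|exact: measurable_itv|].
  move=> x; rewrite /box/ico/= !in_itv/= => /andP[h1 h2].
  rewrite intrN natrD mulNr; apply/andP; split; first lra.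
  by rewrite (_ : _ * l = m%:R * l); [lra|rewrite -[m%:~R]/(m%:R); ring].
rewrite /rhs (mulrC 3) EFinM -muleA; apply: lee_wpmul2l => //.
rewrite mule3; last exact: qi_ge0.
by apply: leeD; [apply: leeD|]; (apply: qi_subT => //; exact: measurable_itv).
Qed.

Lemma qi_period (f : R -> R) (L a b : R) : mf f -> (forall x, 0 <= f x) ->
  (forall x, f (x + L) = f x) -> qi (ico (a + L) (b + L)) f = qi (ico (a) (b)) f.
Proof.
move=> m_f f0 pf; rewrite -(qi_shift_itv a b L)//; apply: qi_eq => x _; exact: pf.
Qed.

(** When m cells make up one period of [f], the two shifted intervals are again full periods, so no
    boundary contribution is lost. *)
Lemma cell_sum_period (f g : R -> R) (c : R) (m : nat) : (0 < m)%N -> mf f -> mf g ->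
  (forall x, 0 <= f x) -> (forall x, 0 <= g x) -> 0 <= c ->
  (forall x, f (x + m%:R * l) = f x) ->
  (forall j, (qi (cell j) g <= c%:E * (qi (cell (j - 1)%R) f + qi (cell j) f + qi (cell (j + 1)%R) f))%E) ->
  (qi (ico (0) (m%:R * l)) g <= (3 * c)%:E * qi (ico (0) (m%:R * l)) f)%E.
Proof.
move=> m0 m_f m_g f0 g0 c0 pf H; have m1 : (1 : R) <= m%:R by rewrite ler1n.
have := @cell_sum3 f g c 0 m m_f m_g f0 g0 c0 H.
rewrite mul0r !add0r mul1r => /le_trans; apply.
have -> : qi (ico (-1 * l) ((-1 + m%:R) * l)) f = qi (ico (0) (m%:R * l)) f.
  have h1 : -1 * l <= 0 by rewrite mulN1r oppr_le0 ltW.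
  have h2 : 0 <= (-1 + m%:R) * l by apply: mulr_ge0; lra.
  rewrite /ico (qi_cat h1 h2 m_f f0) -!/(ico _ _).
  rewrite -(@qi_period f (m%:R * l) (-1 * l) 0)// add0r addeC -mulrDl.
  have h3 : (-1 + m%:R) * l <= m%:R * l by rewrite ler_pM2r//; lra.
  by rewrite /ico (qi_cat h2 h3 m_f f0).
have -> : qi (ico (l) ((1 + m%:R) * l)) f = qi (ico (0) (m%:R * l)) f.
  have h1 : l <= m%:R * l by rewrite ler_peMl// ltW.
  have h2 : m%:R * l <= (1 + m%:R) * l by rewrite ler_pM2r//; lra.
  rewrite /ico (qi_cat h1 h2 m_f f0) -!/(ico _ _).
  have -> : qi (ico (m%:R * l) ((1 + m%:R) * l)) f = qi (ico (0) (l)) f.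
    by rewrite -(@qi_period f (m%:R * l) 0 l)// add0r mulrDl mul1r.
  by rewrite addeC /ico (qi_cat (ltW l0) h1 m_f f0).
rewrite (mulrC 3) EFinM -muleA; apply: lee_wpmul2l => //.
by rewrite mule3//; exact: qi_ge0.
Qed.

End LocallyFiniteSums.

End Jets.

(** * Second-order systems and their commutators with cut-offs *)

Section Operators.
Variables (R : realType) (I : finType).
Local Notation mu := (@lebesgue_measure R).
Local Notation fld := (I -> R -> R).
Local Notation jet := (jet R I).
Variables (d : I -> R) (c : I -> R -> R).
Implicit Types (B : I -> I -> R -> R) (F G : fld) (J : jet).

Definition op B J : fld :=
  fun i x => d i * j2 J i x + c i x * j1 J i x + \sum_k B i k x * j0 J k x.

(** Solvability and an a priori bound, in squared norms. The bound includes the first derivative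
    because commutators with cut-offs contain it; the second derivative is recovered from the
    equation. *)
Definition INV (Op : jet -> fld) (K : R) : Prop :=
  (forall F, mfF F -> (q setT F < +oo)%E ->
    exists2 J, L2jet J & {ae mu, forall x, forall i, Op J i x = F i x}) /\
  (forall J, L2jet J ->
    (q setT (j0 J) + q setT (j1 J) <= K%:E * q setT (Op J))%E).

Definition cont2 B : Prop := forall i k, continuous (B i k).

Lemma mf_op B J : (forall i, continuous (c i)) -> cont2 B -> jetok J -> mfF (op B J).
Proof.
move=> cc cB ok i; have [m0 m1 m2] := jet_mf ok.
apply: mfD; last by apply: mf_sum => k; apply: mfM => //; apply: mf_cont; exact: cB.
by apply: mfD; apply: mfM => //; [exact: mf_cst|exact: mf_cont].
Qed.

Lemma op_sub B J J' i x : op B (jsub J J') i x = op B J i x - op B J' i x.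
Proof.
rewrite /op /= /fsub.
have -> : \sum_k B i k x * (j0 J k x - j0 J' k x) =
    \sum_k B i k x * j0 J k x - \sum_k B i k x * j0 J' k x.
  by rewrite -sumrB; apply: eq_bigr => k _; rewrite mulrBr.
ring.
Qed.

Lemma op_add B J J' i x : op B (jadd J J') i x = op B J i x + op B J' i x.
Proof.
rewrite /op /= /fadd.
have -> : \sum_k B i k x * (j0 J k x + j0 J' k x) =
    \sum_k B i k x * j0 J k x + \sum_k B i k x * j0 J' k x.
  by rewrite -big_split/=; apply: eq_bigr => k _; rewrite mulrDr.
ring.
Qed.

Lemma op_shift B J (s : R) i x : (forall i x, c i (x + s) = c i x) ->
  op (fun i k x => B i k (x + s)) (jshift s J) i x = op B J i (x + s).
Proof. by move=> cs; rewrite /op/= cs. Qed.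

(** The commutator of the operator with [p], plus the effect of exchanging [B] for [B1] on the
    support of [p]. *)
Definition rem (B B1 : I -> I -> R -> R) (p p1 p2 : R -> R) J : fld := fun i x =>
  (2 * d i * p1 x * j1 J i x + (d i * p2 x + c i x * p1 x) * j0 J i x)
  + p x * \sum_k (B1 i k x - B i k x) * j0 J k x.

Lemma op_mul B B1 p p1 p2 J i x :
  op B1 (jmul p p1 p2 J) i x = p x * op B J i x + rem B B1 p p1 p2 J i x.
Proof.
rewrite /op /rem /=.
have -> : \sum_k B1 i k x * (p x * j0 J k x) =
    p x * (\sum_k B i k x * j0 J k x) + p x * \sum_k (B1 i k x - B i k x) * j0 J k x.
  rewrite -mulrDr -big_split/= mulr_sumr; apply: eq_bigr => k _; ring.
ring.
Qed.

Lemma rem_sub B B1 p p1 p2 J J' i x :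
  rem B B1 p p1 p2 (jsub J J') i x = rem B B1 p p1 p2 J i x - rem B B1 p p1 p2 J' i x.
Proof.
rewrite /rem /= /fsub.
have -> : \sum_k (B1 i k x - B i k x) * (j0 J k x - j0 J' k x) =
  \sum_k (B1 i k x - B i k x) * j0 J k x - \sum_k (B1 i k x - B i k x) * j0 J' k x.
  by rewrite -sumrB; apply: eq_bigr => k _; rewrite mulrBr.
ring.
Qed.

(** One more than the number of components, hence positive also for an empty index type. *)
Definition N1 : R := #|I|.+1%:R.

Lemma N1_gt0 : 0 < N1. Proof. by rewrite /N1 ltr0n. Qed.

(** Cauchy-Schwarz, read off from a sum of squared deviations from t. *)
Lemma sum_sq_le (a : I -> R) : (\sum_k a k) ^+ 2 <= N1 * \sum_k a k ^+ 2.
Proof.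
set S := \sum_k a k; set Q := \sum_k a k ^+ 2; pose t := S / N1.
have N0 := N1_gt0.
have H : 0 <= Q - 2 * t * S + #|I|%:R * t ^+ 2.
  have -> : Q - 2 * t * S + #|I|%:R * t ^+ 2 = \sum_k (a k - t) ^+ 2.
    rewrite (eq_bigr (fun k => a k ^+ 2 - 2 * t * a k + t ^+ 2)); last by move=> k _; ring.
    by rewrite big_split/= sumrB -mulr_sumr sumr_const; congr (_ + _); rewrite mulr_natl.
  by apply: sumr_ge0 => k _; exact: sqr_ge0.
have e : N1 = #|I|%:R + 1 by rewrite /N1 -natr1.
have St : S = t * N1 by rewrite /t mulfVK// gt_eqF.
have t2 : 0 <= t ^+ 2 by exact: sqr_ge0.
have : 0 <= N1 * (Q - 2 * t * S + N1 * t ^+ 2) by apply: mulr_ge0; [exact: ltW|rewrite e; lra].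
by rewrite St; set n := N1 in N0 *; nra.
Qed.

(* kap collects the commutator with the cut-off and the coefficient mismatch *)
Lemma sq_rem (A C dl : R) B B1 p p1 p2 J x :
  (forall i, `|2 * d i * p1 x| <= A) -> (forall i, `|d i * p2 x + c i x * p1 x| <= A) ->
  `|p x| <= C -> (p x != 0 -> forall i k, `|B1 i k x - B i k x| <= dl) ->
  sq (rem B B1 p p1 p2 J) x <=
    (4 * A ^+ 2 + 2 * C ^+ 2 * dl ^+ 2 * N1 ^+ 2) * (sq (j0 J) x + sq (j1 J) x).
Proof.
move=> h1 h2 h3 h4; have N0 := N1_gt0.
have sqD (u v : R) : (u + v) ^+ 2 <= 2 * u ^+ 2 + 2 * v ^+ 2.
  by have := sqr_ge0 (u - v); rewrite sqrrB sqrrD; lra.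
have sqM (u v w : R) : `|u| <= w -> (u * v) ^+ 2 <= w ^+ 2 * v ^+ 2.
  move=> uw; rewrite exprMn ler_wpM2r ?sqr_ge0// -real_normK ?num_real// lerXn2r// nnegrE//.
  exact: le_trans uw.
have j00 := sq_ge0 (j0 J) x; have j10 := sq_ge0 (j1 J) x.
have vb i : (p x * \sum_k (B1 i k x - B i k x) * j0 J k x) ^+ 2 <=
    C ^+ 2 * dl ^+ 2 * N1 * sq (j0 J) x.
  have [->|px] := eqVneq (p x) 0.
    rewrite mul0r expr2 mul0r; apply: mulr_ge0 => //; apply: mulr_ge0; last exact: ltW.
    by apply: mulr_ge0; exact: sqr_ge0.
  apply: (le_trans (sqM _ _ _ h3)).
  have -> : C ^+ 2 * dl ^+ 2 * N1 * sq (j0 J) x = C ^+ 2 * (N1 * (dl ^+ 2 * sq (j0 J) x)) by ring.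
  apply: ler_wpM2l; first exact: sqr_ge0.
  apply: (le_trans (sum_sq_le _)); rewrite ler_pM2l// mulr_sumr.
  by apply: ler_sum => k _; apply: sqM; exact: h4.
apply: (@le_trans _ _ (\sum_i ((4 * A ^+ 2) * (j1 J i x ^+ 2 + j0 J i x ^+ 2)
    + 2 * (C ^+ 2 * dl ^+ 2 * N1 * sq (j0 J) x)))).
  apply: ler_sum => i _; apply: (le_trans (sqD _ _)); apply: lerD; last by rewrite ler_pM2l.
  have := sqD (2 * d i * p1 x * j1 J i x) ((d i * p2 x + c i x * p1 x) * j0 J i x).
  by have := sqM _ (j1 J i x) _ (h1 i); have := sqM _ (j0 J i x) _ (h2 i); lra.
rewrite big_split/= sumr_const -mulr_sumr big_split/= -/(sq (j1 J) x) -/(sq (j0 J) x).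
have nN : (#|I|%:R : R) <= N1 by rewrite /N1 ler_nat.
set X := C ^+ 2 * dl ^+ 2 * N1 * sq (j0 J) x.
have X0 : 0 <= 2 * X.
  apply: mulr_ge0 => //; apply: mulr_ge0 => //; apply: mulr_ge0; last exact: ltW.
  by apply: mulr_ge0; exact: sqr_ge0.
have Y0 : 0 <= C ^+ 2 * dl ^+ 2 * N1 ^+ 2 * sq (j1 J) x.
  apply: mulr_ge0 => //; apply: mulr_ge0; last exact: sqr_ge0.
  by apply: mulr_ge0; exact: sqr_ge0.
rewrite -(mulr_natl (2 * X)); have := ler_wpM2r X0 nN.
have -> : N1 * (2 * X) = 2 * (C ^+ 2 * dl ^+ 2 * N1 ^+ 2 * sq (j0 J) x) by rewrite /X; ring.
by lra.
Qed.

(** The equation is solved for the second derivative, the leading coefficients being bounded below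
    by [d0]. *)
Lemma sq_j2 (d0 Cc Cb : R) B J x : 0 < d0 -> (forall i, d0 <= d i) ->
  (forall i, `|c i x| <= Cc) -> (forall i k, `|B i k x| <= Cb) ->
  sq (j2 J) x <= 3 / d0 ^+ 2 * (sq (op B J) x + Cc ^+ 2 * sq (j1 J) x +
     N1 ^+ 2 * Cb ^+ 2 * sq (j0 J) x).
Proof.
move=> d00 hd hc hB; have N0 := N1_gt0.
have sqM (u v w : R) : `|u| <= w -> (u * v) ^+ 2 <= w ^+ 2 * v ^+ 2.
  move=> uw; rewrite exprMn ler_wpM2r ?sqr_ge0// -real_normK ?num_real// lerXn2r// nnegrE//.
  exact: le_trans uw.
have j00 := sq_ge0 (j0 J) x.
rewrite mulrAC ler_pdivlMr ?exprn_gt0//.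
apply: (@le_trans _ _ (\sum_i 3 * (op B J i x ^+ 2 + Cc ^+ 2 * j1 J i x ^+ 2 + N1 * Cb ^+ 2 * sq (j0 J) x))).
  rewrite /sq mulr_suml; apply: ler_sum => i _.
  have : (\sum_k B i k x * j0 J k x) ^+ 2 <= N1 * Cb ^+ 2 * sq (j0 J) x.
    apply: (le_trans (sum_sq_le _)); rewrite -mulrA ler_pM2l// mulr_sumr.
    by apply: ler_sum => k _; exact: sqM.
  have := sqM _ (j1 J i x) _ (hc i).
  have : (d0 * j2 J i x) ^+ 2 <= (d i * j2 J i x) ^+ 2.
    rewrite !exprMn; apply: ler_wpM2r; first exact: sqr_ge0.
    apply: lerXn2r; [rewrite nnegrE; exact: ltW|rewrite nnegrE; exact: le_trans (ltW d00) (hd i)|exact: hd].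
  rewrite -/(sq (j0 J) x) (mulrC (j2 J i x ^+ 2)) -exprMn.
  have -> : d i * j2 J i x = op B J i x - c i x * j1 J i x - \sum_k B i k x * j0 J k x.
    by rewrite /op; ring.
  set u := op B J i x; set v := c i x * _; set w := \sum_k _.
  have := sqr_ge0 (u + v); have := sqr_ge0 (u + w); have := sqr_ge0 (v - w).
  have -> : (u - v - w) ^+ 2 = u ^+ 2 + v ^+ 2 + w ^+ 2 - 2 * u * v - 2 * u * w + 2 * v * w by ring.
  by rewrite !sqrrD sqrrN; lra.
rewrite -mulr_sumr big_split/= sumr_const big_split/= -mulr_sumr.
rewrite -/(sq _ _) -/(sq (j1 J) x) ler_pM2l// lerD2l -mulr_natl.
have X0 : 0 <= N1 * Cb ^+ 2 * sq (j0 J) x.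
  by apply: mulr_ge0 => //; apply: mulr_ge0; [exact: ltW|exact: sqr_ge0].
have nN : (#|I|%:R : R) <= N1 by rewrite /N1 ler_nat.
by have := ler_wpM2r X0 nN; rewrite (expr2 N1) !mulrA.
Qed.

End Operators.

(** * The parametrix on the line *)

Section Parametrix.
Variables (R : realType) (I : finType).
Local Notation mu := (@lebesgue_measure R).
Local Notation fld := (I -> R -> R).
Local Notation jet := (jet R I).
Implicit Types (F G : fld) (J : jet).

Variables (d : I -> R) (c : I -> R -> R) (B B' : I -> I -> R -> R).
Variables (d0 Dm Cc Cb K C dl l : R) (b b1 b2 : R -> R) (s : int -> R).
Hypotheses (cc : forall i, continuous (c i)) (cB : cont2 B) (cB' : cont2 B').
Hypotheses (d00 : 0 < d0) (Dm0 : 0 <= Dm) (Cc0 : 0 <= Cc) (hd0 : forall i, d0 <= d i) (hd : forall i, d i <= Dm).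
Hypotheses (hc : forall i x, `|c i x| <= Cc) (hB' : forall i k x, `|B' i k x| <= Cb).
Hypotheses (l1 : 1 <= l) (K0 : 0 <= K) (bump : bump_spec b b1 b2 C).
Hypothesis (Hinv : INV (op d c B) K).
Hypothesis (sc : forall j i x, c i (x + s j) = c i x).
Hypothesis (sB : forall j i k x, (j%:~R - 1) * l <= x <= (j%:~R + 2) * l ->
  `|B' i k x - B i k (x + s j)| <= dl).

Definition kap : R := 4 * ((2 * Dm + Cc) * C / l) ^+ 2 + 2 * C ^+ 2 * dl ^+ 2 * N1 R I ^+ 2.

(** 576 is 9 times 64. Two overlaps of three cells turn [kap * K] into [9 * (kap * K)], so the error
    of the parametrix contracts squared norms by 1/64. *)
Hypothesis small : 576 * (kap * K) <= 1.

Variable Rs : fld -> jet.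
Hypothesis Rs0 : Rs (@fzero R I) = @jzero R I.
Hypothesis RsP : forall F, mfF F -> (q setT F < +oo)%E ->
  L2jet (Rs F) /\ {ae mu, forall x, forall i, op d c B (Rs F) i x = F i x}.

Let l0 : 0 < l. Proof. exact: lt_le_trans ltr01 l1. Qed.
Let C0 : 0 <= C. Proof. exact: bump_C bump. Qed.

Let p (j : int) x := b (l^-1 * x - j%:~R).
Let p1 (j : int) x := l^-1 * b1 (l^-1 * x - j%:~R).
Let p2 (j : int) x := l^-1 * (l^-1 * b2 (l^-1 * x - j%:~R)).
Let Bs (j : int) : I -> I -> R -> R := fun i k x => B i k (x + s j).
Let cel := cell l.

Lemma p_D2 j : D2 (p j) (p1 j) (p2 j).
Proof.
have [a1 a2 a3] := bump_scale (- j%:~R) l0 bump.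
by split => //; exact: prim_C1.
Qed.

Lemma p_bd j x : [/\ `|p j x| <= C, `|p1 j x| <= C / l & `|p2 j x| <= C / l].
Proof.
have [h0 h1 h2] := bump_bound bump (l^-1 * x - j%:~R).
have li : 0 < l^-1 by rewrite invr_gt0.
have li1 : l^-1 <= 1 by rewrite invf_le1.
split => //.
  by rewrite /p1 normrM gtr0_norm// mulrC ler_pM2r.
rewrite /p2 !normrM gtr0_norm// mulrC ler_pM2r//.
have := normr_ge0 (b2 (l^-1 * x - j%:~R)); set t := `|b2 _| in h2 *; nra.
Qed.

Lemma p_supp j x : x <= (j%:~R - 1) * l \/ (j%:~R + 2) * l <= x ->
  [/\ p j x = 0, p1 j x = 0 & p2 j x = 0].
Proof.
move=> H; rewrite /p /p1 /p2; have [|-> -> ->] := bump_supp bump (x := l^-1 * x - j%:~R); last by rewrite !mulr0.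
case: H => H; [left|right].
  by rewrite lerBlDl mulrC ler_pdivrMr//.
by rewrite lerBrDl mulrC ler_pdivlMr//.
Qed.

Lemma p_one j x : cel j x -> p j x = 1 /\ p1 j x = 0.
Proof.
rewrite /cel /cell/= in_itv/= => /andP[h1 h2].
suff H : 0 <= l^-1 * x - j%:~R <= 1.
  by rewrite /p /p1; have [-> ->] := bump_one bump H; rewrite mulr0.
rewrite subr_ge0 lerBlDl mulrC ler_pdivlMr// h1/= ler_pdivrMr//; exact: ltW.
Qed.

Lemma rem_bd2 j (Ba Bb : I -> I -> R -> R) J x :
  (p j x != 0 -> forall i k, `|Bb i k x - Ba i k x| <= dl) ->
  sq (rem d c Ba Bb (p j) (p1 j) (p2 j) J) x <= kap * (sq (j0 J) x + sq (j1 J) x).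
Proof.
move=> hab.
have [h0 h1 h2] := p_bd j x; have li : 0 < l^-1 by rewrite invr_gt0.
have Cl : 0 <= C / l by rewrite divr_ge0// ltW.
have dA i : `|d i| <= Dm by rewrite ger0_norm//; apply: le_trans (hd0 i); exact: ltW.
apply: (@sq_rem _ _ _ _ ((2 * Dm + Cc) * C / l) C dl) => //.
- move=> i; rewrite (normrM (2 * d i)) (normrM 2) normr_nat.
  have := normr_ge0 (p1 j x); have := normr_ge0 (d i); have := dA i; have := Cc0.
  rewrite -(mulrA _ C); set t := C / l in h1 Cl *; set u := `|p1 j x| in h1 *; set v := `|d i| => _ vD v0 u0.
  have : v * u <= Dm * t by apply: ler_pM.
  have : 0 <= Cc * t by apply: mulr_ge0.
  lra.
- move=> i; apply: (le_trans (ler_normD _ _)); rewrite (normrM (d i)) (normrM (c i x)).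
  have := normr_ge0 (p1 j x); have := normr_ge0 (p2 j x); have := normr_ge0 (d i).
  have := dA i; have := Cc0; have := hc i x; have := normr_ge0 (c i x).
  rewrite -(mulrA _ C); set t := C / l in h1 h2 Cl *; set u := `|p1 j x| in h1 *; set v := `|d i|.
  set w := `|p2 j x| in h2 *; set y := `|c i x| => y0 yC cc1 vD v0 w0 u0.
  have : v * w <= Dm * t by apply: ler_pM.
  have : y * u <= Cc * t by apply: ler_pM.
  have : 0 <= Dm * t by apply: mulr_ge0 => //; lra.
  lra.
Qed.

Lemma mismatch j x : p j x != 0 -> forall i k, `|B' i k x - Bs j i k x| <= dl.
Proof.
move=> px i k; apply: sB; apply/andP; split; rewrite leNgt; apply/negP => h.
  by have [|e _ _] := p_supp (j := j) (x := x); [left; exact: ltW|rewrite e eqxx in px].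
by have [|e _ _] := p_supp (j := j) (x := x); [right; exact: ltW|rewrite e eqxx in px].
Qed.

Lemma rem_bd j J x :
  sq (rem d c (Bs j) B' (p j) (p1 j) (p2 j) J) x <= kap * (sq (j0 J) x + sq (j1 J) x).
Proof. by apply: rem_bd2; exact: mismatch. Qed.

Lemma kap_ge0 : 0 <= kap.
Proof.
apply: addr_ge0; first by apply: mulr_ge0 => //; exact: sqr_ge0.
by rewrite -mulrA; apply: mulr_ge0; [apply: mulr_ge0 => //|apply: mulr_ge0]; exact: sqr_ge0.
Qed.

(** Square integrability on each cell: the common setting for data on the line and for periodic
    data. *)
Definition locL2 F : Prop := mfF F /\ forall j, (q (cel j) F < +oo)%E.

(** Data are cut sharply, so that their pieces add up exactly. The solutions are cut by the smooth
    [p j], which is one on cell j and therefore does not change the piece of the datum living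
    there. *)
Definition cut (j : int) F : fld := fun i x => \1_(cel j) x * F i x.

Lemma mf_cut j F : mfF F -> mfF (cut j F).
Proof.
move=> mF i; apply: mfM => //.
by apply: measurable_indic; exact: cell_meas.
Qed.

Lemma cut_in j F i x : cel j x -> cut j F i x = F i x.
Proof. by move=> h; rewrite /cut indicE mem_set// mul1r. Qed.

Lemma cut_out j F i x : ~ cel j x -> cut j F i x = 0.
Proof. by move=> h; rewrite /cut indicE memNset// mul0r. Qed.

Lemma q_cut j F : mfF F -> q setT (cut j F) = q (cel j) F.
Proof.
move=> mF; rewrite /q /qi [RHS]integral_mkcond; apply: eq_integral => x _.
rewrite patchE; case: ifPn => [/set_mem h|/negP h].
  by congr (_%:E); apply: eq_bigr => i _; rewrite cut_in.
by rewrite /sq big1// => i _; rewrite cut_out ?expr0n// => /mem_set.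
Qed.

(** The piece is moved by [s j] to the place where [B] models the coefficients [B'] of window j;
    [Sj] moves the solution back. *)
Definition arg (j : int) F : fld := fun i x => cut j F i (x - s j).

Lemma arg_ok j F : locL2 F -> mfF (arg j F) /\ (q setT (arg j F) < +oo)%E.
Proof.
move=> [mF fF]; have mc := mf_cut j mF; split; first by move=> i; exact: mf_shift.
by rewrite /arg (@q_shiftT R I (cut j F))// q_cut.
Qed.

Definition Sj (j : int) F : jet := jshift (s j) (Rs (arg j F)).
Definition Tj F (j : int) : jet := jmul (p j) (p1 j) (p2 j) (Sj j F).
Definition P F : jet := lsum l (Tj F).
Definition Er F : fld := fsub (op d c B' (P F)) F.

Lemma Sj_L2 j F : locL2 F -> L2jet (Sj j F).
Proof. by move=> /(arg_ok j)[m f]; apply: L2jet_shift; have [] := RsP m f. Qed.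

Lemma Sj_op j F : locL2 F ->
  {ae mu, forall x, forall i, op d c (Bs j) (Sj j F) i x = cut j F i x}.
Proof.
move=> /(arg_ok j)[m f]; have [_ e] := RsP m f.
apply: (ae_imp (ae_shift (s j) e)) => x h i.
transitivity (op d c B (Rs (arg j F)) i (x + s j)).
  by apply: op_shift => ? ?; exact: sc.
rewrite h /arg; congr (cut j F i _); ring.
Qed.

(** The a priori bound applied to the difference of two selected solutions gives the Lipschitz
    estimate that linearity would have provided. *)
Lemma Sj_diff j F G : locL2 F -> locL2 G ->
  (q setT (j0 (jsub (Sj j F) (Sj j G))) + q setT (j1 (jsub (Sj j F) (Sj j G))) <=
   K%:E * q (cel j) (fsub F G))%E.
Proof.
move=> lF lG; have [mF fF] := arg_ok j lF; have [mG fG] := arg_ok j lG.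
have [LF eF] := RsP mF fF; have [LG eG] := RsP mG fG.
have LD := L2jet_sub LF LG; have [ok _ _ _] := LD; have [m0 m1 _] := jet_mf ok.
have := Hinv.2 _ LD.
have -> : q setT (op d c B (jsub (Rs (arg j F)) (Rs (arg j G)))) = q (cel j) (fsub F G).
  rewrite (@q_ae _ _ _ _ (fsub (arg j F) (arg j G)))//.
  - have mfs : mfF (fsub F G) by apply: mf_fsub; [case: lF|case: lG].
    rewrite -q_cut// -[RHS](q_shiftT (- s j)); last exact: mf_cut.
    apply: q_eq => x _ i; rewrite /fsub /arg /cut; ring.
  - exact: mf_op.
  - exact: mf_fsub.
  apply: (ae_imp (ae_and eF eG)) => x [e1 e2] i.
  by rewrite op_sub e1 e2.
move=> H; apply: le_trans H; rewrite -(q_shiftT (s j) m0) -(q_shiftT (s j) m1).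
exact: lexx.
Qed.

Lemma Tj_ok F j : locL2 F -> jetok (Tj F j).
Proof. by move=> lF; apply: jmul_ok; [exact: p_D2|have [] := Sj_L2 j lF]. Qed.

Lemma Tj_supp F : tsupp l (Tj F).
Proof.
move=> j x H i; have [e0 e1 e2] := p_supp H.
by split; rewrite /= ?e0 ?e1 ?e2 !(mul0r, mulr0, addr0).
Qed.

Lemma P_ok F : locL2 F -> jetok (P F).
Proof. by move=> lF; apply: lsum_ok => //; [move=> j; exact: Tj_ok|exact: Tj_supp]. Qed.

Lemma mf_Er F : locL2 F -> mfF (Er F).
Proof. by move=> lF; apply: mf_fsub; [apply: mf_op => //; exact: P_ok|case: lF]. Qed.

Definition Dj F G j : jet := jsub (Sj j F) (Sj j G).
Definition hj F G j (x : R) : R := sq (j0 (Dj F G j)) x + sq (j1 (Dj F G j)) x.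

Lemma hj_ge0 F G j x : 0 <= hj F G j x.
Proof. by apply: addr_ge0; exact: sq_ge0. Qed.

Lemma mf_hj F G j : locL2 F -> locL2 G -> mf (hj F G j).
Proof.
move=> lF lG; have [ok _ _ _] := L2jet_sub (Sj_L2 j lF) (Sj_L2 j lG).
by have [m0 m1 _] := jet_mf ok; apply: mfD; exact: mf_sq.
Qed.

Lemma qi_hj F G j : locL2 F -> locL2 G ->
  (qi setT (hj F G j) <= K%:E * q (cel j) (fsub F G))%E.
Proof.
move=> lF lG; have [ok _ _ _] := L2jet_sub (Sj_L2 j lF) (Sj_L2 j lG).
have [m0 m1 _] := jet_mf ok; rewrite /hj qiD//; [exact: Sj_diff|exact: mf_sq|exact: mf_sq|exact: sq_ge0|exact: sq_ge0].
Qed.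

Lemma cell_bound F G (g : R -> R) (a : R) j : locL2 F -> locL2 G -> mf g ->
  (forall x, 0 <= g x) -> 0 <= a ->
  {ae mu, forall x, cel j x -> g x <= a * sum3 (fun i => hj F G i x) j} ->
  (qi (cel j) g <= (a * K)%:E * (q (cel (j - 1)%R) (fsub F G) +
     q (cel j) (fsub F G) + q (cel (j + 1)%R) (fsub F G)))%E.
Proof.
move=> lF lG mg g0 a0 H.
have mS : mf (fun x => sum3 (fun i => hj F G i x) j).
  by apply: mfD; [apply: mfD|]; exact: mf_hj.
have S0 x : 0 <= sum3 (fun i => hj F G i x) j.
  by apply: addr_ge0; [apply: addr_ge0|]; exact: hj_ge0.
apply: (@le_trans _ _ (qi (cel j) (fun x => a * sum3 (fun i => hj F G i x) j))).
  apply: qi_le_ae => //; [exact: cell_meas|by apply: mfM => //; exact: mf_cst|].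
  by move=> x; exact: mulr_ge0.
rewrite qiZ//; last exact: cell_meas.
rewrite EFinM -muleA; apply: lee_wpmul2l => //.
have Kd (x y z : \bar R) : (0 <= x)%E -> (0 <= y)%E -> (0 <= z)%E ->
    (K%:E * (x + y + z) = K%:E * x + K%:E * y + K%:E * z)%E.
  by move=> x0 y0 z0; rewrite !ge0_muleDr//; exact: adde_ge0.
rewrite Kd; [|exact: q_ge0..].
have mc := @cell_meas R l j.
have m3 i := mf_hj i lF lG; have z3 i x := hj_ge0 F G i x.
rewrite /sum3 qiD//; [|by apply: mfD|by move=> x; apply: addr_ge0].
rewrite qiD//; apply: leeD; [apply: leeD|]; (apply: le_trans (qi_hj _ lF lG); exact: qi_subT).
Qed.

Lemma sq3 (u v w : R) : (u + v + w) ^+ 2 <= 3 * (u ^+ 2 + v ^+ 2 + w ^+ 2).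
Proof.
have := sqr_ge0 (u - v); have := sqr_ge0 (u - w); have := sqr_ge0 (v - w).
have -> : (u + v + w) ^+ 2 = u ^+ 2 + v ^+ 2 + w ^+ 2 + 2 * u * v + 2 * u * w + 2 * v * w by ring.
by rewrite !sqrrB; lra.
Qed.

Lemma sq_sum3 (X : int -> fld) j x :
  sq (fun i x => sum3 (fun k => X k i x) j) x <= 3 * sum3 (fun k => sq (X k) x) j.
Proof.
rewrite /sum3 /sq -!big_split/= mulr_sumr; apply: ler_sum => i _; exact: sq3.
Qed.

(** On cell j the pieces of the datum reproduce it exactly, so the error is the sum of the three
    remainders with indices j - 1, j and j + 1. The factor 3 comes from squaring that sum. *)
Lemma Er_cell F G j : locL2 F -> locL2 G ->
  (q (cel j) (fsub (Er F) (Er G)) <= (3 * kap * K)%:E * (q (cel (j - 1)%R) (fsub F G) +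
     q (cel j) (fsub F G) + q (cel (j + 1)%R) (fsub F G)))%E.
Proof.
move=> lF lG; have kap0 := kap_ge0.
apply: cell_bound => //; [apply: mf_sq; apply: mf_fsub; exact: mf_Er|exact: sq_ge0|by rewrite mulr_ge0|].
have ae1 k : {ae mu, forall x, (forall i, op d c (Bs k) (Sj k F) i x = cut k F i x) /\
    (forall i, op d c (Bs k) (Sj k G) i x = cut k G i x)}.
  by apply: ae_and; exact: Sj_op.
apply: (ae_imp (ae_and (ae1 (j - 1)) (ae_and (ae1 j) (ae1 (j + 1))))) => x [[a1 a2] [[b3 b4] [c5 c6]]] cj.
have idx : cidx l x = j by apply/cellP.
pose X k := rem d c (Bs k) B' (p k) (p1 k) (p2 k) (Dj F G k).
have opP H i : op d c B' (P H) i x = sum3 (fun k => op d c B' (Tj H k) i x) j.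
  rewrite /op /P /= idx /sum3.
  rewrite (eq_bigr (fun k => B' i k x * j0 (Tj H (j - 1)) k x + B' i k x * j0 (Tj H j) k x
     + B' i k x * j0 (Tj H (j + 1)) k x)); last by move=> k _; rewrite !mulrDr.
  by rewrite !big_split/=; ring.
have cutS H i : H i x = sum3 (fun k => cut k H i x) j.
  rewrite /sum3 (cut_in H i cj) !cut_out ?add0r ?addr0// => /(cellP l0); rewrite idx; clear; lia.
have opT H k i : locL2 H -> (forall i, op d c (Bs k) (Sj k H) i x = cut k H i x) ->
    op d c B' (Tj H k) i x = cut k H i x + rem d c (Bs k) B' (p k) (p1 k) (p2 k) (Sj k H) i x.
  move=> lH e; rewrite /Tj (op_mul d c (Bs k)) e; congr (_ + _).
  have [ck|ck] := pselect (cel k x); first by rewrite (p_one ck).1 mul1r.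
  by rewrite cut_out// mulr0.
apply: (@le_trans _ _ (sq (fun i x => sum3 (fun k => X k i x) j) x)).
  rewrite le_eqVlt; apply/orP; left; apply/eqP; apply: eq_bigr => i _; congr (_ ^+ 2).
  rewrite /fsub /Er /fsub !opP {1}/sum3 (cutS F i) (cutS G i) /sum3 !opT//.
  by rewrite /X /Dj !rem_sub; ring.
apply: (le_trans (sq_sum3 _ _ _)); rewrite -mulrA ler_pM2l//.
rewrite /sum3 2!mulrDr; apply: lerD; [apply: lerD|]; exact: (rem_bd _ (Dj F G _) x).
Qed.

Lemma P_cell F G j : locL2 F -> locL2 G ->
  (qi (cel j) (fun x => sq (j0 (jsub (P F) (P G))) x + sq (j1 (jsub (P F) (P G))) x)%R <=
   (9 * C ^+ 2 * K)%:E * (q (cel (j - 1)%R) (fsub F G) +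
     q (cel j) (fsub F G) + q (cel (j + 1)%R) (fsub F G)))%E.
Proof.
move=> lF lG; have [m0 m1 _] := jet_mf (jsub_ok (P_ok lF) (P_ok lG)).
apply: cell_bound => //.
- by apply: mfD; exact: mf_sq.
- by move=> x; apply: addr_ge0; exact: sq_ge0.
- by rewrite mulr_ge0 ?sqr_ge0.
apply: ae_all => x cj; have idx : cidx l x = j by apply/cellP.
have Cl : C / l <= C by rewrite ler_pdivrMr// ler_peMr.
pose X0 k : fld := fun i x => p k x * j0 (Dj F G k) i x.
pose X1 k : fld := fun i x => p1 k x * j0 (Dj F G k) i x + p k x * j1 (Dj F G k) i x.
have e0 : sq (j0 (jsub (P F) (P G))) x = sq (fun i x => sum3 (fun k => X0 k i x) j) x.
  by apply: eq_bigr => i _; congr (_ ^+ 2); rewrite /= /fsub/= idx /sum3 /X0 /Dj /= /fsub; ring.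
have e1 : sq (j1 (jsub (P F) (P G))) x = sq (fun i x => sum3 (fun k => X1 k i x) j) x.
  by apply: eq_bigr => i _; congr (_ ^+ 2); rewrite /= /fsub/= idx /sum3 /X1 /Dj /= /fsub; ring.
have b0 k : sq (X0 k) x <= C ^+ 2 * sq (j0 (Dj F G k)) x.
  by apply: sq_mul_le; have [] := p_bd k x.
have b1' k : sq (X1 k) x <= 2 * (C ^+ 2 * sq (j0 (Dj F G k)) x) + 2 * (C ^+ 2 * sq (j1 (Dj F G k)) x).
  have [h0 h1 _] := p_bd k x; apply: (le_trans (@sq_fadd R I (fun i x => p1 k x * j0 (Dj F G k) i x) (fun i x => p k x * j1 (Dj F G k) i x) x)).
  have := @sq_mul_le R I (p1 k x) C (j0 (Dj F G k)) x (le_trans h1 Cl).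
  by have := @sq_mul_le R I (p k x) C (j1 (Dj F G k)) x h0; rewrite /sq; lra.
rewrite e0 e1; have := sq_sum3 X0 j x; have := sq_sum3 X1 j x.
have C2 : 0 <= C ^+ 2 by exact: sqr_ge0.
have := b0 (j - 1); have := b0 j; have := b0 (j + 1).
have := b1' (j - 1); have := b1' j; have := b1' (j + 1).
rewrite /hj /sum3.
have := mulr_ge0 C2 (sq_ge0 (j1 (Dj F G (j - 1))) x); have := mulr_ge0 C2 (sq_ge0 (j1 (Dj F G j)) x).
have := mulr_ge0 C2 (sq_ge0 (j1 (Dj F G (j + 1))) x).
lra.
Qed.

Lemma P_fzero : (forall i x, [/\ j0 (P (@fzero R I)) i x = 0, j1 (P (@fzero R I)) i x = 0 &
  j2 (P (@fzero R I)) i x = 0]).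
Proof.
have S0 j : Rs (arg j (@fzero R I)) = @jzero R I.
  by rewrite -Rs0; congr Rs; apply/funext => i; apply/funext => x; rewrite /arg /cut mulr0.
have SjE j : Sj j (@fzero R I) = jshift (s j) (@jzero R I) by rewrite /Sj S0.
have TjE j i x : [/\ j0 (Tj (@fzero R I) j) i x = 0, j1 (Tj (@fzero R I) j) i x = 0 &
    j2 (Tj (@fzero R I) j) i x = 0].
  by rewrite /Tj SjE; split; rewrite /= /fzero ?mulr0 ?addr0 ?mulr0 ?addr0.
move=> i x; have [a0 a1 a2] := TjE (cidx l x - 1) i x; have [e0 e1 e2] := TjE (cidx l x) i x.
have [f0 f1 f2] := TjE (cidx l x + 1) i x.
split.
- change (sum3 (fun j => j0 (Tj (@fzero R I) j) i x) (cidx l x) = 0); by rewrite /sum3 a0 e0 f0 !addr0.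
- change (sum3 (fun j => j1 (Tj (@fzero R I) j) i x) (cidx l x) = 0); by rewrite /sum3 a1 e1 f1 !addr0.
- change (sum3 (fun j => j2 (Tj (@fzero R I) j) i x) (cidx l x) = 0); by rewrite /sum3 a2 e2 f2 !addr0.
Qed.

Lemma Er_fzero i x : Er (@fzero R I) i x = 0.
Proof.
have P0 := P_fzero; rewrite /Er /fsub /op.
have [_ -> ->] := P0 i x; rewrite !mulr0 big1 ?addr0 ?subr0// => k _.
by have [-> _ _] := P0 k x; rewrite mulr0.
Qed.

Lemma locL2_line F : mfF F -> (q setT F < +oo)%E -> locL2 F.
Proof.
move=> mF fF; split => // j; apply: le_lt_trans fF; apply: q_sub => //; exact: cell_meas.
Qed.

Lemma Er_line F G : locL2 F -> locL2 G ->
  (q setT (fsub (Er F) (Er G)) <= (64^-1)%:E * q setT (fsub F G))%E.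
Proof.
move=> lF lG; have kap0 := kap_ge0.
have mfs : mfF (fsub F G) by apply: mf_fsub; [case: lF|case: lG].
have mE : mfF (fsub (Er F) (Er G)) by apply: mf_fsub; exact: mf_Er.
apply: (@le_trans _ _ ((3 * (3 * kap * K))%:E * q setT (fsub F G))%E).
  apply: (cell_sum_line l0 (mf_sq mfs) (mf_sq mE) (sq_ge0 _) (sq_ge0 _)); first by rewrite !mulr_ge0.
  by move=> j; exact: Er_cell.
apply: lee_wpmul2r; first exact: q_ge0.
by rewrite lee_fin (_ : 3 * (3 * kap * K) = 9 * (kap * K)); [have h := small; lra|ring].
Qed.

Lemma P_line F G : locL2 F -> locL2 G ->
  (q setT (j0 (jsub (P F) (P G))) + q setT (j1 (jsub (P F) (P G))) <=
   (27 * C ^+ 2 * K)%:E * q setT (fsub F G))%E.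
Proof.
move=> lF lG; have C2 : 0 <= C ^+ 2 by exact: sqr_ge0.
have mfs : mfF (fsub F G) by apply: mf_fsub; [case: lF|case: lG].
have [m0 m1 _] := jet_mf (jsub_ok (P_ok lF) (P_ok lG)).
rewrite /q -qiD//; [|exact: mf_sq|exact: mf_sq|exact: sq_ge0|exact: sq_ge0].
have -> : (27 * C ^+ 2 * K) = 3 * (9 * C ^+ 2 * K) by ring.
apply: (cell_sum_line l0 (mf_sq mfs)).
- by apply: mfD; exact: mf_sq.
- exact: sq_ge0.
- by move=> x; apply: addr_ge0; exact: sq_ge0.
- by rewrite !mulr_ge0.
by move=> j; exact: P_cell.
Qed.

Lemma locL2_zero : locL2 (@fzero R I).
Proof.
apply: locL2_line; first exact: mf_fzero.
by rewrite /q (@qi_eq _ _ _ (fun=> 0)) => [|x _]; [rewrite /qi integral0|exact: sq_fzero].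
Qed.

Lemma j2_finite D J : measurable D -> jetok J -> (q D (op d c B' J) < +oo)%E ->
  (q D (j0 J) < +oo)%E -> (q D (j1 J) < +oo)%E -> (q D (j2 J) < +oo)%E.
Proof.
move=> mD ok fo f0 f1; have [m0 m1 m2] := jet_mf ok.
have mo : mfF (op d c B' J) by exact: mf_op.
have N0 := N1_gt0 R I.
have e2 : 0 <= 3 / d0 ^+ 2 by rewrite divr_ge0// sqr_ge0.
pose h x := (3 / d0 ^+ 2) * (sq (op d c B' J) x + Cc ^+ 2 * sq (j1 J) x + N1 R I ^+ 2 * Cb ^+ 2 * sq (j0 J) x).
have mh : mf h.
  apply: mfM; first exact: mf_cst.
  by apply: mfD; [apply: mfD; [exact: mf_sq|]|]; (apply: mfM; [exact: mf_cst|exact: mf_sq]).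
have a0 x : 0 <= Cc ^+ 2 * sq (j1 J) x by apply: mulr_ge0; [exact: sqr_ge0|exact: sq_ge0].
have b0 x : 0 <= N1 R I ^+ 2 * Cb ^+ 2 * sq (j0 J) x.
  by apply: mulr_ge0; [apply: mulr_ge0; exact: sqr_ge0|exact: sq_ge0].
apply: (@le_lt_trans _ _ (qi D h)).
  apply: qi_le => //; [exact: mf_sq|exact: sq_ge0|] => x _.
  exact: sq_j2.
have mc F : mfF F -> forall a : R, mf (fun x => a * sq F x).
  by move=> mF a; apply: mfM; [exact: mf_cst|exact: mf_sq].
rewrite /h qiZ//.
- rewrite qiD//; [|by apply: mfD; [exact: mf_sq|exact: mc]|exact: mc|by move=> x; apply: addr_ge0 => //; exact: sq_ge0].
  rewrite qiD//; [|exact: mf_sq|exact: mc|exact: sq_ge0].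
  rewrite !qiZ//; [|exact: mf_sq|exact: sq_ge0|by apply: mulr_ge0; exact: sqr_ge0|exact: mf_sq|exact: sq_ge0|exact: sqr_ge0].
  rewrite -!/(q _ _); move: fo f0 f1; have := q_ge0 D (op d c B' J); have := q_ge0 D (j0 J); have := q_ge0 D (j1 J).
  case: (q D (op d c B' J)) => // x; case: (q D (j0 J)) => // y; case: (q D (j1 J)) => // z *.
  by apply: (@le_lt_trans _ _ ((3 / d0 ^+ 2) * (x + Cc ^+ 2 * z + N1 R I ^+ 2 * Cb ^+ 2 * y))%:E); rewrite ?ltry// EFinM !EFinD !EFinM.
- by apply: mfD; [apply: mfD; [exact: mf_sq|exact: mc]|exact: mc].
- by move=> x; apply: addr_ge0 => //; apply: addr_ge0 => //; exact: sq_ge0.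
Qed.

(** Applying the operator to [P F] yields [F] plus [Er F]. A fixed point of F -> psi - Er F
    therefore gives a solution [P F], almost everywhere. *)
Lemma line_solve psi : mfF psi -> (q setT psi < +oo)%E ->
  exists2 J, L2jet J & {ae mu, forall x, forall i, op d c B' J i x = psi i x}.
Proof.
move=> mpsi fpsi; have [r er] : exists r : R, q setT psi = r%:E.
  by case: (q setT psi) fpsi (q_ge0 setT psi) => // r _ _; exists r.
have r0 : 0 <= r by rewrite -lee_fin -er q_ge0.
have lb F : inball setT 0 r F -> locL2 F.
  by move=> [m _ f]; apply: locL2_line => //; apply: le_lt_trans f (ltry _).
(* Period 0 makes the periodicity clause of [inball] trivial. *)
have [|||F bF F0] := @fixpoint R I setT 0 r (fun F => fsub psi (Er F)) measurableT r0.
- move=> F bF; split; first by apply: mf_fsub => //; apply: mf_Er; exact: lb.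
  by move=> i x; rewrite addr0.
- move=> F G bF bG; have lF := lb F bF; have lG := lb G bG.
  rewrite (@q_eq _ _ _ _ (fsub (Er G) (Er F))) => [|x _ i]; last by rewrite /fsub; ring.
  rewrite (@q_eq _ _ _ (fsub F G) (fscale (-1) (fsub G F))) => [|x _ i]; last by rewrite /fsub /fscale; ring.
  rewrite q_fscale//; last by apply: mf_fsub; [case: lG|case: lF].
  rewrite sqrrN expr1n mul1e; apply: (le_trans (Er_line lG lF)).
  by apply: lee_wpmul2r; [exact: q_ge0|rewrite lee_fin; lra].
- rewrite (@q_eq _ _ _ _ psi) ?er// => x _ i; by rewrite /fsub Er_fzero subr0.
have lF := lb F bF; have [mF _ fF] := bF.
have mE := mf_Er lF.
have aeF : {ae mu, forall x, forall i, op d c B' (P F) i x = psi i x}.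
  have := q0_ae (mf_fsub (mf_fsub mpsi mE) mF) F0; move=> h; apply: (ae_imp h) => x hx i.
  by have := hx i; rewrite /fsub /Er /fsub; lra.
exists (P F) => //.
have H := P_line lF locL2_zero.
have PP D : q D (j0 (jsub (P F) (P (@fzero R I)))) = q D (j0 (P F)).
  by apply: q_eq => x _ i; change (j0 (P F) i x - j0 (P (@fzero R I)) i x = j0 (P F) i x); have [-> _ _] := P_fzero i x; rewrite subr0.
have PP1 D : q D (j1 (jsub (P F) (P (@fzero R I)))) = q D (j1 (P F)).
  by apply: q_eq => x _ i; change (j1 (P F) i x - j1 (P (@fzero R I)) i x = j1 (P F) i x); have [_ -> _] := P_fzero i x; rewrite subr0.
rewrite PP PP1 in H.
have fin01 : (q setT (j0 (P F)) + q setT (j1 (P F)) < +oo)%E.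
  apply: (le_lt_trans H); rewrite (@q_eq _ _ _ _ F) => [|x _ i]; last by rewrite /fsub subr0.
  by case: (q setT F) fF (q_ge0 setT F) => // z _ _; rewrite -EFinM ltry.
have f0 : (q setT (j0 (P F)) < +oo)%E.
  by apply: le_lt_trans fin01; rewrite leeDl// q_ge0.
have f1 : (q setT (j1 (P F)) < +oo)%E.
  by apply: le_lt_trans fin01; rewrite leeDr// q_ge0.
have okP := P_ok lF.
split => //; apply: j2_finite => //.
rewrite (@q_ae _ _ _ _ psi)//; exact: mf_op.
Qed.

Lemma est_shift j J : L2jet J ->
  (q setT (j0 J) + q setT (j1 J) <= K%:E * q setT (op d c (Bs j) J))%E.
Proof.
move=> LJ; have [ok _ _ _] := LJ; have [m0 m1 _] := jet_mf ok.
have := Hinv.2 _ (L2jet_shift (- s j) LJ); rewrite /= !q_shiftT// => H; apply: (le_trans H).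
apply: lee_wpmul2l => //.
have mo : mfF (op d c (Bs j) J).
  by apply: mf_op => // i k; apply: cont_shift; exact: cB.
rewrite -(q_shiftT (- s j) mo) (@q_eq _ _ _ _ (fun i x => op d c (Bs j) J i (x + - s j)))// => x _ i.
rewrite /op /= /Bs; have -> : c i x = c i (x - s j) by rewrite -(sc j i (x - s j)) subrK.
by congr (_ + _); apply: eq_bigr => k _; rewrite subrK.
Qed.

(** Absorption subtracts X/2 from both sides, which requires X to be finite; Y may be infinite. *)
Lemma half_absorb (X Y : \bar R) (a : R) : 0 <= a -> (0 <= X)%E -> (X < +oo)%E -> (0 <= Y)%E ->
  (X <= a%:E * Y + (2^-1)%:E * X)%E -> (X <= (2 * a)%:E * Y)%E.
Proof.
move=> a0; case: X => // x _ _; case: Y => [y _|_|//].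
  by rewrite -!EFinM -EFinD !lee_fin; lra.
have [->|an] := eqVneq a 0; first by rewrite mulr0 !mul0e add0e -EFinM !lee_fin; lra.
by move=> _; rewrite gt0_muley ?leey// lte_fin mulr_gt0// lt_neqAle eq_sym an.
Qed.

(** The solution itself is localized: [p j] times J obeys the translated a priori bound, its
    remainder is at most [kap] times the squares of J and its derivative, and summation over cells
    leaves a term to be absorbed. *)
Lemma line_est J : L2jet J ->
  (q setT (j0 J) + q setT (j1 J) <= (12 * C ^+ 2 * K)%:E * q setT (op d c B' J))%E.
Proof.
move=> LJ; have [ok f0 f1 _] := LJ; have [m0 m1 _] := jet_mf ok.
have kap0 := kap_ge0; have C2 : 0 <= C ^+ 2 by exact: sqr_ge0.
have mo : mfF (op d c B' J) by exact: mf_op.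
pose g x := sq (j0 J) x + sq (j1 J) x.
have mg : mf g by apply: mfD; exact: mf_sq.
have g0 x : 0 <= g x by apply: addr_ge0; exact: sq_ge0.
pose f x := 2 * C ^+ 2 * sq (op d c B' J) x + 2 * kap * g x.
have m_f : mf f by apply: mfD; apply: mfM => //; [exact: mf_cst|exact: mf_sq|exact: mf_cst].
have f0' x : 0 <= f x.
  by apply: addr_ge0; apply: mulr_ge0; rewrite ?mulr_ge0// sq_ge0.
have qg : (q setT (j0 J) + q setT (j1 J) = qi setT g)%E.
  by rewrite /g qiD//; [exact: mf_sq|exact: mf_sq|exact: sq_ge0|exact: sq_ge0].
have cellwise j : (qi (cel j) g <= K%:E * (qi (cel (j - 1)%R) f + qi (cel j) f + qi (cel (j + 1)%R) f))%E.
  pose phi := jmul (p j) (p1 j) (p2 j) J.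
  have Lphi : L2jet phi.
    apply: (@L2jet_mul _ _ _ _ _ C) => //; first exact: p_D2.
    move=> x; have [h0 h1 h2] := p_bd j x; split => //.
      by apply: (le_trans h1); rewrite ler_pdivrMr// ler_peMr.
    by apply: (le_trans h2); rewrite ler_pdivrMr// ler_peMr.
  have [okp _ _ _] := Lphi; have [n0 n1 _] := jet_mf okp.
  apply: (@le_trans _ _ (q setT (j0 phi) + q setT (j1 phi))%E).
    rewrite /q -qiD//; [|exact: mf_sq|exact: mf_sq|exact: sq_ge0|exact: sq_ge0].
    apply: (@le_trans _ _ (qi (cel j) (fun x => sq (j0 phi) x + sq (j1 phi) x)%R)).
      rewrite (@qi_eq _ _ _ (fun x => sq (j0 phi) x + sq (j1 phi) x)) ?lexx// => x cx.
      have [e e1] := p_one cx.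
      by congr (_ + _); apply: eq_bigr => i _; rewrite /phi /= e ?e1 ?mul0r ?mul1r ?add0r.
    apply: qi_subT; [exact: cell_meas|by apply: mfD; exact: mf_sq|by move=> x; apply: addr_ge0; exact: sq_ge0].
  apply: (le_trans (est_shift j Lphi)); apply: lee_wpmul2l => //.
  pose fj x := sum3 (fun k => \1_(cel k) x * f x) j.
  have mfk k : mf (fun x => \1_(cel k) x * f x).
    by apply: mfM => //; apply: measurable_indic; exact: cell_meas.
  have f0k k x : 0 <= \1_(cel k) x * f x by apply: mulr_ge0.
  have mBs : mfF (op d c (Bs j) phi).
    by apply: mf_op => // i k; apply: cont_shift; exact: cB.
  apply: (@le_trans _ _ (qi setT fj)).
    apply: qi_le => //; [exact: mf_sq|by apply: mfD; [apply: mfD|]|exact: sq_ge0|] => x _.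
    have opE i : op d c (Bs j) phi i x = p j x * op d c B' J i x + rem d c B' (Bs j) (p j) (p1 j) (p2 j) J i x.
      exact: op_mul.
    have bd : sq (op d c (Bs j) phi) x <= f x.
      have : sq (rem d c B' (Bs j) (p j) (p1 j) (p2 j) J) x <= kap * g x.
        by apply: rem_bd2 => px i k; rewrite distrC; exact: mismatch.
      have := @sq_mul_le R I (p j x) C (op d c B' J) x (let: And3 h _ _ := p_bd j x in h).
      have := @sq_fadd R I (fun i x => p j x * op d c B' J i x) (rem d c B' (Bs j) (p j) (p1 j) (p2 j) J) x.
      have -> : sq (op d c (Bs j) phi) x = sq (fadd (fun i x => p j x * op d c B' J i x) (rem d c B' (Bs j) (p j) (p1 j) (p2 j) J)) x.
        by apply: eq_bigr => i _; rewrite opE.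
      by rewrite /f [X in _ <= 2 * X + _]/sq; lra.
    have [inw|outw] := pselect (cel (j - 1) x \/ cel j x \/ cel (j + 1) x).
      apply: (le_trans bd); rewrite /fj /sum3.
      have := f0k (j - 1) x; have := f0k j x; have := f0k (j + 1) x.
      have ik k : cel k x -> \1_(cel k) x * f x = f x by move=> h; rewrite indicE mem_set// mul1r.
      by case: inw => [|[|]] => /ik ->; lra.
    have z : x <= (j%:~R - 1) * l \/ (j%:~R + 2) * l <= x.
      have [h1|h1] := leP x ((j%:~R - 1) * l); first by left.
      have [h2|h2] := leP ((j%:~R + 2) * l) x; first by right.
      exfalso; apply: outw.
      rewrite /cel /cell/= !in_itv/=.
      have [x1|x1] := ltP x (j%:~R * l).
        by left; rewrite intrB; apply/andP; split; [exact: ltW|rewrite subrK].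
      right; have [x2|x2] := ltP x ((j%:~R + 1) * l); first by left; apply/andP.
      by right; rewrite intrD; apply/andP; split => //; rewrite -addrA.
    have [e0 e1 e2] := p_supp z.
    rewrite (_ : sq _ x = 0); first by apply: addr_ge0; [apply: addr_ge0|]; exact: f0k.
    rewrite /sq big1// => i _; rewrite opE /rem e0 e1 e2 !mul0r !mulr0 !addr0 !mul0r add0r addr0.
    by rewrite expr0n.
  have ck k : qi setT (fun x => \1_(cel k) x * f x) = qi (cel k) f.
    rewrite /qi [RHS]integral_mkcond; apply: eq_integral => x _.
    by rewrite patchE indicE; case: (x \in cel k); rewrite ?mul1r ?mul0r.
  rewrite /fj /sum3 qiD//; [|by apply: mfD|by move=> x; apply: addr_ge0].
  by rewrite qiD// !ck.
have := cell_sum_line l0 m_f mg f0' g0 K0 cellwise.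
rewrite -qg => H; apply: (@le_trans _ _ ((2 * (6 * C ^+ 2 * K))%:E * q setT (op d c B' J))%E); last first.
  by rewrite (_ : 2 * (6 * C ^+ 2 * K) = 12 * C ^+ 2 * K) ?lexx//; ring.
(* The term to be absorbed has the factor [6 * (kap * K)], which [small] keeps below 1/2. *)
apply: half_absorb => //.
- by rewrite !mulr_ge0.
- by apply: adde_ge0; exact: q_ge0.
- by case: (q setT (j0 J)) f0 => //; case: (q setT (j1 J)) f1 => // *; rewrite -EFinD ltry.
- exact: q_ge0.
apply: (le_trans H); rewrite /f qiD//.
- rewrite !qiZ//; [|by apply: mulr_ge0|exact: mf_sq|exact: sq_ge0|by apply: mulr_ge0].
  rewrite -/(q _ _) -qg ge0_muleDr; last 2 first.
  + by apply: mule_ge0; [rewrite lee_fin mulr_ge0|exact: q_ge0].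
  + by apply: mule_ge0; [rewrite lee_fin mulr_ge0|apply: adde_ge0; exact: q_ge0].
  rewrite !muleA -!EFinM; apply: leeD; apply: lee_wpmul2r.
  + exact: q_ge0.
  + by rewrite lee_fin (_ : 3 * K * (2 * C ^+ 2) = 6 * C ^+ 2 * K) ?lexx//; ring.
  + by apply: adde_ge0; exact: q_ge0.
  by rewrite lee_fin (_ : 3 * K * (2 * kap) = 6 * (kap * K)); [have h := small; have := mulr_ge0 kap0 K0; lra|ring].
- by apply: mfM; [exact: mf_cst|exact: mf_sq].
- by apply: mfM => //; exact: mf_cst.
- by move=> x; apply: mulr_ge0; [rewrite mulr_ge0|exact: sq_ge0].
- by move=> x; apply: mulr_ge0 => //; rewrite mulr_ge0.
Qed.

Lemma line_INV : INV (op d c B') (12 * C ^+ 2 * K).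
Proof. by split; [exact: line_solve|exact: line_est]. Qed.

(** * Periodic data under the parametrix *)

Section Periodic.
Variable m : nat.
Hypothesis m0 : (0 < m)%N.
Let L : R := m%:R * l.
(** The shifts compensate the period: cell j + m at x + L is sent to the same place as cell j at x.
    Hence the parametrix commutes with translation by L. *)
Hypothesis sm : forall j, s (j + m%:Z) = s j - L.
Hypothesis cP : forall i x, c i (x + L) = c i x.
Hypothesis BP : forall i k x, B' i k (x + L) = B' i k x.

Let jm (j : int) : (j + m%:Z)%:~R * l = j%:~R * l + L.
Proof. by rewrite intrD mulrDl. Qed.

Lemma cell_per j x : cel (j + m%:Z) (x + L) <-> cel j x.
Proof.
rewrite /cel /cell/= !in_itv/= intrD.
have e1 : (j%:~R + m%:~R) * l = j%:~R * l + L by rewrite mulrDl.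
have e2 : (j%:~R + m%:~R + 1) * l = (j%:~R + 1) * l + L by rewrite /L -[m%:~R]/(m%:R); ring.
by rewrite e1 e2 lerD2r ltrD2r.
Qed.

Lemma cidx_per x : cidx l (x + L) = cidx l x + m%:Z.
Proof. by apply/(cellP l0); apply/cell_per/(cellP l0). Qed.

Lemma arg_per F j : perF L F -> arg (j + m%:Z) F = arg j F.
Proof.
move=> pF; apply/funext => i; apply/funext => x; rewrite /arg sm.
have -> : x - (s j - L) = (x - s j) + L by ring.
have [h|h] := pselect (cel j (x - s j)).
  by rewrite !cut_in ?pF//; apply/cell_per.
by rewrite !cut_out// => /cell_per.
Qed.

Lemma Tj_per F j i x : perF L F ->
  [/\ j0 (Tj F (j + m%:Z)) i (x + L) = j0 (Tj F j) i x,
      j1 (Tj F (j + m%:Z)) i (x + L) = j1 (Tj F j) i x &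
      j2 (Tj F (j + m%:Z)) i (x + L) = j2 (Tj F j) i x].
Proof.
move=> pF; have e : l^-1 * (x + L) - (j + m%:Z)%:~R = l^-1 * x - j%:~R.
  by rewrite intrD /L -[m%:~R]/(m%:R); field; rewrite gt_eqF.
have e' : x + L + (s j - L) = x + s j by ring.
by rewrite /Tj /Sj (arg_per _ pF) /= sm /p /p1 /p2 e e'.
Qed.

Lemma P_per F : perF L F -> [/\ perF L (j0 (P F)), perF L (j1 (P F)) & perF L (j2 (P F))].
Proof.
move=> pF; have T j i x := Tj_per j i x pF.
have e j : (j + m%:Z - 1 = j - 1 + m%:Z) /\ (j + m%:Z + 1 = j + 1 + m%:Z) by lia.
split=> i x.
- change (sum3 (fun j => j0 (Tj F j) i (x + L)) (cidx l (x + L)) = sum3 (fun j => j0 (Tj F j) i x) (cidx l x)).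
  rewrite cidx_per /sum3; have [-> ->] := e (cidx l x).
  by have [-> _ _] := T (cidx l x - 1) i x; have [-> _ _] := T (cidx l x) i x; have [-> _ _] := T (cidx l x + 1) i x.
- change (sum3 (fun j => j1 (Tj F j) i (x + L)) (cidx l (x + L)) = sum3 (fun j => j1 (Tj F j) i x) (cidx l x)).
  rewrite cidx_per /sum3; have [-> ->] := e (cidx l x).
  by have [_ -> _] := T (cidx l x - 1) i x; have [_ -> _] := T (cidx l x) i x; have [_ -> _] := T (cidx l x + 1) i x.
- change (sum3 (fun j => j2 (Tj F j) i (x + L)) (cidx l (x + L)) = sum3 (fun j => j2 (Tj F j) i x) (cidx l x)).
  rewrite cidx_per /sum3; have [-> ->] := e (cidx l x).
  by have [_ _ ->] := T (cidx l x - 1) i x; have [_ _ ->] := T (cidx l x) i x; have [_ _ ->] := T (cidx l x + 1) i x.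
Qed.

Lemma locL2_per F : mfF F -> perF L F -> (q (ico 0 L) F < +oo)%E -> locL2 F.
Proof.
move=> mF pF fF; split => // j.
have pk (k : int) i x : F i (x + k%:~R * L) = F i x.
  elim/int_rect: k x => [x|k IH x|k IH x]; first by rewrite mul0r addr0.
    by rewrite -addn1 PoszD intrD mulrDl mul1r addrA pF IH.
  rewrite -[RHS]IH -(pF i (x + _)); congr (F i _); rewrite !intrN -addn1 PoszD intrD; ring.
pose k := (j %/ m%:Z)%Z.
have e : q (ico (0 + k%:~R * L) (L + k%:~R * L)) F = q (ico 0 L) F.
  apply: qi_period; [exact: mf_sq|exact: sq_ge0|] => x.
  by apply: eq_bigr => i _; rewrite pk.
apply: le_lt_trans fF; rewrite -e; apply: q_sub => //; [exact: cell_meas|exact: measurable_itv|] => x.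
rewrite /cel /cell /ico/= !in_itv/= add0r => /andP[h1 h2].
have m00 : (m%:Z != 0) by rewrite eqz_nat -lt0n.
have [r0 rm] : (0 <= j %% m%:Z)%Z /\ (j %% m%:Z < m%:Z)%Z.
  by split; [exact: modz_ge0|exact: ltz_pmod].
have E : j = k * m%:Z + (j %% m%:Z)%Z by exact: divz_eq.
have E' : (j%:~R : R) = k%:~R * m%:R + (j %% m%:Z)%Z%:~R by rewrite {1}E intrD intrM.
have a1 : (0 : R) <= (j %% m%:Z)%Z%:~R by rewrite ler0z.
have a2 : (j %% m%:Z)%Z%:~R + 1 <= (m%:R : R).
  by rewrite -[m%:R]/(m%:Z%:~R) -[1]/(1%:~R) -intrD ler_int lezD1.
apply/andP; split; [apply: le_trans h1|apply: (lt_le_trans h2)]; rewrite E' /L.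
- by have := mulr_ge0 a1 (ltW l0); lra.
- by have := ler_wpM2r (ltW l0) a2; lra.
Qed.

Lemma perF_sub F G : perF L F -> perF L G -> perF L (fsub F G).
Proof. by move=> h1 h2 i x; rewrite /fsub h1 h2. Qed.

Lemma sq_per F x : perF L F -> sq F (x + L) = sq F x.
Proof. by move=> h; apply: eq_bigr => i _; rewrite h. Qed.

Lemma Er_period F G : locL2 F -> locL2 G -> perF L F -> perF L G ->
  (q (ico 0 L) (fsub (Er F) (Er G)) <= (64^-1)%:E * q (ico 0 L) (fsub F G))%E.
Proof.
move=> lF lG pF pG; have kap0 := kap_ge0.
have mfs : mfF (fsub F G) by apply: mf_fsub; [case: lF|case: lG].
have mE : mfF (fsub (Er F) (Er G)) by apply: mf_fsub; exact: mf_Er.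
apply: (@le_trans _ _ ((3 * (3 * kap * K))%:E * q (ico 0 L) (fsub F G))%E).
  apply: (cell_sum_period l0 m0 (mf_sq mfs) (mf_sq mE) (sq_ge0 _) (sq_ge0 _)).
  - by rewrite !mulr_ge0.
  - by move=> x; apply: sq_per; exact: perF_sub.
  by move=> j; exact: Er_cell.
apply: lee_wpmul2r; first exact: q_ge0.
by rewrite lee_fin (_ : 3 * (3 * kap * K) = 9 * (kap * K)); [have h := small; lra|ring].
Qed.

Lemma P_period F G : locL2 F -> locL2 G -> perF L F -> perF L G ->
  (q (ico 0 L) (j0 (jsub (P F) (P G))) + q (ico 0 L) (j1 (jsub (P F) (P G))) <=
   (27 * C ^+ 2 * K)%:E * q (ico 0 L) (fsub F G))%E.
Proof.
move=> lF lG pF pG; have C2 : 0 <= C ^+ 2 by exact: sqr_ge0.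
have mfs : mfF (fsub F G) by apply: mf_fsub; [case: lF|case: lG].
have [mm0 mm1 _] := jet_mf (jsub_ok (P_ok lF) (P_ok lG)).
have mI : measurable (ico 0 L) by exact: measurable_itv.
rewrite /q -qiD//; [|exact: mf_sq|exact: mf_sq|exact: sq_ge0|exact: sq_ge0].
have -> : (27 * C ^+ 2 * K) = 3 * (9 * C ^+ 2 * K) by ring.
apply: (cell_sum_period l0 m0 (mf_sq mfs)).
- by apply: mfD; exact: mf_sq.
- exact: sq_ge0.
- by move=> x; apply: addr_ge0; exact: sq_ge0.
- by rewrite !mulr_ge0.
- by move=> x; apply: sq_per; exact: perF_sub.
by move=> j; exact: P_cell.
Qed.

End Periodic.

End Parametrix.

(** * Transfer of invertibility between locally similar operators *)

Section Transfer.
Variables (R : realType) (I : finType).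
Local Notation mu := (@lebesgue_measure R).
Local Notation fld := (I -> R -> R).
Local Notation jet := (jet R I).

Lemma solution_operator (Op : jet -> fld) K : INV Op K -> exists Rs : fld -> jet,
  Rs (@fzero R I) = @jzero R I /\
  (Op (@jzero R I) = @fzero R I -> forall F, mfF F -> (q setT F < +oo)%E ->
    L2jet (Rs F) /\ {ae mu, forall x, forall i, Op (Rs F) i x = F i x}).
Proof.
move=> [H _].
have /choice[Rs HR] : forall F, exists J : jet, (F = @fzero R I -> J = @jzero R I) /\
    (Op (@jzero R I) = @fzero R I -> mfF F -> (q setT F < +oo)%E ->
    L2jet J /\ {ae mu, forall x, forall i, Op J i x = F i x}).
  move=> F; have [->|n0] := pselect (F = @fzero R I).
    exists (@jzero R I); split => // Oz _ _; split; first exact: L2jet_zero.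
    by apply: aeW => x i; rewrite Oz.
  have [[mF fF]|nf] := pselect (mfF F /\ (q setT F < +oo)%E).
    by have [J LJ e] := H F mF fF; exists J.
  by exists (@jzero R I); split => // _ mF fF; case: nf.
exists Rs; split; first by have [-> //] := HR (@fzero R I).
by move=> Oz F mF fF; have [_ h] := HR F; exact: h.
Qed.

Lemma op_zero (d : I -> R) c B : op d c B (@jzero R I) = @fzero R I.
Proof.
apply/funext => i; apply/funext => x; rewrite /op /= /fzero big1 ?mulr0 ?addr0// => k _.
by rewrite mulr0.
Qed.

(** Long cells make the commutator small, and a small tolerance makes the mismatch small; the two
    can be chosen independently. *)
Lemma choose_kap (Dm Cc C K : R) : 0 <= Dm -> 0 <= Cc -> 0 <= C -> 0 <= K ->
  exists l1 dl : R, [/\ 1 <= l1, 0 < dl & forall l, l1 <= l -> 576 * (kap I Dm Cc C dl l * K) <= 1].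
Proof.
move=> Dm0 Cc0 C0 K0; have [A AE] : exists A, A = (2 * Dm + Cc) * C by eexists.
have A2 : 0 <= A ^+ 2 * K by apply: mulr_ge0 => //; exact: sqr_ge0.
have [Q QE] : exists Q, Q = C ^+ 2 * N1 R I ^+ 2 * K by eexists.
have Q0 : 0 <= Q by rewrite QE; apply: mulr_ge0 => //; apply: mulr_ge0; exact: sqr_ge0.
have [t t0 tE] : exists2 t : R, 0 < t & t * (1 + (48 * 48) * Q) = 1.
  have q1 : 0 < 1 + (48 * 48) * Q by clear -Q0; lra.
  by exists (1 + (48 * 48) * Q)^-1; [rewrite invr_gt0|rewrite mulVf// gt_eqF].
have tQ : t + (48 * 48) * (Q * t) = 1 by rewrite -[RHS]tE; ring.
have Qt : 0 <= Q * t by apply: mulr_ge0 => //; exact: ltW.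
have t1 : t <= 1 by clear -tQ Qt; lra.
have Qtt : Q * t ^+ 2 <= Q * t.
  by apply: ler_wpM2l => //; rewrite expr2 ler_piMr// ltW.
(* Each of the two parts of [576 * (kap * K)] is kept below 1/2. The first equals half of
   [(A / l)^2 * K * (72 * 64)]; the second is at most half of [48 * 48 * (Q * t)], which is 1 -
   t. *)
exists (1 + (72 * 64) * (A ^+ 2 * K)), t; split; [by clear -A2; lra|exact: t0|].
move=> l hl; have l1 : 1 <= l by clear -hl A2; lra.
rewrite /kap -AE.
have e1 : (A / l) ^+ 2 * K * (72 * 64) <= 1.
  have -> : (A / l) ^+ 2 * K * (72 * 64) = (A ^+ 2 * K * (72 * 64)) / l ^+ 2.
    by rewrite exprMn exprVn; ring.
  have l20 : 0 < l ^+ 2 by apply: exprn_gt0; clear -l1; lra.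
  rewrite (ler_pdivrMr _ _ l20).
  by rewrite mul1r; have : l <= l ^+ 2 by [rewrite expr2 ler_peMr//; clear -l1; lra]; clear -hl; lra.
have -> : 576 * ((4 * (A / l) ^+ 2 + 2 * C ^+ 2 * t ^+ 2 * N1 R I ^+ 2) * K) =
  ((A / l) ^+ 2 * K * (72 * 64)) / 2 + (48 * 24) * (Q * t ^+ 2) by rewrite QE; field; rewrite gt_eqF//; clear -l1; lra.
by clear -e1 Qtt tQ t0; lra.
Qed.

Lemma window (l x : R) (j : int) : 0 < l -> (j%:~R - 1) * l <= x <= (j%:~R + 2) * l ->
  `|x - (j%:~R + 2^-1) * l| <= 2 * l.
Proof. by move=> l0 /andP[h1 h2]; rewrite ler_norml; apply/andP; split; lra. Qed.

(* The parametrix glues translates of the given inverse along a partition into long windows; its error is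
   small because the derivatives of the cut-offs and the mismatch of the coefficients are. *)
Theorem transfer_line (d : I -> R) (d0 Dm Cc K : R) : 0 < d0 -> (forall i, d0 <= d i) ->
  (forall i, d i <= Dm) -> 0 <= Dm -> 0 <= Cc -> 0 <= K ->
  exists (r dl K' : R), [/\ 0 < r, 0 < dl, 0 <= K' &
  forall c B B' Cb, (forall i, continuous (c i)) -> cont2 B -> cont2 B' ->
    (forall i x, `|c i x| <= Cc) -> (forall i k x, `|B' i k x| <= Cb) ->
    (forall x0 : R, exists2 sg, (forall i x, c i (x + sg) = c i x) &
      forall i k x, `|x - x0| <= r -> `|B' i k x - B i k (x + sg)| <= dl) ->
    INV (op d c B) K -> INV (op d c B') K'].
Proof.
move=> d00 hd0 hd Dm0 Cc0 K0; have [b [b1 [b2 [C bump]]]] := bump_exists R.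
have C0 := bump_C bump.
have [l1 [dl [l11 dl0 sm]]] := choose_kap Dm0 Cc0 C0 K0.
have l0 : 0 < l1 by lra.
exists (2 * l1), dl, (12 * C ^+ 2 * K); split => //; [lra|by rewrite !mulr_ge0// sqr_ge0|].
move=> c B B' Cb cc cB cB' hc hB' hw Hinv.
have [Rs [Rs0 RsP]] := solution_operator Hinv.
have {}RsP := RsP (op_zero _ _ _).
have /choice[s Hs] : forall j : int, exists sj : R, (forall i x, c i (x + sj) = c i x) /\
   forall i k x, (j%:~R - 1) * l1 <= x <= (j%:~R + 2) * l1 -> `|B' i k x - B i k (x + sj)| <= dl.
  move=> j; have [sg h1 h2] := hw ((j%:~R + 2^-1) * l1).
  by exists sg; split => // i k x hx; apply: h2; exact: window.
have sc j : forall i x, c i (x + s j) = c i x by have [] := Hs j.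
have sB j i k x : (j%:~R - 1) * l1 <= x <= (j%:~R + 2) * l1 -> `|B' i k x - B i k (x + s j)| <= dl.
  by have [_ h] := Hs j; exact: h.
exact: (line_INV cc cB cB' d00 Dm0 Cc0 hd0 hd hc hB' l11 K0 bump Hinv sc sB (sm _ (lexx _)) Rs0 RsP).
Qed.

Definition perL2 (L : R) (F : fld) : Prop := [/\ mfF F, perF L F & (q (ico 0 L) F < +oo)%E].

(** For periodic data the parametrix is kept as such instead of being turned into an inverse: the
    nonlinear problem is solved by iterating with it directly, and one fixed point removes both the
    linear error and the nonlinearity. *)
Record parametrix d c B (L K : R) (P : fld -> jet) : Prop := MkParametrix {
  pm_zero : forall i x, [/\ j0 (P (@fzero R I)) i x = 0, j1 (P (@fzero R I)) i x = 0 &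
    j2 (P (@fzero R I)) i x = 0];
  pm_ok : forall F, perL2 L F -> jetok (P F);
  pm_per : forall F, perL2 L F -> [/\ perF L (j0 (P F)), perF L (j1 (P F)) & perF L (j2 (P F))];
  pm_err : forall F G, perL2 L F -> perL2 L G ->
    (q (ico 0 L) (fsub (fsub (op d c B (P F)) F) (fsub (op d c B (P G)) G)) <=
     (64^-1)%:E * q (ico 0 L) (fsub F G))%E;
  pm_bound : forall F G, perL2 L F -> perL2 L G ->
    (q (ico 0 L) (j0 (jsub (P F) (P G))) + q (ico 0 L) (j1 (jsub (P F) (P G))) <=
     K%:E * q (ico 0 L) (fsub F G))%E
}.

(** The construction of [transfer_line] with two adjustments: the cell length has to divide the
    period, and the window shifts have to be chosen compatibly with it. *)
Theorem transfer_period (d : I -> R) (d0 Dm Cc K : R) : 0 < d0 -> (forall i, d0 <= d i) ->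
  (forall i, d i <= Dm) -> 0 <= Dm -> 0 <= Cc -> 0 <= K ->
  exists (r dl K' : R), [/\ 0 < r, 0 < dl, 0 <= K' &
  forall c B B' Cb L, (forall i, continuous (c i)) -> cont2 B -> cont2 B' ->
    (forall i x, `|c i x| <= Cc) -> (forall i k x, `|B' i k x| <= Cb) -> r <= L ->
    (forall i x, c i (x + L) = c i x) -> (forall i k x, B' i k (x + L) = B' i k x) ->
    (forall x0 : R, exists2 sg, (forall i x, c i (x + sg) = c i x) &
      forall i k x, `|x - x0| <= r -> `|B' i k x - B i k (x + sg)| <= dl) ->
    INV (op d c B) K -> exists P, parametrix d c B' L K' P].
Proof.
move=> d00 hd0 hd Dm0 Cc0 K0; have [b [b1 [b2 [C bump]]]] := bump_exists R.
have C0 := bump_C bump.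
have [l1 [dl [l11 dl0 sm]]] := choose_kap Dm0 Cc0 C0 K0.
have l10 : 0 < l1 by lra.
exists (4 * l1), dl, (27 * C ^+ 2 * K); split => //; [lra|by rewrite !mulr_ge0// sqr_ge0|].
move=> c B B' Cb L cc cB cB' hc hB' rL cP BP hw Hinv.
have [Rs [Rs0 RsP]] := solution_operator Hinv.
have {}RsP := RsP (op_zero _ _ _).
(* The cell length becomes L/m, which lies between [l1] and [2 * l1]; this is why the window radius
   is [4 * l1]. *)
pose m := Num.truncn (L / l1); pose l := L / m%:R.
have L0 : 0 < L by lra.
have Ll : 1 <= L / l1 by rewrite ler_pdivlMr//; lra.
have m0 : (0 < m)%N by rewrite /m truncn_gt0.
have m0' : (0 : R) < m%:R by rewrite ltr0n.
have mE : m%:R * l = L by rewrite /l mulrC divfK// gt_eqF.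
have lb : l1 <= l.
  rewrite /l ler_pdivlMr// mulrC -ler_pdivlMr//; have := truncn_itv (le_trans ler01 Ll); by case/andP.
have lu : l <= 2 * l1.
  have : L / l1 < m.+1%:R by exact: truncnS_gt.
  rewrite ltr_pdivrMr// -natr1 => h; rewrite /l ler_pdivrMr//.
  by have : (1 : R) <= m%:R by [rewrite ler1n]; nra.
have l0 : 0 < l by lra.
have /choice[sg Hs] : forall j : int, exists sj : R, (forall i x, c i (x + sj) = c i x) /\
   forall i k x, (j%:~R - 1) * l <= x <= (j%:~R + 2) * l -> `|B' i k x - B i k (x + sj)| <= dl.
  move=> j; have [sg h1 h2] := hw ((j%:~R + 2^-1) * l).
  by exists sg; split => // i k x hx; apply: h2; apply: (le_trans (window l0 hx)); lra.
have pk (g : R -> R) (k : int) x : (forall y, g (y + L) = g y) -> g (x + k%:~R * L) = g x.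
  move=> pg; elim/int_rect: k x => [x|k IH x|k IH x]; first by rewrite mul0r addr0.
    by rewrite -addn1 PoszD intrD mulrDl mul1r addrA pg IH.
  rewrite -[RHS]IH -(pg (x + _)); congr (g _); rewrite !intrN -addn1 PoszD intrD; ring.
(* Shifts are chosen freely for the residues modulo m and extended by subtracting whole periods,
   which gives s (j + m) = s j - L. *)
pose s j := sg (j %% m%:Z)%Z - (j %/ m%:Z)%Z%:~R * L.
have m00 : (m%:Z != 0) by rewrite eqz_nat -lt0n.
have E j : (j%:~R : R) = (j %/ m%:Z)%Z%:~R * m%:R + (j %% m%:Z)%Z%:~R.
  by rewrite {1}(divz_eq j m%:Z) intrD intrM.
have sc j i x : c i (x + s j) = c i x.
  rewrite /s; have [h _] := Hs (j %% m%:Z)%Z.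
  have -> : x + (sg (j %% m%:Z)%Z - (j %/ m%:Z)%Z%:~R * L) = x + (- (j %/ m%:Z)%Z)%:~R * L + sg (j %% m%:Z)%Z.
    by rewrite intrN; ring.
  by rewrite h pk.
have sB j i k x : (j%:~R - 1) * l <= x <= (j%:~R + 2) * l -> `|B' i k x - B i k (x + s j)| <= dl.
  move=> /andP[h1 h2]; have [_ h] := Hs (j %% m%:Z)%Z.
  have := h i k (x + (- (j %/ m%:Z)%Z)%:~R * L); rewrite (pk (B' i k))//.
  have -> : x + (- (j %/ m%:Z)%Z)%:~R * L + sg (j %% m%:Z)%Z = x + s j.
    by rewrite /s intrN; ring.
  apply; rewrite E -mE in h1 h2 *; rewrite intrN; apply/andP; split; lra.
have smm j : s (j + m%:Z) = s j - m%:R * l.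
  by rewrite mE /s modzDr divzDr// divzz m00/= intrD; ring.
have cP' i x : c i (x + m%:R * l) = c i x by rewrite mE.
have BP' i k x : B' i k (x + m%:R * l) = B' i k x by rewrite mE.
have l1' : 1 <= l by lra.
have Sm := sm l lb.
exists (P l b b1 b2 s Rs).
have LL F : perL2 L F -> locL2 l F.
  by move=> [mF pF fF]; apply: (locL2_per l1' m0 mF); rewrite mE.
have pLm F : perL2 L F -> perF (m%:R * l) F by move=> [_ h _]; rewrite mE.
split.
- exact: P_fzero Rs0.
- by move=> F /LL lF; exact: (P_ok s l1' bump RsP lF).
- by move=> F /pLm pF; rewrite -mE; exact: (P_per d00 Dm0 Cc0 l1' K0 bump Sm Rs m0 smm pF).
- move=> F G pF pG; rewrite -mE.
  exact: (Er_period cc cB cB' d00 Dm0 Cc0 hd0 hd hc l1' K0 bump Hinv sc sB Sm RsP m0 (LL _ pF) (LL _ pG) (pLm _ pF) (pLm _ pG)).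
- move=> F G pF pG; rewrite -mE.
  exact: (P_period s cc cB l1' K0 bump Hinv RsP m0 (LL _ pF) (LL _ pG) (pLm _ pF) (pLm _ pG)).
Qed.

End Transfer.

(** * The spectral parameter and uniform a priori bounds *)

Section Spectral.
Variables (R : realType).
Local Notation mu := (@lebesgue_measure R).

(* Complex two-component fields are encoded by four real ones: (j, c) is the real (c = false) or
   imaginary (c = true) part of w (j = false) or p (j = true). *)
Definition I4 : finType := (bool * bool)%type.
Local Notation fld := (I4 -> R -> R).
Local Notation jet := (jet R I4).
Implicit Types (F G H : fld) (J : jet) (B : I4 -> I4 -> R -> R).

Lemma sum4 (V : nmodType) (f : I4 -> V) :
  \sum_i f i = f (false, false) + f (false, true) + (f (true, false) + f (true, true)).
Proof.
rewrite (eq_bigr (fun p => f (p.1, p.2))); last by case.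
rewrite -(pair_bigA _ (fun a b : bool => f (a, b)))/= !big_bool /=.
by rewrite addrC; congr (_ + _); rewrite addrC.
Qed.

(** The real matrix of multiplication by the complex number a + ib. *)
Definition Ml (a b : R) (i k : I4) : R :=
  if i.1 == k.1 then (if i.2 == k.2 then a else if i.2 then b else - b) else 0.

Definition cmul (a b : R) F : fld := fun i x => \sum_k Ml a b i k * F k x.

Definition Bl B (a b : R) : I4 -> I4 -> R -> R := fun i k x => B i k x - Ml a b i k.

Lemma cmulE a b F (j : bool) x : cmul a b F (j, false) x = a * F (j, false) x - b * F (j, true) x /\
  cmul a b F (j, true) x = a * F (j, true) x + b * F (j, false) x.
Proof. by rewrite /cmul !sum4 /Ml /=; case: j => /=; split; ring. Qed.

Lemma sq_cmul a b F x : sq (cmul a b F) x = (a ^+ 2 + b ^+ 2) * sq F x.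
Proof.
rewrite /sq !sum4; have [-> ->] := cmulE a b F false x; have [-> ->] := cmulE a b F true x; ring.
Qed.

Lemma mf_cmul a b F : mfF F -> mfF (cmul a b F).
Proof. by move=> mF i; apply: mf_sum => k; apply: mfM => //; exact: mf_cst. Qed.

Lemma q_cmul D a b F : measurable D -> mfF F -> q D (cmul a b F) = ((a ^+ 2 + b ^+ 2)%:E * q D F)%E.
Proof.
move=> mD mF; rewrite /q -qiZ//; [|exact: mf_sq|exact: sq_ge0|by apply: addr_ge0; exact: sqr_ge0].
by apply: qi_eq => x _; exact: sq_cmul.
Qed.

Lemma op_Bl d c B a b J i x : op d c (Bl B a b) J i x = op d c B J i x - cmul a b (j0 J) i x.
Proof.
rewrite /op /Bl /cmul -[RHS]addrA; congr (_ + _).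
by rewrite -sumrB; apply: eq_bigr => k _; rewrite mulrBl.
Qed.

Lemma cmul_sub a b a' b' F i x : cmul (a - a') (b - b') F i x = cmul a b F i x - cmul a' b' F i x.
Proof.
case: i => j []; [have [_ ->] := cmulE (a - a') (b - b') F j x|have [-> _] := cmulE (a - a') (b - b') F j x];
  [have [_ ->] := cmulE a b F j x; have [_ ->] := cmulE a' b' F j x|
   have [-> _] := cmulE a b F j x; have [-> _] := cmulE a' b' F j x]; ring.
Qed.

Lemma op_Bl_diff d c B a b a' b' J i x : op d c (Bl B a b) J i x =
  op d c (Bl B a' b') J i x - cmul (a - a') (b - b') (j0 J) i x.
Proof. rewrite !op_Bl cmul_sub; ring. Qed.

Lemma cont_Bl B a b : cont2 B -> cont2 (Bl B a b).
Proof. by move=> cB i k x; apply: cvgB; [exact: cB|exact: cvg_cst]. Qed.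

Lemma Ml_le a b i k : `|Ml a b i k| <= `|a| + `|b|.
Proof.
have := normr_ge0 a; have := normr_ge0 b.
by rewrite /Ml; case: eqP => _; [case: eqP => _; [|case: i.2]|]; rewrite ?normrN ?normr0; lra.
Qed.

Lemma abs_mul_le (y z : R) : `|y * z| <= (y ^+ 2 + z ^+ 2) / 2.
Proof.
by rewrite ler_norml; apply/andP; split;
  [have := sqr_ge0 (y + z)|have := sqr_ge0 (y - z)]; rewrite ?sqrrD ?sqrrB; lra.
Qed.

Lemma real_of_fin (x : \bar R) : (0 <= x)%E -> (x < +oo)%E -> exists2 r : R, x = r%:E & 0 <= r.
Proof. by case: x => // r; rewrite lee_fin => r0 _; exists r. Qed.

Section Estimates.
Variables (d : I4 -> R) (c : I4 -> R -> R) (d0 Dm Cc : R).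
Hypotheses (d00 : 0 < d0) (hd0 : forall i, d0 <= d i) (hd : forall i, d i <= Dm).
Hypotheses (dC : forall j, d (j, false) = d (j, true)) (ccC : forall j x, c (j, false) x = c (j, true) x).
Hypotheses (cc : forall i, continuous (c i)) (hc : forall i x, `|c i x| <= Cc).

Let Cc0 : 0 <= Cc. Proof. by have := hc (true, true) 0; apply: le_trans. Qed.
Let Dm0 : 0 < Dm. Proof. exact: lt_le_trans d00 (le_trans (hd0 (true, true)) (hd _)). Qed.
Let dp i : 0 < d i. Proof. exact: lt_le_trans d00 (hd0 i). Qed.

Lemma op_real B Cb J : cont2 B -> (forall i k x, `|B i k x| <= Cb) -> L2jet J ->
  exists r0 r1 r, [/\ q setT (j0 J) = r0%:E, q setT (j1 J) = r1%:E,
    q setT (op d c B J) = r%:E & [/\ 0 <= r0, 0 <= r1 & 0 <= r]].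
Proof.
move=> cB hB LJ; have [ok f0 f1 f2] := LJ; have [m0 m1 m2] := jet_mf ok.
have mo : mfF (op d c B J) by apply: mf_op.
have [r0 e0 p0] := real_of_fin (q_ge0 _ _) f0; have [r1 e1 p1] := real_of_fin (q_ge0 _ _) f1.
have [r2 e2 p2] := real_of_fin (q_ge0 _ _) f2.
pose X := fadd (fun i x => d i * j2 J i x) (fun i x => c i x * j1 J i x).
pose Y : fld := fun i x => \sum_k B i k x * j0 J k x.
have mX1 : mfF (fun i x => d i * j2 J i x) by move=> i; apply: mfM => //; exact: mf_cst.
have mX2 : mfF (fun i x => c i x * j1 J i x) by move=> i; apply: mfM => //; exact: mf_cont.
have mY : mfF Y by move=> i; apply: mf_sum => k; apply: mfM => //; apply: mf_cont; exact: cB.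
have Cb0 : 0 <= Cb by have := hB (true, true) (true, true) 0; apply: le_trans.
have N0 := N1_gt0 R I4.
have fX : (q setT X < +oo)%E.
  apply: (@q_fin2 _ _ X (j2 J) (j1 J) (2 * Dm ^+ 2) (2 * Cc ^+ 2)) => //.
  - exact: mf_fadd.
  - by apply: mulr_ge0 => //; exact: sqr_ge0.
  - by apply: mulr_ge0 => //; exact: sqr_ge0.
  move=> x; apply: (le_trans (sq_fadd _ _ _)); rewrite -[2 * Dm ^+ 2 * _]mulrA -[2 * Cc ^+ 2 * _]mulrA; apply: lerD; rewrite ler_pM2l// /sq [leRHS]mulr_sumr;
    apply: ler_sum => i _; rewrite exprMn; apply: ler_wpM2r; rewrite ?sqr_ge0//.
    by rewrite lerXn2r// nnegrE ltW.
  by rewrite -real_normK ?num_real// lerXn2r// nnegrE.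
have fY : (q setT Y < +oo)%E.
  apply: (@q_fin2 _ _ Y (j0 J) (j0 J) (Cb ^+ 2 * N1 R I4 ^+ 2) 0) => //.
  - by apply: mulr_ge0; exact: sqr_ge0.
  move=> x; rewrite mul0r addr0 {1}/sq.
  apply: (@le_trans _ _ (\sum_(i : I4) N1 R I4 * (Cb ^+ 2 * sq (j0 J) x))).
    apply: ler_sum => i _; apply: (le_trans (sum_sq_le _)); rewrite ler_pM2l// /sq mulr_sumr.
    apply: ler_sum => k _; rewrite exprMn ler_wpM2r ?sqr_ge0//.
    by rewrite -real_normK ?num_real// lerXn2r// nnegrE.
  rewrite sumr_const -mulr_natl; set Z := N1 R I4 * (Cb ^+ 2 * _).
  rewrite [leRHS](_ : _ = N1 R I4 * Z); last by rewrite /Z; ring.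
  apply: ler_wpM2r; first by rewrite /Z; apply: mulr_ge0; [exact: ltW|apply: mulr_ge0; [exact: sqr_ge0|exact: sq_ge0]].
  by rewrite /N1 ler_nat.
have fo : (q setT (op d c B J) < +oo)%E.
  apply: (@q_fin2 _ _ _ X Y 2 2) => //; first exact: mf_fadd.
  move=> x; exact: sq_fadd.
have [r e p] := real_of_fin (q_ge0 _ _) fo.
by exists r0, r1, r.
Qed.

Lemma q_comb F G H (a b g rF rG rH : R) : mfF F -> mfF G -> mfF H -> 0 <= a -> 0 <= b -> 0 <= g ->
  q setT F = rF%:E -> q setT G = rG%:E -> q setT H = rH%:E ->
  [/\ mf (fun x => a * sq F x + b * sq G x + g * sq H x),
    forall x, 0 <= a * sq F x + b * sq G x + g * sq H x &
    qi setT (fun x => a * sq F x + b * sq G x + g * sq H x) = (a * rF + b * rG + g * rH)%:E].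
Proof.
move=> mF mG mH a0 b0 g0 eF eG eH.
have mZ : forall (s : R) (X : fld), mfF X -> mf (fun x => s * sq X x).
  by move=> s X mX; apply: mfM; [exact: mf_cst|exact: mf_sq].
have pZ : forall (s : R) (X : fld), 0 <= s -> forall x, 0 <= s * sq X x.
  by move=> s X s0 x; apply: mulr_ge0 => //; exact: sq_ge0.
split.
- by apply: mfD; [apply: mfD; exact: mZ|exact: mZ].
- by move=> x; apply: addr_ge0; [apply: addr_ge0; exact: pZ|exact: pZ].
rewrite qiD//; [|by apply: mfD; exact: mZ|exact: mZ|by move=> x; apply: addr_ge0; exact: pZ|exact: pZ].
rewrite qiD//; [|exact: mZ|exact: mZ|exact: pZ|exact: pZ].
rewrite !qiZ//; [|exact: mf_sq|exact: sq_ge0|exact: mf_sq|exact: sq_ge0|exact: mf_sq|exact: sq_ge0].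
by rewrite -!/(q _ _) eF eG eH !EFinD !EFinM.
Qed.

Lemma flux_comb F G H (e E : R -> R) (D a0 a1 b0 b1 b2 r0 r1 r : R) :
  mfF F -> mfF G -> mfF H -> prim E e ->
  0 <= D -> 0 <= a0 -> 0 <= a1 -> 0 <= b0 -> 0 <= b1 -> 0 <= b2 ->
  q setT F = r0%:E -> q setT G = r1%:E -> q setT H = r%:E ->
  (forall x, `|E x| <= D * (sq F x + sq G x)) ->
  (forall x, a0 * sq F x + a1 * sq G x <= e x + (b0 * sq F x + b1 * sq G x + b2 * sq H x)) ->
  a0 * r0 + a1 * r1 <= b0 * r0 + b1 * r1 + b2 * r.
Proof.
move=> mF mG mH pE D0 a00 a10 b00 b10 b20 e0 e1 e2 hE hA.
have [q1 q2 q3] := q_comb mF mG mH D0 D0 (lexx 0) e0 e1 e2.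
have [s1 s2 s3] := q_comb mF mG mH a00 a10 (lexx 0) e0 e1 e2.
have [t1 t2 t3] := q_comb mF mG mH b00 b10 b20 e0 e1 e2.
have fQ : (qi setT (fun x => D * sq F x + D * sq G x + 0 * sq H x)%R < +oo)%E by rewrite q3 ltry.
have := flux pE q1 q2 fQ _ s1 s2 t1 t2; rewrite s3 t3 lee_fin mul0r addr0; apply.
- by move=> x; apply: (le_trans (hE x)); rewrite mul0r addr0 mulrDr.
- by apply: aeW => x; rewrite mul0r addr0; exact: hA.
Qed.

Lemma bilin_le (b y z : I4 -> R) (w : I4 -> I4 -> R) (Cb : R) : (forall i k, `|w i k| <= Cb) ->
  `|\sum_i \sum_k w i k * y k * z i| <= 4 * Cb * (\sum_i y i ^+ 2 + \sum_i z i ^+ 2).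
Proof.
move=> hw; apply: (@le_trans _ _ (\sum_i \sum_k Cb * (y k ^+ 2 + z i ^+ 2))).
  apply: (le_trans (ler_norm_sum _ _ _)); apply: ler_sum => i _.
  apply: (le_trans (ler_norm_sum _ _ _)); apply: ler_sum => k _.
  rewrite -mulrA normrM; apply: ler_pM => //.
  by apply: (le_trans (abs_mul_le _ _)); have := sqr_ge0 (y k); have := sqr_ge0 (z i); lra.
rewrite !sum4; lra.
Qed.

Lemma prim_sum4 (f g : I4 -> R -> R) : (forall i, prim (f i) (g i)) ->
  prim (fun x => \sum_i f i x) (fun x => \sum_i g i x).
Proof.
move=> H; have -> : (fun x => \sum_i f i x) = (fun x => (f (false, false) x + f (false, true) x) + (f (true, false) x + f (true, true) x)).
  by apply/funext => x; rewrite sum4.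
have -> : (fun x => \sum_i g i x) = (fun x => (g (false, false) x + g (false, true) x) + (g (true, false) x + g (true, true) x)).
  by apply/funext => x; rewrite sum4.
by apply: primD; apply: primD.
Qed.

Lemma prim_pair J i k : jetok J ->
  prim (fun x => d i * (j0 J k x * j1 J i x)) (fun x => d i * (j1 J k x * j1 J i x + j0 J k x * j2 J i x)).
Proof.
move=> ok; apply: primZ; have [h1 h2] := ok i; have [g1 g2] := ok k.
by apply: prim_mul => //; have [] := D2_cont (ok k).
Qed.

(** The equation is tested with J itself. Diffusion yields the square of the first derivative, half
    of which absorbs the drift term by Young's inequality; the flux is d J J'. *)
Lemma energy B (beta gam Cb : R) J : cont2 B -> (forall i k x, `|B i k x| <= Cb) ->
  0 <= beta -> 0 <= gam ->
  (forall x (y : I4 -> R), \sum_i \sum_k B i k x * y k * y i <= (beta - gam) * \sum_i y i ^+ 2) ->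
  L2jet J -> forall r0 r1 r, q setT (j0 J) = r0%:E -> q setT (j1 J) = r1%:E ->
    q setT (op d c B J) = r%:E ->
  gam * r0 + d0 / 2 * r1 <= (1 + Cc ^+ 2 / d0 + beta) * r0 + r.
Proof.
move=> cB hB be0 ga0 hBB LJ r0 r1 r e0 e1 e2; have [ok _ _ _] := LJ; have [m0 m1 m2] := jet_mf ok.
have mo : mfF (op d c B J) by apply: mf_op.
have Cd : 0 <= Cc ^+ 2 / d0 by rewrite divr_ge0 ?sqr_ge0// ltW.
have P := prim_sum4 (fun i => prim_pair i i ok).
have := @flux_comb _ _ _ _ _ Dm gam (d0 / 2) (1 + Cc ^+ 2 / d0 + beta) 0 1 r0 r1 r m0 m1 mo P.
rewrite mul0r addr0 mul1r; apply => //; try exact: ltW.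
- by rewrite divr_ge0// ltW.
- by apply: addr_ge0 => //; apply: addr_ge0.
- move=> x; have -> : sq (j0 J) x + sq (j1 J) x = \sum_i (j0 J i x ^+ 2 + j1 J i x ^+ 2) by rewrite big_split.
  apply: (le_trans (ler_norm_sum _ _ _)); rewrite mulr_sumr.
  apply: ler_sum => i _; rewrite normrM gtr0_norm//; apply: ler_pM => //; first exact: ltW.
  by apply: (le_trans (abs_mul_le _ _)); have := sqr_ge0 (j0 J i x); have := sqr_ge0 (j1 J i x); lra.
move=> x; rewrite mul0r addr0 mul1r.
have hs : \sum_i op d c B J i x * j0 J i x = \sum_i d i * j2 J i x * j0 J i x +
   \sum_i c i x * j1 J i x * j0 J i x + \sum_i \sum_k B i k x * j0 J k x * j0 J i x.
  rewrite -!big_split/=; apply: eq_bigr => i _; rewrite /op !mulrDl mulr_suml; by [].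
have he : \sum_i d i * (j1 J i x * j1 J i x + j0 J i x * j2 J i x) =
  \sum_i d i * j1 J i x ^+ 2 + \sum_i d i * j2 J i x * j0 J i x.
  by rewrite -big_split/=; apply: eq_bigr => i _; ring.
have h1 := hBB x (fun i => j0 J i x).
have h2 : d0 * sq (j1 J) x <= \sum_i d i * j1 J i x ^+ 2.
  by rewrite /sq mulr_sumr; apply: ler_sum => i _; apply: ler_wpM2r => //; exact: sqr_ge0.
have h3 : \sum_i c i x * j1 J i x * j0 J i x <= d0 / 2 * sq (j1 J) x + Cc ^+ 2 / d0 * sq (j0 J) x.
  rewrite /sq !mulr_sumr -big_split/=; apply: ler_sum => i _.
  set y := j1 J i x; set z := j0 J i x.
  have a1 : c i x * y * z <= Cc * (`|y| * `|z|).
    by apply: (le_trans (ler_norm _)); rewrite !normrM -mulrA; apply: ler_pM => //; exact: mulr_ge0.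
  apply: (le_trans a1); rewrite -(real_normK (num_real y)) -(real_normK (num_real z)).
  have := sqr_ge0 (d0 / 2 * `|y| - Cc * `|z|); set Y := `|y|; set Z := `|z| => s.
  have e : d0 / 2 * Y ^+ 2 + Cc ^+ 2 / d0 * Z ^+ 2 - Cc * (Y * Z) =
    ((d0 / 2 * Y - Cc * Z) ^+ 2 + (d0 / 2 * Y) ^+ 2) / d0 by field; rewrite gt_eqF.
  by rewrite -subr_ge0 e divr_ge0 ?(ltW d00)// addr_ge0// sqr_ge0.
have h4 : - (\sum_i op d c B J i x * j0 J i x) <= sq (op d c B J) x + sq (j0 J) x.
  rewrite /sq -sumrN -big_split/=; apply: ler_sum => i _.
  by have := abs_mul_le (op d c B J i x) (j0 J i x); rewrite ler_norml => /andP[+ _]; have := sqr_ge0 (op d c B J i x); have := sqr_ge0 (j0 J i x); lra.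
rewrite -/(sq (j0 J) x) in h1; rewrite he; move: hs h1 h2 h3 h4; set S := \sum_i op d c B J i x * _ => -> .
set S1 := \sum_i d i * j2 J i x * _; set S2 := \sum_i c i x * _ * _; set S3 := \sum_i \sum_k _.
rewrite mulrBl; set s0 := sq (j0 J) x; set s1 := sq (j1 J) x.
move: (Cc ^+ 2 / d0) => cd; lra.
Qed.

(** The equation is tested with iJ. The diffusion part is then an exact derivative, and
    multiplication by a + ib leaves b times the squared norm: this is what controls large imaginary
    parts. *)
Lemma skew B (Cb a b : R) J : cont2 B -> (forall i k x, `|B i k x| <= Cb) -> 0 <= Cb -> L2jet J ->
  forall r0 r1 r, q setT (j0 J) = r0%:E -> q setT (j1 J) = r1%:E ->
    q setT (op d c (Bl B a b) J) = r%:E ->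
  `|b| * r0 <= (1 + Cc + 8 * Cb) * r0 + Cc * r1 + r.
Proof.
move=> cB hB Cb0 LJ r0 r1 r e0 e1 e2; have [ok _ _ _] := LJ; have [m0 m1 m2] := jet_mf ok.
have mo : mfF (op d c (Bl B a b) J) by apply: mf_op => //; exact: cont_Bl.
pose rho : I4 -> I4 := fun i => (i.1, ~~ i.2).
pose sg : I4 -> R := fun i => if i.2 then -1 else 1.
(* The sign turns b into its absolute value. *)
pose s : R := if 0 <= b then -1 else 1.
have s2 : s = 1 \/ s = -1 by rewrite /s; case: ifP; auto.
have P := primZ s (prim_sum4 (fun i => primZ (sg i) (prim_pair i (rho i) ok))).
have sb : - s * b = `|b| by rewrite /s; case: ifP => h; [rewrite opprK mul1r ger0_norm|rewrite mulN1r ltr0_norm// ltNge h].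
have := @flux_comb _ _ _ _ _ Dm `|b| 0 (1 + Cc + 8 * Cb) Cc 1 r0 r1 r m0 m1 mo P.
rewrite mul0r addr0 mul1r; apply => //; try exact: ltW.
- by apply: addr_ge0; [apply: addr_ge0|apply: mulr_ge0].
- move=> x; have -> : `|s * \sum_i sg i * (d i * (j0 J (rho i) x * j1 J i x))| = `|\sum_i sg i * (d i * (j0 J (rho i) x * j1 J i x))|.
    by case: s2 => ->; rewrite ?mul1r ?mulN1r ?normrN.
  apply: (@le_trans _ _ (\sum_i Dm / 2 * (j0 J (rho i) x ^+ 2 + j1 J i x ^+ 2))).
    apply: (le_trans (ler_norm_sum _ _ _)); apply: ler_sum => i _; rewrite normrM.
    have -> : `|sg i| = 1 by rewrite /sg; case: ifP; rewrite ?normrN normr1.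
    rewrite mul1r normrM gtr0_norm// -mulrA; apply: ler_pM => //; first exact: ltW.
    by apply: (le_trans (abs_mul_le _ _)); lra.
  rewrite /sq !sum4 /rho /=.
  have h y : 0 <= Dm * y ^+ 2 by apply: mulr_ge0; [exact: ltW|exact: sqr_ge0].
  have := h (j0 J (false, false) x); have := h (j0 J (false, true) x); have := h (j0 J (true, false) x); have := h (j0 J (true, true) x).
  have := h (j1 J (false, false) x); have := h (j1 J (false, true) x); have := h (j1 J (true, false) x); have := h (j1 J (true, true) x).
  lra.
move=> x; rewrite mul0r addr0 mul1r.
pose T := \sum_i sg i * (op d c (Bl B a b) J i x * j0 J (rho i) x).
pose T1 := \sum_i c i x * (sg i * j1 J i x * j0 J (rho i) x).
pose T2 := \sum_i (\sum_k B i k x * j0 J k x) * (sg i * j0 J (rho i) x).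
(* The products of first derivatives cancel in pairs, since [sg] is odd under [rho] and the real and
   imaginary parts diffuse at the same rate. *)
have E1 : \sum_i sg i * (d i * (j1 J (rho i) x * j1 J i x + j0 J (rho i) x * j2 J i x)) =
   \sum_i sg i * (d i * (j0 J (rho i) x * j2 J i x)).
  rewrite !sum4 /rho /sg /= !dC; ring.
have E2 : T = \sum_i sg i * (d i * (j0 J (rho i) x * j2 J i x)) + T1 + T2 + b * sq (j0 J) x.
  rewrite /T; under eq_bigr do rewrite op_Bl.
  rewrite /T1 /T2 /op /sq !sum4 /sg /rho /=; have [-> ->] := cmulE a b (j0 J) false x; have [-> ->] := cmulE a b (j0 J) true x.
  ring.
have hT : `|T| <= sq (op d c (Bl B a b) J) x + sq (j0 J) x.
  rewrite [X in _ + X](_ : _ = \sum_i j0 J (rho i) x ^+ 2); last by rewrite /sq !sum4 /rho/=; ring.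
  rewrite /sq -big_split/=; apply: (le_trans (ler_norm_sum _ _ _)); apply: ler_sum => i _; rewrite normrM.
  have -> : `|sg i| = 1 by rewrite /sg; case: ifP; rewrite ?normrN normr1.
  rewrite mul1r; set y := op _ _ _ _ _ _; set z := j0 _ _ _.
  by apply: (le_trans (abs_mul_le _ _)); have := sqr_ge0 y; have := sqr_ge0 z; lra.
have hT1 : `|T1| <= Cc * (sq (j1 J) x + sq (j0 J) x).
  rewrite [X in _ * (_ + X)](_ : _ = \sum_i j0 J (rho i) x ^+ 2); last by rewrite /sq !sum4 /rho/=; ring.
  rewrite /sq -big_split/= mulr_sumr; apply: (le_trans (ler_norm_sum _ _ _)); apply: ler_sum => i _; rewrite normrM.
  apply: ler_pM => //; rewrite -mulrA normrM.
  have -> : `|sg i| = 1 by rewrite /sg; case: ifP; rewrite ?normrN normr1.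
  rewrite mul1r; set y := j1 _ _ _; set z := j0 _ _ _.
  by apply: (le_trans (abs_mul_le _ _)); have := sqr_ge0 y; have := sqr_ge0 z; lra.
have hT2 : `|T2| <= 8 * Cb * sq (j0 J) x.
  have := @bilin_le (fun=> 0) (fun k => j0 J k x) (fun i => sg i * j0 J (rho i) x) (fun i k => B i k x) Cb (fun i k => hB i k x).
  have -> : T2 = \sum_i \sum_k B i k x * j0 J k x * (sg i * j0 J (rho i) x).
    by apply: eq_bigr => i _; rewrite mulr_suml.
  rewrite -/(sq _ _) [X in _ + X](_ : _ = sq (j0 J) x); first by lra.
  by rewrite /sq !sum4 /sg /rho /=; ring.
rewrite E1; move: E2 hT hT1 hT2; rewrite -sb; set S := \sum_i sg i * (d i * _) => E2.
rewrite -[- s * b * _]mulrA (_ : b * sq (j0 J) x = T - S - T1 - T2); last by rewrite E2; ring.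
by case: s2 => ->; rewrite !ler_norml => /andP[? ?] /andP[? ?] /andP[? ?]; lra.
Qed.

Definition Est (Op : jet -> fld) (K : R) : Prop := forall J, L2jet J ->
  (q setT (j0 J) + q setT (j1 J) <= K%:E * q setT (Op J))%E.

Lemma Est_le Op K K' : K <= K' -> Est Op K -> Est Op K'.
Proof.
move=> KK H J LJ; apply: (le_trans (H J LJ)); apply: lee_wpmul2r; [exact: q_ge0|by rewrite lee_fin].
Qed.

Section Coefficient.
Variables (B : I4 -> I4 -> R -> R) (Cb : R).
Hypotheses (cB : cont2 B) (hB : forall i k x, `|B i k x| <= Cb).

Let Cb0 : 0 <= Cb. Proof. by have := hB (true, true) (true, true) 0; apply: le_trans. Qed.
Let L a b := op d c (Bl B a b).

Lemma Bl_real a b J : L2jet J ->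
  exists r0 r1 r, [/\ q setT (j0 J) = r0%:E, q setT (j1 J) = r1%:E,
    q setT (L a b J) = r%:E & [/\ 0 <= r0, 0 <= r1 & 0 <= r]].
Proof.
apply: (@op_real _ (Cb + (`|a| + `|b|))); first exact: cont_Bl.
by move=> i k x; apply: (le_trans (ler_normB _ _)); apply: lerD; [exact: hB|exact: Ml_le].
Qed.

Lemma Bl_quad a b x (y : I4 -> R) :
  \sum_i \sum_k Bl B a b i k x * y k * y i <= (8 * Cb - a) * \sum_i y i ^+ 2.
Proof.
have E : \sum_i \sum_k Bl B a b i k x * y k * y i =
    \sum_i \sum_k B i k x * y k * y i - a * \sum_i y i ^+ 2.
  rewrite !sum4 /Bl /Ml /=; ring.
rewrite E mulrBl lerD2r; apply: (le_trans (ler_norm _)).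
apply: (le_trans (@bilin_le (fun=> 0) y y (fun i k => B i k x) Cb (fun i k => hB i k x))).
lra.
Qed.

Lemma Bl_energy (a b beta gam : R) J : 0 <= beta -> 0 <= gam -> 8 * Cb - a <= beta - gam -> L2jet J ->
  forall r0 r1 r, q setT (j0 J) = r0%:E -> q setT (j1 J) = r1%:E -> q setT (L a b J) = r%:E ->
  gam * r0 + d0 / 2 * r1 <= (1 + Cc ^+ 2 / d0 + beta) * r0 + r.
Proof.
move=> be0 ga0 le LJ; apply: (@energy _ _ _ (Cb + (`|a| + `|b|))) => //; first exact: cont_Bl.
  by move=> i k x; apply: (le_trans (ler_normB _ _)); apply: lerD; [exact: hB|exact: Ml_le].
move=> x y; apply: (le_trans (Bl_quad _ _ _ _)); apply: ler_wpM2r => //.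
by apply: sumr_ge0 => i _; exact: sqr_ge0.
Qed.

(** The energy inequality bounds the first derivative by the field and the datum, so a bound on the
    field alone is enough. *)
Lemma Est_j0 (a b rho K : R) : 0 <= K -> 0 <= rho -> - rho <= a ->
  (forall J, L2jet J -> (q setT (j0 J) <= K%:E * q setT (L a b J))%E) ->
  Est (L a b) (K + 2 / d0 * ((1 + Cc ^+ 2 / d0 + (8 * Cb + rho)) * K + 1)).
Proof.
move=> K0 rho0 ha H J LJ; have [r0 [r1 [r [e0 e1 e2 [p0 p1 p2]]]]] := Bl_real a b LJ.
have := H J LJ; rewrite e0 e2 e1 -!EFinM -EFinD !lee_fin => h0.
have c0 : 0 <= 8 * Cb + rho by have := Cb0; lra.
have := Bl_energy c0 (lexx 0) (_ : 8 * Cb - a <= _) LJ e0 e1 e2; rewrite mul0r add0r => E.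
have {}E : d0 / 2 * r1 <= (1 + Cc ^+ 2 / d0 + (8 * Cb + rho)) * r0 + r by apply: E; lra.
have cd : 0 <= Cc ^+ 2 / d0 by rewrite divr_ge0 ?sqr_ge0// ltW.
have E2 : (1 + Cc ^+ 2 / d0 + (8 * Cb + rho)) * r0 <= (1 + Cc ^+ 2 / d0 + (8 * Cb + rho)) * (K * r).
  by apply: ler_wpM2l => //; lra.
have E3 : r1 <= 2 / d0 * ((1 + Cc ^+ 2 / d0 + (8 * Cb + rho)) * (K * r) + r).
  have -> : r1 = 2 / d0 * (d0 / 2 * r1) by field; rewrite gt_eqF.
  apply: ler_wpM2l; first by rewrite divr_ge0// ltW.
  by apply: (le_trans E); rewrite lerD2r.
by rewrite (_ : (K + _) * r = K * r + 2 / d0 * ((1 + Cc ^+ 2 / d0 + (8 * Cb + rho)) * (K * r) + r)); [exact: lerD|ring].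
Qed.

(** A large real part acts as damping in the energy inequality. For a large imaginary part, [skew]
    is combined with the energy bound on the first derivative. *)
Lemma large_parameter (rho : R) : 0 <= rho -> exists X : R, forall a b, - rho <= a -> X <= a \/ X <= `|b| ->
  forall J, L2jet J -> (q setT (j0 J) <= 1%:E * q setT (L a b J))%E.
Proof.
move=> rho0; have cd : 0 <= Cc ^+ 2 / d0 by rewrite divr_ge0 ?sqr_ge0// ltW.
have d2 : 0 <= 2 / d0 by rewrite divr_ge0// ltW.
have CB0 := Cb0; have CC0 := Cc0.
pose be := 1 + Cc ^+ 2 / d0 + (8 * Cb + rho).
(* Eliminating the first derivative from [skew] gives |b| r0 <= G1 r0 + G2 r; from |b| >= G1 + G2 on
   this yields r0 <= r. *)
pose G2 := 1 + Cc * (2 / d0); pose G1 := 1 + Cc + 8 * Cb + Cc * (2 / d0 * be).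
have be0 : 0 <= be by rewrite /be; lra.
have w0 : 0 <= Cc * (2 / d0) by exact: mulr_ge0.
have w1 : 0 <= Cc * (2 / d0 * be) by apply: mulr_ge0 => //; exact: mulr_ge0.
exists (2 + Cc ^+ 2 / d0 + 8 * Cb + G1 + G2) => a b ha hab J LJ.
have [r0 [r1 [r [e0 e1 e2 [p0 p1 p2]]]]] := Bl_real a b LJ.
rewrite e0 e2 mul1e lee_fin; case: hab => [xa|xb].
  have a0 : 0 <= a by move: xa; rewrite /G1 /G2; lra.
  have c0 : 0 <= 8 * Cb by lra.
  have := Bl_energy c0 a0 (_ : 8 * Cb - a <= _) LJ e0 e1 e2 => /(_ (lexx _)) E.
  have d1 : 0 <= d0 / 2 * r1 by apply: mulr_ge0 => //; rewrite divr_ge0// ltW.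
  have : (2 + Cc ^+ 2 / d0 + 8 * Cb) * r0 <= a * r0 by apply: ler_wpM2r => //; move: xa; rewrite /G1 /G2; lra.
  lra.
have c0 : 0 <= 8 * Cb + rho by lra.
have := Bl_energy c0 (lexx 0) (_ : 8 * Cb - a <= _) LJ e0 e1 e2; rewrite mul0r add0r => E.
have {}E : d0 / 2 * r1 <= be * r0 + r by apply: E; lra.
have E3 : r1 <= 2 / d0 * (be * r0 + r).
  have -> : r1 = 2 / d0 * (d0 / 2 * r1) by field; rewrite gt_eqF.
  exact: ler_wpM2l.
have S := skew cB hB Cb0 LJ e0 e1 e2.
have S2 : Cc * r1 <= Cc * (2 / d0 * (be * r0 + r)) by exact: ler_wpM2l.
have S3 : (G1 + G2) * r0 <= `|b| * r0 by apply: ler_wpM2r => //; lra.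
have S4 : G2 * r0 <= G2 * r.
  have -> : G2 * r = Cc * (2 / d0 * (be * r0 + r)) + r - Cc * (2 / d0 * be) * r0 by rewrite /G2; ring.
  have -> : G2 * r0 = (G1 + G2) * r0 - (1 + Cc + 8 * Cb) * r0 - Cc * (2 / d0 * be) * r0 by rewrite /G1; ring.
  lra.
by rewrite -(ler_pM2l (_ : 0 < G2))// /G2; lra.
Qed.

(** The change of parameter contributes at most half of [r0], which is absorbed; this doubles the
    constant a second time. *)
Lemma Est_near (a b a' b' K : R) : 0 <= K -> 4 * K * ((a - a') ^+ 2 + (b - b') ^+ 2) <= 1 ->
  Est (L a b) K -> Est (L a' b') (4 * K).
Proof.
move=> K0 hK H J LJ; have [r0 [r1 [r [e0 e1 e2 [p0 p1 p2]]]]] := Bl_real a b LJ.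
have [s0 [s1 [s [e0' e1' e2' [_ _ p2']]]]] := Bl_real a' b' LJ.
have [ok _ _ _] := LJ; have [m0 m1 _] := jet_mf ok.
have ee : s0 = r0 by apply: EFin_inj; rewrite -e0 -e0'.
have := H J LJ; rewrite e0 e1 e2 e2' -!EFinM -EFinD !lee_fin => h.
have h2 : r <= 2 * s + 2 * (((a - a') ^+ 2 + (b - b') ^+ 2) * r0).
  rewrite -lee_fin EFinD !EFinM -e2 -e2' -e0 -q_cmul//.
  rewrite (@q_eq _ _ _ _ (fsub (L a' b' J) (cmul (a - a') (b - b') (j0 J)))) => [|x _ i]; last exact: op_Bl_diff.
  apply: q_fsub => //; last exact: mf_cmul.
  by apply: mf_op => //; exact: cont_Bl.
move: hK h2; set t := (a - a') ^+ 2 + _ => hK h2.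
have h3 : 2 * (K * (t * r0)) <= 2^-1 * r0.
  rewrite (_ : 2 * (K * (t * r0)) = (4 * K * t) * (2^-1 * r0)); last by field.
  by rewrite -[leRHS]mul1r; apply: ler_wpM2r => //; rewrite mulr_ge0.
have h4 : K * r <= K * (2 * s + 2 * (t * r0)) by exact: ler_wpM2l.
have -> : 4 * K * s = 2 * (K * (2 * s)) by ring.
move: h4; rewrite mulrDr (_ : K * (2 * (t * r0)) = 2 * (K * (t * r0))); [lra|ring].
Qed.

(** Bounds are locally uniform by [Est_near], and a compact set has the near-covering property. *)
Lemma compact_est (Q : set (R * R)) : compact Q ->
  (forall p, Q p -> exists2 K, 0 <= K & Est (L p.1 p.2) K) ->
  exists2 K, 0 <= K & forall p, Q p -> Est (L p.1 p.2) K.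
Proof.
move=> cQ H.
have NC := (compact_near_coveringP Q).1 cQ R (pinfty_nbhs R) (fun K (p : R * R) => Est (L p.1 p.2) K).
have {NC} : \forall K \near +oo, Q `<=` (fun p => Est (L p.1 p.2) K).
  apply: NC => -[a b] Qab.
  (* With e <= 1 the two squared displacements add up to at most 2e, and 8Ke <= 1 is the smallness
     required by [Est_near]. *)
  have [K K0 HK] := H _ Qab; pose e : R := (1 + 8 * K)^-1.
  have k8 : 0 < 1 + 8 * K by lra.
  have e0 : 0 < e by rewrite invr_gt0.
  have e1 : e <= 1 by rewrite invf_le1//; lra.
  have eK : 8 * K * e <= 1 by rewrite ler_pdivrMr//; lra.
  exists (ball (a, b) e, [set K' | 4 * K <= K']) => /=.
    by split; [exact: nbhsx_ballx|apply: nbhs_pinfty_ge; exact: num_real].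
  move=> [[a' b'] K'] [/= [ha hb] hK']; apply: (Est_le hK'); apply: (Est_near K0 _ HK).
  have sq1 (y : R) : `|y| < e -> y ^+ 2 <= e.
    move=> ye; rewrite -real_normK ?num_real// expr2; have := normr_ge0 y; nra.
  have h1 : (a - a') ^+ 2 <= e := sq1 _ ha.
  have h2 : (b - b') ^+ 2 <= e := sq1 _ hb.
  have K4 : 0 <= 4 * K by lra.
  apply: (le_trans _ eK); rewrite (_ : 8 * K * e = 4 * K * (e + e)); last by ring.
  by apply: (ler_wpM2l K4); exact: lerD.
move=> [M [_ HM]]; exists (Num.max (M + 1) 0); first by rewrite le_max lexx orbT.
by move=> p Qp; apply: (HM (Num.max (M + 1) 0) _ p) => //; rewrite lt_max; apply/orP; left; lra.
Qed.

(** A compact rectangle is treated by compactness, and the rest of the half-plane by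
    [large_parameter]. *)
Theorem uniform_est (rho : R) : 0 <= rho ->
  (forall a b, - rho <= a -> exists2 K, 0 <= K & Est (L a b) K) ->
  exists2 K, 0 <= K & forall a b, - rho <= a -> Est (L a b) K.
Proof.
move=> rho0 H; have [X HX] := large_parameter rho0.
pose Q : set (R * R) := `[- rho, X] `*` `[- X, X].
have cQ : compact Q by apply: compact_setX; exact: segment_compact.
have [K1 K10 HM] : exists2 K, 0 <= K & forall p, Q p -> Est (L p.1 p.2) K.
  by apply: (compact_est cQ) => -[a b] [/=]; rewrite !in_itv/= => /andP[a1 _] _; exact: H.
pose K2 := 1 + 2 / d0 * ((1 + Cc ^+ 2 / d0 + (8 * Cb + rho)) * 1 + 1).
exists (Num.max K1 K2); first by rewrite le_max K10.
move=> a b ha; have [small|big] := pselect (Q (a, b)).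
  apply: (@Est_le _ K1); first by rewrite le_max lexx.
  exact: (HM (a, b)).
apply: (@Est_le _ K2); first by rewrite le_max lexx orbT.
apply: Est_j0 => //; apply: HX => //; apply: contrapT => /not_orP[/negP + /negP +].
rewrite -!ltNge => h1 h2; apply: big; split; rewrite /= in_itv/=; first by rewrite ha ltW.
by rewrite -ler_norml ltW.
Qed.

End Coefficient.
End Estimates.
End Spectral.

(** * From complex resolvents to the real four-component system *)

Section Bridge.
Variables (R : realType).
Local Notation mu := (@lebesgue_measure R).
Local Notation fld := (I4 -> R -> R).
Local Notation jet := (jet R I4).
Local Notation field := (R -> R[i] * R[i]).
Implicit Types (F G : fld) (J : jet) (phi psi : field).

Definition rl phi : fld := fun i x =>
  let z := if i.1 then (phi x).2 else (phi x).1 in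
  if i.2 then complex.Im z else complex.Re z.

Definition cx F : field := fun x =>
  (complex.Complex (F (false, false) x) (F (false, true) x),
   complex.Complex (F (true, false) x) (F (true, true) x)).

Lemma cxK F : rl (cx F) = F.
Proof. by apply/funext => -[[] []]; apply/funext. Qed.

Lemma rlK phi : cx (rl phi) = phi.
Proof. by apply/funext => x; rewrite /cx /rl /=; case: (phi x) => [[? ?] [? ?]]. Qed.

Lemma all4cP P phi : all4c P phi <-> forall i, P (rl phi i).
Proof.
split; first by move=> [a b c d] [[] []].
by move=> H; split; [exact: (H (false, false))|exact: (H (false, true))|exact: (H (true, false))|exact: (H (true, true))].
Qed.

Lemma q_comp D F i : measurable D -> mfF F -> (qi D (fun x => F i x ^+ 2)%R <= q D F)%E.
Proof.
move=> mD mF; apply: qi_le => //; [exact: mfX|exact: mf_sq|by move=> x; exact: sqr_ge0|].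
by move=> x _; exact: sq_ge1.
Qed.

Lemma q_lt_oo D F : measurable D -> mfF F -> (forall i, (qi D (fun x => F i x ^+ 2)%R < +oo)%E) ->
  (q D F < +oo)%E.
Proof.
move=> mD mF H; rewrite /q /sq qi_sum//; [|by move=> i; exact: mfX|by move=> i x; exact: sqr_ge0].
elim/big_ind : _ => //; first by move=> x y; exact: lte_add_pinfty.
Qed.

Lemma L2_mf (h : R -> R) : L2 setT h -> mf h. Proof. by case. Qed.

Lemma cL2P phi : cL2 phi <-> mfF (rl phi) /\ (q setT (rl phi) < +oo)%E.
Proof.
split => [/all4cP H|[m f]].
  have m : mfF (rl phi) by move=> i; exact: L2_mf (H i).
  by split => //; apply: q_lt_oo => // i; exact: qi_L2.
apply/all4cP => i; apply: L2_qi => //; apply: le_lt_trans f; exact: q_comp.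
Qed.

Lemma cL2norm_sq phi (r : R) : q setT (rl phi) = r%:E -> cL2norm phi = Num.sqrt r.
Proof.
move=> e; rewrite /cL2norm /Rintegral; congr Num.sqrt.
rewrite -[r]/(fine r%:E) -e; congr fine; apply: eq_integral => x _.
by rewrite /sq sum4 /rl /=.
Qed.

Lemma ae_fin (P : I4 -> R -> Prop) : (forall i, {ae mu, forall x, P i x}) -> {ae mu, forall x, forall i, P i x}.
Proof.
move=> H; apply: (ae_imp (ae_and (ae_and (H (false, false)) (H (false, true))) (ae_and (H (true, false)) (H (true, true))))).
by move=> x [[? ?] [? ?]] [[] []].
Qed.

Lemma twd_mf (h : R -> R) : twice_weakly_derivable h -> [/\ mf h, mf (wD h) & mf (wD (wD h))].
Proof.
move=> [ch w1 w2]; split; first exact: mf_cont.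
  by have [_ l _] := wD_weak w1; have [] := loc_lint l.
by have [_ l _] := wD_weak w2; have [] := loc_lint l.
Qed.

(** [wD] picks an arbitrary version, whereas a jet carries a continuous first derivative; the two
    agree only almost everywhere. *)
Definition jet_of F J : Prop := j0 J = F /\ {ae mu, forall x, forall i,
  wD (F i) x = j1 J i x /\ wD (wD (F i)) x = j2 J i x}.

Lemma H2_jet F : (forall i, twice_weakly_derivable (F i)) -> exists2 J, jetok J & jet_of F J.
Proof.
move=> H; have /choice[h Hh] : forall i, exists hh : (R -> R) * (R -> R),
   [/\ D2 (F i) hh.1 hh.2, {ae mu, forall x, wD (F i) x = hh.1 x} &
     {ae mu, forall x, wD (wD (F i)) x = hh.2 x}].
  by move=> i; have [h1 [h2 [? ? ?]]] := twd_D2 (H i); exists (h1, h2).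
exists (Jet F (fun i => (h i).1) (fun i => (h i).2)).
  by move=> i; have [] := Hh i.
split => //=; apply: ae_fin => i; have [_ a b] := Hh i.
exact: (ae_and a b).
Qed.

Lemma jet_twd J : jetok J -> (forall i, twice_weakly_derivable (j0 J i)) /\ jet_of (j0 J) J.
Proof.
move=> ok; split; first by move=> i; have [] := D2_twd (ok i).
by split => //; apply: ae_fin => i; have [_ a b] := D2_twd (ok i); exact: (ae_and a b).
Qed.

Lemma jet_of_q D F J : measurable D -> (forall i, twice_weakly_derivable (F i)) -> jetok J -> jet_of F J ->
  q D (j1 J) = q D (fun i => wD (F i)) /\ q D (j2 J) = q D (fun i => wD (wD (F i))).
Proof.
move=> mD H ok [_ e]; have [m0 m1 m2] := jet_mf ok.
have w i : [/\ mf (F i), mf (wD (F i)) & mf (wD (wD (F i)))] by exact: twd_mf.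
split; apply: q_ae => //; try (by move=> i; have [] := w i).
  by apply: (ae_imp e) => x h i; have [-> _] := h i.
by apply: (ae_imp e) => x h i; have [_ ->] := h i.
Qed.

Lemma H2F_jet D F : measurable D -> (forall i, H2 D (F i)) -> exists2 J, jetok J & jet_of F J /\
  [/\ (q D (j0 J) < +oo)%E, (q D (j1 J) < +oo)%E & (q D (j2 J) < +oo)%E].
Proof.
move=> mD H; have H' i : twice_weakly_derivable (F i) by have [] := H i.
have [J ok jF] := H2_jet H'; have [e1 e2] := jet_of_q mD H' ok jF; have [e0 _] := jF.
have w i : [/\ mf (F i), mf (wD (F i)) & mf (wD (wD (F i)))] by exact: twd_mf.
exists J => //; split => //; rewrite e0 e1 e2.
by split; apply: q_lt_oo => // i; [have [] := w i|have [_ a _ _] := H i; exact: qi_L2|have [] := w i|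
  have [_ _ a _] := H i; exact: qi_L2|have [] := w i|have [_ _ _ a] := H i; exact: qi_L2].
Qed.

Lemma jet_H2F D J : measurable D -> jetok J -> (q D (j0 J) < +oo)%E -> (q D (j1 J) < +oo)%E ->
  (q D (j2 J) < +oo)%E -> forall i, H2 D (j0 J i).
Proof.
move=> mD ok f0 f1 f2 i; have [t jF] := jet_twd ok; have [e1 e2] := jet_of_q mD t ok jF.
have w k : [/\ mf (j0 J k), mf (wD (j0 J k)) & mf (wD (wD (j0 J k)))] by exact: twd_mf.
have [m0 m1 m2] := w i.
split => //; apply: L2_qi => //.
- by apply: le_lt_trans f0; apply: q_comp => // k; have [] := w k.
- rewrite e1 in f1; apply: le_lt_trans f1.
  by apply: (@q_comp D (fun k => wD (j0 J k)) i mD) => k; have [] := w k.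
- rewrite e2 in f2; apply: le_lt_trans f2.
  by apply: (@q_comp D (fun k => wD (wD (j0 J k))) i mD) => k; have [] := w k.
Qed.

Lemma cH2_jet phi : cH2 phi -> exists2 J, L2jet J & jet_of (rl phi) J.
Proof.
move=> /all4cP H; have [J ok [jF [f0 f1 f2]]] := H2F_jet measurableT H.
by exists J.
Qed.

Lemma jet_cH2 J : L2jet J -> cH2 (cx (j0 J)).
Proof. by move=> [ok f0 f1 f2]; apply/all4cP => i; rewrite cxK; exact: jet_H2F. Qed.

Variable K : klausmeier R.
Local Notation f := (kf K).
Local Notation g := (kg K).

Definition ddk (i : I4) : R := if i.1 then kd K ^+ 2 else 1.
Definition cck (eps : R) (i : I4) (x : R) : R := if i.1 then 0 else eps * f x.
(** The Jacobian of the reaction. Its entries are real, so it acts separately on real and imaginary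
    parts. *)
Definition Bk (eps : R) (u : R -> R * R) (i k : I4) (x : R) : R :=
  if i.2 == k.2 then
    match i.1, k.1 with
    | false, false => eps * g x - 1 - (u x).2 ^+ 2
    | false, true => - (2 * (u x).1 * (u x).2)
    | true, false => (u x).2 ^+ 2
    | true, true => - km K + 2 * (u x).1 * (u x).2
    end
  else 0.

Definition Lk eps u (a b : R) : jet -> fld := op ddk (cck eps) (Bl (Bk eps u) a b).

Lemma derive1_val (h : R -> R) (x a : R) : is_derive x (1 : R) h a -> derive1 h x = a.
Proof. by move=> H; rewrite derive1E derive_val. Qed.

Lemma dreactionE eps (v : R * R) x :
  [/\ dreaction11 K eps v x = eps * g x - 1 - v.2 ^+ 2,
      dreaction12 K eps v x = - (2 * v.1 * v.2),
      dreaction21 K eps v x = v.2 ^+ 2 &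
      dreaction22 K eps v x = - km K + 2 * v.1 * v.2].
Proof.
split; apply: derive1_val.
- by apply: is_derive_eq; rewrite /GRing.scale/=; ring.
- by apply: is_derive_eq; rewrite /GRing.scale/=; ring.
- by apply: is_derive_eq; rewrite /GRing.scale/=; ring.
- by apply: is_derive_eq; rewrite /GRing.scale/=; ring.
Qed.

Lemma rl_shifted eps u (lam : R[i]) phi i x :
  rl (shifted (linearization K eps u) lam phi) i x =
  ddk i * wD (wD (rl phi i)) x + cck eps i x * wD (rl phi i) x +
  \sum_k Bl (Bk eps u) (complex.Re lam) (complex.Im lam) i k x * rl phi k x.
Proof.
have [e1 e2 e3 e4] := dreactionE eps (u x) x.
case: i => [[] []]; rewrite sum4 /rl /shifted /linearization /clinear_part /= ?e1 ?e2 ?e3 ?e4 /cwD /Bl /Bk /Ml /ddk /cck /=.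
all: generalize (@wD R) => W; case: (phi x) => [[p1 p2] [p3 p4]]; case: lam => l1 l2 /=; ring.
Qed.

Lemma shifted_op eps u (lam : R[i]) phi J : jet_of (rl phi) J ->
  {ae mu, forall x, forall i, rl (shifted (linearization K eps u) lam phi) i x =
    Lk eps u (complex.Re lam) (complex.Im lam) J i x}.
Proof.
move=> [e0 e]; apply: (ae_imp e) => x h i; rewrite rl_shifted /Lk /op e0.
by have [-> ->] := h i.
Qed.

Definition cpair (u : R -> R * R) : Prop := continuous (fun x => (u x).1) /\ continuous (fun x => (u x).2).
Definition bpair (u : R -> R * R) (M : R) : Prop := forall x, `|(u x).1| <= M /\ `|(u x).2| <= M.

Lemma cont_f : continuous f. Proof.
by have [h _] := kf_C1 K => x; apply: differentiable_continuous; apply/derivable1_diffP. Qed.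
Lemma cont_g : continuous g. Proof.
by have [h _] := kg_C1 K => x; apply: differentiable_continuous; apply/derivable1_diffP. Qed.

Lemma cont_cck eps i : continuous (cck eps i).
Proof.
rewrite /cck; case: i.1 => x; first exact: cvg_cst.
by apply: cvgM; [exact: cvg_cst|exact: cont_f].
Qed.

Lemma cont_Bk eps u : cpair u -> cont2 (Bk eps u).
Proof.
move=> [c1 c2] i k; rewrite /Bk; case: (i.2 == k.2) => x; last exact: cvg_cst.
have v1 : (fun x => (u x).1) @ x --> (u x).1 by exact: c1.
have v2 : (fun x => (u x).2) @ x --> (u x).2 by exact: c2.
have v3 : (fun x => (u x).2 ^+ 2) @ x --> (u x).2 ^+ 2 by exact: cvgM.
have v4 : (fun x => 2 * (u x).1 * (u x).2) @ x --> 2 * (u x).1 * (u x).2.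
  by apply: cvgM => //; apply: cvgM => //; exact: cvg_cst.
case: i.1; case: k.1 => //.
- by apply: cvgD => //; exact: cvg_cst.
- exact: cvgN.
- apply: cvgB => //; apply: cvgB; last exact: cvg_cst.
  by apply: cvgM; [exact: cvg_cst|exact: cont_g].
Qed.

Lemma periodic_bounded (h : R -> R) (L : R) : 0 < L -> continuous h -> (forall x, h (x + L) = h x) ->
  exists2 M, 0 <= M & forall x, `|h x| <= M.
Proof.
move=> L0 ch ph; have [M M0 HM] := continuous_bound 0 L ch.
exists M => // x; pose k := Num.floor (x / L).
have pk (n : int) y : h (y + n%:~R * L) = h y.
  elim/int_rect: n y => [y|n IH y|n IH y]; first by rewrite mul0r addr0.
    by rewrite -addn1 PoszD intrD mulrDl mul1r addrA ph IH.
  rewrite -[RHS]IH -(ph (y + _)); congr (h _); rewrite !intrN -addn1 PoszD intrD; ring.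
rewrite -(pk (- k) x); apply: HM.
have : k%:~R <= x / L < (k + 1)%:~R by exact: floor_itv.
rewrite ler_pdivlMr// ltr_pdivrMr// intrD intrN => /andP[h1 h2]; apply/andP; split; lra.
Qed.

Lemma f_bound : exists2 M, 0 <= M & forall x, `|f x| <= M.
Proof. by apply: (periodic_bounded (kT_gt0 K) cont_f) => x; exact: kf_per. Qed.
Lemma g_bound : exists2 M, 0 <= M & forall x, `|g x| <= M.
Proof. by apply: (periodic_bounded (kT_gt0 K) cont_g) => x; exact: kg_per. Qed.

Lemma cck_bound eps : exists2 Cc, 0 <= Cc & forall i x, `|cck eps i x| <= Cc.
Proof.
have [M M0 HM] := f_bound; exists (`|eps| * M); first exact: mulr_ge0.
move=> i x; rewrite /cck; case: i.1; first by rewrite normr0 mulr_ge0.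
by rewrite normrM ler_wpM2l.
Qed.

(** One constant for all profiles below [M], and hence for all the periodic solutions at once. *)
Lemma Bk_bound_unif eps M : 0 <= M -> exists2 Cb, 0 <= Cb &
  forall u, bpair u M -> forall i k x, `|Bk eps u i k x| <= Cb.
Proof.
move=> M0; have [Mg Mg0 Hg] := g_bound.
have eg : 0 <= `|eps| * Mg by apply: mulr_ge0.
have M2 : 0 <= M ^+ 2 by exact: sqr_ge0.
exists (`|eps| * Mg + 1 + `|km K| + 2 * M ^+ 2).
  by have := normr_ge0 (km K); lra.
move=> u hu i k x; have [h1 h2] := hu x; have hm := normr_ge0 (km K).
have q1 : `|(u x).2 ^+ 2| <= M ^+ 2 by rewrite normrX lerXn2r// nnegrE.
have q2 : `|2 * (u x).1 * (u x).2| <= 2 * M ^+ 2.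
  by rewrite -mulrA normrM normr_nat ler_pM2l// normrM expr2; apply: ler_pM.
have q3 : `|eps * g x| <= `|eps| * Mg by rewrite normrM ler_wpM2l.
rewrite /Bk; case: (_ == _); last by rewrite normr0; lra.
case: i.1; case: k.1.
- by apply: (le_trans (ler_normD _ _)); rewrite normrN; lra.
- lra.
- by rewrite normrN; lra.
- apply: (le_trans (ler_normB _ _)); have := ler_normB (eps * g x) 1; rewrite normr1; lra.
Qed.

Lemma Bk_bound eps u M : bpair u M -> exists2 Cb, 0 <= Cb & forall i k x, `|Bk eps u i k x| <= Cb.
Proof.
move=> hu; have M0 : 0 <= M by have [h _] := hu 0; exact: le_trans h.
by have [Cb Cb0 H] := Bk_bound_unif eps M0; exists Cb => //; exact: H.
Qed.

Definition dmin : R := Num.min 1 (kd K ^+ 2).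
Definition dmax : R := Num.max 1 (kd K ^+ 2).
Lemma dmin_gt0 : 0 < dmin.
Proof. by rewrite /dmin lt_min ltr01 exprn_gt0// kd_gt0. Qed.
Lemma ddk_min i : dmin <= ddk i.
Proof. by rewrite /ddk /dmin; case: i.1; rewrite ge_min lexx ?orbT. Qed.
Lemma ddk_max i : ddk i <= dmax.
Proof. by rewrite /ddk /dmax; case: i.1; rewrite le_max lexx ?orbT. Qed.

Lemma mf_rl_shifted eps u lam phi : cpair u -> cH2 phi ->
  mfF (rl (shifted (linearization K eps u) lam phi)).
Proof.
move=> cu /all4cP H i; rewrite (funext (rl_shifted eps u lam phi i)).
have w k : [/\ mf (rl phi k), mf (wD (rl phi k)) & mf (wD (wD (rl phi k)))] by apply: twd_mf; have [] := H k.
have [m0 m1 m2] := w i.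
apply: mfD; last first.
  by apply: mf_sum => k; apply: mfM; [apply: mf_cont; apply: cont_Bl; exact: cont_Bk|have [] := w k].
by apply: mfD; apply: mfM => //; [exact: mf_cst|apply: mf_cont; exact: cont_cck].
Qed.

(** A resolvent bound controls the field only; [Est_j0] adds its derivative. Conversely, the a
    priori bound makes a null solution vanish almost everywhere, and by continuity everywhere. *)
Theorem res_INV eps u M lam : cpair u -> bpair u M ->
  resolvent_set (linearization K eps u) lam <->
  exists2 C, 0 <= C & INV (Lk eps u (complex.Re lam) (complex.Im lam)) C.
Proof.
move=> cu bu; have [Cc Cc0 hc] := cck_bound eps; have [Cb Cb0 hB] := Bk_bound eps bu.
have cB := cont_Bk (eps := eps) cu; set a := complex.Re lam; set b := complex.Im lam.
have reals J := @Bl_real _ _ _ _ _ _ dmin_gt0 ddk_min ddk_max (cont_cck (eps := eps)) hc _ _ cB hB a b J.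
split.
- move=> [su _ [C HC]].
  have est J : L2jet J -> (q setT (j0 J) <= (C ^+ 2)%:E * q setT (Lk eps u a b J))%E.
    move=> LJ; have [r0 [r1 [r [e0 e1 e2 [p0 p1 p2]]]]] := reals J LJ; rewrite -/(Lk _ _ _ _) in e2.
    have H2J := jet_cH2 LJ; have [ok _ _ _] := LJ; have [_ jof] := jet_twd ok.
    have := HC _ H2J; rewrite (cL2norm_sq (r := r0)) ?cxK// (cL2norm_sq (r := r)); last first.
      rewrite -e2; apply: q_ae => //; [exact: mf_rl_shifted|by apply: mf_op => //; [exact: cont_cck|exact: cont_Bl]|].
      by apply: shifted_op; rewrite cxK.
    rewrite e0 e2 -EFinM lee_fin => h; rewrite -(sqr_sqrtr p0) -(sqr_sqrtr p2) -exprMn.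
    have h2 : Num.sqrt r0 <= `|C * Num.sqrt r| by exact: le_trans (ler_norm _).
    by rewrite -[leRHS]real_normK ?num_real// lerXn2r// nnegrE ?sqrtr_ge0.
  have rho0 : 0 <= `|a| by [].
  have ra : - `|a| <= a by have := ler_norm (- a); rewrite normrN; lra.
  exists (C ^+ 2 + 2 / dmin * ((1 + Cc ^+ 2 / dmin + (8 * Cb + `|a|)) * C ^+ 2 + 1)).
    have d0 := ltW dmin_gt0; have C2 := sqr_ge0 C.
    apply: addr_ge0 => //; apply: mulr_ge0; first exact: divr_ge0.
    apply: addr_ge0 => //; apply: mulr_ge0 => //; apply: addr_ge0; last by lra.
    by apply: addr_ge0 => //; apply: divr_ge0 => //; exact: sqr_ge0.
  split; last by apply: (Est_j0 dmin_gt0 ddk_min ddk_max (cont_cck (eps := eps)) hc cB hB (sqr_ge0 C) rho0 ra est).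
  move=> F mF fF; have [|phi hphi ephi] := su (cx F); first by apply/cL2P; rewrite cxK.
  have [J LJ jof] := cH2_jet hphi; exists J => //.
  apply: (ae_imp (ae_and (shifted_op eps u lam jof) ephi)) => x [h1 h2] i.
  by rewrite -h1 /rl h2 -[RHS](f_equal (fun F => F i x) (cxK F)).
move=> [C C0 [su est]]; split.
- move=> psi /cL2P[m fm]; have [J LJ e] := su _ m fm; exists (cx (j0 J)); first exact: jet_cH2.
  have [ok _ _ _] := LJ; have [_ jof] := jet_twd ok.
  have {}jof : jet_of (rl (cx (j0 J))) J by rewrite cxK.
  apply: (ae_imp (ae_and (shifted_op eps u lam jof) e)) => x [h1 h2].
  have E i : rl (shifted (linearization K eps u) lam (cx (j0 J))) i x = rl psi i x by rewrite h1.
  set sh := shifted _ _ _ in E *; rewrite -(rlK sh) -(rlK psi).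
  by rewrite /cx !E.
- move=> phi hphi e0; have [J LJ jof] := cH2_jet hphi; have [ok _ _ _] := LJ.
  have [m0 m1 m2] := jet_mf ok.
  have z : q setT (Lk eps u a b J) = 0%E.
    rewrite (@q_ae _ _ _ _ (@fzero R I4)) => //.
    - by rewrite /q (@qi_eq _ _ _ (fun=> 0)) => [|x _]; [rewrite /qi integral0|exact: sq_fzero].
    - by apply: mf_op => //; [exact: cont_cck|exact: cont_Bl].
    - exact: mf_fzero.
    apply: (ae_imp (ae_and (shifted_op eps u lam jof) e0)) => x [h1 h2] i.
    by rewrite -h1 /rl h2; case: i => [[] []].
  have := est J LJ; rewrite -/(Lk _ _ _ _) z mule0 => h.
  have q0 : q setT (j0 J) = 0%E.
    apply/eqP; rewrite eq_le q_ge0 andbT; by apply: le_trans h; rewrite leeDl// q_ge0.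
  have j0z i x : rl phi i x = 0.
    have [<- _] := jof; apply: (@continuous_ae_eq _ (j0 J i) (fun=> 0)).
    - by have [] := D2_cont (ok i).
    - by move=> y; exact: cvg_cst.
    by apply: (ae_imp (q0_ae m0 q0)) => y hy; exact: hy.
  by move=> x; rewrite -(rlK phi) /cx !j0z.
- exists (Num.sqrt C) => phi hphi; have [J LJ jof] := cH2_jet hphi; have [ok _ _ _] := LJ.
  have [r0 [r1 [r [e0 e1 e2 [p0 p1 p2]]]]] := reals J LJ; rewrite -/(Lk _ _ _ _) in e2.
  have [m0 m1 m2] := jet_mf ok.
  rewrite (cL2norm_sq (r := r0)); last by have [<- _] := jof.
  rewrite (cL2norm_sq (r := r)); last first.
    rewrite -e2; apply: q_ae => //; [exact: mf_rl_shifted|by apply: mf_op => //; [exact: cont_cck|exact: cont_Bl]|].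
    exact: shifted_op.
  rewrite -sqrtrM// ler_wsqrtr//; have := est J LJ; rewrite -/(Lk _ _ _ _) e0 e1 e2 -EFinM -EFinD lee_fin; lra.
Qed.

End Bridge.

(** * Tails, periods and pointwise bounds *)

Section Tails.
Variable R : realType.
Local Notation mu := (@lebesgue_measure R).
Implicit Types (h : R -> R).

(** Some box carries all but [e] of the finite integral, and a set outside a slightly larger radius
    is disjoint from it. *)
Lemma qi_tail h (e : R) : mf h -> (forall x, 0 <= h x) -> (qi setT h < +oo)%E -> 0 < e ->
  exists X : R, forall D : set R, measurable D -> (forall x : R, D x -> X <= `|x|) -> (qi D h <= e%:E)%E.
Proof.
move=> mh h0 fh e0; have [r er r0] := real_of_fin (qi_ge0 _ h0) fh.
have [n hn] : exists n : nat, (~ (qi (box n) h <= (r - e)%:E))%E.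
  apply: contrapT => /forallNP H.
  have : (qi setT h <= (r - e)%:E)%E by apply: qi_setT_le => // n; apply: contrapT; exact: H.
  by rewrite er lee_fin; lra.
exists (n%:R + 1) => D mD hD.
have mb : measurable (box n : set R) by exact: measurable_itv.
have : (qi (D `|` box n) h <= qi setT h)%E by apply: qi_subT => //; exact: measurableU.
rewrite {1}/qi ge0_integral_setU//; last 3 first.
- by apply: measurable_funTS; exact: mf_EFin.
- by move=> x _; rewrite lee_fin.
- apply/disj_setPLR => x Dx; rewrite /box/= in_itv/= => /andP[h1 h2]; have := hD _ Dx.
  by have : `|x| <= n%:R by [rewrite ler_norml; apply/andP; split; lra]; lra.
rewrite -!/(qi _ _) er.
have f1 := qi_ge0 D h0; have f2 := qi_ge0 (box n) h0.
case: (qi D h) f1 => [x|//|//] x0; case: (qi (box n) h) f2 hn => [y|//|//] y0; last by rewrite addeC.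
by rewrite -EFinD !lee_fin => /negP; rewrite -ltNge; lra.
Qed.

Lemma shift_int h (L : R) (k : int) x : (forall y, h (y + L) = h y) -> h (x + k%:~R * L) = h x.
Proof.
move=> ph; elim/int_rect: k x => [x|k IH x|k IH x]; first by rewrite mul0r addr0.
  by rewrite -addn1 PoszD intrD mulrDl mul1r addrA ph IH.
rewrite -[RHS]IH -(ph (x + _)); congr (h _); rewrite !intrN -addn1 PoszD intrD; ring.
Qed.

Lemma qi_period_int h (L a b : R) (k : int) : mf h -> (forall x, 0 <= h x) ->
  (forall x, h (x + L) = h x) -> qi (ico (a + k%:~R * L) (b + k%:~R * L)) h = qi (ico a b) h.
Proof. by move=> mh h0 ph; apply: qi_period => // x; exact: shift_int. Qed.

(** A unit interval meets at most two consecutive periods when the period is at least one. *)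
Lemma qi_unit_le h (L x : R) : mf h -> (forall x, 0 <= h x) -> (forall x, h (x + L) = h x) ->
  1 <= L -> (qi (ico x (x + 1)) h <= 2%:E * qi (ico 0 L) h)%E.
Proof.
move=> mh h0 ph L1; pose k := Num.floor (x / L); have L0 : 0 < L by lra.
have : k%:~R <= x / L < (k + 1)%:~R by exact: floor_itv.
rewrite ler_pdivlMr// ltr_pdivrMr// intrD => /andP[h1 h2].
have E (j : int) : qi (ico (j%:~R * L) ((j%:~R + 1) * L)) h = qi (ico 0 L) h.
  by rewrite -(qi_period_int 0 L j mh h0 ph) add0r mulrDl mul1r addrC.
apply: (@le_trans _ _ (qi (ico (k%:~R * L) ((k%:~R + 1 + 1) * L)) h)).
  apply: qi_sub => //; [exact: measurable_itv|exact: measurable_itv|] => y.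
  by rewrite /ico/= !in_itv/= => /andP[a1 a2]; apply/andP; split; lra.
rewrite /ico (@qi_cat _ _ ((k%:~R + 1) * L))//; [|lra|lra].
rewrite -!/(ico _ _) E -(intrD _ k 1) E; rewrite (_ : 2%:E = 1%:E + 1%:E :> \bar R)%E; last by rewrite -EFinD.
by rewrite ge0_muleDl// !mul1e.
Qed.

Lemma qi_period0 h (L : R) : 0 < L -> mf h -> (forall x, 0 <= h x) -> (forall x, h (x + L) = h x) ->
  qi (ico 0 L) h = 0%E -> qi setT h = 0%E.
Proof.
move=> L0 mh h0 ph z; apply/eqP; rewrite eq_le qi_ge0// andbT.
have m0 : mf (fun=> 0 : R) by exact: mf_cst.
have := @cell_sum_line _ _ L0 (fun=> 0) h 0 m0 mh (fun=> lexx _) h0 (lexx 0).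
rewrite mulr0 mul0e; apply => j; rewrite mul0e.
have := qi_period_int 0 L j mh h0 ph; rewrite add0r z /cell mulrDl mul1r (addrC (j%:~R * L)) => H.
by rewrite -[qi _ _]/(qi (ico _ _) _) H.
Qed.

(** n periods carry n times the integral over one period, so a finite total forces that integral to
    be zero. *)
Lemma qi_finite_period0 h (L : R) : 0 < L -> mf h -> (forall x, 0 <= h x) ->
  {ae mu, forall x, h (x + L) = h x} -> (qi setT h < +oo)%E -> {ae mu, forall x, h x = 0}.
Proof.
move=> L0 mh h0 ph fh.
have [r er r0] := real_of_fin (qi_ge0 _ h0) fh.
have E (n : nat) : qi (ico (n%:R * L) (n%:R * L + L)) h = qi (ico 0 L) h.
  elim: n => [|n IH]; first by rewrite mul0r add0r.
  rewrite -IH /ico -natr1 mulrDl mul1r -(qi_shift_itv _ _ _ mh h0).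
  by apply: qi_eq_ae; [exact: measurable_itv|exact: mf_shift|exact: mh|by move=> x; exact: h0|exact: h0|apply: (ae_imp ph) => x ->].
have S (n : nat) : qi (ico 0 (n%:R * L)) h = (n%:R%:E * qi (ico 0 L) h)%E.
  elim: n => [|n IH]; first by rewrite !mul0r mul0e /ico /qi set_itvco0 integral_set0.
  rewrite -natr1 /ico (@qi_cat _ _ (n%:R * L))//; [|by rewrite mulr_ge0// ltW|by rewrite ler_pM2r//; lra].
  rewrite -!/(ico _ _) IH (_ : (n%:R + 1) * L = n%:R * L + L); last by ring.
  by rewrite E EFinD ge0_muleDl ?mul1e// lee_fin.
have t0 : qi (ico 0 L) h = 0%E.
  have [t et t0] : exists2 t : R, qi (ico 0 L) h = t%:E & 0 <= t.
    apply: real_of_fin; first exact: qi_ge0.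
    by apply: le_lt_trans fh; apply: qi_subT => //; exact: measurable_itv.
  rewrite et; congr (_%:E); apply/eqP; rewrite eq_le t0 andbT leNgt; apply/negP => tp.
  pose n := (Num.truncn (r / t)).+1.
  have : r / t < n%:R by exact: truncnS_gt.
  rewrite ltr_pdivrMr// => h1.
  have : (qi (ico 0 (n%:R * L)) h <= qi setT h)%E by apply: qi_subT => //; exact: measurable_itv.
  by rewrite S et er -EFinM lee_fin; lra.
have Neg (n : nat) : qi (ico (- (n%:R * L)) (- (n%:R * L) + L)) h = 0%E.
  elim: n => [|n IH]; first by rewrite mul0r oppr0 add0r.
  rewrite -[RHS]IH /ico -natr1 mulrDl mul1r.
  have -> : - (n%:R * L) = - (n%:R * L + L) + L by ring.
  rewrite -(qi_shift_itv _ _ _ mh h0).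
  by apply/esym; apply: qi_eq_ae; [exact: measurable_itv|exact: mf_shift|exact: mh|by move=> x; exact: h0|exact: h0|apply: (ae_imp ph) => x ->].
have J (j : int) : qi (cell L j) h = 0%E.
  rewrite /cell mulrDl mul1r; case: j => n; first by rewrite -[_%:~R]/(n%:R) -[qi _ _]/(qi (ico _ _) _) E.
  by rewrite NegzE intrN mulNr -[_%:~R]/(n.+1%:R) -[qi _ _]/(qi (ico _ _) _) Neg.
have z : qi setT h = 0%E.
  apply/eqP; rewrite eq_le qi_ge0// andbT.
  have := @cell_sum_line _ _ L0 (fun=> 0) h 0 (mf_cst _ ) mh (fun=> lexx _) h0 (lexx 0).
  by rewrite mulr0 mul0e; apply => j; rewrite mul0e J.
pose F : unit -> R -> R := fun _ x => Num.sqrt (h x).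
have sF x : sq F x = h x by rewrite /sq (bigD1 tt)//= big1 ?addr0 ?sqr_sqrtr// => -[].
have mF : mfF F by move=> []; apply: measurableT_comp mh; exact: (mf_cont (@sqrt_continuous R)).
have qF : q setT F = 0%E by rewrite -z; apply: qi_eq => x _; exact: sF.
apply: (ae_imp (q0_ae mF qF)) => x hx; have := hx tt; rewrite /F => s.
by rewrite -(sqr_sqrtr (h0 x)) s expr0n.
Qed.

Variable I : finType.

Lemma sup_jet (J : jet R I) i x : jetok J ->
  ((j0 J i x ^+ 2)%:E <= 2%:E * (q (ico x (x + 1)) (j0 J) + q (ico x (x + 1)) (j1 J)))%E.
Proof.
move=> ok; have [m0 m1 _] := jet_mf ok; have [c0 c1] := D2_cont (ok i).
have := sobolev x (D2_prim (ok i)) c1; rewrite -lee_fin => /le_trans; apply; rewrite [(2 * _)%:E]EFinM.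
apply: lee_wpmul2l => //; rewrite itg_qi//; last 2 first.
- by apply: lint_cont => y; apply: cvgD; apply: contX.
- by move=> y; apply: addr_ge0; exact: sqr_ge0.
have mI : measurable (`[x, (x + 1)[%classic : set R) by exact: measurable_itv.
rewrite qiD//; [|exact: mfX|exact: mfX|by move=> y; exact: sqr_ge0|by move=> y; exact: sqr_ge0].
by apply: leeD; apply: qi_le => //; try (by move=> y; exact: sqr_ge0); try exact: mfX; try exact: mf_sq; move=> y _; exact: sq_ge1.
Qed.

Lemma sup_period (J : jet R I) (L : R) i x : jetok J -> perF L (j0 J) -> perF L (j1 J) -> 1 <= L ->
  ((j0 J i x ^+ 2)%:E <= 4%:E * (q (ico 0 L) (j0 J) + q (ico 0 L) (j1 J)))%E.
Proof.
move=> ok p0 p1 L1; have [m0 m1 _] := jet_mf ok.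
apply: (le_trans (sup_jet i x ok)).
have A : (q (ico x (x + 1)) (j0 J) <= 2%:E * q (ico 0 L) (j0 J))%E.
  by apply: qi_unit_le => //; [exact: mf_sq|exact: sq_ge0|move=> y; apply: eq_bigr => k _; rewrite p0].
have B : (q (ico x (x + 1)) (j1 J) <= 2%:E * q (ico 0 L) (j1 J))%E.
  by apply: qi_unit_le => //; [exact: mf_sq|exact: sq_ge0|move=> y; apply: eq_bigr => k _; rewrite p1].
apply: (@le_trans _ _ (2%:E * (2%:E * q (ico 0 L) (j0 J) + 2%:E * q (ico 0 L) (j1 J)))%E).
  by apply: lee_wpmul2l => //; exact: leeD.
rewrite (_ : 4%:E = 2%:E * 2%:E :> \bar R)%E; last by rewrite -EFinM; congr (_%:E); ring.
by rewrite -[in leRHS]muleA [in leRHS]ge0_muleDr ?q_ge0.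
Qed.

Lemma L2jet_bound (J : jet R I) : L2jet J -> exists2 M, 0 <= M & forall i x, `|j0 J i x| <= M.
Proof.
move=> [ok f0 f1 _]; have [m0 m1 _] := jet_mf ok.
have [r0 e0 p0] := real_of_fin (q_ge0 _ _) f0; have [r1 e1 p1] := real_of_fin (q_ge0 _ _) f1.
exists (Num.sqrt (2 * (r0 + r1))); first exact: sqrtr_ge0.
move=> i x; rewrite -sqrtr_sqr ler_wsqrtr// -lee_fin.
apply: (le_trans (sup_jet i x ok)); rewrite [(2 * _)%:E]EFinM [(r0 + r1)%:E]EFinD -e0 -e1; apply: lee_wpmul2l => //.
by apply: leeD; apply: q_sub => //; exact: measurable_itv.
Qed.

(** The Sobolev bound at x uses only [x, x + 1], where the tails of the squared norms are small. *)
Lemma L2jet_decay (J : jet R I) (e : R) : L2jet J -> 0 < e ->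
  exists X, forall i x, X <= `|x| -> `|j0 J i x| <= e.
Proof.
move=> [ok f0 f1 _] e0; have [m0 m1 _] := jet_mf ok.
have e2 : 0 < e ^+ 2 / 4 by rewrite divr_gt0// exprn_gt0.
have [X0 H0] := qi_tail (mf_sq m0) (sq_ge0 _) f0 e2.
have [X1 H1] := qi_tail (mf_sq m1) (sq_ge0 _) f1 e2.
exists (`|X0| + `|X1| + 1) => i x hx.
rewrite -ler_sqr ?nnegrE// ?(ltW e0)// real_normK ?num_real// -lee_fin.
apply: (le_trans (sup_jet i x ok)).
have far y : ico x (x + 1) y -> `|X0| + `|X1| <= `|y|.
  rewrite /ico/= in_itv/= => /andP[a1 a2].
  by have : `|x| <= `|y| + 1 by [rewrite -(subrK y x) addrC; apply: (le_trans (ler_normD _ _)); rewrite lerD2l distrC ger0_norm; lra]; lra.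
have n0 := ler_norm X0; have n1 := ler_norm X1; have n2 := normr_ge0 X0; have n3 := normr_ge0 X1.
have mI : measurable (ico x (x + 1)) by exact: measurable_itv.
apply: (@le_trans _ _ (2%:E * ((e ^+ 2 / 4)%:E + (e ^+ 2 / 4)%:E))%E).
  by apply: lee_wpmul2l => //; apply: leeD; [apply: H0|apply: H1] => // y /far; lra.
by rewrite -EFinD -EFinM lee_fin; lra.
Qed.

End Tails.

(** * Stationary profiles and their periodic background *)

Section Profiles.
Variables (R : realType) (K : klausmeier R) (eps : R).
Local Notation mu := (@lebesgue_measure R).
Local Notation fld := (I4 -> R -> R).
Local Notation jet := (jet R I4).
Local Notation T := (kT K).
Implicit Types (u v z : R -> R * R) (F G : fld) (J : jet).

(** Real profiles are embedded with zero imaginary parts, so that the machinery for the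
    linearization serves the profile equation as well. *)
Definition emb u : fld := fun i x => if i.2 then 0 else if i.1 then (u x).2 else (u x).1.
Definition prj F : R -> R * R := fun x => (F (false, false) x, F (true, false) x).
Definition Nk (i : I4) (x : R) (y : R * R) : R :=
  if i.2 then 0 else if i.1 then - km K * y.2 + y.1 * y.2 ^+ 2
  else eps * kg K x * y.1 - y.1 - y.1 * y.2 ^+ 2 + ka K.

Definition lin J : fld := fun i x => ddk K i * j2 J i x + cck K eps i x * j1 J i x.

(* j2 is chosen such that the equation holds everywhere *)
Definition kjet u J : Prop := [/\ jetok J, j0 J = emb u & forall i x, lin J i x + Nk i x (u x) = 0].

Lemma ddk_gt0 i : 0 < ddk K i.
Proof. exact: lt_le_trans (dmin_gt0 K) (ddk_min K i). Qed.

Lemma cont_emb u J : jetok J -> j0 J = emb u -> cpair u.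
Proof.
move=> ok e; have c i : continuous (j0 J i) by have [] := D2_cont (ok i).
by split; [have := c (false, false)|have := c (true, false)]; rewrite e.
Qed.

Lemma cont_Nk u i : cpair u -> continuous (fun x => Nk i x (u x)).
Proof.
move=> [c1 c2] x; rewrite /Nk; case: i.2; first exact: cvg_cst.
have v1 : (fun x => (u x).1) @ x --> (u x).1 by exact: c1.
have v2 : (fun x => (u x).2) @ x --> (u x).2 by exact: c2.
have v3 : (fun x => (u x).1 * (u x).2 ^+ 2) @ x --> (u x).1 * (u x).2 ^+ 2.
  by apply: cvgM => //; exact: cvgM.
case: i.1; first by apply: cvgD => //; apply: cvgM => //; exact: cvg_cst.
apply: cvgD; last exact: cvg_cst.
apply: cvgB => //; apply: cvgB => //; apply: cvgM => //.
by apply: cvgM; [exact: cvg_cst|exact: cont_g].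
Qed.

(** The second derivative matters only up to null sets; defining it by the equation yields a version
    for which the equation, and later its periodicity, holds at every point. *)
Lemma exact_jet u (h1 : fld) (h2 : fld) : cpair u ->
  (forall i, D2 (emb u i) (h1 i) (h2 i)) ->
  {ae mu, forall x, forall i, ddk K i * h2 i x + cck K eps i x * h1 i x + Nk i x (u x) = 0} ->
  exists J, [/\ kjet u J, j1 J = h1 & {ae mu, forall x, forall i, j2 J i x = h2 i x}].
Proof.
move=> cu H e.
pose g2 : fld := fun i x => - (cck K eps i x * h1 i x + Nk i x (u x)) / ddk K i.
have g2e : {ae mu, forall x, forall i, g2 i x = h2 i x}.
  apply: (ae_imp e) => x hx i; have := hx i; rewrite /g2 => E.
  have -> : - (cck K eps i x * h1 i x + Nk i x (u x)) = ddk K i * h2 i x by lra.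
  by rewrite mulrAC divff ?mul1r// gt_eqF// ddk_gt0.
have c1 i : continuous (h1 i) by have [] := D2_cont (H i).
have mg i : mf (g2 i).
  apply: mfM; last exact: mf_cst.
  apply: mfN; apply: mfD; first by apply: mfM; apply: mf_cont => //; exact: cont_cck.
  by apply: mf_cont; exact: cont_Nk.
exists (Jet (emb u) h1 g2); split => //; split => //=.
- move=> i; have [a b] := H i; split => //; apply: (prim_ae b) => //.
  by apply: (ae_imp g2e) => x h /=; rewrite h.
- move=> i x; rewrite /lin /g2 /= mulrCA divff ?gt_eqF ?ddk_gt0//; ring.
Qed.

Lemma stationary_kjet u : stationary K eps u -> exists J, kjet u J.
Proof.
move=> [[t1 t2] e].
have [w1 [w2 [dw ew1 ew2]]] := twd_D2 t1; have [p1 [p2 [dp ep1 ep2]]] := twd_D2 t2.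
have cu : cpair u by split; [case: t1|case: t2].
have [||J [kJ _ _]] := @exact_jet u (fun i => if i.2 then fun=> 0 else if i.1 then p1 else w1)
  (fun i => if i.2 then fun=> 0 else if i.1 then p2 else w2) cu.
- by move=> [[] []]; [exact: D2_zero|exact: dp|exact: D2_zero|exact: dw].
- apply: (ae_imp (ae_and e (ae_and (ae_and ew1 ew2) (ae_and ep1 ep2)))) => x [h [[a1 a2] [b1 b2]]].
  rewrite /linear_part a1 a2 b2 /reaction in h.
  move: h; case E : (u x) => [w p] /= [h1 h2].
  case=> [[] []]; rewrite /Nk /ddk /cck /= ?E /=; try ring.
  + by rewrite -[RHS]h2; ring.
  + by rewrite -[RHS]h1; ring.
by exists J.
Qed.

Lemma jet_stationary u J : jetok J -> (forall x, (u x).1 = j0 J (false, false) x) ->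
  (forall x, (u x).2 = j0 J (true, false) x) ->
  {ae mu, forall x, lin J (false, false) x + Nk (false, false) x (u x) = 0 /\
    lin J (true, false) x + Nk (true, false) x (u x) = 0} ->
  stationary K eps u.
Proof.
move=> ok e1 e2 e; have [t [_ jo]] := jet_twd ok.
have E1 : (fun x => (u x).1) = j0 J (false, false) by apply/funext.
have E2 : (fun x => (u x).2) = j0 J (true, false) by apply/funext.
split; first by rewrite /all2c E1 E2; split; exact: t.
apply: (ae_imp (ae_and e jo)) => x [[h1 h2] hj].
have [a1 a2] := hj (false, false); have [b1 b2] := hj (true, false).
rewrite /linear_part E1 E2 a1 a2 b2 /reaction; case E : (u x) => [w p].
move: h1 h2; rewrite /lin /Nk /ddk /cck E /= => h1 h2.
by apply: injective_projections => /=; [rewrite -[RHS]h1|rewrite -[RHS]h2]; ring.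
Qed.

Lemma Nk_sub i x (y y' : R * R) (M : R) : `|y.1| <= M -> `|y.2| <= M -> `|y'.1| <= M -> `|y'.2| <= M ->
  `|Nk i x y - Nk i x y'| <= (`|eps * kg K x| + 1 + `|km K| + 3 * M ^+ 2) * (`|y.1 - y'.1| + `|y.2 - y'.2|).
Proof.
case: y => w p; case: y' => w' p' /= hw hp hw' hp'.
have M0 : 0 <= M by exact: le_trans hw.
set a := `|w - w'|; set b := `|p - p'|.
have a0 : 0 <= a by exact: normr_ge0.
have b0 : 0 <= b by exact: normr_ge0.
have cub : `|w * p ^+ 2 - w' * p' ^+ 2| <= M ^+ 2 * a + 2 * M ^+ 2 * b.
  have -> : w * p ^+ 2 - w' * p' ^+ 2 = p ^+ 2 * (w - w') + w' * (p + p') * (p - p') by ring.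
  apply: (le_trans (ler_normD _ _)); apply: lerD; rewrite normrM; apply: ler_wpM2r => //.
    by rewrite normrX lerXn2r// nnegrE.
  rewrite normrM expr2 (_ : 2 * (M * M) = M * (2 * M)); last by ring.
  by apply: ler_pM => //; apply: (le_trans (ler_normD _ _)); lra.
have g0 := normr_ge0 (eps * kg K x); have m0 := normr_ge0 (km K).
have M2 := sqr_ge0 M.
have X1 := mulr_ge0 g0 a0; have X2 := mulr_ge0 g0 b0; have X3 := mulr_ge0 m0 a0; have X4 := mulr_ge0 m0 b0.
have X5 := mulr_ge0 M2 a0; have X6 := mulr_ge0 M2 b0.
rewrite /Nk; case: i.2; first by rewrite subrr normr0; nra.
case: i.1 => /=.
  have -> : - km K * p + w * p ^+ 2 - (- km K * p' + w' * p' ^+ 2) =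
    - km K * (p - p') + (w * p ^+ 2 - w' * p' ^+ 2) by ring.
  apply: (le_trans (ler_normD _ _)); rewrite normrM normrN -/b; nra.
have -> : eps * kg K x * w - w - w * p ^+ 2 + ka K - (eps * kg K x * w' - w' - w' * p' ^+ 2 + ka K) =
  eps * kg K x * (w - w') - (w - w') - (w * p ^+ 2 - w' * p' ^+ 2) by ring.
apply: (le_trans (ler_normB _ _)).
have := ler_normB (eps * kg K x * (w - w')) (w - w').
rewrite (normrM (eps * kg K x)) -/a; nra.
Qed.

Lemma Nk_lip (M : R) : 0 <= M -> exists2 C, 0 <= C & forall i x (y y' : R * R),
  `|y.1| <= M -> `|y.2| <= M -> `|y'.1| <= M -> `|y'.2| <= M ->
  `|Nk i x y - Nk i x y'| <= C * (`|y.1 - y'.1| + `|y.2 - y'.2|).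
Proof.
move=> M0; have [Mg Mg0 Hg] := g_bound K; have m0 := normr_ge0 (km K); have M2 := sqr_ge0 M.
have eg : 0 <= `|eps| * Mg by exact: mulr_ge0.
exists (`|eps| * Mg + 1 + `|km K| + 3 * M ^+ 2); first lra.
move=> i x y y' h1 h2 h3 h4; apply: (le_trans (Nk_sub i x h1 h2 h3 h4)); apply: ler_wpM2r.
  exact: addr_ge0.
have : `|eps * kg K x| <= `|eps| * Mg by rewrite normrM ler_wpM2l.
lra.
Qed.

Lemma Nk_per i x y : Nk i (x + T) y = Nk i x y.
Proof. by rewrite /Nk kg_per. Qed.

Lemma cck_per i x : cck K eps i (x + T) = cck K eps i x.
Proof. by rewrite /cck kf_per. Qed.

Lemma jet_per J (L : R) : jetok J -> perF L (j0 J) -> perF L (j1 J).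
Proof.
move=> ok p0 i x; have [d _] := ok i; apply: (is_derive_uniq _ (d x)).
have := is_derive_shift (d (x + L)); have -> // : (fun y => j0 J i (y + L)) = j0 J i.
by apply/funext => y; exact: p0.
Qed.

Lemma prim_shift_ae (h k : R -> R) (L : R) : prim h k -> (forall x, h (x + L) = h x) ->
  {ae mu, forall x, k (x + L) = k x}.
Proof.
move=> p ph; apply: (prim_uniq (h := h)) => //.
have -> : h = (fun x => h (x + L)) by apply/funext => x; rewrite ph.
exact: prim_shift.
Qed.

(* The residual of v is periodic, and square integrable because u is a solution; so it vanishes. *)
Theorem background u v z : stationary K eps u -> (forall x, u x = z x + v x) -> H2line z ->
  periodic v T -> exists Ju Jv Jz, [/\ kjet u Ju, kjet v Jv, L2jet Jz, j0 Jz = emb z &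
    [/\ Jz = jsub Ju Jv, perF T (j0 Jv) /\ perF T (j1 Jv),
     exists2 M, 0 <= M & bpair u M /\ bpair v M & cpair v]].
Proof.
move=> su uzv [hz1 hz2] pv; have [Ju kJu] := stationary_kjet su; have [oku eu equ] := kJu.
have T0 := kT_gt0 K.
have [Jz [okz f0 f1 f2] [ez _]] : exists2 J, L2jet J & jet_of (emb z) J.
  have H0 : H2 setT (fun=> 0 : R) by exact: (@jet_H2F _ _ _ measurableT (let: And4 a _ _ _ := @L2jet_zero R I4 in a) (let: And4 _ a _ _ := @L2jet_zero R I4 in a) (let: And4 _ _ a _ := @L2jet_zero R I4 in a) (let: And4 _ _ _ a := @L2jet_zero R I4 in a) (true, true)).
  have [J ok [jo [g0 g1 g2]]] := @H2F_jet _ setT (emb z) measurableT (fun i => match i with (false, false) => hz1 | (true, false) => hz2 | _ => H0 end).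
  by exists J.
have LJz : L2jet Jz by [].
(* The background is assumed periodic but not differentiable: its regularity comes from u - z. *)
pose Jv := jsub Ju Jz; have okv : jetok Jv by exact: jsub_ok.
have ev : j0 Jv = emb v.
  apply/funext => i; apply/funext => x; rewrite /= /fsub eu ez /emb uzv.
  by case: i => [[] []] /=; ring.
have cv : cpair v by exact: cont_emb okv ev.
have pv0 : perF T (j0 Jv) by move=> i x; rewrite ev /emb pv.
have pv1 := jet_per okv pv0.
have [Mz Mz0 HMz] := L2jet_bound LJz.
have [cv1 cv2] := cv.
have [M1 M10 HM1] := periodic_bounded T0 cv1 (fun x => f_equal fst (pv x)).
have [M2 M20 HM2] := periodic_bounded T0 cv2 (fun x => f_equal snd (pv x)).
pose M := Mz + M1 + M2.
have M0 : 0 <= M by rewrite /M; lra.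
have bv : bpair v M by move=> x; have := HM1 x; have := HM2 x; rewrite /M; lra.
have bu : bpair u M.
  move=> x; rewrite uzv /=; have := HM1 x; have := HM2 x.
  have := HMz (false, false) x; have := HMz (true, false) x; rewrite ez /emb /= => h1 h2 h3 h4.
  by split; apply: (le_trans (ler_normD _ _)); rewrite /M; lra.
have [C C0 HC] := Nk_lip M0.
pose rho : fld := fun i x => lin Jv i x + Nk i x (v x).
have [mz0 mz1 mz2] := jet_mf okz; have [mv0 mv1 mv2] := jet_mf okv.
have mrho : mfF rho.
  move=> i; apply: mfD; last by apply: mf_cont; exact: cont_Nk.
  by apply: mfD; apply: mfM => //; [exact: mf_cst|apply: mf_cont; exact: cont_cck].
(* Since [u] solves the equation at every point, the residual of [v] is expressed by [z] alone, up
   to a Lipschitz difference, and is thus square integrable. *)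
have rhoE i x : rho i x = - lin Jz i x + (Nk i x (v x) - Nk i x (u x)).
  by have := equ i x; rewrite /rho /lin /= /fsub => e; rewrite -[LHS]subr0 -e; ring.
have [Cc Cc0 hc] := cck_bound K eps.
have dm i : `|ddk K i| <= dmax K by rewrite gtr0_norm ?ddk_gt0// ddk_max.
have dm0 : 0 <= dmax K by apply: le_trans (dm (true, true)).
have frho : (q setT rho < +oo)%E.
  pose X := fadd (fun i x => ddk K i * j2 Jz i x) (fun i x => cck K eps i x * j1 Jz i x).
  have mX1 : mfF (fun i x => ddk K i * j2 Jz i x) by move=> i; apply: mfM => //; exact: mf_cst.
  have mX2 : mfF (fun i x => cck K eps i x * j1 Jz i x) by move=> i; apply: mfM => //; apply: mf_cont; exact: cont_cck.
  have sqk (a b c : R) : `|a| <= c -> (a * b) ^+ 2 <= c ^+ 2 * b ^+ 2.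
    move=> h; rewrite exprMn ler_wpM2r ?sqr_ge0// -real_normK ?num_real// lerXn2r// nnegrE//.
    exact: le_trans h.
  have fX : (q setT X < +oo)%E.
    apply: (@q_fin2 _ _ X (j2 Jz) (j1 Jz) (2 * dmax K ^+ 2) (2 * Cc ^+ 2)) => //.
    - exact: mf_fadd.
    - by apply: mulr_ge0 => //; exact: sqr_ge0.
    - by apply: mulr_ge0 => //; exact: sqr_ge0.
    move=> x; apply: (le_trans (sq_fadd _ _ _)); rewrite -[2 * dmax K ^+ 2 * _]mulrA -[2 * Cc ^+ 2 * _]mulrA.
    apply: lerD; rewrite ler_pM2l// /sq [leRHS]mulr_sumr; apply: ler_sum => i _; exact: sqk.
  apply: (@q_fin2 _ _ rho X (j0 Jz) 2 (16 * C ^+ 2)) => //.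
  - exact: mf_fadd.
  - by apply: mulr_ge0 => //; exact: sqr_ge0.
  move=> x; apply: (@le_trans _ _ (\sum_i (2 * X i x ^+ 2 + 4 * C ^+ 2 * sq (j0 Jz) x))).
    apply: ler_sum => i _; rewrite rhoE -/(X i x).
    have [b1 b2] := bv x; have [a1 a2] := bu x.
    have := HC i x (v x) (u x) b1 b2 a1 a2.
    have -> : (v x).1 - (u x).1 = - j0 Jz (false, false) x by rewrite ez /emb uzv /=; ring.
    have -> : (v x).2 - (u x).2 = - j0 Jz (true, false) x by rewrite ez /emb uzv /=; ring.
    rewrite !normrN; set D := Nk _ _ _ - _; set s := `|j0 _ _ _|; set t := `|j0 _ _ _| => hD.
    have st : (s + t) ^+ 2 <= 2 * sq (j0 Jz) x.
      have : s ^+ 2 + t ^+ 2 <= sq (j0 Jz) x.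
        rewrite /sq sum4 !real_normK ?num_real//.
        by have := sqr_ge0 (j0 Jz (false, true) x); have := sqr_ge0 (j0 Jz (true, true) x); lra.
      by have := sqr_ge0 (s - t); rewrite sqrrB sqrrD; lra.
    have D2' : D ^+ 2 <= C ^+ 2 * (s + t) ^+ 2.
      have st0 : 0 <= s + t by apply: addr_ge0; exact: normr_ge0.
      by rewrite -exprMn -[D ^+ 2]real_normK ?num_real// lerXn2r// nnegrE// mulr_ge0.
    have := ler_wpM2l (sqr_ge0 C) st; have := sqr_ge0 (X i x + D).
    have -> : - lin Jz i x = - X i x by [].
    have -> : (- X i x + D) ^+ 2 = 2 * X i x ^+ 2 + 2 * D ^+ 2 - (X i x + D) ^+ 2 by ring.
    lra.
  rewrite big_split/= -mulr_sumr -/(sq X x); set t := 4 * C ^+ 2 * _.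
  have -> : 16 * C ^+ 2 * sq (j0 Jz) x = 4 * t by rewrite /t; ring.
  by rewrite sum4; lra.
(* At this stage the second derivative of [v] is periodic only almost everywhere, which is all that
   [qi_finite_period0] asks. *)
have rho0 : {ae mu, forall x, sq rho x = 0}.
  apply: (@qi_finite_period0 _ (sq rho) T) => //; [exact: mf_sq|exact: sq_ge0|].
  have p2 i : {ae mu, forall x, j2 Jv i (x + T) = j2 Jv i x}.
    by have [_ p] := okv i; apply: (prim_shift_ae p) => x; exact: pv1.
  apply: (ae_imp (ae_fin p2)) => x h; apply: eq_bigr => i _.
  by rewrite /rho /lin h pv1 cck_per Nk_per pv.
have [||Jv' [kv ev1 ev2]] := @exact_jet v (j1 Jv) (j2 Jv) cv.
- by move=> i; rewrite -ev; exact: okv.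
- apply: (ae_imp rho0) => x hx i; have := sq_ge1 rho i x; rewrite hx => h.
  by apply/eqP; rewrite -[_ == _]/(rho i x == 0) -sqrf_eq0 eq_le h sqr_ge0.
have [okv' ev0' _] := kv.
have P0 : perF T (j0 Jv') by move=> i x; rewrite ev0' /emb pv.
exists Ju, Jv', (jsub Ju Jv'); split => //.
- have okz' : jetok (jsub Ju Jv') by exact: jsub_ok.
  have [n0 n1 n2] := jet_mf okz'.
  split => //.
  + rewrite (@q_eq _ _ _ _ (j0 Jz)) => // x _ i.
    by rewrite /= /fsub ev0' eu ez /emb uzv; case: i => [[] []] /=; ring.
  + rewrite (@q_eq _ _ _ _ (j1 Jz)) => // x _ i; rewrite /= /fsub ev1 /= /fsub; ring.
  + rewrite (@q_ae _ _ _ _ (j2 Jz)) => //.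
    apply: (ae_imp ev2) => x h i; rewrite /= /fsub h /= /fsub; ring.
- apply/funext => i; apply/funext => x.
  by rewrite /= /fsub ev0' eu /emb uzv; case: i => [[] []] /=; ring.
- by split => //; [split => //; exact: jet_per|exists M].
Qed.

End Profiles.

(** * The nonlinear equation on a long period *)

Section Existence.
Variables (R : realType) (K : klausmeier R) (eps : R).
Local Notation mu := (@lebesgue_measure R).
Local Notation fld := (I4 -> R -> R).
Local Notation jet := (jet R I4).
Local Notation T := (kT K).
Implicit Types (F G : fld) (J : jet).

(** What remains of (w + a1)(p + a2)^2 after subtracting its value and its linear part at (w, p). *)
Definition Sq (w p a1 a2 : R) : R := w * a2 ^+ 2 + 2 * p * a1 * a2 + a1 * a2 ^+ 2.

(** The remainder starts at second order, so on a ball of radius [s] its Lipschitz constant is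
    proportional to [s]. *)
Lemma Sq_diff (w p a1 a2 b1 b2 M s : R) : `|w| <= M -> `|p| <= M -> `|a1| <= s -> `|a2| <= s ->
  `|b1| <= s -> `|b2| <= s -> s <= 1 ->
  (Sq w p a1 a2 - Sq w p b1 b2) ^+ 2 <= 2 * (s ^+ 2 * (6 * M + 3) ^+ 2) * ((a1 - b1) ^+ 2 + (a2 - b2) ^+ 2).
Proof.
move=> hw hp h1 h2 h3 h4 s1; have M0 : 0 <= M by exact: le_trans hw.
have s0 : 0 <= s by exact: le_trans h1.
set x := `|a1 - b1|; set y := `|a2 - b2|.
have x0 : 0 <= x by exact: normr_ge0.
have y0 : 0 <= y by exact: normr_ge0.
have prod3 (u v t A B C : R) : `|u| <= A -> `|v| <= B -> `|t| <= C -> `|u * v * t| <= A * B * C.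
  by move=> hu hv ht; rewrite !normrM; apply: ler_pM => //; exact: ler_pM.
have s2 : `|a2 + b2| <= 2 * s by apply: (le_trans (ler_normD _ _)); lra.
have ss : s * s <= s by rewrite ler_piMr.
have key : `|Sq w p a1 a2 - Sq w p b1 b2| <= s * (6 * M + 3) * (x + y).
  have -> : Sq w p a1 a2 - Sq w p b1 b2 =
    w * (a2 + b2) * (a2 - b2) + (2 * (p * a1 * (a2 - b2)) + 2 * (p * b2 * (a1 - b1))) +
    (a2 * a2 * (a1 - b1) + b1 * (a2 + b2) * (a2 - b2)) by rewrite /Sq; ring.
  have t1 := prod3 w (a2 + b2) (a2 - b2) M (2 * s) y hw s2 (lexx _).
  have t2 := prod3 p a1 (a2 - b2) M s y hp h1 (lexx _).
  have t3 := prod3 p b2 (a1 - b1) M s x hp h4 (lexx _).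
  have t4 := prod3 a2 a2 (a1 - b1) s s x h2 h2 (lexx _).
  have t5 := prod3 b1 (a2 + b2) (a2 - b2) s (2 * s) y h3 s2 (lexx _).
  apply: (le_trans (ler_normD _ _)).
  have := ler_normD (w * (a2 + b2) * (a2 - b2)) (2 * (p * a1 * (a2 - b2)) + 2 * (p * b2 * (a1 - b1))).
  have := ler_normD (2 * (p * a1 * (a2 - b2))) (2 * (p * b2 * (a1 - b1))).
  have := ler_normD (a2 * a2 * (a1 - b1)) (b1 * (a2 + b2) * (a2 - b2)).
  rewrite (normrM 2 (p * a1 * _)) (normrM 2 (p * b2 * _)) normr_nat.
  have u1 : s * s * x <= s * x by rewrite ler_wpM2r.
  have u2 : s * (2 * s) * y <= 2 * (s * y) by rewrite (_ : _ * y = 2 * (s * s * y)); [rewrite ler_pM2l// ler_wpM2r|ring].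
  have v1 := mulr_ge0 s0 x0; have v2 := mulr_ge0 s0 y0.
  have v3 := mulr_ge0 M0 v1; have v4 := mulr_ge0 M0 v2.
  have -> : s * (6 * M + 3) * (x + y) = 6 * (M * (s * x)) + 6 * (M * (s * y)) + 3 * (s * x) + 3 * (s * y) by ring.
  move: t1 t2 t3 t4 t5; rewrite (_ : M * (2 * s) * y = 2 * (M * (s * y))); last by ring.
  rewrite -(mulrA M s y) -(mulrA M s x); lra.
have b0 : 0 <= s * (6 * M + 3) * (x + y) by rewrite !mulr_ge0// addr_ge0// mulr_ge0.
rewrite -[leLHS]real_normK ?num_real//.
apply: (@le_trans _ _ ((s * (6 * M + 3) * (x + y)) ^+ 2)); first by rewrite lerXn2r// nnegrE.
rewrite -[(a1 - b1) ^+ 2]real_normK ?num_real// -[(a2 - b2) ^+ 2]real_normK ?num_real// -/x -/y.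
rewrite exprMn exprMn.
have -> : 2 * (s ^+ 2 * (6 * M + 3) ^+ 2) * (x ^+ 2 + y ^+ 2) = s ^+ 2 * (6 * M + 3) ^+ 2 * (2 * (x ^+ 2 + y ^+ 2)) by ring.
apply: ler_wpM2l; first by apply: mulr_ge0; exact: sqr_ge0.
have := sqr_ge0 (x - y); rewrite sqrrB sqrrD; lra.
Qed.

Definition Qf (w : R -> R * R) F : fld := fun i x =>
  let t := Sq (w x).1 (w x).2 (F (false, false) x) (F (true, false) x) in
  if i.2 then 0 else if i.1 then t else - t.

Lemma mf_Qf w F : cpair w -> mfF F -> mfF (Qf w F).
Proof.
move=> [c1 c2] mF; have m1 := mf_cont c1; have m2 := mf_cont c2.
have mS : mf (fun x => Sq (w x).1 (w x).2 (F (false, false) x) (F (true, false) x)).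
  apply: mfD; [apply: mfD|].
  - by apply: mfM => //; exact: mfX.
  - by apply: mfM => //; apply: mfM => //; apply: mfM => //; exact: mf_cst.
  - by apply: mfM => //; exact: mfX.
by move=> [[] []] //; [exact: mf_cst|exact: mf_cst|exact: mfN].
Qed.

(** An exact expansion, because the reaction is polynomial. *)
Lemma Nk_taylor (w : R -> R * R) (A : jet) i x : ~~ i.2 ->
  Nk K eps i x ((w x).1 + j0 A (false, false) x, (w x).2 + j0 A (true, false) x) =
  Nk K eps i x (w x) + \sum_k Bk K eps w i k x * j0 A k x + Qf w (j0 A) i x.
Proof.
by rewrite sum4 /Bk /Nk /Qf /Sq; case: i => [[] []] //= _; ring.
Qed.

Definition resid J : fld := fun i x => lin K eps J i x + Nk K eps i x (prj (j0 J) x).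

Lemma fin_le4 (x : \bar R) (r : R) : (x <= r%:E)%E -> (x < +oo)%E.
Proof. by move=> h; exact: le_lt_trans h (ltry _). Qed.

(** With the correction written as [P F], the equation reads F = - residual - Er F - Qf (P F). The
    linear error contracts by construction; the nonlinearity contracts because [P F] is uniformly
    small when the residual is. *)
Theorem solve_period (M Kp : R) : 0 <= M -> 0 <= Kp -> exists (r0 C1 : R), [/\ 0 < r0, 0 <= C1 &
  forall (L r : R) JW P, 1 <= L -> (forall i x, cck K eps i (x + L) = cck K eps i x) ->
    (forall x, kg K (x + L) = kg K x) -> jetok JW -> perF L (j0 JW) -> bpair (prj (j0 JW)) M ->
    parametrix (ddk K) (cck K eps) (Bk K eps (prj (j0 JW))) L Kp P ->
    mfF (resid JW) -> perF L (resid JW) -> (q (ico 0 L) (resid JW) <= r%:E)%E -> 0 <= r -> r <= r0 ->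
    exists A, [/\ jetok A, perF L (j0 A), (q (ico 0 L) (j0 A) + q (ico 0 L) (j1 A) <= (C1 * r)%:E)%E,
      (q (ico 0 L) (j2 A) <= (C1 * r)%:E)%E &
      {ae mu, forall x, forall i, op (ddk K) (cck K eps) (Bk K eps (prj (j0 JW))) A i x
         + Qf (prj (j0 JW)) (j0 A) i x + resid JW i x = 0}]].
Proof.
move=> M0 Kp0; have [Cc Cc0 hc] := cck_bound K eps.
have [Cb Cb0 HCb] := Bk_bound_unif K eps M0.
pose D := Kp * (6 * M + 3).
have D0 : 0 <= D by apply: mulr_ge0 => //; lra.
have den : 0 < 1 + 16 * Kp + (64 * 64) * D ^+ 2 by have := sqr_ge0 D; lra.
have d2 : 0 <= 3 / dmin K ^+ 2 by rewrite divr_ge0// sqr_ge0.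
pose C2 := 3 / dmin K ^+ 2 * (16 + Cc ^+ 2 * (4 * Kp) + N1 R I4 ^+ 2 * Cb ^+ 2 * (4 * Kp)).
have K4 : 0 <= 4 * Kp by lra.
have C20 : 0 <= C2.
  apply: mulr_ge0 => //; apply: addr_ge0; first by apply: addr_ge0 => //; apply: mulr_ge0 => //; exact: sqr_ge0.
  by apply: mulr_ge0 => //; apply: mulr_ge0; exact: sqr_ge0.
(* The term 16 Kp makes the sup bound [s] at most 1; the term with D^2 makes the squared Lipschitz
   factor 64 r D^2 of the nonlinearity at most 1/64. [C2] bounds the second derivative through the
   equation. *)
exists (1 + 16 * Kp + (64 * 64) * D ^+ 2)^-1, (4 * Kp + C2); split; [by rewrite invr_gt0|exact: addr_ge0|].
move=> L r JW P L1 hcL hgL okW pW bW HP mrho prho hrho r0 rr0.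
set w := prj (j0 JW) in bW HP *; set rho := resid JW in mrho prho hrho *.
have cw : cpair w.
  by split; [have [c _] := D2_cont (okW (false, false))|have [c _] := D2_cont (okW (true, false))].
have rD : r * (1 + 16 * Kp + (64 * 64) * D ^+ 2) <= 1.
  by rewrite -ler_pdivlMr// div1r.
have rK : 0 <= r * Kp by exact: mulr_ge0.
have rDD : 0 <= r * D ^+ 2 by apply: mulr_ge0 => //; exact: sqr_ge0.
have small1 : 16 * Kp * r <= 1 by move: rD; lra.
have small2 : (64 * 64) * (r * D ^+ 2) <= 1 by move: rD; lra.
(* A sup bound for [P F]: the squared norms of field and derivative are at most 4 Kp r, and the
   Sobolev inequality on a period costs another 4. *)
pose s := Num.sqrt (16 * Kp * r).
have s20 : 0 <= 16 * Kp * r by rewrite -mulrA mulr_ge0// mulrC.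
have s2 : s ^+ 2 = 16 * Kp * r by rewrite /s sqr_sqrtr.
have s1 : s <= 1 by rewrite -[leRHS]sqrtr1 ler_wsqrtr.
have mI : measurable (ico 0 L) by exact: measurable_itv.
pose Er F := fsub (op (ddk K) (cck K eps) (Bk K eps w) (P F)) F.
have cB : cont2 (Bk K eps w) by exact: cont_Bk.
have [z0 z1 z2] := And3 (fun i x => let: And3 a _ _ := pm_zero HP i x in a)
   (fun i x => let: And3 _ a _ := pm_zero HP i x in a) (fun i x => let: And3 _ _ a := pm_zero HP i x in a).
have L2z : perL2 L (@fzero R I4).
  split; [exact: mf_fzero|by []|].
  by rewrite /q (@qi_eq _ _ _ (fun=> 0)) => [|x _]; [rewrite /qi integral0|exact: sq_fzero].
have inb F : inball (ico 0 L) L r F -> perL2 L F by move=> [m p f]; split => //; exact: fin_le4 f.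
have jP F G i x : j0 (jsub (P F) (P G)) i x = j0 (P F) i x - j0 (P G) i x by [].
have bd F : inball (ico 0 L) L r F ->
   (q (ico 0 L) (j0 (P F)) + q (ico 0 L) (j1 (P F)) <= (4 * Kp * r)%:E)%E.
  move=> bF; have [mF pF fF] := bF; have := pm_bound HP (inb _ bF) L2z.
  rewrite (@q_eq _ _ _ _ (j0 (P F))) => [|x _ i]; last by rewrite jP z0 subr0.
  rewrite (@q_eq _ _ _ (j1 _) (j1 (P F))) => [|x _ i]; last first.
    by change (j1 (P F) i x - j1 (P (@fzero R I4)) i x = j1 (P F) i x); rewrite z1 subr0.
  rewrite (@q_eq _ _ _ (fsub F _) F) => [|x _ i]; last by rewrite /fsub subr0.
  move=> /le_trans; apply; rewrite (_ : 4 * Kp * r = Kp * (4 * r)); last by ring.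
  by rewrite EFinM; apply: lee_wpmul2l.
have supP F i x : inball (ico 0 L) L r F -> `|j0 (P F) i x| <= s.
  move=> bF; have [p0 p1 _] := pm_per HP (inb _ bF).
  rewrite /s -sqrtr_sqr ler_wsqrtr// -lee_fin.
  apply: (le_trans (sup_period i x (pm_ok HP (inb _ bF)) p0 p1 L1)).
  rewrite (_ : 16 * Kp * r = 4 * (4 * Kp * r)); last by ring.
  by rewrite [(4 * (4 * Kp * r))%:E]EFinM; apply: lee_wpmul2l => //; exact: bd.
have mEr F : perL2 L F -> mfF (Er F).
  move=> pF; have [mF _ _] := pF; apply: mf_fsub => //; apply: mf_op => //; [exact: cont_cck|exact: pm_ok HP _ pF].
have mQ F : perL2 L F -> mfF (Qf w (j0 (P F))).
  by move=> pF; apply: mf_Qf => //; have [] := jet_mf (pm_ok HP pF).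
have perw x : w (x + L) = w x by rewrite /w /prj !pW.
have perop F i x : perL2 L F -> op (ddk K) (cck K eps) (Bk K eps w) (P F) i (x + L) = op (ddk K) (cck K eps) (Bk K eps w) (P F) i x.
  move=> pF; have [p0 p1 p2] := pm_per HP pF.
  by rewrite /op p1 p2 hcL; congr (_ + _); apply: eq_bigr => k _; rewrite p0 /Bk perw hgL.
have hQ F G : inball (ico 0 L) L r F -> inball (ico 0 L) L r G ->
   (q (ico 0 L) (fsub (Qf w (j0 (P F))) (Qf w (j0 (P G)))) <= (64^-1)%:E * q (ico 0 L) (fsub F G))%E.
  move=> bF bG; have iF := inb _ bF; have iG := inb _ bG.
  have okD := jsub_ok (pm_ok HP iF) (pm_ok HP iG); have [m0 m1 _] := jet_mf okD.
  have e0 : 0 <= 4 * (s ^+ 2 * (6 * M + 3) ^+ 2).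
    by apply: mulr_ge0 => //; apply: mulr_ge0; exact: sqr_ge0.
  apply: (@le_trans _ _ ((4 * (s ^+ 2 * (6 * M + 3) ^+ 2))%:E * q (ico 0 L) (j0 (jsub (P F) (P G))))%E).
    apply: q_le1 => //; [by apply: mf_fsub; exact: mQ|].
    apply: ae_all => x _; have [w1 w2] := bW x.
    have := Sq_diff w1 w2 (supP F (false, false) x bF) (supP F (true, false) x bF)
      (supP G (false, false) x bG) (supP G (true, false) x bG) s1.
    rewrite -!jP => h.
    have : j0 (jsub (P F) (P G)) (false, false) x ^+ 2 + j0 (jsub (P F) (P G)) (true, false) x ^+ 2 <= sq (j0 (jsub (P F) (P G))) x.
      by rewrite /sq sum4; have := sqr_ge0 (j0 (jsub (P F) (P G)) (false, true) x); have := sqr_ge0 (j0 (jsub (P F) (P G)) (true, true) x); lra.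
    move=> /(ler_wpM2l e0); move: h.
    set X := Sq _ _ _ _; set Y := Sq _ _ _ _.
    have -> : sq (fsub (Qf w (j0 (P F))) (Qf w (j0 (P G)))) x = 2 * (X - Y) ^+ 2.
      by rewrite /sq sum4 /fsub /Qf /= -/X -/Y; ring.
    by rewrite -(mulrA 2); lra.
  apply: (@le_trans _ _ ((4 * (s ^+ 2 * (6 * M + 3) ^+ 2))%:E * (Kp%:E * q (ico 0 L) (fsub F G)))%E).
    apply: lee_wpmul2l => //; apply: le_trans (pm_bound HP iF iG).
    by rewrite leeDl// q_ge0.
  rewrite muleA -EFinM; apply: lee_wpmul2r; first exact: q_ge0.
  rewrite lee_fin s2 (_ : 4 * (16 * Kp * r * (6 * M + 3) ^+ 2) * Kp = 64 * (r * D ^+ 2)); last by rewrite /D; ring.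
  by move: small2; lra.
have [|||F bF F0] := @fixpoint R I4 (ico 0 L) L r (fun F => fsub (fsub (fscale (-1) rho) (Er F)) (Qf w (j0 (P F)))) mI r0.
- move=> F bF; have iF := inb _ bF; split.
    by apply: mf_fsub; [apply: mf_fsub; [exact: mf_fscale|exact: mEr]|exact: mQ].
  have [p0 p1 p2] := pm_per HP iF; have [_ pF _] := bF.
  by move=> i x; rewrite /fsub /fscale /Er /Qf /fsub (perop _ _ _ iF) prho perw !p0 pF.
- move=> F G bF bG; have iF := inb _ bF; have iG := inb _ bG.
  rewrite (@q_eq _ _ _ _ (fsub (fsub (Er G) (Er F)) (fsub (Qf w (j0 (P F))) (Qf w (j0 (P G)))))) => [|x _ i]; last first.
    by rewrite /fsub /fscale; ring.
  apply: (le_trans (q_fsub _ _ _)) => //; [by apply: mf_fsub; exact: mEr|by apply: mf_fsub; exact: mQ|].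
  have h1 := pm_err HP iG iF; have h2 := hQ F G bF bG.
  rewrite (@q_eq _ _ _ (fsub G F) (fscale (-1) (fsub F G))) in h1; last by move=> x _ i; rewrite /fsub /fscale; ring.
  rewrite q_fscale// in h1; last by apply: mf_fsub; [case: bF|case: bG].
  rewrite sqrrN expr1n mul1e in h1.
  apply: (@le_trans _ _ (2%:E * ((64^-1)%:E * q (ico 0 L) (fsub F G)) + 2%:E * ((64^-1)%:E * q (ico 0 L) (fsub F G)))%E).
    by apply: leeD; apply: lee_wpmul2l.
  rewrite -ge0_muleDr; last 2 first.
  + by apply: mule_ge0; [rewrite lee_fin|exact: q_ge0].
  + by apply: mule_ge0; [rewrite lee_fin|exact: q_ge0].
  rewrite -ge0_muleDl; [|by rewrite lee_fin|by rewrite lee_fin].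
  rewrite -EFinD muleA -EFinM; apply: lee_wpmul2r; first exact: q_ge0.
  by rewrite lee_fin; lra.
- rewrite (@q_eq _ _ _ _ (fscale (-1) rho)) => [|x _ i].
    by rewrite q_fscale// sqrrN expr1n mul1e.
  rewrite /fsub /Er /Qf /Sq /op /fsub z0 z0 z1 z2 big1 => [|k _]; last by rewrite z0 mulr0.
  by case: i => [[] []] /=; rewrite /fzero; ring.
have iF := inb _ bF; have [mF pF fF] := bF; have [p0 p1 p2] := pm_per HP iF.
have okP := pm_ok HP iF; have [m0 m1 m2] := jet_mf okP.
have mE := mEr F iF.
exists (P F); split => //.
- by apply: (le_trans (bd F bF)); rewrite lee_fin; apply: ler_wpM2r => //; lra.
- have hB := HCb w bW.
  have mo : mfF (op (ddk K) (cck K eps) (Bk K eps w) (P F)) by apply: mf_op => //; exact: cont_cck.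
  have qo : (q (ico 0 L) (op (ddk K) (cck K eps) (Bk K eps w) (P F)) <= (16 * r)%:E)%E.
    rewrite (@q_eq _ _ _ _ (fadd F (Er F))) => [|x _ i]; last by rewrite /fadd /Er /fsub; ring.
    apply: (le_trans (q_fadd _ _ _)) => //.
    have := pm_err HP iF L2z; rewrite -/(Er F).
    rewrite (@q_eq _ _ _ _ (Er F)) => [|x _ i]; last first.
      rewrite /fsub /op z1 z2 big1 => [|k _]; last by rewrite z0 mulr0.
      by rewrite /Er /fsub /op /fzero; ring.
    rewrite (@q_eq _ _ _ (fsub F _) F) => [|x _ i]; last by rewrite /fsub subr0.
    move=> h; apply: (@le_trans _ _ (2%:E * (4 * r)%:E + 2%:E * ((64^-1)%:E * (4 * r)%:E))%E).
      apply: leeD; apply: lee_wpmul2l => //; apply: (le_trans h); exact: lee_wpmul2l.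
    by rewrite -!EFinM -EFinD lee_fin; lra.
  have [rq eq rq0] := real_of_fin (q_ge0 (ico 0 L) (j0 (P F))) (le_lt_trans (leeDl _ (q_ge0 _ _)) (fin_le4 (bd F bF))).
  have [rq1 eq1 rq10] := real_of_fin (q_ge0 (ico 0 L) (j1 (P F))) (le_lt_trans (leeDr _ (q_ge0 _ _)) (fin_le4 (bd F bF))).
  have := bd F bF; rewrite eq eq1 -EFinD lee_fin => b01.
  pose h x := (3 / dmin K ^+ 2) * (sq (op (ddk K) (cck K eps) (Bk K eps w) (P F)) x + Cc ^+ 2 * sq (j1 (P F)) x + N1 R I4 ^+ 2 * Cb ^+ 2 * sq (j0 (P F)) x).
  have mc G : mfF G -> forall a : R, mf (fun x => a * sq G x).
    by move=> mG a; apply: mfM; [exact: mf_cst|exact: mf_sq].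
  have a0 x : 0 <= Cc ^+ 2 * sq (j1 (P F)) x by apply: mulr_ge0; [exact: sqr_ge0|exact: sq_ge0].
  have b0 x : 0 <= N1 R I4 ^+ 2 * Cb ^+ 2 * sq (j0 (P F)) x.
    by apply: mulr_ge0; [apply: mulr_ge0; exact: sqr_ge0|exact: sq_ge0].
  have mh1 : mf (fun x => sq (op (ddk K) (cck K eps) (Bk K eps w) (P F)) x + Cc ^+ 2 * sq (j1 (P F)) x).
    by apply: mfD; [exact: mf_sq|exact: mc].
  have mh : mf h by apply: mfM; [exact: mf_cst|apply: mfD => //; exact: mc].
  apply: (@le_trans _ _ (qi (ico 0 L) h)).
    apply: qi_le => //; [exact: mf_sq|exact: sq_ge0|] => x _.
    apply: sq_j2 => //; [exact: dmin_gt0|exact: ddk_min].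
  rewrite /h qiZ//; last 2 first.
  + by apply: mfD => //; exact: mc.
  + by move=> x; apply: addr_ge0 => //; apply: addr_ge0 => //; exact: sq_ge0.
  rewrite qiD//; [|exact: mc|by move=> x; apply: addr_ge0 => //; exact: sq_ge0].
  rewrite qiD//; [|exact: mf_sq|exact: mc|exact: sq_ge0].
  have qc (a : R) G : 0 <= a -> mfF G -> qi (ico 0 L) (fun x => a * sq G x) = (a%:E * q (ico 0 L) G)%E.
    by move=> ? mG; rewrite qiZ//; [exact: mf_sq|exact: sq_ge0].
  have cc0 : 0 <= Cc ^+ 2 by exact: sqr_ge0.
  have nn0 : 0 <= N1 R I4 ^+ 2 * Cb ^+ 2 by apply: mulr_ge0; exact: sqr_ge0.
  rewrite (qc _ _ cc0 m1) (qc _ _ nn0 m0) -!/(q _ _) eq eq1.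
  have [rqo eqo rqo0] := real_of_fin (q_ge0 (ico 0 L) _) (fin_le4 qo).
  pose A := 3 / dmin K ^+ 2 * (rqo + Cc ^+ 2 * rq1 + N1 R I4 ^+ 2 * Cb ^+ 2 * rq).
  apply: (@le_trans _ _ A%:E).
    by rewrite eqo /A [in leRHS]EFinM [(rqo + _ + _)%:E]EFinD [(rqo + _)%:E]EFinD [(Cc ^+ 2 * _)%:E]EFinM [(_ * rq)%:E]EFinM.
  rewrite lee_fin /A; move: qo; rewrite eqo lee_fin => qo.
  have eC : C2 * r = 3 / dmin K ^+ 2 * ((16 + Cc ^+ 2 * (4 * Kp) + N1 R I4 ^+ 2 * Cb ^+ 2 * (4 * Kp)) * r).
    by rewrite /C2 !mulrA.
  rewrite [leRHS]mulrDl eC.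
  have : 3 / dmin K ^+ 2 * (rqo + Cc ^+ 2 * rq1 + N1 R I4 ^+ 2 * Cb ^+ 2 * rq) <=
     3 / dmin K ^+ 2 * ((16 + Cc ^+ 2 * (4 * Kp) + N1 R I4 ^+ 2 * Cb ^+ 2 * (4 * Kp)) * r).
    apply: ler_wpM2l => //; rewrite [leRHS]mulrDl [in leRHS]mulrDl; apply: lerD; [apply: lerD => //|].
      by rewrite -mulrA; apply: ler_wpM2l; [exact: sqr_ge0|lra].
    by rewrite -(mulrA (N1 R I4 ^+ 2 * Cb ^+ 2) (4 * Kp) r); apply: ler_wpM2l => //; lra.
  have : 0 <= 4 * Kp * r by exact: mulr_ge0.
  by lra.
- pose Z := fsub (fsub (fsub (fscale (-1) rho) (Er F)) (Qf w (j0 (P F)))) F.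
  have mZ : mfF Z by apply: mf_fsub => //; apply: mf_fsub; [apply: mf_fsub => //; exact: mf_fscale|exact: mQ].
  (* The fixed-point equation is known on one period only; both sides are periodic, so it extends to
     the line. *)
  have q0 : q setT Z = 0%E.
    apply: (@qi_period0 _ (sq Z) L); [lra|exact: mf_sq|exact: sq_ge0| |exact: F0] => x.
    by apply: eq_bigr => i _; rewrite /Z /fsub /fscale /Er /Qf /fsub (perop _ _ _ iF) prho perw !p0 pF.
  apply: (ae_imp (q0_ae mZ q0)) => x hx i; have := hx i.
  by rewrite /Z /fsub /fscale /Er /fsub => h; lra.
Qed.

End Existence.

(** * A single hump of the periodic cut-off *)

Section Truncation.
Variables (R : realType) (L : R).
Hypothesis L0 : 0 < L.

(** The threshold 5/12 L is the midpoint between L/3 and L/2. The function vanishes on that band, so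
    cutting there creates no jump, and truncation commutes with differentiation. *)
Definition trunc (h : R -> R) : R -> R := fun x => if `|x| < 5 / 12 * L then h x else 0.

Let near_lt (a b x : R) (h h' : R -> R) : a < `|x| < b -> (forall y, a < `|y| < b -> h y = h' y) ->
  \forall y \near x, h y = h' y.
Proof.
move=> /andP[h1 h2] H.
apply: (@near_dist _ x (Num.min (`|x| - a) (b - `|x|))) => [|y]; first by rewrite lt_min !subr_gt0 h1.
rewrite lt_min => /andP[e1 e2]; apply: H.
have : `|y| <= `|x| + `|y - x| by rewrite -{1}(subrK x y) addrC ler_normD.
have : `|x| <= `|y| + `|y - x| by rewrite -{1}(subKr y x) ler_normB.
by move=> ? ?; apply/andP; split; lra.
Qed.

Lemma is_derive0 (c x : R) : is_derive x (1 : R) (fun=> c) 0.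
Proof. exact: is_derive_cst. Qed.

Lemma near_core_derive (h : R -> R) (a x : R) (c d : R) : (forall y, `|y| < a -> h y = c) -> `|x| < a ->
  is_derive x (1 : R) h d -> d = 0.
Proof.
move=> H xa D; apply: (is_derive_uniq D).
apply: (near_eq_is_derive _ (is_derive0 c x)).
apply: (@near_lt (-1) a) => [|y /andP[_ ya]]; last by rewrite H.
by rewrite xa andbT; apply: lt_le_trans (normr_ge0 x); rewrite ltrN10.
Qed.

Variables (h h1 : R -> R).
Hypothesis dh : forall x, is_derive x (1 : R) h (h1 x).
Hypothesis z : forall x, L / 3 < `|x| < L / 2 -> h x = 0.

Lemma trunc_zero' x : L / 3 < `|x| < L / 2 -> h1 x = 0.
Proof.
move=> hx; apply: (is_derive_uniq (dh x)).
apply: (near_eq_is_derive _ (is_derive0 0 x)).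
by apply: (near_lt hx) => y /z.
Qed.

Lemma trunc_derive x : is_derive x (1 : R) (trunc h) (trunc h1 x).
Proof.
have [hx|hx] := ltP `|x| (5 / 12 * L).
  rewrite {2}/trunc hx; apply: (near_eq_is_derive _ (dh x)).
  apply: (@near_lt (-1) (5 / 12 * L)) => [|y /andP[_ hy]]; last by rewrite /trunc hy.
  by rewrite hx andbT; apply: lt_le_trans (normr_ge0 x); rewrite ltrN10.
rewrite {2}/trunc ltNge hx /=.
apply: (near_eq_is_derive _ (is_derive0 0 x)).
apply: (@near_lt (L / 3) (`|x| + 1)) => [|y /andP[h2 _]]; first by have := L0; move=> ?; apply/andP; split; lra.
by rewrite /trunc; case: ifP => // h3; rewrite z//; apply/andP; split; lra.
Qed.

End Truncation.

(** * The glued periodic profile and its residual *)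

Section Glue.
Variables (R : realType) (K : klausmeier R) (eps : R).
Local Notation mu := (@lebesgue_measure R).
Local Notation fld := (I4 -> R -> R).
Local Notation jet := (jet R I4).
Local Notation T := (kT K).

Variables (u v : R -> R * R) (Ju Jv : jet) (M : R).
Hypotheses (ku : kjet K eps u Ju) (kv : kjet K eps v Jv).
Hypotheses (pv0 : perF T (j0 Jv)) (pv1 : perF T (j1 Jv)) (bu : bpair u M) (bv : bpair v M).
Let Jz := jsub Ju Jv.
Hypothesis LJz : L2jet Jz.

Variables (n : nat) (chi : R -> R).
Hypotheses (n0 : (0 < n)%N) (Hc : periodic_cutoff K n chi).
Let L : R := n%:R * T.

Let T0 : 0 < T := kT_gt0 K.
Lemma glue_L0 : 0 < L. Proof. by rewrite /L mulr_gt0// ltr0n. Qed.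
Let L0 := glue_L0.

Let dchi k x : is_derive x (1 : R) (derive1n k chi) (derive1n k.+1 chi x).
Proof. by rewrite derive1nS derive1E; apply/derivableP; exact: pc_smooth Hc k x. Qed.

Let zchi x : L / 3 < `|x| < L / 2 -> chi x = 0.
Proof.
move=> /andP[a b]; apply: (pc_zero Hc); rewrite /L in a b.
by apply/andP; split; lra.
Qed.

Definition ct k := trunc L (derive1n k chi).

Let zchik k x : L / 3 < `|x| < L / 2 -> derive1n k chi x = 0.
Proof. by elim: k x => [|k IH] x; [exact: zchi|exact: (trunc_zero' (dchi k) IH)]. Qed.

Let ct_derive k x : is_derive x (1 : R) (ct k) (ct k.+1 x).
Proof. by apply: trunc_derive; [exact: L0|exact: dchi|exact: zchik]. Qed.

Lemma ct_D2 : D2 (ct 0) (ct 1) (ct 2).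
Proof.
split; first exact: ct_derive.
apply: prim_C1; first exact: ct_derive.
by move=> x; have [d _] := ct_derive 2 x; apply: differentiable_continuous; apply/derivable1_diffP.
Qed.

Lemma ct_bound k x : (k <= 2)%N -> `|ct k x| <= 1.
Proof. by move=> hk; rewrite /ct /trunc; case: ifP => _; [exact: pc_bound Hc k hk x|rewrite normr0]. Qed.

Lemma ct_far k x : 5 / 12 * L <= `|x| -> ct k x = 0.
Proof. by move=> h; rewrite /ct /trunc ltNge h. Qed.

Lemma ct_core x : `|x| <= L / 6 -> ct 0 x = 1.
Proof.
move=> h; rewrite /ct /trunc ifT; last by have := L0; lra.
by rewrite /=; apply: (pc_one Hc); move: h; rewrite /L; lra.
Qed.

Lemma ct_core12 x : `|x| < L / 6 -> ct 1 x = 0 /\ ct 2 x = 0.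
Proof.
move=> h; have c1 y : `|y| < L / 6 -> ct 1 y = 0.
  by move=> hy; exact: (near_core_derive (fun t ht => ct_core (ltW ht)) hy (ct_derive 0 y)).
split; first exact: c1.
exact: (near_core_derive c1 h (ct_derive 1 x)).
Qed.

Lemma ct_chi x : - (L / 2) <= x < L / 2 -> ct 0 x = chi x.
Proof.
move=> /andP[a b]; rewrite /ct /trunc; case: ltP => // h.
rewrite (pc_zero Hc)//; apply/andP; split; first by have := L0; move: h; rewrite /L; lra.
by rewrite ler_norml; apply/andP; split; move: a b; rewrite /L; lra.
Qed.

Definition jz : jet := jmul (ct 0) (ct 1) (ct 2) Jz.
Definition Tz (j : int) : jet := jshift (- (j%:~R * L)) jz.
(** The truncated pulse part, cut-off times z, is repeated with period L on top of [v]. On one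
    period this is chi u + (1 - chi) v; written as a sum of translates it is visibly twice
    differentiable where two periods meet. *)
Definition JW : jet := jadd Jv (lsum L Tz).

Let okv : jetok Jv. Proof. by case: kv. Qed.
Let oku : jetok Ju. Proof. by case: ku. Qed.
Let okz : jetok Jz. Proof. exact: jsub_ok. Qed.

Lemma jz_ok : jetok jz. Proof. by move=> i; apply: D2_mul; [exact: ct_D2|exact: okz]. Qed.

Lemma jz_far i x : 5 / 12 * L <= `|x| -> [/\ j0 jz i x = 0, j1 jz i x = 0 & j2 jz i x = 0].
Proof. by move=> h; rewrite /jz /= !(ct_far _ h) !mul0r !mulr0 !addr0. Qed.

Lemma Tz_supp : tsupp L Tz.
Proof.
move=> j x hx i; apply: (@jz_far i (x - j%:~R * L)).
have := L0; case: hx => h l0; [rewrite ler0_norm|rewrite ger0_norm]; lra.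
Qed.

Lemma JW_ok : jetok JW.
Proof.
apply: jadd_ok => //; apply: (lsum_ok L0); last exact: Tz_supp.
by move=> j; apply: jshift_ok; exact: jz_ok.
Qed.

Lemma perv (h : R -> R) : (forall x, h (x + T) = h x) -> forall x, h (x + L) = h x.
Proof. by move=> ph x; rewrite /L -[n%:R]/(n%:Z%:~R); exact: shift_int. Qed.

Lemma lsum_per (x : R) i : [/\ j0 (lsum L Tz) i (x + L) = j0 (lsum L Tz) i x,
  j1 (lsum L Tz) i (x + L) = j1 (lsum L Tz) i x & j2 (lsum L Tz) i (x + L) = j2 (lsum L Tz) i x].
Proof.
have c : cidx L (x + L) = cidx L x + 1.
  apply/(cellP L0); have /(cellP L0) := erefl (cidx L x).
  rewrite /cell/= !in_itv/= intrD => /andP[a b]; apply/andP; split; lra.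
have e (j : int) : x + L - (j + 1)%:~R * L = x - j%:~R * L by rewrite intrD; ring.
rewrite /lsum /= c /sum3 (_ : cidx L x + 1 - 1 = cidx L x - 1 + 1); last by ring.
by rewrite !e.
Qed.

Lemma lsum_eval x i : - (L / 2) <= x < L / 2 -> [/\ j0 (lsum L Tz) i x = j0 jz i x,
  j1 (lsum L Tz) i x = j1 jz i x & j2 (lsum L Tz) i x = j2 jz i x].
Proof.
move=> /andP[a b]; have l0 := L0.
have far (j : int) : j%:~R * L <= - L \/ L <= j%:~R * L ->
   [/\ j0 (Tz j) i x = 0, j1 (Tz j) i x = 0 & j2 (Tz j) i x = 0].
  by move=> h; apply: jz_far; case: h => h; [rewrite ger0_norm|rewrite ler0_norm]; lra.
have T00 : [/\ j0 (Tz 0) i x = j0 jz i x, j1 (Tz 0) i x = j1 jz i x & j2 (Tz 0) i x = j2 jz i x].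
  by rewrite /Tz /= mul0r oppr0 addr0.
have [s0 s1 s2] := T00.
have e1 : j0 (lsum L Tz) i x = sum3 (fun j => j0 (Tz j) i x) (cidx L x) by [].
have e2 : j1 (lsum L Tz) i x = sum3 (fun j => j1 (Tz j) i x) (cidx L x) by [].
have e3 : j2 (lsum L Tz) i x = sum3 (fun j => j2 (Tz j) i x) (cidx L x) by [].
rewrite e1 e2 e3 /sum3.
have [x0|x0] := leP 0 x.
  have -> : cidx L x = 0 by apply/(cellP l0); rewrite /cell/= in_itv/= mul0r add0r mul1r x0; lra.
  have [|-> -> ->] := far (0 - 1); first by left; rewrite mulN1r.
  have [|-> -> ->] := far (0 + 1); first by right; rewrite mul1r.
  by rewrite s0 s1 s2 !add0r !addr0.
have -> : cidx L x = -1.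
  by apply/(cellP l0); rewrite /cell/= in_itv/= mulN1r addNr mul0r x0 andbT; lra.
have [|-> -> ->] := far (-1 - 1); first by left; rewrite -opprD mulrNz; lra.
have [|-> -> ->] := far (-1); first by left; rewrite mulN1r.
by rewrite addNr s0 s1 s2 !add0r.
Qed.

Let w := prj (j0 JW).

Lemma JW_per : perF L (j0 JW) /\ perF L (j1 JW).
Proof.
split=> i x; have [a b _] := lsum_per x i; rewrite /JW /jadd /fadd /=.
  by rewrite -[X in _ + X = _]/(j0 (lsum L Tz) i (x + L)) a (perv (pv0 i)).
by rewrite -[X in _ + X = _]/(j1 (lsum L Tz) i (x + L)) b (perv (pv1 i)).
Qed.

Lemma JW_eval x i : - (L / 2) <= x < L / 2 -> j0 JW i x = j0 Jv i x + ct 0 x * j0 Jz i x.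
Proof. by move=> h; have [a _ _] := lsum_eval i h; rewrite /JW /jadd /fadd; congr (_ + _). Qed.

Lemma reduce (y : R) : exists k : int, - (L / 2) <= y - k%:~R * L < L / 2.
Proof.
pose k := Num.floor ((y + L / 2) / L); exists k; have l0 := L0.
have : k%:~R <= (y + L / 2) / L < (k + 1)%:~R by exact: floor_itv.
rewrite ler_pdivlMr// ltr_pdivrMr// intrD => /andP[a b]; apply/andP; split; lra.
Qed.

Lemma w_int (k : int) i x : j0 JW i (x + k%:~R * L) = j0 JW i x.
Proof. by apply: shift_int => y; have [h _] := JW_per. Qed.

Lemma z_uv i x : j0 Jz i x = emb u i x - emb v i x.
Proof. by have [_ e1 _] := ku; have [_ e2 _] := kv; rewrite /= /fsub e1 e2. Qed.

Lemma W_bound : bpair w (3 * M).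
Proof.
have key i x : ~~ i.2 -> `|j0 JW i x| <= 3 * M.
  move=> hi; have [k hk] := reduce x; rewrite -(subrK (k%:~R * L) x) w_int JW_eval// z_uv.
  set y := x - _; have [v1 v2] := bv y; have [u1 u2] := bu y.
  have [_ -> _] := kv; have c1 := ct_bound y (isT : (0 <= 2)%N).
  have a : `|emb v i y| <= M /\ `|emb u i y| <= M by case: i hi => [[] []].
  case: a => a1 a2; apply: (le_trans (ler_normD _ _)); rewrite normrM.
  have := ler_normB (emb u i y) (emb v i y); have := normr_ge0 (emb u i y - emb v i y).
  set s := `|emb u i y - _|; set t := `|ct 0 y| in c1 * => s0 hs.
  have : t * s <= s by rewrite ler_piMl.
  lra.
by move=> x; split; exact: key.
Qed.

Lemma W_core y : `|y| <= L / 6 -> w y = u y.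
Proof.
move=> h; have l0 := L0; have hy : - (L / 2) <= y < L / 2.
  by move: h; rewrite ler_norml => /andP[a b]; apply/andP; split; lra.
rewrite /w /prj !JW_eval// (ct_core h) !mul1r !z_uv; have [_ -> _] := kv.
by rewrite !(addrC (emb v _ _)) !subrK /emb /=; case: (u y).
Qed.

(** The point may leave the fundamental period by at most r <= L/6, so it is reduced by -1, 0 or 1
    periods, and in each case lands where z is small. *)
Lemma W_far (eta X r : R) : (forall i x, X <= `|x| -> `|j0 Jz i x| <= eta) -> 0 <= r ->
  X <= L / 6 - 2 * r -> 6 * r <= L -> forall y, L / 6 - 2 * r <= `|y| -> `|y| <= L / 2 + r ->
  forall i, `|j0 JW i y - j0 Jv i y| <= eta.
Proof.
move=> HX r0 hX rL y y1 y2 i; have l0 := L0; have [k hk] := reduce y.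
have [k1 k2] : (k < 2)%R /\ (-2 < k)%R.
  move: y2 hk; rewrite ler_norml => /andP[a b] /andP[c d].
  split; rewrite -(ltr_int R) -(ltr_pM2r l0) ?intrN; [rewrite -[2%:~R]/(2 : R)|rewrite -[2%:~R]/(2 : R)]; lra.
have e : j0 JW i y = j0 JW i (y - k%:~R * L) by rewrite -{1}(subrK (k%:~R * L) y) w_int.
have ev : j0 Jv i y = j0 Jv i (y - k%:~R * L).
  by rewrite -{1}(subrK (k%:~R * L) y) shift_int//; exact: perv (pv0 i).
rewrite e ev JW_eval// addrC addKr normrM.
have c1 := ct_bound (y - k%:~R * L) (isT : (0 <= 2)%N).
apply: (@le_trans _ _ `|j0 Jz i (y - k%:~R * L)|); first by rewrite ler_piMl.
apply: HX; apply: (le_trans hX).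
have [k0|[k0|k0]] : k = 0 \/ k = 1 \/ k = -1 by clear -k1 k2; lia.
- by rewrite k0 mul0r subr0.
- rewrite k0 mul1r; move: y2 hk; rewrite k0 mul1r ler_norml => /andP[a b] /andP[c d].
  by rewrite ler0_norm; lra.
- rewrite k0 mulN1r opprK; move: y2 hk; rewrite k0 mulN1r opprK ler_norml => /andP[a b] /andP[c d].
  by rewrite ger0_norm; lra.
Qed.

Lemma mf_resid : mfF (resid K eps JW).
Proof.
have [m0 m1 m2] := jet_mf JW_ok; move=> i; apply: mfD; last first.
  apply: mf_cont; apply: cont_Nk; split; [have [c _] := D2_cont (JW_ok (false, false))|have [c _] := D2_cont (JW_ok (true, false))]; exact: c.
by apply: mfD; apply: mfM => //; [exact: mf_cst|apply: mf_cont; exact: cont_cck].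
Qed.

(** The equation of [v] holds at every point and determines the second derivative from periodic
    quantities. *)
Lemma j2v_per : perF T (j2 Jv).
Proof.
have [_ ev eq] := kv; have pv x : v (x + T) = v x.
  have a := pv0 (false, false) x; have b := pv0 (true, false) x.
  by move: a b; rewrite ev /emb /=; case: (v x) (v (x + T)) => [? ?] [? ?] /= -> ->.
move=> i x; have := eq i (x + T); have := eq i x; rewrite /lin cck_per Nk_per pv pv1 => a b.
by apply: (mulfI (lt0r_neq0 (ddk_gt0 K i))); lra.
Qed.

Lemma resid_per : perF L (resid K eps JW).
Proof.
have [p0 p1] := JW_per.
move=> i x; rewrite /resid /lin p1 {1}/prj !p0.
have [_ _ a] := lsum_per x i.
have -> : j2 JW i (x + L) = j2 JW i x.
  by rewrite /JW /jadd /fadd /= -[X in _ + X = _]/(j2 (lsum L Tz) i (x + L)) a (perv (j2v_per i)).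
rewrite (perv (cck_per K eps i)); congr (_ + _).
by rewrite /Nk (perv (kg_per K)).
Qed.

(** Both [u] and [v] solve the equation, so the second derivatives cancel. What remains is the
    failure of the nonlinearity to commute with gluing, and terms with derivatives of the
    cut-off. *)
Lemma residE x i : - (L / 2) <= x < L / 2 -> resid K eps JW i x =
  (Nk K eps i x (w x) - Nk K eps i x (v x)) - ct 0 x * (Nk K eps i x (u x) - Nk K eps i x (v x))
  + (ddk K i * (2 * (ct 1 x * j1 Jz i x) + ct 2 x * j0 Jz i x) + cck K eps i x * (ct 1 x * j0 Jz i x)).
Proof.
move=> h; have [_ a1 a2] := lsum_eval i h; have [_ _ eu] := ku; have [_ _ ev] := kv.
have := eu i x; have := ev i x; rewrite /resid -/w /lin.
have -> : j1 JW i x = j1 Jv i x + j1 jz i x by rewrite -a1.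
have -> : j2 JW i x = j2 Jv i x + j2 jz i x by rewrite -a2.
rewrite /jz /jmul /= /fsub.
set Nu := Nk _ _ _ _ (u x); set Nv := Nk _ _ _ _ (v x) => E1 E2.
have -> : Nu = - (ddk K i * j2 Ju i x + cck K eps i x * j1 Ju i x) by lra.
have -> : Nv = - (ddk K i * j2 Jv i x + cck K eps i x * j1 Jv i x) by lra.
ring.
Qed.

Lemma resid_core x i : `|x| < L / 6 -> resid K eps JW i x = 0.
Proof.
move=> h; have l0 := L0; have [c1 c2] := ct_core12 h.
rewrite residE; last by move: h; rewrite ltr_norml => /andP[a b]; apply/andP; split; lra.
by rewrite (ct_core (ltW h)) c1 c2 (W_core (ltW h)); ring.
Qed.

Lemma resid_le (CN Cc Dm : R) : 0 <= CN -> 0 <= Cc -> 0 <= Dm -> (forall i, `|ddk K i| <= Dm) ->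
  (forall i x, `|cck K eps i x| <= Cc) ->
  (forall i x (y y' : R * R), `|y.1| <= 3 * M -> `|y.2| <= 3 * M -> `|y'.1| <= 3 * M -> `|y'.2| <= 3 * M ->
    `|Nk K eps i x y - Nk K eps i x y'| <= CN * (`|y.1 - y'.1| + `|y.2 - y'.2|)) ->
  forall x, - (L / 2) <= x < L / 2 -> sq (resid K eps JW) x <=
    3 * (32 * CN ^+ 2 + (Dm + Cc) ^+ 2 + 4 * Dm ^+ 2) * (sq (j0 Jz) x + sq (j1 Jz) x).
Proof.
move=> CN0 Cc0 Dm0 hD hC hN x hx.
pose s := `|j0 Jz (false, false) x| + `|j0 Jz (true, false) x|.
have c0 := ct_bound x (isT : (0 <= 2)%N); have c1 := ct_bound x (isT : (1 <= 2)%N); have c2 := ct_bound x (isT : (2 <= 2)%N).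
have M0 : 0 <= M by have [h _] := bu 0; exact: le_trans h.
have M3 (t : R) : `|t| <= M -> `|t| <= 3 * M by move=> h; apply: (le_trans h); lra.
have [u1 u2] := bu x; have [v1 v2] := bv x; have [w1 w2] := W_bound x.
have s0 : 0 <= s by apply: addr_ge0; exact: normr_ge0.
have mul1 (t y : R) : `|t| <= 1 -> `|t * y| <= `|y| by move=> ht; rewrite normrM ler_piMl.
have N1' i : `|Nk K eps i x (w x) - Nk K eps i x (v x)| <= CN * s.
  have hh := hN i x (w x) (v x) w1 w2 (M3 _ v1) (M3 _ v2).
  apply: (le_trans hh); apply: ler_wpM2l => //.
  have d1 : (w x).1 - (v x).1 = ct 0 x * j0 Jz (false, false) x.
    transitivity (j0 JW (false, false) x - emb v (false, false) x); first by [].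
    by rewrite JW_eval//; have [_ -> _] := kv; ring.
  have d2 : (w x).2 - (v x).2 = ct 0 x * j0 Jz (true, false) x.
    transitivity (j0 JW (true, false) x - emb v (true, false) x); first by [].
    by rewrite JW_eval//; have [_ -> _] := kv; ring.
  by rewrite d1 d2; apply: lerD; exact: mul1.
have N2' i : `|Nk K eps i x (u x) - Nk K eps i x (v x)| <= CN * s.
  have hh := (hN i x (u x) (v x) (M3 _ u1) (M3 _ u2) (M3 _ v1) (M3 _ v2)).
  apply: (le_trans hh); apply: ler_wpM2l => //.
  by rewrite /s !z_uv /emb /=.
have bdi i : `|resid K eps JW i x| <= 2 * CN * s + (Dm + Cc) * `|j0 Jz i x| + 2 * Dm * `|j1 Jz i x|.
  rewrite residE//; set z0 := `|j0 Jz i x|; set z1 := `|j1 Jz i x|.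
  have k1 : `|ct 0 x * (Nk K eps i x (u x) - Nk K eps i x (v x))| <= CN * s by apply: (le_trans (mul1 _ _ c0)).
  have k2 : `|2 * (ct 1 x * j1 Jz i x) + ct 2 x * j0 Jz i x| <= 2 * z1 + z0.
    apply: (le_trans (ler_normD _ _)); apply: lerD; last exact: mul1.
    by rewrite normrM normr_nat ler_pM2l//; exact: mul1.
  have k3 : `|ddk K i * (2 * (ct 1 x * j1 Jz i x) + ct 2 x * j0 Jz i x)| <= Dm * (2 * z1 + z0).
    by rewrite normrM; apply: ler_pM.
  have k4 : `|cck K eps i x * (ct 1 x * j0 Jz i x)| <= Cc * z0.
    by rewrite normrM; apply: ler_pM => //; exact: mul1.
  move: k1 k3 k4 (N1' i); set A := ct 0 x * _; set B := ddk K i * _; set D := cck K eps i x * _.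
  set E := Nk _ _ _ _ _ - _ => k1 k3 k4 k5.
  apply: (le_trans (ler_normD _ _)); have := ler_normB E A; have := ler_normD B D; lra.
have cauchy3 (a b c : R) : (a + b + c) ^+ 2 <= 3 * (a ^+ 2 + b ^+ 2 + c ^+ 2).
  have := sqr_ge0 (a - b); have := sqr_ge0 (a - c); have := sqr_ge0 (b - c).
  by rewrite (_ : (a + b + c) ^+ 2 = a ^+ 2 + b ^+ 2 + c ^+ 2 + 2 * (a * b) + 2 * (a * c) + 2 * (b * c)); [rewrite !sqrrB; lra|ring].
have ssq : s ^+ 2 <= 2 * sq (j0 Jz) x.
  have := sqr_ge0 (`|j0 Jz (false, false) x| - `|j0 Jz (true, false) x|).
  rewrite /s /sq sum4 sqrrB sqrrD !real_normK ?num_real//.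
  have := sqr_ge0 (j0 Jz (false, true) x); have := sqr_ge0 (j0 Jz (true, true) x); lra.
apply: (@le_trans _ _ (\sum_i 3 * (4 * CN ^+ 2 * s ^+ 2 + (Dm + Cc) ^+ 2 * j0 Jz i x ^+ 2 + 4 * Dm ^+ 2 * j1 Jz i x ^+ 2))).
  apply: ler_sum => i _; rewrite -[leLHS]real_normK ?num_real//.
  have r0 : 0 <= 2 * CN * s + (Dm + Cc) * `|j0 Jz i x| + 2 * Dm * `|j1 Jz i x|.
    by apply: addr_ge0; [apply: addr_ge0|]; rewrite !mulr_ge0// addr_ge0.
  apply: (@le_trans _ _ ((2 * CN * s + (Dm + Cc) * `|j0 Jz i x| + 2 * Dm * `|j1 Jz i x|) ^+ 2)).
    by rewrite lerXn2r// nnegrE.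
  apply: (le_trans (cauchy3 _ _ _)); rewrite ler_pM2l// !exprMn !real_normK ?num_real//.
  by rewrite le_eqVlt; apply/orP; left; apply/eqP; ring.
rewrite -mulr_sumr !big_split/= sumr_const card_prod card_bool -!mulr_sumr -/(sq (j0 Jz) x) -/(sq (j1 Jz) x).
have n4 (t : R) : t *+ (2 * 2) = 4 * t by rewrite mulr_natl.
rewrite n4 -[sq (fsub (j0 Ju) (j0 Jv)) x]/(sq (j0 Jz) x) -[sq (fsub (j1 Ju) (j1 Jv)) x]/(sq (j1 Jz) x).
have cn2 := sqr_ge0 CN; have d2 := sqr_ge0 Dm; have dc2 := sqr_ge0 (Dm + Cc).
have z0 := sq_ge0 (j0 Jz) x; have z1 := sq_ge0 (j1 Jz) x.
move: cn2 d2 dc2 z0 z1 ssq; move: (CN ^+ 2) (Dm ^+ 2) ((Dm + Cc) ^+ 2) (sq _ x) (sq _ x) (s ^+ 2).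
move=> a c b x0 x1 y a0 c0' b0 x00 x10 yx.
have := ler_wpM2l a0 yx; have := mulr_ge0 a0 x10; have := mulr_ge0 b0 x10; have := mulr_ge0 c0' x00.
lra.
Qed.

(** The residual vanishes where the cut-off is one, and elsewhere on the period it is controlled by
    z and its derivative. Its squared norm is thus bounded by a tail of z. *)
Lemma q_resid_le (CN Cc Dm : R) : 0 <= CN -> 0 <= Cc -> 0 <= Dm -> (forall i, `|ddk K i| <= Dm) ->
  (forall i x, `|cck K eps i x| <= Cc) ->
  (forall i x (y y' : R * R), `|y.1| <= 3 * M -> `|y.2| <= 3 * M -> `|y'.1| <= 3 * M -> `|y'.2| <= 3 * M ->
    `|Nk K eps i x y - Nk K eps i x y'| <= CN * (`|y.1 - y'.1| + `|y.2 - y'.2|)) ->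
  (q (ico 0 L) (resid K eps JW) <= (3 * (32 * CN ^+ 2 + (Dm + Cc) ^+ 2 + 4 * Dm ^+ 2))%:E *
     (q [set x | L / 6 <= `|x|]%R (j0 Jz) + q [set x | L / 6 <= `|x|]%R (j1 Jz)))%E.
Proof.
move=> CN0 Cc0 Dm0 hD hC hN; have l0 := L0; have mr := mf_resid; have pr := resid_per.
set Cr := 3 * _; have Cr0 : 0 <= Cr.
  by rewrite /Cr; have := sqr_ge0 CN; have := sqr_ge0 (Dm + Cc); have := sqr_ge0 Dm; lra.
have ms : mf (sq (resid K eps JW)) by exact: mf_sq.
have ps x : sq (resid K eps JW) (x + L) = sq (resid K eps JW) x by apply: eq_bigr => i _; rewrite pr.
have [m0 m1 _] := jet_mf okz.
have mD : measurable ([set x | L / 6 <= `|x|] : set R).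
  rewrite (_ : [set x | _] = (fun x : R => `|x|) @^-1` `[L / 6, +oo[%classic); last first.
    by apply/seteqP; split => x /=; rewrite in_itv/= andbT.
  by rewrite -[X in measurable X]setTI; exact: (mf_norm (@measurable_id _ R setT) measurableT (measurable_itv _)).
have -> : q (ico 0 L) (resid K eps JW) = q (ico (- (L / 2)) (L / 2)) (resid K eps JW).
  rewrite /q /ico (@qi_cat _ 0 (L / 2) L)//; [|lra|lra|exact: sq_ge0].
  rewrite (@qi_cat _ (- (L / 2)) 0 (L / 2))//; [|lra|lra|exact: sq_ge0].
  rewrite addeC; congr (_ + _)%E; rewrite -!/(ico _ _).
  by rewrite -(qi_period (- (L / 2)) 0 ms (sq_ge0 _) ps) add0r (_ : - (L / 2) + L = L / 2)//; lra.
rewrite /q -qiD//; [|exact: mf_sq|exact: mf_sq|exact: sq_ge0|exact: sq_ge0].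
have mg : mf (fun x => sq (j0 Jz) x + sq (j1 Jz) x) by apply: mfD; exact: mf_sq.
have g0 x : 0 <= sq (j0 Jz) x + sq (j1 Jz) x by apply: addr_ge0; exact: sq_ge0.
rewrite -qiZ//.
have mI : measurable (ico (- (L / 2)) (L / 2)) by exact: measurable_itv.
rewrite /qi [leLHS]integral_mkcond [leRHS]integral_mkcond; apply: ge0_le_integral => //.
- by move=> x _; rewrite patchE; case: ifP => // _; rewrite lee_fin sq_ge0.
- by apply/(measurable_restrictT _ mI); apply: measurable_funTS; exact: mf_EFin.
- apply/(measurable_restrictT _ mD); apply: measurable_funTS; apply: mf_EFin.
  by apply: mfM => //; exact: mf_cst.
move=> x _; rewrite !patchE.
have R0 : (0 <= (Cr * (sq (j0 Jz) x + sq (j1 Jz) x))%:E)%E by rewrite lee_fin mulr_ge0.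
case: ifPn => [/set_mem hx|_]; last by case: ifP => // _.
have hx' : - (L / 2) <= x < L / 2 by move: hx; rewrite /ico/= in_itv.
have bd := resid_le CN0 Cc0 Dm0 hD hC hN hx'.
case: ifPn => [_|/negP nf]; first by rewrite lee_fin.
have [far|core] := leP (L / 6) `|x|; first by case: nf; apply/mem_set.
by rewrite lee_fin /sq big1// => i _; rewrite resid_core// expr0n.
Qed.

End Glue.

(** * Periodic solutions and their local closeness to the multipulse *)

Section PeriodicSolutions.
Variables (R : realType) (K : klausmeier R) (eps : R).
Local Notation mu := (@lebesgue_measure R).
Local Notation fld := (I4 -> R -> R).
Local Notation jet := (jet R I4).
Local Notation T := (kT K).
Implicit Types (w : R -> R * R).

Lemma sq_re (F : fld) x : F (false, false) x ^+ 2 + F (true, false) x ^+ 2 <= sq F x.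
Proof.
by rewrite /sq sum4; have := sqr_ge0 (F (false, true) x); have := sqr_ge0 (F (true, true) x); lra.
Qed.

(** Every window of [w1] is matched by some window of [w2]; the converse is a separate statement.
    Shifts are multiples of T, so that f and g are unchanged. *)
Definition close (eta r : R) w1 w2 : Prop := forall x0 : R, exists k : int, forall x, `|x - x0| <= r ->
  `|(w1 x).1 - (w2 (x + k%:~R * T)).1| <= eta /\ `|(w1 x).2 - (w2 (x + k%:~R * T)).2| <= eta.

Lemma Bk_close (M eta x y : R) w1 w2 i k : 0 <= eta -> bpair w1 M -> bpair w2 M -> kg K y = kg K x ->
  `|(w1 x).1 - (w2 y).1| <= eta -> `|(w1 x).2 - (w2 y).2| <= eta ->
  `|Bk K eps w1 i k x - Bk K eps w2 i k y| <= 4 * M * eta.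
Proof.
move=> e0 b1 b2 gxy; have [h1 h2] := b1 x; have [h3 h4] := b2 y.
rewrite /Bk gxy; case: (w1 x) h1 h2 => w p /= hw hp; case: (w2 y) h3 h4 => w' p' /= hw' hp' hd1 hd2.
have M0 : 0 <= M by exact: le_trans hw.
have Me := mulr_ge0 M0 e0.
have q1 : `|p ^+ 2 - p' ^+ 2| <= 2 * M * eta.
  rewrite subr_sqr mulrC normrM; apply: ler_pM => //.
  by apply: (le_trans (ler_normD _ _)); lra.
have q2 : `|2 * w * p - 2 * w' * p'| <= 4 * M * eta.
  have -> : 2 * w * p - 2 * w' * p' = 2 * (w * (p - p') + (w - w') * p') by ring.
  rewrite normrM normr_nat; have := ler_normD (w * (p - p')) ((w - w') * p'); rewrite !normrM.
  have : `|w| * `|p - p'| <= M * eta by apply: ler_pM.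
  have : `|w - w'| * `|p'| <= eta * M by apply: ler_pM.
  lra.
case: (_ == _); last by rewrite subrr normr0; lra.
case: i.1; case: k.1 => //=.
- by rewrite (_ : - km K + 2 * w * p - (- km K + 2 * w' * p') = 2 * w * p - 2 * w' * p')//; ring.
- by apply: (le_trans q1); lra.
- by rewrite opprK addrC distrC.
- rewrite (_ : eps * kg K x - 1 - p ^+ 2 - (eps * kg K x - 1 - p' ^+ 2) = - (p ^+ 2 - p' ^+ 2)); last by ring.
  by rewrite normrN; apply: (le_trans q1); lra.
Qed.

Lemma close_window (M eta r a b : R) w1 w2 : 0 <= eta -> bpair w1 M -> bpair w2 M -> close eta r w1 w2 ->
  forall x0 : R, exists2 sg, (forall i x, cck K eps i (x + sg) = cck K eps i x) &
    forall i k x, `|x - x0| <= r ->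
      `|Bl (Bk K eps w1) a b i k x - Bl (Bk K eps w2) a b i k (x + sg)| <= 4 * M * eta.
Proof.
move=> e0 b1 b2 H x0; have [k hk] := H x0; exists (k%:~R * T).
  by move=> i x; apply: shift_int => y; exact: cck_per.
move=> i j x hx; rewrite /Bl (_ : _ - _ = Bk K eps w1 i j x - Bk K eps w2 i j (x + k%:~R * T)); last by ring.
have [h1 h2] := hk x hx; apply: Bk_close => //.
by apply: shift_int => y; exact: kg_per.
Qed.

Section Closeness.
Variables (u v : R -> R * R) (Ju Jv : jet).
Hypotheses (ku : kjet K eps u Ju) (kv : kjet K eps v Jv).
Hypotheses (pv0 : perF T (j0 Jv)) (pv1 : perF T (j1 Jv)).
Let Jz := jsub Ju Jv.
Variables (n : nat) (chi : R -> R).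
Hypotheses (n3 : (3 <= n)%N) (Hc : periodic_cutoff K n chi).
Let L : R := n%:R * T.
Variables (eta X r : R).
Hypotheses (HX : forall i x, X <= `|x| -> `|j0 Jz i x| <= eta) (r0 : 0 <= r) (eta0 : 0 <= eta).
Hypotheses (hX : X <= L / 6 - 2 * r) (rL : 6 * r <= L).
Let W := prj (j0 (JW K Ju Jv n chi)).

Let n0 : (0 < n)%N. Proof. exact: leq_trans n3. Qed.
Let T0 : 0 < T := kT_gt0 K.
Let L0 : 0 < L. Proof. by rewrite /L mulr_gt0// ltr0n. Qed.

Let vk (k : int) x : v (x + k%:~R * T) = v x.
Proof.
have [_ ev _] := kv; have s i : j0 Jv i (x + k%:~R * T) = j0 Jv i x by apply: shift_int; exact: pv0.
have a := s (false, false); have b := s (true, false).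
by move: a b; rewrite ev /emb /=; case: (v x) (v _) => [? ?] [? ?] /= -> ->.
Qed.

Let zsmall x : X <= `|x| -> `|(u x).1 - (v x).1| <= eta /\ `|(u x).2 - (v x).2| <= eta.
Proof.
move=> h; have := HX (false, false) h; have := HX (true, false) h.
by rewrite !(z_uv ku kv) /emb.
Qed.

Let Wfar y : L / 6 - 2 * r <= `|y| -> `|y| <= L / 2 + r ->
  `|(W y).1 - (v y).1| <= eta /\ `|(W y).2 - (v y).2| <= eta.
Proof.
move=> h1 h2; have H := W_far pv0 pv1 n0 Hc HX r0 hX rL h1 h2.
have [_ ev _] := kv; have := H (false, false); have := H (true, false).
by rewrite ev /emb.
Qed.

(** In the core the profile coincides with [u]. Elsewhere it is near [v], as is [u] far out on the
    line, and the T-periodicity of [v] makes the two places comparable; two errors [eta] add up. *)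
Lemma close_glued : close (2 * eta) r W u.
Proof.
have e0 := eta0; have rr := r0; have hX' := hX; have rL' := rL; have l0 := L0.
move=> x0; have [m hm] := reduce K n0 x0; rewrite -/L in hm.
have Wm x : W x = W (x - m%:~R * L).
  by rewrite /W /prj -{1 2}(subrK (m%:~R * L) x) !(w_int Ju pv0 pv1 chi n0).
set y0 := x0 - m%:~R * L in hm.
have [core|far] := leP `|y0| (L / 6 - r).
  exists (- (m * n%:Z)) => x hx.
  have -> : x + (- (m * n%:Z))%:~R * T = x - m%:~R * L.
    by rewrite intrN intrM /L -[n%:~R]/(n%:R); ring.
  have hy : `|x - m%:~R * L| <= L / 6.
    have -> : x - m%:~R * L = (x - x0) + y0 by rewrite /y0; ring.
    by apply: (le_trans (ler_normD _ _)); lra.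
  have E : W (x - m%:~R * L) = u (x - m%:~R * L) := W_core ku kv n0 Hc hy.
  by rewrite Wm E !subrr normr0; split; rewrite mulr_ge0.
(* The shift is large enough to push the whole window into the region where [u] is near [v]. *)
pose k := Num.floor ((`|X| + `|x0| + r) / T) + 1.
have hk : `|X| + `|x0| + r <= k%:~R * T.
  by rewrite -ler_pdivrMr//; apply: ltW; have /andP[] := floor_itv ((`|X| + `|x0| + r) / T).
exists k => x hx; set y := x - m%:~R * L.
have yy : `|y - y0| <= r by rewrite /y /y0 (_ : _ - _ = x - x0)//; ring.
have y2 : `|y| <= L / 2 + r.
  have : `|y0| <= L / 2 by move: hm => /andP[a b]; rewrite ler_norml; apply/andP; split; lra.
  have := ler_normD (y - y0) y0; rewrite subrK; lra.
have y1 : L / 6 - 2 * r <= `|y|.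
  have := ler_normB y (y - y0); rewrite subKr; lra.
have [w1 w2] := Wfar y1 y2.
have vy : v y = v x.
  by rewrite /y /L (_ : x - m%:~R * (n%:R * T) = x + (- (m * n%:Z))%:~R * T) ?vk// intrN intrM -[n%:~R]/(n%:R); ring.
have xl : `|X| <= `|x + k%:~R * T|.
  apply: le_trans (ler_norm _); move: hx; rewrite ler_norml => /andP[a b].
  by have := ler_norm (- x0); rewrite normrN; lra.
have [z1 z2] := zsmall (le_trans (ler_norm X) xl).
rewrite vk in z1 z2; rewrite vy in w1 w2; rewrite Wm -/y.
by split; [move: w1 z1|move: w2 z2]; rewrite !ler_norml => /andP[? ?] /andP[? ?]; apply/andP; split; lra.
Qed.

Variable w : R -> R * R.
Hypothesis hw : forall x, `|(w x).1 - (W x).1| <= eta /\ `|(w x).2 - (W x).2| <= eta.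

Lemma close_to : close (3 * eta) r w u.
Proof.
move=> x0; have [k hk] := close_glued x0; exists k => x hx; have [a b] := hk x hx; have [c d] := hw x.
by split; [move: a c|move: b d]; rewrite !ler_norml => /andP[? ?] /andP[? ?]; apply/andP; split; lra.
Qed.

(** Windows of [u] in the core are matched in place. A window farther out shows [v], which also
    occurs in the profile near L/2. *)
Lemma close_from : close (3 * eta) r u w.
Proof.
have e0 := eta0; have rr := r0; have hX' := hX; have rL' := rL; have l0 := L0.
move=> x0; have [core|far] := leP `|x0| (L / 6 - r).
  exists 0 => x hx; rewrite mul0r addr0.
  have hy : `|x| <= L / 6 by rewrite -(subrK x0 x); apply: (le_trans (ler_normD _ _)); lra.
  have [c d] := hw x; rewrite /W (W_core ku kv n0 Hc hy) in c d.
  by split; rewrite distrC; lra.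
(* Some multiple of T moves [x0] to within T below L/2, and T <= L/3 keeps the window away from the
   core. *)
have nT : 3 * T <= L by rewrite /L; apply: ler_wpM2r; [exact: ltW|rewrite ler_nat].
pose k := Num.floor ((L / 2 - x0) / T); exists k => x hx.
have : k%:~R <= (L / 2 - x0) / T < (k + 1)%:~R by exact: floor_itv.
rewrite ler_pdivlMr// ltr_pdivrMr// intrD => /andP[k1 k2].
set y := x + k%:~R * T; move: (hx); rewrite ler_norml => /andP[x1 x2].
have y0 : 0 <= y by rewrite /y; lra.
have [w1 w2] := @Wfar y (ltac:(rewrite ger0_norm// /y; lra)) (ltac:(rewrite ger0_norm// /y; lra)).
have xX : X <= `|x|.
  by have := ler_normB x (x - x0); rewrite subKr; lra.
have [z1 z2] := zsmall xX; have [c d] := hw y.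
rewrite /y vk -/y in w1 w2.
by split; [move: w1 z1 c|move: w2 z2 d]; rewrite !ler_norml => /andP[? ?] /andP[? ?] /andP[? ?]; apply/andP; split; lra.
Qed.

End Closeness.

(** The equation makes the second derivative continuous, so all derivatives involved are bounded on
    a period. *)
Lemma H2per_stationary (L : R) u : 0 < L -> stationary K eps u -> periodic u L -> H2per L u.
Proof.
move=> L0 su pu; split => //; have [J [ok ej eq]] := stationary_kjet su.
have cu := cont_emb ok ej.
have c2 i : continuous (j2 J i).
  have -> : j2 J i = (fun x => - (cck K eps i x * j1 J i x + Nk K eps i x (u x)) / ddk K i).
    apply/funext => x; have := eq i x; rewrite /lin => e.
    have -> : - (cck K eps i x * j1 J i x + Nk K eps i x (u x)) = ddk K i * j2 J i x by lra.
    by rewrite mulrAC divff ?mul1r// gt_eqF// ddk_gt0.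
  have [_ c1] := D2_cont (ok i).
  move=> x; apply: cvgM; last exact: cvg_cst.
  apply: cvgN; apply: cvgD; last exact: cont_Nk.
  by apply: cvgM; [exact: cont_cck|exact: c1].
pose D : set R := `]0, L[%classic.
have fin (F : fld) : mfF F -> (forall i, continuous (F i)) -> (q D F < +oo)%E.
  move=> mF cF; apply: (@le_lt_trans _ _ (q (ico 0 L) F)).
    apply: q_sub => //; [exact: measurable_itv|exact: measurable_itv|] => x.
    by rewrite /ico/= !in_itv/= => /andP[a b]; rewrite (ltW a).
  have cs : continuous (sq F).
    have -> : sq F = (fun x => F (false, false) x ^+ 2 + F (false, true) x ^+ 2 + (F (true, false) x ^+ 2 + F (true, true) x ^+ 2)).
      by apply/funext => x; rewrite /sq sum4.
    by move=> x; apply: cvgD; apply: cvgD; apply: contX.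
  by rewrite /q /ico -itg_qi; [rewrite ltry|exact: lint_cont|exact: sq_ge0].
have [m0 m1 m2] := jet_mf ok.
have H := jet_H2F (measurable_itv `]0, L[) ok (fin _ m0 (fun i => (D2_cont (ok i)).1))
  (fin _ m1 (fun i => (D2_cont (ok i)).2)) (fin _ m2 c2).
have e1 : (fun x => (u x).1) = j0 J (false, false) by rewrite ej.
have e2 : (fun x => (u x).2) = j0 J (true, false) by rewrite ej.
by rewrite /all2c e1 e2; split; exact: H.
Qed.

Lemma H2per_jet (L r0 r1 : R) J : 0 < L -> jetok J -> perF L (j0 J) ->
  (q (ico 0 L) (j0 J) + q (ico 0 L) (j1 J) <= r0%:E)%E -> (q (ico 0 L) (j2 J) <= r1%:E)%E ->
  H2per L (prj (j0 J)) /\ H2per_norm L (prj (j0 J)) <= Num.sqrt (r0 + r1).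
Proof.
move=> L0 ok p0 h01 h2; have [m0 m1 m2] := jet_mf ok.
pose D : set R := `]0, L[%classic; have mD : measurable D by exact: measurable_itv.
have DI F : mfF F -> (q D F <= q (ico 0 L) F)%E.
  move=> mF; apply: q_sub => //; [exact: measurable_itv|] => x.
  by rewrite /D /ico/= !in_itv/= => /andP[a b]; rewrite (ltW a).
have f01 : (q D (j0 J) + q D (j1 J) <= r0%:E)%E by apply: le_trans h01; apply: leeD; exact: DI.
have f2' : (q D (j2 J) <= r1%:E)%E by apply: le_trans h2; exact: DI.
have f0 : (q D (j0 J) < +oo)%E by apply: (fin_le4 (r := r0)); apply: le_trans f01; rewrite leeDl// q_ge0.
have f1 : (q D (j1 J) < +oo)%E by apply: (fin_le4 (r := r0)); apply: le_trans f01; rewrite leeDr// q_ge0.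
have f2 := fin_le4 f2'.
have H := jet_H2F mD ok f0 f1 f2.
split.
  split; first by move=> x; rewrite /prj !p0.
  exact: (conj (H (false, false)) (H (true, false))).
have [t [_ jo]] := jet_twd ok.
have w i : [/\ mf (j0 J i), mf (wD (j0 J i)) & mf (wD (wD (j0 J i)))] by exact: twd_mf.
rewrite /H2per_norm /H2norm ler_wsqrtr// /Rintegral.
set h := (X in (fine (integral _ _ X))).
pose g x := (j0 J (false, false) x ^+ 2 + j0 J (true, false) x ^+ 2) +
  (wD (j0 J (false, false)) x ^+ 2 + wD (j0 J (true, false)) x ^+ 2) +
  (wD (wD (j0 J (false, false))) x ^+ 2 + wD (wD (j0 J (true, false))) x ^+ 2).
have -> : integral mu `]0, L[%classic h = qi D g by [].
have [a0 a1 a2] := w (false, false); have [b0 b1 b2] := w (true, false).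
have m2D (x y : R -> R) : mf x -> mf y -> mf (fun t => x t ^+ 2 + y t ^+ 2).
  by move=> mx my; apply: mfD; exact: mfX.
have mg : mf g by exact: (mfD (mfD (m2D _ _ a0 b0) (m2D _ _ a1 b1)) (m2D _ _ a2 b2)).
have g0 x : 0 <= g x by rewrite /g !addr_ge0// sqr_ge0.
have gle : (qi D g <= (r0 + r1)%:E)%E.
  apply: (@le_trans _ _ (qi D (fun x => sq (j0 J) x + sq (j1 J) x + sq (j2 J) x)%R)).
    apply: qi_le_ae => //; first by apply: mfD; [apply: mfD; exact: mf_sq|exact: mf_sq].
      by move=> x; apply: addr_ge0; [apply: addr_ge0|]; exact: sq_ge0.
    apply: (ae_imp jo) => x hx _; have [e1 e2] := hx (false, false); have [e3 e4] := hx (true, false).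
    rewrite /g e1 e2 e3 e4.
    by apply: lerD; [apply: lerD|]; exact: sq_re.
  rewrite qiD//; [|by apply: mfD; exact: mf_sq|exact: mf_sq|by move=> x; apply: addr_ge0; exact: sq_ge0|exact: sq_ge0].
  rewrite qiD//; [|exact: mf_sq|exact: mf_sq|exact: sq_ge0|exact: sq_ge0].
  by rewrite EFinD; apply: leeD.
have := qi_ge0 D g0; by case: (qi D g) gle => // s; rewrite lee_fin.
Qed.

Definition vanishing (kappa : nat -> R) : Prop := forall e, 0 < e -> exists N : nat, forall n, (N <= n)%N -> kappa n <= e.

Lemma Bl0 (B : I4 -> I4 -> R -> R) : Bl B 0 0 = B.
Proof.
apply/funext => i; apply/funext => k; apply/funext => x; rewrite /Bl /Ml oppr0.
by case: ifP => _; rewrite ?subr0//; case: ifP; rewrite ?subr0//; case: ifP; rewrite ?subr0.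
Qed.

(** Besides the solutions, this records what the spectral part needs: bounds common to all [n], and
    closeness in both directions on windows of every radius. *)
Theorem periodic_solutions (u v z : R -> R * R) (chi : nat -> R -> R) (nchi : nat) (K0 : R) :
  stationary K eps u -> (forall x, u x = z x + v x) -> H2line z -> periodic v T ->
  0 <= K0 -> INV (Lk K eps u 0 0) K0 -> (forall n, (nchi <= n)%N -> periodic_cutoff K n (chi n)) ->
  exists (N : nat) (kappa : nat -> R) (a un : nat -> R -> R * R) (M : R),
  [/\ vanishing kappa, 0 <= M, bpair u M /\ cpair u,
    forall n, (N <= n)%N -> [/\ H2per (n%:R * T) (a n), H2per (n%:R * T) (un n) /\ stationary K eps (un n),
      forall x : R, - (n%:R / 2 * T) <= x < n%:R / 2 * T ->
        un n x = chi n x *: u x + (1 - chi n x) *: v x + a n x,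
      H2per_norm (n%:R * T) (a n) <= kappa n & bpair (un n) M /\ cpair (un n)] &
    forall eta r, 0 < eta -> 0 <= r -> exists N', forall n, (N' <= n)%N -> close eta r u (un n) /\ close eta r (un n) u].
Proof.
move=> su uzv hz pv K00 Hinv Hchi; have T0 := kT_gt0 K.
have [Ju [Jv [Jz [ku kv LJz ejz [eJz [pv0 pv1] [M M0 [bu bv]] cv]]]]] := background su uzv hz pv.
have [oku eu _] := ku; have cu := cont_emb oku eu.
rewrite eJz in LJz ejz *; have [okz f0 f1 _] := LJz; have [mz0 mz1 _] := jet_mf okz.
have M30 : 0 <= 3 * M by lra.
have [CN CN0 HCN] := Nk_lip K eps M30.
have [Cc Cc0 hc] := cck_bound K eps.
have dm i : `|ddk K i| <= dmax K by rewrite gtr0_norm ?ddk_gt0// ddk_max.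
have dm0 : 0 <= dmax K by apply: le_trans (dm (true, true)).
pose Cr := 3 * (32 * CN ^+ 2 + (dmax K + Cc) ^+ 2 + 4 * dmax K ^+ 2).
have Cr0 : 0 <= Cr by rewrite /Cr; have := sqr_ge0 CN; have := sqr_ge0 (dmax K + Cc); have := sqr_ge0 (dmax K); lra.
have [rT [dl [KT [rT0 dl0 KT0 HT]]]] := transfer_period (dmin_gt0 K) (ddk_min K) (ddk_max K) dm0 Cc0 K00.
have [r0 [C1 [r00 C10 HS]]] := solve_period K eps M30 KT0.
pose D n : set R := [set x | n%:R * T / 6 <= `|x|].
have mD n : measurable (D n).
  rewrite (_ : D n = (fun x : R => `|x|) @^-1` `[n%:R * T / 6, +oo[%classic); last first.
    by apply/seteqP; split => x /=; rewrite in_itv/= andbT.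
  by rewrite -[X in measurable X]setTI; exact: (mf_norm (@measurable_id _ R setT) measurableT (measurable_itv _)).
pose tau n := fine (q (D n) (j0 (jsub Ju Jv)) + q (D n) (j1 (jsub Ju Jv))).
have tauE n : (q (D n) (j0 (jsub Ju Jv)) + q (D n) (j1 (jsub Ju Jv)))%E = (tau n)%:E.
  have [s0 e0 _] := real_of_fin (q_ge0 (D n) (j0 (jsub Ju Jv))) (le_lt_trans (q_sub (mD n) measurableT mz0 (@subsetT _ _)) f0).
  have [s1 e1 _] := real_of_fin (q_ge0 (D n) (j1 (jsub Ju Jv))) (le_lt_trans (q_sub (mD n) measurableT mz1 (@subsetT _ _)) f1).
  by rewrite /tau e0 e1.
have tau0 n : 0 <= tau n by rewrite -lee_fin -tauE adde_ge0// q_ge0.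
have nlarge (X : R) : exists N : nat, forall n, (N <= n)%N -> X <= n%:R * T.
  exists (Num.truncn (`|X| / T)).+1 => n hn; rewrite -ler_pdivrMr//.
  have : `|X| / T < (Num.truncn (`|X| / T)).+1%:R by exact: truncnS_gt.
  have : X / T <= `|X| / T by rewrite ler_pM2r ?invr_gt0//; exact: ler_norm.
  have : ((Num.truncn (`|X| / T)).+1%:R : R) <= n%:R by rewrite ler_nat.
  by lra.
have tauv : vanishing tau.
  move=> e e0; have e2 : 0 < e / 2 by lra.
  have [X0 H0] := qi_tail (mf_sq mz0) (sq_ge0 _) f0 e2.
  have [X1 H1] := qi_tail (mf_sq mz1) (sq_ge0 _) f1 e2.
  have [N HN] := nlarge (6 * (`|X0| + `|X1|)); exists N => n hn; have := HN n hn => hX.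
  rewrite -lee_fin -tauE (_ : e = e / 2 + e / 2); last by field.
  have n0 := ler_norm X0; have n1 := ler_norm X1; have n2 := normr_ge0 X0; have n3 := normr_ge0 X1.
  by rewrite EFinD; apply: leeD; [apply: H0|apply: H1] => // x; rewrite /D /=; clear -hX n0 n1 n2 n3; lra.
pose rho n := Cr * tau n.
have rho0 n : 0 <= rho n by exact: mulr_ge0.
have rhov : vanishing rho.
  move=> e e0; have c1 : 0 < 1 + Cr by lra.
  have [N HN] := tauv (e / (1 + Cr)) (divr_gt0 e0 c1); exists N => n hn.
  by have := HN n hn; rewrite ler_pdivlMr// /rho; have := tau0 n; lra.
(* The factor 2 covers the H^2 norm and also the sup norm, where the Sobolev inequality on a period
   costs 4 in squares. *)
pose kappa n := 2 * Num.sqrt (C1 * rho n).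
have kap0 n : 0 <= kappa n by rewrite mulr_ge0// sqrtr_ge0.
have kapv : vanishing kappa.
  move=> e e0; have c1 : 0 < 4 * (1 + C1) by lra.
  have e2 : 0 < e ^+ 2 / (4 * (1 + C1)) by rewrite divr_gt0// exprn_gt0.
  have [N HN] := rhov _ e2; exists N => n hn; have := HN n hn; rewrite ler_pdivlMr// => h.
  have cr : 0 <= C1 * rho n := mulr_ge0 C10 (rho0 n).
  have -> : e = Num.sqrt (e ^+ 2) by rewrite sqrtr_sqr ger0_norm// ltW.
  rewrite /kappa -{1}[2]ger0_norm// -[`|2|]sqrtr_sqr -sqrtrM ?sqr_ge0// ler_wsqrtr//.
  rewrite (_ : 2 ^+ 2 = 4 :> R); last by ring.
  by have := rho0 n; lra.
have decay eta : 0 < eta -> exists X, forall i x, X <= `|x| -> `|j0 (jsub Ju Jv) i x| <= eta.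
  by move=> ee0; exact: L2jet_decay LJz ee0.
pose M' := 3 * M + 1.
have [N1 HN1] : exists N1, forall n, (N1 <= n)%N -> exists A : jet,
    [/\ jetok A, perF (n%:R * T) (j0 A),
      (q (ico 0 (n%:R * T)) (j0 A) + q (ico 0 (n%:R * T)) (j1 A) <= (C1 * rho n)%:E)%E,
      (q (ico 0 (n%:R * T)) (j2 A) <= (C1 * rho n)%:E)%E &
      {ae mu, forall x, forall i, op (ddk K) (cck K eps) (Bk K eps (prj (j0 (JW K Ju Jv n (chi n))))) A i x
         + Qf (prj (j0 (JW K Ju Jv n (chi n)))) (j0 A) i x + resid K eps (JW K Ju Jv n (chi n)) i x = 0}].
  (* Gluing gives closeness [2 * eta], and profiles bounded by 3M turn this into a coefficient
     mismatch 24 M eta, which is at most [dl]. *)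
  pose eta := dl / (1 + 24 * M).
  have c1 : 0 < 1 + 24 * M by clear -M0; lra.
  have eta0 : 0 < eta by rewrite divr_gt0.
  have [X HX] := decay eta eta0.
  have [Na HNa] := nlarge (1 + `|rT| + 6 * (X + 2 * rT) + 6 * rT + 6 * `|X|).
  have [Nb HNb] := rhov r0 r00.
  exists (maxn (maxn Na Nb) (maxn nchi 3)) => n; rewrite !geq_max => /andP[/andP[na nb] /andP[nc n3]].
  have hL := HNa n na; have n0 : (0 < n)%N by exact: leq_trans n3.
  have x0 := ler_norm X; have x1 := normr_ge0 X; have rr := ler_norm rT.
  have rr0 := ltW rT0.
  have Hcn := Hchi _ nc.
  have bW := W_bound ku kv pv0 pv1 bu bv n0 Hcn.
  have okW := JW_ok ku kv n0 Hcn.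
  have [pW pW1] := JW_per Ju pv0 pv1 (chi n) n0.
  have cW : cpair (prj (j0 (JW K Ju Jv n (chi n)))).
    by split; [have [c _] := D2_cont (okW (false, false))|have [c _] := D2_cont (okW (true, false))].
  have [Cb Cb0 hB] := Bk_bound K eps bW.
  have hL1 : X <= n%:R * T / 6 - 2 * rT by clear -hL x0 x1 rr rr0; lra.
  have hL2 : 6 * rT <= n%:R * T by clear -hL x0 x1 rr rr0 hL1; have := ler_norm (- X); rewrite normrN; lra.
  have cl := close_glued ku kv pv0 pv1 n3 Hcn HX rr0 (ltW eta0) hL1 hL2.
  have hcL i x : cck K eps i (x + n%:R * T) = cck K eps i x.
    by rewrite -[n%:R]/(n%:Z%:~R); apply: shift_int; exact: cck_per.
  have hgL x : kg K (x + n%:R * T) = kg K x.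
    by rewrite -[n%:R]/(n%:Z%:~R); apply: shift_int => y; exact: kg_per.
  have pWx x : prj (j0 (JW K Ju Jv n (chi n))) (x + n%:R * T) = prj (j0 (JW K Ju Jv n (chi n))) x.
    by rewrite /prj !pW.
  have [P HP] : exists P, parametrix (ddk K) (cck K eps) (Bk K eps (prj (j0 (JW K Ju Jv n (chi n))))) (n%:R * T) KT P.
    have Hinv' : INV (op (ddk K) (cck K eps) (Bk K eps u)) K0 by move: Hinv; rewrite /Lk Bl0.
    apply: (HT _ (Bk K eps u) _ Cb _ _ _ _ hc hB _ hcL) Hinv'.
    - by move=> i; exact: cont_cck.
    - exact: cont_Bk.
    - exact: cont_Bk.
    - by clear -hL2 rr0; lra.
    - by move=> i k x; rewrite /Bk pWx hgL.
    move=> x0'; have b3 : bpair u (3 * M) by move=> x; have [h1 h2] := bu x; clear -h1 h2 M0; split; lra.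
    have e2 : 0 <= 2 * eta by clear -eta0; lra.
    have [sg s1 s2] := close_window 0 0 e2 bW b3 cl x0'.
    exists sg => // i k x hx; have := s2 i k x hx; rewrite !Bl0 => /le_trans; apply.
    have -> : 4 * (3 * M) * (2 * eta) = 24 * M * eta by ring.
    have : (1 + 24 * M) * eta = dl by rewrite /eta mulrC divfK// gt_eqF.
    by move=> <-; rewrite [leRHS]mulrDl mul1r lerDr ltW.
  have L1 : 1 <= n%:R * T by clear -hL hL1 hL2 x1 rr0; have := ler_norm (- X); rewrite normrN; have := normr_ge0 rT; lra.
  have mr : mfF (resid K eps (JW K Ju Jv n (chi n))) := mf_resid ku kv n0 Hcn.
  have pr : perF (n%:R * T) (resid K eps (JW K Ju Jv n (chi n))) := resid_per Ju kv pv0 pv1 (chi n) n0.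
  have qr : (q (ico 0 (n%:R * T)) (resid K eps (JW K Ju Jv n (chi n))) <= (rho n)%:E)%E.
    have := q_resid_le ku kv pv0 pv1 bu bv n0 Hcn CN0 Cc0 dm0 dm hc HCN.
    by rewrite -/(D n) tauE -EFinM.
  exact: (HS _ _ _ P L1 hcL hgL okW pW bW HP mr pr qr (rho0 n) (HNb n nb)).
have /choice[A HA] : forall n, exists A : jet, (N1 <= n)%N ->
    [/\ jetok A, perF (n%:R * T) (j0 A),
      (q (ico 0 (n%:R * T)) (j0 A) + q (ico 0 (n%:R * T)) (j1 A) <= (C1 * rho n)%:E)%E,
      (q (ico 0 (n%:R * T)) (j2 A) <= (C1 * rho n)%:E)%E &
      {ae mu, forall x, forall i, op (ddk K) (cck K eps) (Bk K eps (prj (j0 (JW K Ju Jv n (chi n))))) A i x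
         + Qf (prj (j0 (JW K Ju Jv n (chi n)))) (j0 A) i x + resid K eps (JW K Ju Jv n (chi n)) i x = 0}].
  move=> n; have [h|h] := pselect (N1 <= n)%N; first by have [A HA] := HN1 n h; exists A.
  by exists (@jzero R I4).
pose a n := prj (j0 (A n)).
pose un n x := prj (j0 (JW K Ju Jv n (chi n))) x + a n x.
have [N2 HN2] := nlarge 1.
have [N3 HN3] := kapv 1 ltr01.
pose Nm := maxn (maxn N1 N2) (maxn (maxn nchi 3) N3).
have supA n : (Nm <= n)%N -> forall x, `|(a n x).1| <= kappa n /\ `|(a n x).2| <= kappa n.
  rewrite !geq_max => /andP[/andP[n1 n2] _] x; have [ok p0 q01 _ _] := HA n n1.
  have s i : `|j0 (A n) i x| <= kappa n.
    have cr : 0 <= C1 * rho n := mulr_ge0 C10 (rho0 n).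
    rewrite -ler_sqr ?nnegrE ?kap0// real_normK ?num_real// -lee_fin.
    apply: (le_trans (sup_period i x ok p0 (jet_per ok p0) (HN2 n n2))).
    rewrite /kappa exprMn sqr_sqrtr// (_ : 2 ^+ 2 = 4 :> R); last by ring.
    by rewrite EFinM; apply: lee_wpmul2l.
  by split; exact: s.
exists Nm, kappa, a, un, M'; split.
- exact: kapv.
- by rewrite /M'; clear -M0; lra.
- by split; [move=> x; have [h1 h2] := bu x; rewrite /M'; clear -h1 h2 M0; split; lra|exact: cu].
- move=> n hn; have hS := supA n hn; move: (hn); rewrite !geq_max => /andP[/andP[n1 n2] /andP[/andP[nc n3] n3']].
  have n0 : (0 < n)%N by exact: leq_trans n3.
  have Hcn := Hchi _ nc; have [okA pA q01 q2 eqA] := HA n n1.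
  have okW := JW_ok ku kv n0 Hcn; have [pW pW1] := JW_per Ju pv0 pv1 (chi n) n0.
  have L1 := HN2 n n2; have L0 : 0 < n%:R * T by exact: lt_le_trans ltr01 L1.
  have ok := jadd_ok okW okA.
  have pun : periodic (un n) (n%:R * T) by move=> x; rewrite /un /a /prj !pW !pA.
  have sun : stationary K eps (un n).
    have E1 x : (un n x).1 = j0 (jadd (JW K Ju Jv n (chi n)) (A n)) (false, false) x by [].
    have E2 x : (un n x).2 = j0 (jadd (JW K Ju Jv n (chi n)) (A n)) (true, false) x by [].
    apply: (jet_stationary ok E1 E2).
    apply: (ae_imp eqA) => x hx.
    have key i : ~~ i.2 -> lin K eps (jadd (JW K Ju Jv n (chi n)) (A n)) i x + Nk K eps i x (un n x) = 0.
      move=> hi; rewrite -[RHS](hx i) /resid.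
      have -> : un n x = ((prj (j0 (JW K Ju Jv n (chi n))) x).1 + j0 (A n) (false, false) x,
         (prj (j0 (JW K Ju Jv n (chi n))) x).2 + j0 (A n) (true, false) x) by [].
      rewrite Nk_taylor// /op /lin /= /fadd; ring.
    by split; exact: key.
  have [Hp Hn] := H2per_jet L0 okA pA q01 q2.
  split.
  + exact: Hp.
  + by split; [exact: H2per_stationary|exact: sun].
  + move=> x /andP[x1 x2]; have hx : - (n%:R * T / 2) <= x < n%:R * T / 2 by clear -x1 x2; apply/andP; split; lra.
    rewrite /un; congr (_ + _).
    have c0 := ct_chi n0 Hcn hx.
    have [_ ev _] := kv.
    have J i : j0 (JW K Ju Jv n (chi n)) i x = emb v i x + chi n x * (emb u i x - emb v i x).
      by rewrite (JW_eval Ju Jv (chi n) n0 i hx) c0 (z_uv ku kv) ev.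
    apply: injective_projections.
    * change (j0 (JW K Ju Jv n (chi n)) (false, false) x = chi n x * (u x).1 + (1 - chi n x) * (v x).1).
      by rewrite J /emb /=; ring.
    * change (j0 (JW K Ju Jv n (chi n)) (true, false) x = chi n x * (u x).2 + (1 - chi n x) * (v x).2).
      by rewrite J /emb /=; ring.
  + apply: (le_trans Hn); rewrite /kappa -{1}[2]ger0_norm// -[`|2|]sqrtr_sqr -sqrtrM ?sqr_ge0// ler_wsqrtr//.
    by have := mulr_ge0 C10 (rho0 n); rewrite expr2; clear; lra.
  + split; last first.
      by split; [have [c _] := D2_cont (ok (false, false))|have [c _] := D2_cont (ok (true, false))].
    have bW := W_bound ku kv pv0 pv1 bu bv n0 Hcn.
    move=> x; have [a1 a2] := hS x; have [b1 b2] := bW x; have k1 := HN3 n n3'.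
    by split; apply: (le_trans (ler_normD _ _)); rewrite /M'; clear -a1 a2 b1 b2 k1; lra.
(* Three errors add up: solution against glued profile, profile against background, background
   against [u]. *)
- move=> eta r e0 rr; have e3 : 0 < eta / 3 by lra.
  have [X HX] := decay _ e3; have [Na HNa] := nlarge (1 + `|X| * 6 + 12 * r).
  have [Nb HNb] := kapv _ e3.
  exists (maxn Nm (maxn Na Nb)) => n; rewrite geq_max => /andP[hn]; rewrite geq_max => /andP[na nb].
  have hS := supA n hn; move: (hn); rewrite !geq_max => /andP[_ /andP[/andP[nc n3] _]].
  have hL := HNa n na; have kb := HNb n nb; have x0 := ler_norm X; have x1 := normr_ge0 X.
  have hw x : `|(un n x).1 - (prj (j0 (JW K Ju Jv n (chi n))) x).1| <= eta / 3 /\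
      `|(un n x).2 - (prj (j0 (JW K Ju Jv n (chi n))) x).2| <= eta / 3.
    have ad (p t : R * R) : (p + t).1 - p.1 = t.1 /\ (p + t).2 - p.2 = t.2 by split; rewrite /= addrAC subrr add0r.
    have [a1 a2] := hS x; rewrite /un; have [-> ->] := ad (prj (j0 (JW K Ju Jv n (chi n))) x) (a n x).
    by split; [exact: le_trans a1 kb|exact: le_trans a2 kb].
  have hL1 : X <= n%:R * T / 6 - 2 * r by clear -hL x0 x1 rr; lra.
  have hL2 : 6 * r <= n%:R * T by clear -hL x1 rr; lra.
  have c1 := close_from ku kv pv0 pv1 n3 (Hchi _ nc) HX rr (ltW e3) hL1 hL2 hw.
  have c2 := close_to ku kv pv0 pv1 n3 (Hchi _ nc) HX rr (ltW e3) hL1 hL2 hw.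
  have e : 3 * (eta / 3) = eta by rewrite mulrC divfK ?pnatr_eq0.
  by rewrite e in c1 c2.
Qed.

End PeriodicSolutions.

(** * Complex-linear operators on real fields *)

Section ComplexLinear.
Variable R : realType.
Local Notation mu := (@lebesgue_measure R).
Local Notation fld := (I4 -> R -> R).
Local Notation jet := (jet R I4).
Local Notation C := R[i].
Implicit Types (F G H : fld) (J : jet) (z h : C).

Definition isL2 F : Prop := mfF F /\ (q setT F < +oo)%E.
Definition n2 F : R := fine (q setT F).

Lemma n2E F : isL2 F -> q setT F = (n2 F)%:E.
Proof. by move=> [_ f]; have [r e _] := real_of_fin (q_ge0 _ _) f; rewrite /n2 e. Qed.

Lemma n2_ge0 F : 0 <= n2 F. Proof. by apply: fine_ge0; exact: q_ge0. Qed.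

Lemma isL2_add F G : isL2 F -> isL2 G -> isL2 (fadd F G).
Proof.
move=> LF LG; split; first exact: mf_fadd LF.1 LG.1.
apply: (le_lt_trans (q_fadd measurableT LF.1 LG.1)).
by rewrite (n2E LF) (n2E LG) -!EFinM -EFinD ltry.
Qed.

Lemma isL2_sub F G : isL2 F -> isL2 G -> isL2 (fsub F G).
Proof.
move=> LF LG; split; first exact: mf_fsub LF.1 LG.1.
apply: (le_lt_trans (q_fsub measurableT LF.1 LG.1)).
by rewrite (n2E LF) (n2E LG) -!EFinM -EFinD ltry.
Qed.

Lemma isL2_le F G (a : R) : mfF F -> isL2 G -> 0 <= a -> (forall x, sq F x <= a * sq G x) ->
  isL2 F /\ n2 F <= a * n2 G.
Proof.
move=> mF LG a0 le; have h : (q setT F <= (a * n2 G)%:E)%E.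
  by rewrite EFinM -(n2E LG); apply: q_le1 => //; [exact: LG.1|exact: aeW].
have LF : isL2 F by split => //; exact: le_lt_trans h (ltry _).
by split => //; rewrite -lee_fin -(n2E LF).
Qed.

Lemma n2_le2 F G H (a b : R) : isL2 F -> isL2 G -> isL2 H -> 0 <= a -> 0 <= b ->
  (forall x, sq F x <= a * sq G x + b * sq H x) -> n2 F <= a * n2 G + b * n2 H.
Proof.
move=> LF LG LH a0 b0 le; rewrite -lee_fin EFinD [in leRHS]EFinM [X in (_ + X)%E]EFinM -!n2E//.
by apply: q_le2 => //; [exact: LF.1|exact: LG.1|exact: LH.1|apply: aeW].
Qed.

Lemma n2_zero : isL2 (@fzero R I4) /\ n2 (@fzero R I4) = 0.
Proof.
have q0 : q setT (@fzero R I4) = 0%E.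
  by rewrite /q (@qi_eq _ _ _ (fun=> 0)) => [|x _]; [rewrite /qi integral0|exact: sq_fzero].
by rewrite /isL2 /n2 q0; split => //; split; [exact: mf_fzero|exact: ltry].
Qed.

(** Young's inequality with a free parameter: for small [e] the first term keeps a factor close to
    1, as the maximum principle requires. *)
Lemma n2_add F G (e : R) : 0 < e -> isL2 F -> isL2 G ->
  n2 (fadd F G) <= (1 + e) * n2 F + (1 + e^-1) * n2 G.
Proof.
move=> e0 LF LG; have ei : 0 < e^-1 by rewrite invr_gt0.
apply: n2_le2 => //; [exact: isL2_add|by lra|by lra|move=> x].
rewrite /sq !mulr_sumr -big_split/=; apply: ler_sum => i _; rewrite /fadd.
have : 0 <= e^-1 * (e * F i x - G i x) ^+ 2 by rewrite mulr_ge0 ?sqr_ge0// ltW.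
have -> : e^-1 * (e * F i x - G i x) ^+ 2 = e * F i x ^+ 2 - 2 * (F i x * G i x) + e^-1 * G i x ^+ 2.
  by field; rewrite gt_eqF.
rewrite sqrrD; lra.
Qed.

Definition half F G : fld := fun i x => (F i x + G i x) / 2.

(** Convexity of the squared norm: averaging, unlike adding, costs no factor. *)
Lemma isL2_half F G : isL2 F -> isL2 G -> isL2 (half F G) /\ n2 (half F G) <= (n2 F + n2 G) / 2.
Proof.
move=> LF LG; have mH : mfF (half F G).
  by move=> i; apply: mfM; [apply: mfD; [exact: LF.1|exact: LG.1]|exact: mf_cst].
have le x : sq (half F G) x <= 2^-1 * sq F x + 2^-1 * sq G x.
  rewrite /sq !mulr_sumr -big_split/=; apply: ler_sum => i _; rewrite /half.
  by have := sqr_ge0 (F i x - G i x); rewrite sqrrB exprMn sqrrD; lra.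
have LH : isL2 (half F G).
  split => //; have h2 : (0 : R) <= 2^-1 by [].
  apply: (@le_lt_trans _ _ (2^-1%:E * q setT F + 2^-1%:E * q setT G)%E).
    by apply: q_le2 => //; [exact: LF.1|exact: LG.1|exact: aeW].
  by rewrite (n2E LF) (n2E LG) -!EFinM -EFinD ltry.
split => //; rewrite (_ : (_ + _) / 2 = 2^-1 * n2 F + 2^-1 * n2 G); last by lra.
exact: n2_le2.
Qed.

Definition cf z F : fld := cmul (complex.Re z) (complex.Im z) F.
Definition zn z : R := complex.Re z ^+ 2 + complex.Im z ^+ 2.

Lemma znM z w : zn (z * w) = zn z * zn w.
Proof. by case: z => a b; case: w => a' b'; rewrite /zn /=; ring. Qed.

Lemma isL2_cf z F : isL2 F -> isL2 (cf z F).
Proof.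
move=> LF; split; first exact: mf_cmul LF.1.
by rewrite q_cmul ?(n2E LF) ?ltry//; exact: LF.1.
Qed.

Lemma n2_cf z F : isL2 F -> n2 (cf z F) = zn z * n2 F.
Proof.
by move=> LF; apply: EFin_inj; rewrite -(n2E (isL2_cf _ LF)) q_cmul// ?(n2E LF)//; exact: LF.1.
Qed.

Lemma cfD z w F : cf (z + w) F = fadd (cf z F) (cf w F).
Proof.
case: z => a b; case: w => a' b'; apply/funext => -[j []]; apply/funext => x; rewrite /fadd /cf /=;
  have [e1 e2] := cmulE a b F j x; have [e3 e4] := cmulE a' b' F j x;
  have [e5 e6] := cmulE (a + a') (b + b') F j x; rewrite ?e2 ?e4 ?e6 ?e1 ?e3 ?e5; ring.
Qed.

Lemma cfM z w F : cf (z * w) F = cf z (cf w F).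
Proof.
case: z => a b; case: w => a' b'; apply/funext => -[j []]; apply/funext => x; rewrite /cf /=.
- have [_ ->] := cmulE (a * a' - b * b') (a * b' + b * a') F j x.
  have [_ ->] := cmulE a b (cmul a' b' F) j x; have [-> ->] := cmulE a' b' F j x; ring.
- have [-> _] := cmulE (a * a' - b * b') (a * b' + b * a') F j x.
  have [-> _] := cmulE a b (cmul a' b' F) j x; have [-> ->] := cmulE a' b' F j x; ring.
Qed.

Lemma cf1 F : cf 1 F = F.
Proof.
apply/funext => -[j []]; apply/funext => x; rewrite /cf /=; have [e1 e2] := cmulE 1 0 F j x;
  rewrite ?e1 ?e2; ring.
Qed.

Lemma cfN z F : cf (- z) F = fscale (-1) (cf z F).
Proof.
case: z => a b; apply/funext => -[j []]; apply/funext => x; rewrite /fscale /cf /=;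
  have [e1 e2] := cmulE a b F j x; have [e3 e4] := cmulE (- a) (- b) F j x;
  rewrite ?e2 ?e4 ?e1 ?e3; ring.
Qed.

Lemma cf_fadd z F G : cf z (fadd F G) = fadd (cf z F) (cf z G).
Proof.
apply/funext => -[j []]; apply/funext => x; rewrite /fadd /cf;
  have [e1 e2] := cmulE (complex.Re z) (complex.Im z) F j x;
  have [e3 e4] := cmulE (complex.Re z) (complex.Im z) G j x;
  have [e5 e6] := cmulE (complex.Re z) (complex.Im z) (fadd F G) j x;
  rewrite /fadd in e5 e6; rewrite ?e2 ?e4 ?e6 ?e1 ?e3 ?e5; ring.
Qed.

(** Multiplication by the imaginary unit. *)
Definition rot F : fld := fun i x => if i.2 then F (i.1, false) x else - F (i.1, true) x.
Definition jrot J : jet := Jet (rot (j0 J)) (rot (j1 J)) (rot (j2 J)).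

Lemma cfE z F : cf z F = fadd (fscale (complex.Re z) F) (fscale (complex.Im z) (rot F)).
Proof.
apply/funext => -[j []]; apply/funext => x; rewrite /fadd /fscale /cf /rot /=;
  have [e1 e2] := cmulE (complex.Re z) (complex.Im z) F j x; rewrite ?e1 ?e2; ring.
Qed.

Definition cj z J : jet := jadd (jscale (complex.Re z) J) (jscale (complex.Im z) (jrot J)).

Lemma cj0 z J : j0 (cj z J) = cf z (j0 J). Proof. by rewrite cfE. Qed.

Lemma sq_rot F x : sq (rot F) x = sq F x.
Proof. by rewrite /sq !sum4 /rot /= !sqrrN; ring. Qed.

Lemma q_rot D F : q D (rot F) = q D F.
Proof. by apply: qi_eq => x _; exact: sq_rot. Qed.

Lemma L2jet_rot J : L2jet J -> L2jet (jrot J).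
Proof.
move=> [ok f0 f1 f2]; split; rewrite /= ?q_rot// => -[j []] /=; first exact: ok.
have rE F : rot F (j, false) = fscale (-1) F (j, true).
  by apply/funext => x; rewrite /rot /fscale mulN1r.
by rewrite !rE; exact: (jscale_ok (-1) ok (j, true)).
Qed.

Lemma L2jet_cj z J : L2jet J -> L2jet (cj z J).
Proof. by move=> LJ; apply: L2jet_add; apply: L2jet_scale => //; exact: L2jet_rot. Qed.

Lemma jet_L2 J : L2jet J -> [/\ isL2 (j0 J), isL2 (j1 J) & isL2 (j2 J)].
Proof. by move=> [ok f0 f1 f2]; have [m0 m1 m2] := jet_mf ok. Qed.

Record clinear (Op : jet -> fld) : Prop := CLinear {
  cl_add : forall J J', Op (jadd J J') = fadd (Op J) (Op J');
  cl_cj : forall z J, Op (cj z J) = cf z (Op J);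
  cl_L2 : forall J, L2jet J -> isL2 (Op J)
}.

Definition opl (Op : jet -> fld) z J : fld := fadd (Op J) (cf (- z) (j0 J)).

Lemma cf_comm z w F : cf z (cf w F) = cf w (cf z F).
Proof. by rewrite -!cfM mulrC. Qed.

Lemma fadd4 F G F' G' : fadd (fadd F G) (fadd F' G') = fadd (fadd F F') (fadd G G').
Proof. by apply/funext => i; apply/funext => x; rewrite /fadd; ring. Qed.

Lemma opl_clinear Op z : clinear Op -> clinear (opl Op z).
Proof.
move=> cl; split.
- by move=> J J'; rewrite /opl (cl_add cl) [j0 _]/= cf_fadd fadd4.
- by move=> w J; rewrite /opl (cl_cj cl) cj0 cf_fadd (cf_comm (- z)).
- move=> J LJ; have [L0 _ _] := jet_L2 LJ; apply: isL2_add; first exact: (cl_L2 cl).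
  exact: isL2_cf.
Qed.

Definition Sol (Op : jet -> fld) F J : Prop := L2jet J /\ {ae mu, forall x, forall i, Op J i x = F i x}.

Section Solutions.
Variable Op : jet -> fld.
Hypothesis cl : clinear Op.

Lemma sol_add F G J J' : Sol Op F J -> Sol Op G J' -> Sol Op (fadd F G) (jadd J J').
Proof.
move=> [LJ e] [LJ' e']; split; first exact: L2jet_add.
by apply: (ae_imp (ae_and e e')) => x [h h'] i; rewrite (cl_add cl) /fadd h h'.
Qed.

Lemma sol_cj z F J : Sol Op F J -> Sol Op (cf z F) (cj z J).
Proof.
move=> [LJ e]; split; first exact: L2jet_cj.
by apply: (ae_imp e) => x h i; rewrite (cl_cj cl) /cf /cmul; apply: eq_bigr => k _; rewrite h.
Qed.

Lemma sol_ext F G J : (forall i x, F i x = G i x) -> Sol Op F J -> Sol Op G J.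
Proof. by move=> e [LJ h]; split => //; apply: (ae_imp h) => x hx i; rewrite hx e. Qed.

Lemma sol_est K F J : Est Op K -> isL2 F -> Sol Op F J -> n2 (j0 J) + n2 (j1 J) <= K * n2 F.
Proof.
move=> hE LF [LJ e]; have [L0 L1 _] := jet_L2 LJ; rewrite -lee_fin EFinD EFinM -!n2E//.
by rewrite -(q_ae measurableT (cl_L2 cl LJ).1 LF.1 e); exact: hE.
Qed.

Lemma jet_point J i x : L2jet J -> j0 J i x ^+ 2 <= 2 * (n2 (j0 J) + n2 (j1 J)).
Proof.
move=> LJ; have [L0 L1 _] := jet_L2 LJ; have [ok _ _ _] := LJ.
rewrite -lee_fin; apply: (le_trans (sup_jet i x ok)).
rewrite [(2 * _)%:E]EFinM [(n2 _ + n2 _)%:E]EFinD -!n2E//; apply: lee_wpmul2l => //.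
by apply: leeD; apply: q_sub; [exact: measurable_itv| |exact: L0.1| |exact: measurable_itv| |exact: L1.1|].
Qed.

Lemma sol_point K F J i x : Est Op K -> isL2 F -> Sol Op F J -> j0 J i x ^+ 2 <= 2 * (K * n2 F).
Proof.
move=> hE LF S; apply: (le_trans (jet_point i x S.1)); rewrite ler_pM2l//; exact: sol_est.
Qed.

(** Equality holds at every point, not just almost everywhere, by the Sobolev bound on the
    difference. *)
Lemma sol_unique K F J J' : Est Op K -> isL2 F -> Sol Op F J -> Sol Op F J' -> j0 J = j0 J'.
Proof.
move=> hE LF S S'; apply/funext => i; apply/funext => x.
have D := sol_add S (sol_cj (-1) S').
have [L0 n0] := n2_zero.
have D0 : Sol Op (@fzero R I4) (jadd J (cj (-1) J')).
  by apply: sol_ext D => k y; rewrite cfN cf1 /fadd /fscale mulN1r subrr.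
have := sol_point i x hE L0 D0; rewrite n0 !mulr0 => h.
have /eqP : j0 (jadd J (cj (-1) J')) i x ^+ 2 == 0 by rewrite eq_le h sqr_ge0.
move/eqP; rewrite sqrf_eq0 => /eqP.
have -> : j0 (jadd J (cj (-1) J')) i x = j0 J i x + j0 (cj (-1) J') i x by [].
by rewrite cj0 cfN cf1 /fscale; lra.
Qed.

Lemma sol_exists K F : INV Op K -> isL2 F -> exists J, Sol Op F J.
Proof. by move=> [H _] [mF fF]; have [J LJ e] := H F mF fF; exists J. Qed.

End Solutions.

(** A solution at parameter z solves at z + h the equation with datum corrected by - h J; this is
    the source of all resolvent identities below. *)
Lemma sol_move Op z h F J : clinear Op -> Sol (opl Op z) F J -> Sol (opl Op (z + h)) (fadd F (cf (- h) (j0 J))) J.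
Proof.
move=> cl [LJ e]; split => //; apply: (ae_imp e) => x hx i.
by rewrite /opl opprD cfD; have := hx i; rewrite /opl /fadd => <-; ring.
Qed.

End ComplexLinear.

(** * Resolvent bounds for close profiles, uniformly in the parameter *)

Section Transfers.
Variables (R : realType) (K : klausmeier R) (eps : R).
Local Notation mu := (@lebesgue_measure R).
Local Notation fld := (I4 -> R -> R).
Local Notation jet := (jet R I4).
Implicit Types (w u : R -> R * R).

Definition good w (M : R) : Prop := bpair w M /\ cpair w.

Definition Lz w : jet -> fld := op (ddk K) (cck K eps) (Bk K eps w).

Lemma Lz_opl w (z : R[i]) : Lk K eps w (complex.Re z) (complex.Im z) = opl (Lz w) z.
Proof.
apply/funext => J; apply/funext => i; apply/funext => x.
by rewrite /Lk op_Bl /opl /fadd cfN /fscale mulN1r.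
Qed.

Lemma op_jscale d c (B : I4 -> I4 -> R -> R) (a : R) J i x : op d c B (jscale a J) i x = a * op d c B J i x.
Proof. by rewrite /op !sum4 /= /fscale; ring. Qed.

Lemma Lz_rot w J i x : Lz w (jrot J) i x = rot (Lz w J) i x.
Proof.
by case: i => [[] []]; rewrite /Lz /op /rot /= !sum4 /Bk /cck /ddk /rot /=; ring.
Qed.

Lemma Lz_clinear w M : good w M -> clinear (Lz w).
Proof.
move=> [bw cw]; have [Cb Cb0 hB] := Bk_bound K eps bw; split.
- by move=> J J'; apply/funext => i; apply/funext => x; exact: op_add.
- move=> z J; apply/funext => i; apply/funext => x.
  by rewrite /cj /Lz op_add !op_jscale -!/(Lz w _) Lz_rot cfE.
- move=> J LJ; have [Cc Cc0 hc] := cck_bound K eps; have [ok _ _ _] := LJ; split.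
    by apply: mf_op => //; [move=> i; exact: cont_cck|exact: cont_Bk].
  have [_ [_ [r [_ _ e _]]]] := @op_real _ _ _ _ _ _ (dmin_gt0 K) (ddk_min K) (ddk_max K) (@cont_cck _ K eps) hc _ _ _ (@cont_Bk _ K eps _ cw) hB LJ.
  by rewrite /Lz e ltry.
Qed.

Lemma res_good w M (z : R[i]) : good w M ->
  resolvent_set (linearization K eps w) z <-> exists2 C, 0 <= C & INV (opl (Lz w) z) C.
Proof. by move=> [bw cw]; rewrite -Lz_opl; exact: res_INV. Qed.

(** The parameter enters both coefficient matrices through the same constant and cancels in their
    difference, so tolerance and constant serve all z at once. *)
Lemma INV_close (M K0 : R) : 0 <= M -> 0 <= K0 -> exists eta r K', [/\ 0 < eta, 0 < r, 0 <= K' &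
  forall w u, good w M -> good u M -> close K eta r w u -> forall z : R[i],
    INV (opl (Lz u) z) K0 -> INV (opl (Lz w) z) K'].
Proof.
move=> M0 K00; have [Cc Cc0 hc] := cck_bound K eps.
have dm0 : 0 <= dmax K by apply: le_trans (ddk_max K (true, true)); rewrite ltW// ddk_gt0.
have [r [dl [K' [r0 dl0 K'0 H]]]] := transfer_line (dmin_gt0 K) (ddk_min K) (ddk_max K) dm0 Cc0 K00.
have m1 : 0 < 1 + 4 * M by lra.
exists (dl / (1 + 4 * M)), r, K'; split => //; first exact: divr_gt0.
move=> w u [bw cw] [bu cu] cl z; rewrite -!Lz_opl; have [Cb Cb0 hB] := Bk_bound K eps bw.
have e0 : 0 <= dl / (1 + 4 * M) by rewrite divr_ge0// ltW.
apply: (H _ _ _ (Cb + (`|complex.Re z| + `|complex.Im z|))) => //.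
- by move=> i; exact: cont_cck.
- exact: cont_Bl (@cont_Bk _ K eps _ cu).
- exact: cont_Bl (@cont_Bk _ K eps _ cw).
- by move=> i k x; apply: (le_trans (ler_normB _ _)); apply: lerD; [exact: hB|exact: Ml_le].
move=> x0; have [sg s1 s2] := close_window eps (complex.Re z) (complex.Im z) e0 bw bu cl x0.
exists sg => // i k x hx; apply: (le_trans (s2 i k x hx)).
rewrite mulrA ler_pdivrMr// mulrC ler_pM2l//; lra.
Qed.

(** The transfer theorem is applied to one profile with two parameters and without translation; the
    radius depends on the bound only. *)
Lemma INV_open (K0 : R) : 0 <= K0 -> exists dl K', [/\ 0 < dl, 0 <= K' &
  forall w M (z z' : R[i]), good w M -> zn (z - z') <= dl ^+ 2 ->
    INV (opl (Lz w) z) K0 -> INV (opl (Lz w) z') K'].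
Proof.
move=> K00; have [Cc Cc0 hc] := cck_bound K eps.
have dm0 : 0 <= dmax K by apply: le_trans (ddk_max K (true, true)); rewrite ltW// ddk_gt0.
have [r [dl [K' [r0 dl0 K'0 H]]]] := transfer_line (dmin_gt0 K) (ddk_min K) (ddk_max K) dm0 Cc0 K00.
exists (dl / 2), K'; split => //; first by lra.
move=> w M [a b] [a' b'] [bw cw] hz; rewrite -!Lz_opl /=; have [Cb Cb0 hB] := Bk_bound K eps bw.
have dl20 : 0 <= dl / 2 by lra.
have [h1 h2] : `|a - a'| <= dl / 2 /\ `|b - b'| <= dl / 2.
  move: hz; rewrite /zn /= => hz; split; rewrite -(@ler_pXn2r _ 2)// ?nnegrE// real_normK ?num_real//.
    by have := sqr_ge0 (b - b'); lra.
  by have := sqr_ge0 (a - a'); lra.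
apply: (H _ _ _ (Cb + (`|a'| + `|b'|))) => //.
- by move=> i; exact: cont_cck.
- exact: cont_Bl (@cont_Bk _ K eps _ cw).
- exact: cont_Bl (@cont_Bk _ K eps _ cw).
- by move=> i k x; apply: (le_trans (ler_normB _ _)); apply: lerD; [exact: hB|exact: Ml_le].
move=> x0; exists 0; first by move=> i x; rewrite addr0.
move=> i k x _; rewrite addr0 /Bl (_ : _ - _ = Ml (a - a') (b - b') i k).
  by apply: (le_trans (Ml_le _ _ _ _)); lra.
by rewrite /Ml; case: eqP => _; [case: eqP => _; [|case: i.2]|]; ring.
Qed.

Lemma Est_INV (Op : jet -> fld) K0 K1 : INV Op K0 -> Est Op K1 -> INV Op K1.
Proof. by move=> [h _] e; split. Qed.

Lemma uniform_INV w M (rho : R) : good w M -> 0 <= rho ->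
  (forall z : R[i], - rho <= complex.Re z -> resolvent_set (linearization K eps w) z) ->
  exists2 C, 0 <= C & forall z : R[i], - rho <= complex.Re z -> INV (opl (Lz w) z) C.
Proof.
move=> gw rho0 H; have [bw cw] := gw; have [Cb Cb0 hB] := Bk_bound K eps bw.
have [Cc Cc0 hc] := cck_bound K eps.
have E a b : - rho <= a -> exists2 C, 0 <= C & Est (op (ddk K) (cck K eps) (Bl (Bk K eps w) a b)) C.
  move=> ha; have [C1 C10] := (res_good (a +i* b)%C gw).1 (H (a +i* b)%C ha).
  by rewrite -Lz_opl => -[_ e]; exists C1.
have [C C0 HC] := @uniform_est _ _ _ _ _ _ (dmin_gt0 K) (ddk_min K) (ddk_max K) (fun=> erefl)
  (@cont_cck _ K eps) hc _ _ (@cont_Bk _ K eps _ cw) hB rho rho0 E.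
exists C => // z hz; have [C1 C10 I1] := (res_good z gw).1 (H z hz).
by apply: (Est_INV I1); rewrite -Lz_opl; exact: HC.
Qed.

Lemma compact_INV w M (Q : set (R * R)) : good w M -> compact Q ->
  (forall p, Q p -> resolvent_set (linearization K eps w) (p.1 +i* p.2)%C) ->
  exists2 C, 0 <= C & forall p, Q p -> INV (opl (Lz w) (p.1 +i* p.2)%C) C.
Proof.
move=> gw cQ H; have [bw cw] := gw; have [Cb Cb0 hB] := Bk_bound K eps bw.
have [Cc Cc0 hc] := cck_bound K eps.
have E p : Q p -> exists2 C, 0 <= C & Est (op (ddk K) (cck K eps) (Bl (Bk K eps w) p.1 p.2)) C.
  move=> hp; have [C1 C10] := (res_good _ gw).1 (H p hp).
  by rewrite -Lz_opl => -[_ e]; exists C1.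
have [C C0 HC] := @compact_est _ _ _ _ _ _ (dmin_gt0 K) (ddk_min K) (ddk_max K)
  (@cont_cck _ K eps) hc _ _ (@cont_Bk _ K eps _ cw) hB Q cQ E.
exists C => // p hp; have [C1 C10 I1] := (res_good _ gw).1 (H p hp).
by apply: (Est_INV I1); rewrite -Lz_opl; exact: HC.
Qed.

(** On the half-plane reaching to half the spectral gap the resolvent of [u] has a single bound, so
    one tolerance transfers all parameters. *)
Theorem stable_close u M : 0 <= M -> good u M -> strongly_spectrally_stable (linearization K eps u) ->
  exists eta r, [/\ 0 < eta, 0 < r & forall w, good w M -> close K eta r w u ->
    strongly_spectrally_stable (linearization K eps w)].
Proof.
move=> M0 gu [rho rho0 H]; have r2 : 0 <= rho / 2 by lra.
have [C C0 HC] : exists2 C, 0 <= C & forall z : R[i], - (rho / 2) <= complex.Re z -> INV (opl (Lz u) z) C.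
  apply: (uniform_INV gu r2) => z hz; apply: contrapT => /H; lra.
have [eta [r [K' [e0 r0 K'0 HI]]]] := INV_close M0 C0.
exists eta, r; split => // w gw cl; exists (rho / 2); first by lra.
move=> z sz; rewrite leNgt; apply/negP => hz; apply: sz; apply/(res_good z gw).
by exists K' => //; apply: (HI w u) => //; apply: HC; exact: ltW.
Qed.

End Transfers.

(** * A maximum principle for squared resolvent norms *)

Section MaximumPrinciple.
Variable R : realType.
Local Notation fld := (I4 -> R -> R).
Local Notation jet := (jet R I4).
Local Notation C := R[i].
Variable Op : jet -> fld.
Hypothesis cl : clinear Op.
Implicit Types (F G : fld) (J : jet) (z h w : C).

Lemma jadd0 J J' : j0 (jadd J J') = fadd (j0 J) (j0 J'). Proof. by []. Qed.

(** One Horner step of a truncated Neumann series: the solution at z is reused at z + h, and the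
    defect of the inner step gets multiplied by h. *)
Lemma horner_step z h w G X J P : Sol (opl Op z) G J ->
  Sol (opl Op (z + h)) (fadd (j0 J) (cf w X)) P ->
  Sol (opl Op (z + h)) (fadd G (cf (h * w) X)) (jadd J (cj h P)).
Proof.
move=> SJ SP; have clz := opl_clinear (z + h) cl.
apply: sol_ext (sol_add clz (sol_move h cl SJ) (sol_cj clz h SP)) => i x.
by rewrite cf_fadd cfM cfN /fadd /fscale; ring.
Qed.

Lemma mean_mono (x y x' y' : R) : x <= x' -> y <= y' -> (x + y) / 2 <= (x' + y') / 2.
Proof. by lra. Qed.

Lemma mean_le (x y m : R) : x <= m -> y <= m -> (x + y) / 2 <= m.
Proof. by lra. Qed.

(** The solutions are the first four powers of the resolvent applied to F, the coefficients of its
    expansion at z. *)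
Lemma resolvent_chain z (K : R) F : INV (opl Op z) K -> isL2 F -> 0 <= K ->
  exists J0 J1 J2 J3, [/\ Sol (opl Op z) F J0, Sol (opl Op z) (j0 J0) J1, Sol (opl Op z) (j0 J1) J2,
    Sol (opl Op z) (j0 J2) J3 & n2 (j0 J3) <= K ^+ 4 * n2 F].
Proof.
move=> Hi LF K0; have e := Hi.2; have clz := opl_clinear z cl.
have st G : isL2 G -> exists2 J, Sol (opl Op z) G J & isL2 (j0 J) /\ n2 (j0 J) <= K * n2 G.
  move=> LG; have [J S] := sol_exists Hi LG; exists J => //.
  have [L0 _ _] := jet_L2 S.1; split => //.
  by have := sol_est clz e LG S; have := n2_ge0 (j1 J); lra.
have [J0 S0 [L0 b0]] := st F LF; have [J1 S1 [L1 b1]] := st _ L0.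
have [J2 S2 [L2' b2]] := st _ L1; have [J3 S3 [L3 b3]] := st _ L2'.
exists J0, J1, J2, J3; split => //.
apply: (le_trans b3); rewrite exprS -mulrA; apply: ler_wpM2l => //.
apply: (le_trans b2); rewrite exprS -mulrA; apply: ler_wpM2l => //.
by apply: (le_trans b1); rewrite exprS expr1 -mulrA; apply: ler_wpM2l.
Qed.

(* The four displacements are s times the fourth roots of unity, so that the terms of order 1, 2
   and 3 of the Neumann series cancel in the mean. *)
Lemma four_point z (s K e : R) F J J1 J2 J3 J4 : isL2 F -> 0 <= K -> 0 < e -> INV (opl Op z) K ->
  let z1 := z + (s +i* 0)%C in let z2 := z + (- s +i* 0)%C in
  let z3 := z + (0 +i* s)%C in let z4 := z + (0 +i* (- s))%C in
  Est (opl Op z1) K -> Est (opl Op z2) K -> Est (opl Op z3) K -> Est (opl Op z4) K ->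
  Sol (opl Op z) F J -> Sol (opl Op z1) F J1 -> Sol (opl Op z2) F J2 -> Sol (opl Op z3) F J3 ->
  Sol (opl Op z4) F J4 ->
  n2 (j0 J) <= (1 + e) * (((n2 (j0 J1) + n2 (j0 J2)) / 2 + (n2 (j0 J3) + n2 (j0 J4)) / 2) / 2)
     + (1 + e^-1) * (s ^+ 8 * (K ^+ 5 * n2 F)).
Proof.
move=> LF K0 e0 Hi z1 z2 z3 z4 E1 E2 E3 E4 S S1 S2 S3 S4.
have [A0 [A1 [A2 [A3 [T0 T1 T2 T3 b3]]]]] := resolvent_chain Hi LF K0.
have eJ := sol_unique (opl_clinear z cl) Hi.2 LF S T0; rewrite eJ.
have [L0 _ _] := jet_L2 T0.1; have [L3 _ _] := jet_L2 T3.1.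
pose P h := jadd A0 (cj h (jadd A1 (cj h (jadd A2 (cj h A3))))).
pose D h J' := jadd J' (cj (-1) (P h)).
have SD h J' : Sol (opl Op (z + h)) F J' -> Est (opl Op (z + h)) K -> zn h = s ^+ 2 ->
    isL2 (j0 (D h J')) /\ n2 (j0 (D h J')) <= s ^+ 8 * (K ^+ 5 * n2 F).
  move=> S' E' hs; have clz := opl_clinear (z + h) cl.
  (* [P h] is the Neumann polynomial of degree three; its datum at z + h is F minus h^4 times the
     last iterate, so [J' - P h] is of order h^4. *)
  have SP := horner_step T0 (horner_step T1 (horner_step T2 (sol_move h cl T3))).
  have SS : Sol (opl Op (z + h)) (cf (h * (h * (h * h))) (j0 A3)) (D h J').
    apply: sol_ext (sol_add clz S' (sol_cj clz (-1) SP)) => i x.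
    by rewrite cfN cf1 !mulrN cfN /fadd /fscale /fadd /fscale; ring.
  have [LD _ _] := jet_L2 SS.1; split => //.
  have LX := isL2_cf (h * (h * (h * h))) L3.
  have := sol_est clz E' LX SS; rewrite n2_cf// !znM hs => hh.
  have h1 : n2 (j0 (D h J')) <= K * (s ^+ 2 * (s ^+ 2 * (s ^+ 2 * s ^+ 2)) * n2 (j0 A3)).
    by have := n2_ge0 (j1 (D h J')); lra.
  apply: (le_trans h1); rewrite -!exprD mulrCA; apply: ler_wpM2l; first by rewrite (exprM s 2 4) exprn_ge0 ?sqr_ge0.
  by rewrite (exprS K 4) -mulrA; apply: ler_wpM2l.
have zs1 : zn (s +i* 0)%C = s ^+ 2 by rewrite /zn /=; ring.
have zs2 : zn (- s +i* 0)%C = s ^+ 2 by rewrite /zn /=; ring.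
have zs3 : zn (0 +i* s)%C = s ^+ 2 by rewrite /zn /=; ring.
have zs4 : zn (0 +i* (- s))%C = s ^+ 2 by rewrite /zn /=; ring.
have [D1 d1] := SD _ _ S1 E1 zs1; have [D2 d2] := SD _ _ S2 E2 zs2.
have [D3 d3] := SD _ _ S3 E3 zs3; have [D4 d4] := SD _ _ S4 E4 zs4.
have [M1 _ _] := jet_L2 S1.1; have [M2 _ _] := jet_L2 S2.1.
have [M3 _ _] := jet_L2 S3.1; have [M4 _ _] := jet_L2 S4.1.
have [a1 c1] := isL2_half M1 M2; have [a2 c2] := isL2_half M3 M4; have [a c] := isL2_half a1 a2.
have [b1 f1] := isL2_half D1 D2; have [b2 f2] := isL2_half D3 D4; have [b f] := isL2_half b1 b2.
have -> : j0 A0 = fadd (half (half (j0 J1) (j0 J2)) (half (j0 J3) (j0 J4)))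
    (cf (-1) (half (half (j0 (D (s +i* 0)%C J1)) (j0 (D (- s +i* 0)%C J2)))
       (half (j0 (D (0 +i* s)%C J3)) (j0 (D (0 +i* (- s))%C J4))))).
  rewrite cfN cf1; apply/funext => i; apply/funext => x.
  have jD h J' : j0 (D h J') = fadd (j0 J') (fscale (-1) (fadd (j0 A0) (cf h (fadd (j0 A1) (cf h (fadd (j0 A2) (cf h (j0 A3)))))))).
    by rewrite /D /P !(jadd0, cj0) cfN cf1.
  by rewrite !jD !cfE /half /fadd /fscale /rot /=; case: i => [j []] /=; field.
have LN := isL2_cf (-1) b.
have zn1 : zn (-1 : C) = 1.
  have znN w : zn (- w) = zn w by case: w => a' b'; rewrite /zn /= !sqrrN.
  by rewrite znN /zn /= expr1n expr0n addr0.
apply: (le_trans (n2_add e0 a LN)); rewrite n2_cf// zn1 mul1r.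
have ei : 0 < e^-1 by rewrite invr_gt0.
apply: lerD; apply: ler_wpM2l.
- by clear -e0; lra.
- exact: le_trans c (mean_mono c1 c2).
- by clear -ei; lra.
- exact: le_trans f (mean_le (le_trans f1 (mean_le d1 d2)) (le_trans f2 (mean_le d3 d4))).
Qed.

(** Discrete subharmonicity on a grid of mesh s. To the squared norm of the solution, [dl] times the
    squared distance to the center is added; its mean over four neighbours gains dl s^2, which beats
    the error of the four-point formula and excludes an interior maximum. [K2] affects only the
    mesh, so the bound keeps [K1]. *)
Lemma max_principle z0 (rho K1 K2 : R) F J : 0 < rho -> 0 <= K1 -> 0 <= K2 ->
  (forall x y, `|x| <= rho -> `|y| <= rho -> INV (opl Op (z0 + (x +i* y)%C)) K2) ->
  (forall x y, `|x| <= rho -> `|y| <= rho -> `|x| = rho \/ `|y| = rho -> Est (opl Op (z0 + (x +i* y)%C)) K1) ->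
  isL2 F -> Sol (opl Op z0) F J -> n2 (j0 J) <= K1 * n2 F.
Proof.
move=> rho0 K10 K20 Hi Hb LF SJ; have F0 := n2_ge0 F.
pose A := K2 * n2 F; pose D := K2 ^+ 5 * n2 F.
have A0 : 0 <= A by exact: mulr_ge0.
have D0 : 0 <= D by rewrite mulr_ge0// exprn_ge0.
(* The auxiliary quadratic term is at most 2 rho^2 on the square and disappears with [dl]. *)
suff H (dl : R) : 0 < dl -> n2 (j0 J) <= K1 * n2 F + dl * (2 * rho ^+ 2).
  rewrite leNgt; apply/negP => lt; have r2 : 0 < 2 * rho ^+ 2 by rewrite mulr_gt0// exprn_gt0.
  move: (2 * rho ^+ 2) r2 H => W W0 H; pose t := (n2 (j0 J) - K1 * n2 F) / 2.
  have t0 : 0 < t by rewrite divr_gt0// subr_gt0.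
  by have := H (t / W) (divr_gt0 t0 W0); rewrite divfK ?gt_eqF// /t; lra.
(* [X] yields a mesh with s (A + 2 D) < dl, where A bounds the squared norms at grid points and D is
   the constant of the Neumann error. *)
move=> dl0; pose X := 1 + (A + 2 * D) / dl.
have X1 : 1 <= X by rewrite lerDl divr_ge0//; lra.
pose N := (Num.truncn (rho * X)).+1; pose s := rho / N%:R.
have N0 : (0 : R) < N%:R by rewrite ltr0n.
have sN : s * N%:R = rho by rewrite divfK// gt_eqF.
have s0 : 0 < s by rewrite divr_gt0.
have sX : s * X < 1 by rewrite mulrAC ltr_pdivrMr// mul1r truncnS_gt.
have s1 : s <= 1 by nra.
have sD : s * (A + 2 * D) < dl.
  have : s * ((A + 2 * D) / dl) < 1 by move: sX; rewrite /X mulrDr mulr1; lra.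
  by rewrite mulrA ltr_pdivrMr// mul1r.
pose crd (i : nat) : R := i%:R * s - rho.
have crd_le i : (i <= N.*2)%N -> `|crd i| <= rho.
  move=> hi; have h1 : (i%:R : R) <= 2 * N%:R by rewrite -natrM ler_nat mul2n.
  have h2 : (0 : R) <= i%:R by [].
  by rewrite /crd ler_norml; apply/andP; split; nra.
pose zz i j := z0 + (crd i +i* crd j)%C.
have /choice[JJ HJ] : forall p : nat * nat, exists J', (p.1 <= N.*2)%N -> (p.2 <= N.*2)%N ->
    Sol (opl Op (zz p.1 p.2)) F J'.
  move=> [i j]; have [hi|hi] := boolP (i <= N.*2)%N; last by exists J => h; case/negP: hi.
  have [hj|hj] := boolP (j <= N.*2)%N; last by exists J => _ h; case/negP: hj.
  by have [J' S'] := sol_exists (Hi _ _ (crd_le _ hi) (crd_le _ hj)) LF; exists J'.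
pose g (p : 'I_(N.*2).+1 * 'I_(N.*2).+1) := n2 (j0 (JJ (nat_of_ord p.1, nat_of_ord p.2))) + dl * (crd p.1 ^+ 2 + crd p.2 ^+ 2).
have hN : (N < (N.*2).+1)%N by rewrite ltnS -addnn leq_addr.
pose p0 := (Ordinal hN, Ordinal hN).
have cN : crd N = 0 by rewrite /crd mulrC sN subrr.
have g0 : g p0 = n2 (j0 J).
  rewrite /g /= cN expr0n/= addr0 mulr0 addr0; congr n2.
  have := HJ (N, N) hN hN; rewrite /zz /= cN => SN.
  have E0 : z0 + (0 +i* 0)%C = z0 by rewrite -[RHS]addr0.
  rewrite E0 in SN; apply: (sol_unique (opl_clinear z0 cl) _ LF SN SJ).
  by have [_ e] := Hi 0 0 ltac:(by rewrite normr0 ltW) ltac:(by rewrite normr0 ltW); rewrite -E0; exact: e.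
have [p _ hp] : exists2 p, true & forall p', g p' <= g p.
  by case: (@arg_maxP _ _ _ p0 predT g isT) => p _ hp; exists p => // p'; exact: hp.
rewrite -g0; apply: (le_trans (hp p0)).
have ile := ltn_ord p.1; have jle := ltn_ord p.2; rewrite !ltnS in ile jle.
have hc1 := crd_le _ ile; have hc2 := crd_le _ jle.
have sqle (y : R) : `|y| <= rho -> y ^+ 2 <= rho ^+ 2.
  by move=> h; rewrite -real_normK ?num_real// lerXn2r ?nnegrE// ltW.
have [/andP[/andP[i1 i2] /andP[j1' j2']]|bd] := boolP (((0 < p.1) && (p.1 < N.*2)) && ((0 < p.2) && (p.2 < N.*2)))%N; last first.
  have Eb : Est (opl Op (zz p.1 p.2)) K1.
    apply: Hb => //; move: bd; rewrite !negb_and -!leqNgt !leqn0 => /orP[/orP[/eqP e|e]|/orP[/eqP e|e]].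
    - by left; rewrite /crd e mul0r add0r normrN gtr0_norm.
    - left; have -> : nat_of_ord p.1 = N.*2 by apply/eqP; rewrite eqn_leq ile.
      by rewrite /crd -mul2n natrM -mulrA (mulrC N%:R) sN (_ : 2 * rho - rho = rho) ?gtr0_norm//; ring.
    - by right; rewrite /crd e mul0r add0r normrN gtr0_norm.
    - right; have -> : nat_of_ord p.2 = N.*2 by apply/eqP; rewrite eqn_leq jle.
      by rewrite /crd -mul2n natrM -mulrA (mulrC N%:R) sN (_ : 2 * rho - rho = rho) ?gtr0_norm//; ring.
  rewrite /g; apply: lerD.
    have := sol_est (opl_clinear _ cl) Eb LF (HJ (nat_of_ord p.1, nat_of_ord p.2) ile jle).
    by have := n2_ge0 (j1 (JJ (nat_of_ord p.1, nat_of_ord p.2))); lra.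
  by rewrite ler_pM2l//; have := sqle _ hc1; have := sqle _ hc2; lra.
exfalso; pose i := (nat_of_ord p.1).-1; pose j := (nat_of_ord p.2).-1.
have ei : nat_of_ord p.1 = i.+1 by rewrite prednK.
have ej : nat_of_ord p.2 = j.+1 by rewrite prednK.
have hi2 : (i.+2 < (N.*2).+1)%N by rewrite ltnS -ei.
have hj2 : (j.+2 < (N.*2).+1)%N by rewrite ltnS -ej.
have hi0 : (i < (N.*2).+1)%N by apply: leq_trans hi2; rewrite ltnS leqW.
have hj0 : (j < (N.*2).+1)%N by apply: leq_trans hj2; rewrite ltnS leqW.
have m1 := hp (Ordinal hi2, p.2); have m2 := hp (Ordinal hi0, p.2).
have m3 := hp (p.1, Ordinal hj2); have m4 := hp (p.1, Ordinal hj0).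
have hE a b : (a <= N.*2)%N -> (b <= N.*2)%N -> INV (opl Op (zz a b)) K2.
  by move=> ha hb; apply: Hi; exact: crd_le.
have S k l : (k <= N.*2)%N -> (l <= N.*2)%N -> Sol (opl Op (zz k l)) F (JJ (k, l)).
  by move=> hk hl; exact: (HJ (k, l)).
have cS k : crd k.+1 = crd k + s by rewrite /crd -natr1; ring.
have e1 : zz i.+1 j.+1 + (s +i* 0)%C = zz i.+2 j.+1.
  by rewrite /zz -addrA; congr (_ + _); rewrite /GRing.add/= (cS i.+1) addr0.
have e2 : zz i.+1 j.+1 + (- s +i* 0)%C = zz i j.+1.
  by rewrite /zz -addrA; congr (_ + _); rewrite /GRing.add/= (cS i) addr0 addrK.
have e3 : zz i.+1 j.+1 + (0 +i* s)%C = zz i.+1 j.+2.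
  by rewrite /zz -addrA; congr (_ + _); rewrite /GRing.add/= (cS j.+1) addr0.
have e4 : zz i.+1 j.+1 + (0 +i* (- s))%C = zz i.+1 j.
  by rewrite /zz -addrA; congr (_ + _); rewrite /GRing.add/= (cS j) addr0 addrK.
rewrite /g /= ?ei ?ej in m1 m2 m3 m4; rewrite ei in ile; rewrite ej in jle; have {}hi2 : (i.+2 <= N.*2)%N := hi2; have {}hj2 : (j.+2 <= N.*2)%N := hj2; have {}hi0 : (i <= N.*2)%N := hi0; have {}hj0 : (j <= N.*2)%N := hj0.
(* Young's inequality with weight s^3 produces the errors s^3 m and (s^8 + s^5) D, both of smaller
   order than s^2. *)
have s3 : 0 < s ^+ 3 by rewrite exprn_gt0.
have := @four_point (zz i.+1 j.+1) s K2 (s ^+ 3) F _ _ _ _ _ LF K20 s3 (hE _ _ ile jle).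
cbv zeta; rewrite e1 e2 e3 e4 => /(_ _ _ _ _ _ (hE _ _ hi2 jle).2 (hE _ _ hi0 jle).2 (hE _ _ ile hj2).2 (hE _ _ ile hj0).2
  (S _ _ ile jle) (S _ _ hi2 jle) (S _ _ hi0 jle) (S _ _ ile hj2) (S _ _ ile hj0)).
have bA k l : (k <= N.*2)%N -> (l <= N.*2)%N -> n2 (j0 (JJ (k, l))) <= A.
  move=> hk hl; have := sol_est (opl_clinear _ cl) (hE _ _ hk hl).2 LF (S _ _ hk hl).
  by have := n2_ge0 (j1 (JJ (k, l))); rewrite -/A; lra.
have := bA _ _ hi2 jle; have := bA _ _ hi0 jle; have := bA _ _ ile hj2; have := bA _ _ ile hj0.
move: m1 m2 m3 m4; rewrite (cS i.+1) (cS j.+1) (cS i) (cS j) -/D.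
set y := n2 (j0 (JJ (i.+1, j.+1))); set y1 := n2 (j0 (JJ (i.+2, j.+1))); set y2 := n2 (j0 (JJ (i, j.+1))).
set y3 := n2 (j0 (JJ (i.+1, j.+2))); set y4 := n2 (j0 (JJ (i.+1, j))); move: (crd i) (crd j) => a b.
rewrite -exprVn (_ : (1 + s^-1 ^+ 3) * (s ^+ 8 * D) = (s ^+ 8 + s ^+ 5) * D); last by field; rewrite gt_eqF.
move=> m1 m2 m3 m4 q4 q3 q2 q1 hh.
pose m := ((y1 + y2) / 2 + (y3 + y4) / 2) / 2.
have mA : m <= A by rewrite /m; clear -q1 q2 q3 q4; lra.
have hy : m + dl * s ^+ 2 <= y by rewrite /m; clear -m1 m2 m3 m4; lra.
have h5 : s ^+ 8 + s ^+ 5 <= 2 * s ^+ 3.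
  have p5 : s ^+ 5 <= s ^+ 3 by rewrite ler_wiXn2l// ltW.
  have p8 : s ^+ 8 <= s ^+ 3 by rewrite ler_wiXn2l// ltW.
  by clear -p5 p8; lra.
have h6 : s ^+ 3 * m <= s ^+ 3 * A by rewrite ler_pM2l.
have h7 : (s ^+ 8 + s ^+ 5) * D <= 2 * s ^+ 3 * D by apply: ler_wpM2r.
have h8 : s ^+ 2 * (s * (A + 2 * D)) < s ^+ 2 * dl by rewrite ltr_pM2l// exprn_gt0.
have h9 : y <= m + s ^+ 3 * m + (s ^+ 8 + s ^+ 5) * D.
  by apply: (le_trans hh); rewrite -/m mulrDl mul1r.
have h10 : s ^+ 2 * (s * (A + 2 * D)) = s ^+ 3 * A + 2 * s ^+ 3 * D by ring.
rewrite h10 in h8; rewrite (mulrC _ dl) in h8; clear -hy h6 h7 h8 h9; lra.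
Qed.

End MaximumPrinciple.

(** * Small perturbations and sampling at nodes *)

Section Perturbation.
Variable R : realType.
Local Notation mu := (@lebesgue_measure R).
Local Notation fld := (I4 -> R -> R).
Local Notation jet := (jet R I4).
Implicit Types (F G : fld) (J : jet) (z w : R[i]).

(** The perturbation is bounded relative to field and derivative, because sampling needs point
    values. Composed with a solution map of [Op] it becomes a contraction of the datum, of squared
    factor at most 1/64. *)
Lemma INV_perturb (Op : jet -> fld) (Nop : fld -> fld) (K kap : R) : clinear Op -> 0 <= K -> 0 <= kap ->
  64 * (kap * K) <= 1 -> (forall F G, Nop (fadd F G) = fadd (Nop F) (Nop G)) ->
  (forall c F, Nop (cf c F) = cf c (Nop F)) ->
  (forall J, L2jet J -> isL2 (Nop (j0 J)) /\ n2 (Nop (j0 J)) <= kap * (n2 (j0 J) + n2 (j1 J))) ->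
  INV Op K -> INV (fun J => fadd (Op J) (Nop (j0 J))) (4 * K).
Proof.
move=> cl K0 kap0 small Na Nc Nb Hi; have e := Hi.2.
have kK0 : 0 <= kap * K by exact: mulr_ge0.
split; last first.
  move=> J LJ; have [L0 L1 _] := jet_L2 LJ; have LO := cl_L2 cl LJ; have [LN bN] := Nb J LJ.
  have LP := isL2_add LO LN.
  rewrite (n2E L0) (n2E L1) (n2E LP) -EFinD -EFinM lee_fin.
  have h1 : n2 (j0 J) + n2 (j1 J) <= K * n2 (Op J) by apply: (sol_est cl e LO); split => //; exact: aeW.
  have h2 : n2 (Op J) <= 2 * n2 (fadd (Op J) (Nop (j0 J))) + 2 * n2 (Nop (j0 J)).
    apply: (n2_le2 LO LP LN) => // x; rewrite /sq !mulr_sumr -big_split/=; apply: ler_sum => i _.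
    rewrite /fadd; move: (Op J i x) (Nop (j0 J) i x) => a b.
    by have := sqr_ge0 (a + b + b); rewrite !sqrrD; lra.
  have h3 := ler_wpM2l K0 h2; have h4 := ler_wpM2l K0 bN.
  have p1 := n2_ge0 (j0 J); have p2 := n2_ge0 (j1 J); have p3 := n2_ge0 (fadd (Op J) (Nop (j0 J))).
  have h5 : K * (kap * (n2 (j0 J) + n2 (j1 J))) <= 64^-1 * (n2 (j0 J) + n2 (j1 J)).
    by rewrite mulrA (mulrC K); apply: ler_wpM2r; lra.
  rewrite mulrDr in h3; lra.
move=> F mF fF; have LF : isL2 F by [].
have /choice[S HS] : forall G, exists J, isL2 G -> Sol Op G J.
  move=> G; have [LG|nG] := pselect (isL2 G); last by exists (@jzero R I4).
  by have [J SJ] := sol_exists Hi LG; exists J.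
pose Phi G := fadd F (cf (-1) (Nop (j0 (S G)))).
have LPhi G : isL2 G -> isL2 (Phi G).
  by move=> LG; apply: isL2_add => //; apply: isL2_cf; exact: (Nb _ (HS _ LG).1).1.
have Lin L r G : inball setT L r G -> isL2 G.
  by move=> [mG _ qG]; split => //; exact: le_lt_trans qG (ltry _).
have [L0 n0] := n2_zero R.
pose r := n2 (Phi (@fzero R I4)).
have [G inG qG] : exists2 G, inball setT 0 r G & q setT (fsub (Phi G) G) = 0%E.
  apply: fixpoint => //; first exact: n2_ge0.
  - move=> G /Lin/LPhi[mP _]; split => // i x; by rewrite addr0.
  - move=> G G' /Lin LG /Lin LG'; rewrite (n2E (isL2_sub (LPhi _ LG) (LPhi _ LG'))) (n2E (isL2_sub LG LG')).
    rewrite -EFinM lee_fin.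
    have SD := sol_add cl (HS _ LG') (sol_cj cl (-1) (HS _ LG)).
    have eN : fsub (Phi G) (Phi G') = Nop (j0 (jadd (S G') (cj (-1) (S G)))).
      rewrite jadd0 cj0 Na Nc; apply/funext => i; apply/funext => x.
      by rewrite /Phi !cfN !cf1 /fsub /fadd /fscale; ring.
    have LD : isL2 (fadd G' (cf (-1) G)) by apply: isL2_add => //; exact: isL2_cf.
    have [_ b1] := Nb _ SD.1; have b2 := sol_est cl e LD SD.
    have eD : n2 (fadd G' (cf (-1) G)) = n2 (fsub G G').
      congr fine; apply: qi_eq => x _; apply: eq_bigr => i _.
      by rewrite cfN cf1 /fadd /fscale /fsub; ring.
    rewrite eN; apply: (le_trans b1); apply: (le_trans (ler_wpM2l kap0 b2)).
    rewrite eD mulrA; apply: ler_wpM2r; [exact: n2_ge0|lra].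
  by rewrite (n2E (LPhi _ L0)).
have LG := Lin _ _ _ inG; have SG := HS _ LG.
exists (S G); first exact: SG.1.
have := q0_ae (isL2_sub (LPhi _ LG) LG).1 qG => h.
apply: (ae_imp (ae_and h SG.2)) => x [h1 h2] i; have := h1 i; have := h2 i.
by rewrite /Phi cfN cf1 /fsub /fadd /fscale; lra.
Qed.

Lemma oscillation (h h1 : R -> R) (x y L : R) : prim h h1 -> continuous h1 -> 0 < L -> x <= y <= x + L ->
  (h y - h x) ^+ 2 <= L * itg x (x + L) (fun y => h1 y ^+ 2).
Proof.
move=> ph c1 L0 /andP[xy yx]; apply: le_trans (sq_itg_len x c1 L0); have l1 := lint_norm (lint_cont c1).
rewrite -real_normK ?num_real// lerXn2r ?nnegrE ?itg_ge0//.
apply: (le_trans (prim_le ph xy)); rewrite [leRHS](@itg_cat _ _ x y (x + L))//.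
by rewrite lerDl itg_ge0.
Qed.

Definition bmul (b : I4 -> I4 -> R -> R) F : fld := fun i x => \sum_k b i k x * F k x.

Lemma bmul_fadd b F G : bmul b (fadd F G) = fadd (bmul b F) (bmul b G).
Proof.
apply/funext => i; apply/funext => x; rewrite /bmul /fadd -big_split/=.
by apply: eq_bigr => k _; rewrite mulrDr.
Qed.

Lemma bmul_fscale b c F : bmul b (fscale c F) = fscale c (bmul b F).
Proof.
by apply/funext => i; apply/funext => x; rewrite /bmul /fscale mulr_sumr; apply: eq_bigr => k _; rewrite mulrCA.
Qed.

Lemma bmul_cf b z F : bmul b (rot F) = rot (bmul b F) -> bmul b (cf z F) = cf z (bmul b F).
Proof. by move=> h; rewrite !cfE bmul_fadd !bmul_fscale h. Qed.

Lemma sq_bmul b (be : R) F x : (forall i k, `|b i k x| <= be) -> sq (bmul b F) x <= 20 * be ^+ 2 * sq F x.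
Proof.
move=> hb; have N5 : N1 R I4 = 5 by rewrite /N1 card_prod card_bool.
apply: (@le_trans _ _ (\sum_(i : I4) (5 * (be ^+ 2 * sq F x)))).
  apply: ler_sum => i _; rewrite /bmul.
  apply: (le_trans (sum_sq_le (fun k => b i k x * F k x))); rewrite N5 ler_pM2l//.
  rewrite /sq mulr_sumr; apply: ler_sum => k _; rewrite exprMn; apply: ler_wpM2r; first exact: sqr_ge0.
  by rewrite -real_normK ?num_real// lerXn2r// nnegrE; exact: le_trans (hb i k).
by rewrite sum4; lra.
Qed.

Section Sampling.
Variables (l : R) (m : nat).
Hypothesis l0 : 0 < l.

Definition node (j : 'I_(m + m)) : int := j%:Z - m%:Z.

(** Piecewise constant interpolation from the left ends of the 2m cells around the origin, and zero
    elsewhere: a map of finite rank. *)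
Definition sampled F : fld := fun i x => \sum_j \1_(cell l (node j)) x * F i ((node j)%:~R * l).

Lemma mf_sampled F : mfF (sampled F).
Proof.
move=> i; apply: mf_sum => j; apply: mfM; last exact: mf_cst.
by apply: measurable_indic; exact: cell_meas.
Qed.

Lemma sampled_in F i x : - m%:Z <= cidx l x < m%:Z -> sampled F i x = F i ((cidx l x)%:~R * l).
Proof.
move=> /andP[h1 h2]; have hj : (`|(cidx l x + m%:Z)%R|%N < m + m)%N by lia.
have nE : node (Ordinal hj) = cidx l x by rewrite /node /=; lia.
rewrite /sampled (bigD1 (Ordinal hj))//= big1 ?addr0 => [|j nj].
  by rewrite nE indicE mem_set ?mul1r//; exact/cellP.
rewrite indicE memNset ?mul0r// => /(cellP l0) e; case/eqP: nj; apply: val_inj => /=.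
by move: e; rewrite /node; lia.
Qed.

Lemma sampled_out F i x : ~~ (- m%:Z <= cidx l x < m%:Z) -> sampled F i x = 0.
Proof.
move=> h; rewrite /sampled big1// => j _; rewrite indicE memNset ?mul0r// => /(cellP l0) e.
by move: h (ltn_ord j); rewrite e /node; lia.
Qed.

Lemma window_out x : ~~ (- m%:Z <= cidx l x < m%:Z) -> m%:R * l <= `|x|.
Proof.
have := cell_cidx l0 x; rewrite /cell/= in_itv/= => /andP[c1 c2].
rewrite negb_and -ltNge -leNgt => /orP[h|h].
  have h1 : ((cidx l x)%:~R + 1 : R) <= - m%:R by rewrite -[1]/(1%:~R) -intrD -[m%:R]/(m%:Z%:~R) -intrN ler_int; lia.
  have h2 : ((cidx l x)%:~R + 1) * l <= - m%:R * l by rewrite ler_pM2r.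
  by have := ler_norm (- x); rewrite normrN; lra.
have h1 : (m%:R : R) <= (cidx l x)%:~R by rewrite -[m%:R]/(m%:Z%:~R) ler_int.
by have := ler_norm x; have : m%:R * l <= (cidx l x)%:~R * l; [rewrite ler_pM2r|lra].
Qed.

(** Within the sampled cells the oscillation over length l is controlled by the derivative. Outside
    the sample is zero, but there [b] is at most [dl]. A fine mesh over a long range makes both
    parts small. *)
Lemma sampling_error b (Cb dl : R) J : cont2 b -> (forall i k x, `|b i k x| <= Cb) ->
  (forall i k x, m%:R * l <= `|x| -> `|b i k x| <= dl) -> L2jet J ->
  let N := bmul b (fadd (j0 J) (cf (-1) (sampled (j0 J)))) in
  isL2 N /\ n2 N <= 3 * (80 * Cb ^+ 2 * l ^+ 2 + 20 * dl ^+ 2) * (n2 (j0 J) + n2 (j1 J)).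
Proof.
move=> cb hb hd LJ N; have [ok _ _ _] := LJ; have [L0 L1 _] := jet_L2 LJ.
have mN : mfF N.
  move=> i; apply: mf_sum => k; apply: mfM; first exact: mf_cont (cb i k).
  by apply: mf_fadd; [exact: L0.1|apply: mf_cmul; exact: mf_sampled].
set a := 80 * Cb ^+ 2 * l ^+ 2 + 20 * dl ^+ 2.
have a1 : 0 <= 80 * Cb ^+ 2 * l ^+ 2 by apply: mulr_ge0; [apply: mulr_ge0 => //|]; exact: sqr_ge0.
have a2 : 0 <= 20 * dl ^+ 2 by apply: mulr_ge0 => //; exact: sqr_ge0.
have a0 : 0 <= a by exact: addr_ge0.
pose g x := sq (j0 J) x + sq (j1 J) x.
have mg : mf g by apply: mfD; apply: mf_sq; [exact: L0.1|exact: L1.1].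
have g0 x : 0 <= g x by rewrite addr_ge0// sq_ge0.
have NE i x : fadd (j0 J) (cf (-1) (sampled (j0 J))) i x = j0 J i x - sampled (j0 J) i x.
  by rewrite cfN cf1 /fadd /fscale mulN1r.
have cellb j : (qi (cell l j) (sq N) <= a%:E * qi (cell l j) g)%E.
  have mc := cell_meas l j.
  have [win|nwin] := boolP (- m%:Z <= j < m%:Z); last first.
    apply: (@le_trans _ _ ((20 * dl ^+ 2)%:E * qi (cell l j) g)%E); last first.
      by apply: lee_wpmul2r; [exact: qi_ge0|rewrite lee_fin /a lerDr].
    rewrite -qiZ//.
    apply: qi_le => //; [exact: mf_sq|by apply: mfM => //; exact: mf_cst|exact: sq_ge0|].
    move=> x cx; have cE := (cellP l0 j x).1 cx; rewrite -cE in nwin.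
    apply: (@le_trans _ _ (20 * dl ^+ 2 * sq (fadd (j0 J) (cf (-1) (sampled (j0 J)))) x)).
      by apply: sq_bmul => i k; apply: hd; exact: window_out.
    apply: (ler_wpM2l a2).
    have -> : sq (fadd (j0 J) (cf (-1) (sampled (j0 J)))) x = sq (j0 J) x.
      by apply: eq_bigr => i _; rewrite NE sampled_out// subr0.
    by rewrite /g lerDl sq_ge0.
  have ljE : (j%:~R + 1) * l = j%:~R * l + l by rewrite mulrDl mul1r.
  have c1 i : continuous (j1 J i) by have [_ c] := D2_cont (ok i).
  have csq : continuous (sq (j1 J)).
    rewrite (_ : sq (j1 J) = fun x => j1 J (false, false) x ^+ 2 + j1 J (false, true) x ^+ 2 +
      (j1 J (true, false) x ^+ 2 + j1 J (true, true) x ^+ 2)); last by apply/funext => x; rewrite /sq sum4.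
    by move=> x; apply: cvgD; apply: cvgD; apply: contX.
  pose I := itg (j%:~R * l) (j%:~R * l + l) (sq (j1 J)).
  have I0 : 0 <= I by apply: itg_ge0 => x; exact: sq_ge0.
  have IE : (qi (cell l j) (sq (j1 J)) = I%:E)%E.
    rewrite /I itg_qi; [|exact: lint_cont|exact: sq_ge0].
    by rewrite /cell ljE.
  apply: (@le_trans _ _ (qi (cell l j) (fun=> 80 * Cb ^+ 2 * l * I))).
    apply: qi_le => //; [exact: mf_sq|exact: mf_cst|exact: sq_ge0|].
    move=> x cx; have cE := (cellP l0 j x).1 cx; have win' := win; rewrite -cE in win'.
    apply: (le_trans (sq_bmul _ (fun i k => hb i k x))).
    rewrite (_ : 80 * Cb ^+ 2 * l * I = 20 * Cb ^+ 2 * (4 * (l * I))); last by ring.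
    have a3 : 0 <= 20 * Cb ^+ 2 by apply: mulr_ge0 => //; exact: sqr_ge0.
    apply: (ler_wpM2l a3).
    have -> : 4 * (l * I) = \sum_(i : I4) l * I by rewrite sum4; ring.
    apply: ler_sum => i _; rewrite NE sampled_in// cE.
    move: cx; rewrite /cell/= in_itv/= ljE => /andP[x1 x2].
    apply: (le_trans (oscillation (D2_prim (ok i)) (c1 i) l0 (y := x) _)); first by rewrite x1 ltW.
    rewrite ler_pM2l// itg_le//; [by apply: lint_cont; exact: contX|exact: lint_cont|].
    by move=> y _; exact: sq_ge1.
  have -> : (qi (cell l j) (fun=> (80 * Cb ^+ 2 * l * I)%R) = ((80 * Cb ^+ 2 * l ^+ 2)%:E * I%:E)%E).
    have h0 : 0 <= 80 * Cb ^+ 2 * l * I by apply: mulr_ge0 => //; apply: mulr_ge0; [apply: mulr_ge0 => //; exact: sqr_ge0|exact: ltW].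
    have l1 : lint (fun=> 80 * Cb ^+ 2 * l * I) by exact: lint_cst.
    have := itg_qi (j%:~R * l) (j%:~R * l + l) l1 (fun=> h0).
    rewrite /cell ljE => <-; rewrite itg_cst; last by rewrite lerDl ltW.
    by rewrite -EFinM; congr (_%:E); ring.
  rewrite -IE; apply: (@le_trans _ _ (a%:E * qi (cell l j) (sq (j1 J)))%E).
    by apply: lee_wpmul2r; [apply: qi_ge0; exact: sq_ge0|rewrite lee_fin /a lerDl].
  apply: lee_wpmul2l; first by rewrite lee_fin.
  apply: qi_le => //; [by apply: mf_sq; exact: L1.1|exact: sq_ge0|].
  by move=> x _; rewrite /g lerDr sq_ge0.
have h : (q setT N <= ((3 * a) * (n2 (j0 J) + n2 (j1 J)))%:E)%E.
  rewrite EFinM EFinD -!n2E//.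
  have -> : (q setT (j0 J) + q setT (j1 J) = qi setT g)%E.
    by rewrite /q -qiD//; [apply: mf_sq; exact: L0.1|apply: mf_sq; exact: L1.1|exact: sq_ge0|exact: sq_ge0].
  apply: (cell_sum_line l0) => //; [exact: mf_sq|exact: sq_ge0|].
  move=> j; apply: (le_trans (cellb j)); apply: lee_wpmul2l; first by rewrite lee_fin.
  rewrite -[leLHS]add0e -[leLHS]adde0.
  by apply: leeD; [apply: leeD|]; rewrite ?qi_ge0.
have LN : isL2 N by split => //; exact: le_lt_trans h (ltry _).
by split => //; rewrite -lee_fin -n2E.
Qed.

Lemma sampled_fadd F G : sampled (fadd F G) = fadd (sampled F) (sampled G).
Proof.
apply/funext => i; apply/funext => x; rewrite /sampled /fadd -big_split/=.
by apply: eq_bigr => j _; rewrite mulrDr.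
Qed.

Lemma sampled_fscale c F : sampled (fscale c F) = fscale c (sampled F).
Proof.
by apply/funext => i; apply/funext => x; rewrite /sampled /fscale mulr_sumr; apply: eq_bigr => j _; rewrite mulrCA.
Qed.

Lemma sampled_cf z F : sampled (cf z F) = cf z (sampled F).
Proof.
rewrite !cfE sampled_fadd !sampled_fscale; congr (fadd _ (fscale _ _)).
apply/funext => -[j []]; apply/funext => x; rewrite /sampled /rot//=.
by rewrite -sumrN; apply: eq_bigr => k _; rewrite mulrN.
Qed.

End Sampling.
End Perturbation.

(** * Convergent power series in one complex variable *)

Section Germs.
Variable R : realType.
Local Notation C := R[i].
Local Notation nc := (@Normc.normc R).

(* f = g 0 is a convergent power series at 0: g n is its n-th iterated difference quotient. *)
Definition germ (f : C -> C) : Prop := exists (g : nat -> C -> C) (c : nat -> C) (M rho r : R),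
  [/\ 0 <= M, 0 <= rho, 0 < r, forall h, g 0%N h = f h & forall n h, nc h <= r ->
    g n h = c n + h * g n.+1 h /\ nc (g n h) <= M * rho ^+ n].

Lemma nc_ge0 z : 0 <= nc z. Proof. by case: z => a b; exact: sqrtr_ge0. Qed.

Lemma germ_ext f f' : (forall h, f h = f' h) -> germ f -> germ f'.
Proof.
by move=> e [g [c [M [rho [r [M0 rho0 r0 gf H]]]]]]; exists g, c, M, rho, r; split => // h; rewrite gf e.
Qed.

Lemma germ_cst (a : C) : germ (fun=> a).
Proof.
exists (fun n _ => if n is 0%N then a else 0), (fun n => if n is 0%N then a else 0), (nc a), 0, 1.
split => //; first exact: nc_ge0.
move=> n h _; rewrite mulr0 addr0; split => //; case: n => [|n]; first by rewrite expr0 mulr1.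
by rewrite Normc.normc0 expr0n/= mulr0.
Qed.

Lemma germ_add f f' : germ f -> germ f' -> germ (fun h => f h + f' h).
Proof.
move=> [g [c [M [rho [r [M0 rho0 r0 gf H]]]]]] [g' [c' [M' [rho' [r' [M0' rho0' r0' gf' H']]]]]].
exists (fun n h => g n h + g' n h), (fun n => c n + c' n), (M + M'), (rho + rho'), (Num.min r r').
split; [exact: addr_ge0|exact: addr_ge0|by rewrite lt_min r0|by move=> h; rewrite gf gf'|].
move=> n h; rewrite le_min => /andP[h1 h2]; have [e1 b1] := H n h h1; have [e2 b2] := H' n h h2.
split; first by rewrite e1 e2; ring.
apply: (le_trans (le_normcD _ _)); rewrite mulrDl; apply: lerD.
  by apply: (le_trans b1); rewrite ler_wpM2l// lerXn2r ?nnegrE ?addr_ge0// lerDl.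
by apply: (le_trans b2); rewrite ler_wpM2l// lerXn2r ?nnegrE ?addr_ge0// lerDr.
Qed.

Lemma nc_sum (n : nat) (F : nat -> C) (b : R) : (forall k, (k < n)%N -> nc (F k) <= b) ->
  nc (\sum_(k < n) F k) <= n%:R * b.
Proof.
elim: n => [|n IH] hb; first by rewrite big_ord0 Normc.normc0 mul0r.
rewrite big_ord_recr/= -natr1 mulrDl mul1r; apply: (le_trans (le_normcD _ _)); apply: lerD; last exact: hb.
by apply: IH => k hk; apply: hb; exact: ltnW.
Qed.

(** The Cauchy product, carried out on difference quotients so that no infinite sum appears. *)
Lemma germ_mul f f' : germ f -> germ f' -> germ (fun h => f h * f' h).
Proof.
move=> [g [c [M [rho [r [M0 rho0 r0 gf H]]]]]] [g' [c' [M' [rho' [r' [M0' rho0' r0' gf' H']]]]]].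
(* Expanding [f] to order n, and [f'] to order n - k in the k-th term, leaves this expression as the
   factor of h^n. *)
pose G n h := g n h * g' 0%N h + \sum_(k < n) c k * g' (n - k)%N h.
pose Cn n := \sum_(k < n.+1) c k * c' (n - k)%N.
(* The factor 2 in the rate absorbs the n + 1 terms of [G n], as n + 1 <= 2^n. *)
exists G, Cn, (M * M'), (2 * (rho + rho')), (Num.min r r').
have rr : 0 <= rho + rho' by exact: addr_ge0.
split; [exact: mulr_ge0|exact: mulr_ge0|by rewrite lt_min r0| |].
  by move=> h; rewrite /G big_ord0 addr0 gf gf'.
move=> n h; rewrite le_min => /andP[h1 h2].
have cb k : nc (c k) <= M * rho ^+ k.
  have [e1 b1] := H k 0 ltac:(by rewrite Normc.normc0 ltW).
  by rewrite e1 mul0r addr0 in b1.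
split.
  have [e1 _] := H n h h1; rewrite /G e1 mulrDl -addrA.
  have -> : c n * g' 0%N h + (h * g n.+1 h * g' 0%N h + \sum_(k < n) c k * g' (n - k)%N h) =
      h * (g n.+1 h * g' 0%N h) + \sum_(k < n.+1) c k * g' (n - k)%N h.
    by rewrite big_ord_recr/= subnn; ring.
  have -> : \sum_(k < n.+1) c k * g' (n - k)%N h = Cn n + h * \sum_(k < n.+1) c k * g' (n.+1 - k)%N h.
    rewrite /Cn mulr_sumr -big_split/=; apply: eq_bigr => k _.
    have [e2 _] := H' (n - k)%N h h2; rewrite e2 subSn; last by rewrite -ltnS.
    ring.
  ring.
have X0 : 0 <= M * M' * (rho + rho') ^+ n by rewrite !mulr_ge0// exprn_ge0.
have p1 k : (k <= n)%N -> M * rho ^+ k * (M' * rho' ^+ (n - k)) <= M * M' * (rho + rho') ^+ n.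
  move=> kn; rewrite mulrACA; apply: ler_wpM2l; first exact: mulr_ge0.
  rewrite -{2}(subnKC kn) exprD; apply: ler_pM; rewrite ?exprn_ge0//.
    by rewrite lerXn2r ?nnegrE// lerDl.
  by rewrite lerXn2r ?nnegrE// lerDr.
have b : nc (G n h) <= n.+1%:R * (M * M' * (rho + rho') ^+ n).
  rewrite -natr1 mulrDl mul1r; apply: (le_trans (le_normcD _ _)); rewrite [leLHS]addrC; apply: lerD.
    apply: (@nc_sum n (fun k => c k * g' (n - k)%N h)) => k hk; rewrite Normc.normcM; apply: le_trans (p1 k (ltnW hk)).
    by apply: ler_pM; rewrite ?nc_ge0//; have [] := H' (n - k)%N h h2.
  rewrite Normc.normcM; have := p1 n (leqnn n); rewrite subnn; apply: le_trans.
  by apply: ler_pM; rewrite ?nc_ge0//; [have [] := H n h h1|have [] := H' 0%N h h2].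
apply: (le_trans b); rewrite exprMn [leRHS]mulrCA; apply: ler_wpM2r => //.
by rewrite -natrX ler_nat ltn_expl.
Qed.

Lemma germ_sum (I : Type) (s : seq I) (F : I -> C -> C) : (forall i, germ (F i)) ->
  germ (fun h => \sum_(i <- s) F i h).
Proof.
move=> H; elim: s => [|i s IH]; first by apply: germ_ext (germ_cst 0) => h; rewrite big_nil.
by apply: germ_ext (germ_add (H i) IH) => h; rewrite big_cons.
Qed.

Lemma germ_prod (I : Type) (s : seq I) (F : I -> C -> C) : (forall i, germ (F i)) ->
  germ (fun h => \prod_(i <- s) F i h).
Proof.
move=> H; elim: s => [|i s IH]; first by apply: germ_ext (germ_cst 1) => h; rewrite big_nil.
by apply: germ_ext (germ_mul (H i) IH) => h; rewrite big_cons.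
Qed.

Lemma germ_det (n : nat) (A : C -> 'M[C]_n) : (forall i j, germ (fun h => A h i j)) ->
  germ (fun h => \det (A h)).
Proof.
move=> H; apply: germ_sum => s; apply: germ_mul; first exact: germ_cst.
by apply: germ_prod.
Qed.

(** If some coefficient is nonzero, the first such dominates near 0. Otherwise f(h) = h^j g_j(h) for
    every j, and the geometric bound sends this to 0 with growing j. *)
Lemma germ_isolated f : germ f ->
  (exists2 r, 0 < r & forall h, nc h <= r -> f h = 0) \/
  (exists2 r, 0 < r & forall h, 0 < nc h <= r -> f h != 0).
Proof.
move=> [g [c [M [rho [r [M0 rho0 r0 gf H]]]]]].
have [[n nz]|az] := pselect (exists n, c n != 0).
  right; have [k ck kmin] := @ex_minnP (fun n => c n != 0) (ex_intro _ n nz).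
  have cz j : (j < k)%N -> c j = 0 by move=> jk; apply/eqP; apply: contraTT jk => /kmin; rewrite -leqNgt.
  have c0 : 0 < nc (c k) by rewrite lt_neqAle nc_ge0 andbT eq_sym; apply: contraNneq ck => /Normc.eq0_normc ->.
  have fE h : nc h <= r -> forall j, (j <= k)%N -> f h = h ^+ j * g j h.
    move=> hr; elim=> [|j IH] jk; first by rewrite expr0 mul1r gf.
    rewrite IH; last exact: ltnW.
    by have [-> _] := H j h hr; rewrite (cz _ jk) add0r mulrA -exprSr.
  pose X := M * rho ^+ k.+1; have X0 : 0 <= X by rewrite mulr_ge0// exprn_ge0.
  exists (Num.min r (nc (c k) / (2 * (X + 1)))).
    by rewrite lt_min r0 divr_gt0//; lra.
  move=> h /andP[h0]; rewrite le_min => /andP[h1 h2].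
  have hn0 : h != 0 by apply: contraTneq h0 => ->; rewrite Normc.normc0 ltxx.
  rewrite (fE h h1 k (leqnn k)) mulf_neq0// ?expf_neq0//.
  have [-> _] := H k h h1; have [_ b] := H k.+1 h h1.
  apply/negP => /eqP e; have : nc (c k) <= nc h * X.
    have -> : c k = - (h * g k.+1 h) by apply/eqP; rewrite -subr_eq0 opprK e.
    by rewrite normcN Normc.normcM ler_wpM2l// nc_ge0.
  have h3 : nc h * (2 * (X + 1)) <= nc (c k) by rewrite -ler_pdivlMr//; lra.
  have h4 : 0 <= nc h * X by rewrite mulr_ge0// nc_ge0.
  have h5 : nc h * (2 * (X + 1)) = 2 * (nc h * X) + 2 * nc h by ring.
  by rewrite h5 in h3; lra.
left; exists (Num.min r (2 * (rho + 1))^-1).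
  by rewrite lt_min r0 invr_gt0; lra.
move=> h; rewrite le_min => /andP[h1 h2].
have cz j : c j = 0 by apply/eqP; apply: contrapT => cj; apply: az; exists j; apply/negP.
have fE j : f h = h ^+ j * g j h.
  elim: j => [|j IH]; first by rewrite expr0 mul1r gf.
  by rewrite IH; have [-> _] := H j h h1; rewrite cz add0r mulrA -exprSr.
have hr : nc h * rho <= 2^-1.
  have p : 0 < 2 * (rho + 1) by lra.
  have : nc h * (2 * (rho + 1)) <= 1 by rewrite -ler_pdivlMr// mul1r.
  by have := nc_ge0 h; lra.
have ncX j : nc (h ^+ j) = nc h ^+ j.
  by elim: j => [|j IH]; rewrite ?expr0 ?Normc.normc1// !exprS Normc.normcM IH.
have b j : nc (f h) <= 2^-1 ^+ j * M.
  rewrite (fE j) Normc.normcM ncX; have [_ b] := H j h h1.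
  apply: (@le_trans _ _ (nc h ^+ j * (M * rho ^+ j))); first by rewrite ler_wpM2l// exprn_ge0// nc_ge0.
  rewrite mulrCA -exprMn mulrC ler_wpM2r// lerXn2r ?nnegrE ?mulr_ge0 ?nc_ge0//.
apply/Normc.eq0_normc/eqP; rewrite eq_le nc_ge0 andbT leNgt; apply/negP => f0.
have [j hj] := half_pow_lt (divr_gt0 f0 (ltr_wpDl M0 ltr01)).
have := b j; have : 2^-1 ^+ j * (M + 1) < nc (f h) by rewrite -ltr_pdivlMr//; lra.
by have : 0 < (2^-1 : R) ^+ j by [rewrite exprn_gt0]; lra.
Qed.

End Germs.

(** * Finite-rank perturbations and their determinant *)

Section FiniteRank.
Variable R : realType.
Local Notation mu := (@lebesgue_measure R).
Local Notation fld := (I4 -> R -> R).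
Local Notation jet := (jet R I4).
Local Notation C := R[i].
Local Notation nc := (@Normc.normc R).
Implicit Types (F G : fld) (J : jet) (z h w : C).

Lemma nc_sq z : nc z ^+ 2 = zn z.
Proof. by case: z => a b; rewrite /zn /= sqr_sqrtr// addr_ge0// sqr_ge0. Qed.

Section Sums.
Variable I : Type.
Implicit Type s : seq I.

Definition fsum s (F : I -> fld) : fld := foldr (fun l a => fadd (F l) a) (@fzero R I4) s.

Lemma fsumE s (F : I -> fld) i x : fsum s F i x = \sum_(l <- s) F l i x.
Proof. by elim: s => [|l s IH]; rewrite ?big_nil// big_cons -IH. Qed.

Lemma n2_fsum s (F : I -> fld) : (forall l, isL2 (F l)) ->
  isL2 (fsum s F) /\ n2 (fsum s F) <= 2 ^+ size s * \sum_(l <- s) n2 (F l).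
Proof.
move=> LF; elim: s => [|l s [IL IH]]; first by have [L0 n0] := n2_zero R; rewrite big_nil mulr0 /= n0.
split; first exact: isL2_add.
rewrite [fsum _ _]/= big_cons; have := n2_add ltr01 (LF l) IL; rewrite invr1 => h.
apply: (le_trans h); rewrite exprS.
have p1 : (1 : R) <= 2 ^+ size s by rewrite exprn_ege1// ler1n.
have := n2_ge0 (F l); have : 2 * (2 ^+ size s * \sum_(l <- s) n2 (F l)) >= 2 * n2 (fsum s F) by rewrite ler_pM2l.
move: (2 ^+ size s) (\sum_(l <- s) n2 (F l)) (n2 (F l)) (n2 (fsum s F)) p1 => X S a b p1 h1 a0.
by have : a <= X * a by [rewrite ler_peMl]; nra.
Qed.

Lemma cl_zero (T : jet -> fld) : clinear T -> T (@jzero R I4) = @fzero R I4.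
Proof.
move=> cl; have e : jadd (@jzero R I4) (@jzero R I4) = @jzero R I4.
  by congr Jet; apply/funext => i; apply/funext => x; exact: addr0.
have := cl_add cl (@jzero R I4) (@jzero R I4); rewrite e => h.
apply/funext => i; apply/funext => x; have := congr1 (fun F : fld => F i x) h.
by rewrite /fadd /fzero; lra.
Qed.

Lemma sol_sum (T : jet -> fld) s (y : I -> C) (e : I -> fld) (S : I -> jet) : clinear T ->
  (forall l, Sol T (e l) (S l)) ->
  exists2 J, Sol T (fsum s (fun l => cf (y l) (e l))) J & j0 J = fsum s (fun l => cf (y l) (j0 (S l))).
Proof.
move=> cl HS; elim: s => [|l s [J SJ eJ]].
  by exists (@jzero R I4) => //; split; [exact: L2jet_zero|apply: aeW => x i; rewrite cl_zero].
exists (jadd (cj (y l) (S l)) J); first by apply: sol_add => //; exact: sol_cj.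
by rewrite jadd0 cj0 eJ.
Qed.

End Sums.

Section Evaluation.
Variables (n : nat) (c : 'I_n -> bool) (p : 'I_n -> R).

Definition ev (k : 'I_n) F : C := (F (c k, false) (p k) +i* F (c k, true) (p k))%C.

Lemma ev_fadd k F G : ev k (fadd F G) = ev k F + ev k G.
Proof. by []. Qed.

Lemma ev_cf k z F : ev k (cf z F) = z * ev k F.
Proof.
case: z => a b; rewrite /ev /cf /=; have [e1 e2] := cmulE a b F (c k) (p k).
by rewrite e1 e2; congr Complex; rewrite addrC.
Qed.

Lemma ev_fsum k (I : Type) (s : seq I) (F : I -> fld) : ev k (fsum s F) = \sum_(l <- s) ev k (F l).
Proof. by elim: s => [|l s IH]; rewrite ?big_nil// big_cons -IH. Qed.

Lemma ev_bound k J : L2jet J -> zn (ev k (j0 J)) <= 4 * (n2 (j0 J) + n2 (j1 J)).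
Proof.
by move=> LJ; have := jet_point (c k, false) (p k) LJ; have := jet_point (c k, true) (p k) LJ; rewrite /zn /=; lra.
Qed.

Variables (Op T : jet -> fld) (e : 'I_n -> fld).
Hypotheses (clO : clinear Op) (clT : clinear T) (Le : forall l, isL2 (e l)).
Local Notation ix := (index_enum 'I_n).
Hypothesis OpE : forall J, Op J = fadd (T J) (fsum ix (fun k => cf (ev k (j0 J)) (e k))).

(** The Weinstein-Aronszajn matrix: solving with the finite-rank term amounts to finding the
    evaluations y of the solution, and [y *m redmx S] has to be the vector of evaluations of the
    solution without that term. *)
Definition redmx (S : 'I_n -> jet) : 'M[C]_n := \matrix_(l, k) ((l == k)%:R + ev k (j0 (S l))).

Lemma redmxE (S : 'I_n -> jet) (y : 'rV[C]_n) k :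
  (y *m redmx S) 0 k = y 0 k + \sum_l y 0 l * ev k (j0 (S l)).
Proof.
rewrite mxE (eq_bigr (fun l => y 0 l * (l == k)%:R + y 0 l * ev k (j0 (S l)))); last first.
  by move=> l _; rewrite mxE mulrDr.
rewrite big_split/=; congr (_ + _); rewrite (bigD1 k)//= eqxx mulr1 big1 ?addr0// => l /negbTE ->.
by rewrite mulr0.
Qed.

Lemma opl_E z J : opl Op z J = fadd (opl T z J) (fsum ix (fun k => cf (ev k (j0 J)) (e k))).
Proof. by rewrite /opl OpE; apply/funext => i; apply/funext => x; rewrite /fadd; ring. Qed.

Lemma fsum_opp (y : 'I_n -> C) i x : fsum ix (fun l => cf (- y l) (e l)) i x = - fsum ix (fun l => cf (y l) (e l)) i x.
Proof. by rewrite !fsumE -sumrN; apply: eq_bigr => l _; rewrite cfN /fscale mulN1r. Qed.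

(** When [y *m redmx S] is the vector of evaluations of J, the corrected jet has evaluations y, and
    its datum then cancels the finite-rank term. *)
Lemma corrected z (S : 'I_n -> jet) (y : 'rV[C]_n) G J : (forall l, Sol (opl T z) (e l) (S l)) ->
  Sol (opl T z) G J -> exists J', [/\
    Sol (opl T z) (fadd G (fsum ix (fun l => cf (- y 0 l) (e l)))) J' &
    forall k, ev k (j0 J') = ev k (j0 J) + y 0 k - (y *m redmx S) 0 k].
Proof.
move=> HS SJ; have cl := opl_clinear z clT.
have [J1 S1 e1] := sol_sum ix (fun l => - y 0 l) cl HS.
exists (jadd J J1); split; first exact: sol_add.
move=> k; rewrite jadd0 ev_fadd e1 ev_fsum redmxE.
rewrite (eq_bigr (fun l => - (y 0 l * ev k (j0 (S l))))) ?sumrN; last by move=> l _; rewrite ev_cf mulNr.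
by ring.
Qed.

(** A kernel vector y corrects the zero solution to a jet with evaluations y that the full operator
    annihilates; the a priori bound makes this jet, and hence y, zero. *)
Lemma redmx_det z (S : 'I_n -> jet) (K : R) : (forall l, Sol (opl T z) (e l) (S l)) ->
  Est (opl Op z) K -> \det (redmx S) != 0.
Proof.
move=> HS hE; apply/negP => /det0P[y y0 yA]; have clz := opl_clinear z clT; have [L0 n0] := n2_zero R.
have Z : Sol (opl T z) (@fzero R I4) (@jzero R I4).
  by split; [exact: L2jet_zero|apply: aeW => x i; rewrite cl_zero].
have [J [SJ eJ]] := corrected y HS Z.
have evJ k : ev k (j0 J) = y 0 k by rewrite eJ yA mxE subr0 [ev _ _](_ : _ = 0) ?add0r.
have SO : Sol (opl Op z) (@fzero R I4) J.
  split; first exact: SJ.1; apply: (ae_imp SJ.2) => x hx i.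
  rewrite opl_E /fadd hx /fadd fsum_opp !fsumE /fzero add0r.
  by under [X in _ + X]eq_bigr do rewrite evJ; rewrite addNr.
case/eqP: y0; apply/rowP => k; rewrite mxE -evJ.
have pt i x : j0 J i x = 0.
  have := sol_point (opl_clinear z clO) i x hE L0 SO; rewrite n0 !mulr0 => h.
  by apply/eqP; rewrite -sqrf_eq0 eq_le h sqr_ge0.
by rewrite /ev !pt.
Qed.

(** Existence inverts the matrix to find the evaluations. For the bound, the evaluations of a given
    J are recovered from those of the solution without the finite-rank term, which the datum
    controls pointwise. *)
Lemma redmx_INV z (S : 'I_n -> jet) (K : R) : 0 <= K -> (forall l, Sol (opl T z) (e l) (S l)) ->
  INV (opl T z) K -> \det (redmx S) != 0 -> exists2 K', 0 <= K' & INV (opl Op z) K'.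
Proof.
move=> K0 HS Hi dA; have clz := opl_clinear z clT; have clo := opl_clinear z clO.
have uA : redmx S \in unitmx by rewrite unitmxE unitfE.
pose D := \sum_l \sum_k nc (invmx (redmx S) k l); pose E := \sum_(l <- ix) n2 (e l).
have D0 : 0 <= D by do 2 (apply: sumr_ge0 => ? _); exact: nc_ge0.
have E0 : 0 <= E by apply: sumr_ge0 => l _; exact: n2_ge0.
pose X := 2 ^+ size ix * (4 * K * D ^+ 2 * E).
have X0 : 0 <= X by rewrite /X !mulr_ge0 ?exprn_ge0.
exists (K * (2 + 2 * X)); first by rewrite mulr_ge0//; lra.
split.
  move=> F mF fF; have LF : isL2 F by [].
  have [J SJ] := sol_exists Hi LF; pose r : 'rV[C]_n := \row_k ev k (j0 J).
  have [J' [SJ' eJ']] := corrected (r *m invmx (redmx S)) HS SJ; exists J'; first exact: SJ'.1.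
  have evJ k : ev k (j0 J') = (r *m invmx (redmx S)) 0 k.
    by rewrite eJ' mulmxKV// [in X in _ - X]mxE addrAC subrr add0r.
  apply: (ae_imp SJ'.2) => x hx i; rewrite opl_E /fadd hx /fadd fsum_opp.
  rewrite -addrA [X in _ + X](_ : _ = 0) ?addr0//.
  by rewrite !fsumE; under [X in _ + X]eq_bigr do rewrite evJ; rewrite addNr.
move=> J LJ; have [L0 L1 _] := jet_L2 LJ; have LG := cl_L2 clo LJ.
set G := opl Op z J in LG *; rewrite (n2E L0) (n2E L1) (n2E LG) -EFinD -EFinM lee_fin.
pose y : 'rV[C]_n := \row_k ev k (j0 J).
pose H := fsum ix (fun l => cf (- y 0 l) (e l)).
have LH : isL2 H by apply: (n2_fsum _ _).1 => l; exact: isL2_cf.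
have SJ : Sol (opl T z) (fadd G H) J.
  split => //; apply: aeW => x i; rewrite /H /G opl_E /fadd fsum_opp !fsumE.
  by under [X in _ - X]eq_bigr do rewrite mxE; rewrite addrK.
have [JG SG] := sol_exists Hi LG; have [J' [SJ' eJ']] := corrected y HS SG.
have ee := sol_unique clz Hi.2 (isL2_add LG LH) SJ SJ'.
pose r : 'rV[C]_n := \row_k ev k (j0 JG).
have yr : y *m redmx S = r.
  apply/rowP => k; have := eJ' k; rewrite -ee [r 0 k]mxE -[ev k (j0 J)]/(ev k (j0 J)).
  have -> : ev k (j0 J) = y 0 k by rewrite mxE.
  move=> h; have := congr1 (fun t => t - y 0 k + (y *m redmx S) 0 k) h.
  by rewrite subrr add0r => ->; ring.
have yE : y = r *m invmx (redmx S) by rewrite -yr mulmxK.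
have g0 := n2_ge0 G.
have rb k : nc (r 0 k) <= Num.sqrt (4 * K * n2 G).
  have a0 : 0 <= 4 * K * n2 G by rewrite !mulr_ge0.
  rewrite -(@ler_pXn2r _ 2) ?nnegrE ?nc_ge0 ?sqrtr_ge0// sqr_sqrtr// nc_sq mxE.
  have hS := sol_est clz Hi.2 LG SG.
  by apply: (le_trans (ev_bound k SG.1)); rewrite -mulrA ler_pM2l.
have yb l : zn (y 0 l) <= 4 * K * n2 G * D ^+ 2.
  have a0 : 0 <= 4 * K * n2 G by rewrite !mulr_ge0.
  rewrite -nc_sq -[4 * K * n2 G]sqr_sqrtr// -exprMn lerXn2r ?nnegrE ?nc_ge0 ?mulr_ge0 ?sqrtr_ge0//.
  rewrite yE mxE; apply: (@le_trans _ _ (\sum_k nc (r 0 k * invmx (redmx S) k l))).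
    by elim/big_ind2: _ => [|a b a' b' h1 h2|//]; [rewrite Normc.normc0|exact: le_trans (le_normcD _ _) (lerD h1 h2)].
  apply: (@le_trans _ _ (Num.sqrt (4 * K * n2 G) * \sum_k nc (invmx (redmx S) k l))).
    rewrite mulr_sumr; apply: ler_sum => k _; rewrite Normc.normcM; apply: ler_wpM2r; [exact: nc_ge0|exact: rb].
  apply: ler_wpM2l; first exact: sqrtr_ge0.
  rewrite /D [leRHS](bigD1 l)//= lerDl; apply: sumr_ge0 => l' _; apply: sumr_ge0 => k _; exact: nc_ge0.
have hb : n2 H <= X * n2 G.
  apply: (le_trans (n2_fsum ix (fun l => isL2_cf (- y 0 l) (Le l))).2).
  rewrite /X -mulrA; apply: ler_wpM2l; first exact: exprn_ge0.
  rewrite (_ : 4 * K * D ^+ 2 * E * n2 G = (4 * K * n2 G * D ^+ 2) * E); last by ring.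
  rewrite /E mulr_sumr; apply: ler_sum => l _; rewrite n2_cf//; apply: ler_wpM2r; first exact: n2_ge0.
  by have := yb l; rewrite /zn; case: (y 0 l) => a b /=; rewrite !sqrrN.
have h1 := sol_est clz Hi.2 (isL2_add LG LH) SJ.
have h2 := n2_add ltr01 LG LH; rewrite invr1 in h2.
apply: (le_trans h1); rewrite -mulrA; apply: ler_wpM2l => //; apply: (le_trans h2).
by rewrite mulrDl; lra.
Qed.

Variables (z1 : C) (r K : R).
Hypotheses (r0 : 0 < r) (K0 : 0 <= K) (Hd : forall h, nc h <= r -> INV (opl T (z1 + h)) K).

(** By the resolvent identity, the difference quotient of the solution at z1 + h with datum [E m] is
    the solution at z1 + h with datum [E m.+1]. The coefficients are evaluations of powers of the
    resolvent at z1, with geometric bounds from [K]. *)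
Lemma solution_germ (SS : C * fld -> jet) l k :
  (forall h F, nc h <= r -> isL2 F -> Sol (opl T (z1 + h)) F (SS (h, F))) ->
  germ (fun h => ev k (j0 (SS (h, e l)))).
Proof.
move=> HS; pose E n := iter n (fun F => j0 (SS (0, F))) (e l).
have nc0 : nc 0 <= r by rewrite Normc.normc0 ltW.
have H1 : INV (opl T z1) K by have := Hd nc0; rewrite addr0.
have LE m : isL2 (E m) /\ n2 (E m) <= K ^+ m * n2 (e l).
  elim: m => [|m [IL IH]]; first by split; [exact: Le|rewrite expr0 mul1r].
  have SE := HS 0 (E m) nc0 IL; have [L0 _ _] := jet_L2 SE.1; split => //.
  have := sol_est (opl_clinear _ clT) (Hd nc0).2 IL SE; have := n2_ge0 (j1 (SS (0, E m))).
  have := ler_wpM2l K0 IH; rewrite mulrA -exprS -[E m.+1]/(j0 (SS (0, E m))); lra.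
have b0 : 0 <= 4 * K * n2 (e l) by rewrite !mulr_ge0// n2_ge0.
exists (fun m h => ev k (j0 (SS (h, E m)))), (fun m => ev k (E m.+1)), (Num.sqrt (4 * K * n2 (e l))), (Num.sqrt K), r.
split => //; try exact: sqrtr_ge0.
move=> m h hr; have [LEm bE] := LE m; have [LEm1 _] := LE m.+1.
have S0 : Sol (opl T z1) (E m) (SS (0, E m)) by have := HS 0 (E m) nc0 LEm; rewrite addr0.
have Sh := HS h (E m) hr LEm; have Sh1 := HS h (E m.+1) hr LEm1.
split.
  have clh := opl_clinear (z1 + h) clT.
  have SC : Sol (opl T (z1 + h)) (E m) (jadd (SS (0, E m)) (cj h (SS (h, E m.+1)))).
    apply: sol_ext (sol_add clh (sol_move h clT S0) (sol_cj clh h Sh1)) => i x.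
    by rewrite cfN /fadd /fscale -[E m.+1]/(j0 (SS (0, E m))); ring.
  by rewrite (sol_unique clh (Hd hr).2 LEm Sh SC) jadd0 cj0 ev_fadd ev_cf.
rewrite -(@ler_pXn2r _ 2) ?nnegrE ?nc_ge0 ?mulr_ge0 ?exprn_ge0 ?sqrtr_ge0// nc_sq exprMn sqr_sqrtr//.
rewrite -exprM mulnC exprM sqr_sqrtr//.
apply: (le_trans (ev_bound k Sh.1)).
have h1 := sol_est (opl_clinear _ clT) (Hd hr).2 LEm Sh.
have h2 := ler_wpM2l K0 bE.
rewrite (_ : 4 * K * n2 (e l) * K ^+ m = 4 * (K * (K ^+ m * n2 (e l)))); last by ring.
by rewrite ler_pM2l//; exact: le_trans h1 h2.
Qed.

(** The determinant is a germ, so near [z1] it vanishes identically or at most at [z1]; its zeros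
    are the points where the full operator fails to be invertible. *)
Theorem isolated_or_not :
  (exists2 r', 0 < r' & forall h, nc h <= r' -> forall K', ~ INV (opl Op (z1 + h)) K') \/
  (exists2 r', 0 < r' & forall h, 0 < nc h <= r' -> exists2 K', 0 <= K' & INV (opl Op (z1 + h)) K').
Proof.
have /choice[SS HS] : forall q : C * fld, exists J, nc q.1 <= r -> isL2 q.2 -> Sol (opl T (z1 + q.1)) q.2 J.
  move=> [h F]; have [[hr LF]|no] := pselect (nc h <= r /\ isL2 F).
    by have [J SJ] := sol_exists (Hd hr) LF; exists J.
  by exists (@jzero R I4) => hr LF; case: no.
have HS' h F : nc h <= r -> isL2 F -> Sol (opl T (z1 + h)) F (SS (h, F)) by exact: (HS (h, F)).
have gd : germ (fun h => \det (redmx (fun l => SS (h, e l)))).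
  apply: germ_det => l k; apply: germ_ext (germ_add (germ_cst (l == k)%:R) (solution_germ l k HS')) => h.
  by rewrite mxE.
have [[r' r'0 H]|[r' r'0 H]] := germ_isolated gd; [left|right]; exists (Num.min r r'); rewrite ?lt_min ?r0//.
  move=> h; rewrite le_min => /andP[h1 h2] K' [_ hE].
  have := redmx_det (fun l => HS' h (e l) h1 (Le l)) hE; by rewrite H// eqxx.
move=> h /andP[h0]; rewrite le_min => /andP[h1 h2].
by apply: (redmx_INV K0 (fun l => HS' h (e l) h1 (Le l)) (Hd h1)); apply: H; rewrite h0.
Qed.

End Evaluation.
End FiniteRank.

(** * The multipulse as a finite-rank perturbation of its background *)

Section Instability.
Variables (R : realType) (K : klausmeier R) (eps : R).
Local Notation mu := (@lebesgue_measure R).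
Local Notation fld := (I4 -> R -> R).
Local Notation jet := (jet R I4).
Local Notation C := R[i].
Local Notation T := (kT K).
Local Notation nc := (@Normc.normc R).
Local Notation Lw := (Lz K eps).
Implicit Types (u v w : R -> R * R) (z h : C).

Definition asymptotic u v : Prop := forall e, 0 < e -> exists X, forall x, X <= `|x| ->
  `|(u x).1 - (v x).1| <= e /\ `|(u x).2 - (v x).2| <= e.

Lemma background_good u v (z : R -> R * R) : stationary K eps u -> (forall x, u x = z x + v x) -> H2line z ->
  periodic v T -> exists M, [/\ 0 <= M, good u M, good v M & asymptotic u v].
Proof.
move=> su uzv hz pv.
have [Ju [Jv [Jz [ku kv LJz ejz [eJz _ [M M0 [bu bv]] cv]]]]] := background su uzv hz pv.
have [oku eu _] := ku; exists M; split => //; first by split => //; exact: cont_emb oku eu.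
move=> e e0; have [X HX] := L2jet_decay LJz e0; exists X => x hx.
have := HX (false, false) x hx; have := HX (true, false) x hx.
by rewrite ejz /emb /= !uzv /= !addrK.
Qed.

(** Every window of [v] can be moved by a multiple of T to where [u] is near [v], and [v] does not
    notice the move. *)
Lemma background_close u v (eta r : R) : periodic v T -> asymptotic u v -> 0 < eta -> close K eta r v u.
Proof.
move=> pv as_uv e0 x0; have [X HX] := as_uv _ e0; have T0 := kT_gt0 K.
pose k := (Num.truncn ((`|X| + `|x0| + `|r|) / T)).+1; exists k%:Z => x hx.
have hk : `|X| + `|x0| + `|r| <= k%:R * T by rewrite -ler_pdivrMr// ltW// truncnS_gt.
have pvk (i : R * R -> R) : i (v (x + k%:Z%:~R * T)) = i (v x).
  by apply: (@shift_int _ (fun y => i (v y))) => y; rewrite pv.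
have far : X <= `|x + k%:Z%:~R * T|.
  apply: le_trans (ler_norm _); rewrite -[k%:Z%:~R]/(k%:R : R).
  move: hx; rewrite ler_norml => /andP[h1 h2].
  have := ler_norm X; have := ler_norm (- x0); rewrite normrN; have := ler_norm r.
  by move: hk h1; clear; move: (k%:R * T) (`|X|) (`|x0|) (`|r|) => a b c d; lra.
have [h1 h2] := HX _ far; rewrite (pvk fst) in h1; rewrite (pvk snd) in h2.
by rewrite distrC h1 distrC h2.
Qed.

Definition bdiff u v (i k : I4) (x : R) : R := Bk K eps u i k x - Bk K eps v i k x.

Lemma bdiff_rot u v (F : fld) : bmul (bdiff u v) (rot F) = rot (bmul (bdiff u v) F).
Proof.
by apply/funext => -[[] []]; apply/funext => x; rewrite /bmul /rot /= !sum4 /bdiff /Bk /rot /=; ring.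
Qed.

Lemma Lz_bdiff u v J : Lw u J = fadd (Lw v J) (bmul (bdiff u v) (j0 J)).
Proof.
apply/funext => i; apply/funext => x.
by rewrite /fadd /bmul /Lz /op !sum4 /bdiff; ring.
Qed.

Definition bump_field (j : bool) (A : set R) : fld := fun i x => if i == (j, false) then \1_A x else 0.

Lemma bump_field_L2 b j (a c : R) (Cb : R) : cont2 b -> (forall i k x, `|b i k x| <= Cb) ->
  isL2 (bmul b (bump_field j `[a, c[%classic)).
Proof.
move=> cb hb; have mA : measurable `[a, c[%classic by exact: measurable_itv.
have mF : mfF (bump_field j `[a, c[%classic).
  move=> i; rewrite /bump_field; case: (i == _); last exact: mf_cst.
  exact: measurable_indic.
have fF : (q setT (bump_field j `[a, c[%classic) < +oo)%E.
  rewrite /q /qi.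
  have -> : sq (bump_field j `[a, c[%classic) = \1_(`[a, c[%classic).
    apply/funext => x; rewrite /sq sum4 /bump_field indicE.
    by clear; case: j; case: (_ \in _); rewrite /= ?expr0n ?expr1n /= ?addr0 ?add0r.
  rewrite integral_indic// setIT.
  rewrite -[X in (X < _)%E]/(@lebesgue_measure R [set` `[a, c[]) lebesgue_measure_itv/=; case: ifP => _; rewrite ?ltry//.
have [LF _] : isL2 (bmul b (bump_field j `[a, c[%classic)) /\ n2 (bmul b (bump_field j `[a, c[%classic)) <= 20 * Cb ^+ 2 * n2 (bump_field j `[a, c[%classic).
  apply: isL2_le => //; last by move=> x; exact: sq_bmul.
    by move=> i; apply: mf_sum => k; apply: mfM => //; exact: mf_cont (cb i k).
  by apply: mulr_ge0 => //; exact: sqr_ge0.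
exact: LF.
Qed.

Section Node.
Variables (l : R) (m : nat).
Let pt := (bool * 'I_(m + m))%type.

(** Written as complex multiples of fixed bump fields, with the sampled values as coefficients, the
    map shows its finite rank over the complex numbers. *)
Lemma sampled_sum (F : fld) i x : sampled l m F i x =
  \sum_(p : pt) cf (F (p.1, false) ((node p.2)%:~R * l) +i* F (p.1, true) ((node p.2)%:~R * l))%C
    (bump_field p.1 (cell l (node p.2))) i x.
Proof.
rewrite -(pair_bigA _ (fun (j : bool) (k : 'I_(m + m)) => cf (F (j, false) ((node k)%:~R * l) +i* F (j, true) ((node k)%:~R * l))%C
    (bump_field j (cell l (node k))) i x))/= big_bool /= -big_split/=.
apply: eq_bigr => k _; rewrite !cfE /fadd /fscale /rot /bump_field /=.
by case: i => [[] []] /=; ring.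
Qed.

End Node.

(** The coefficients of [u] and [v] differ by a decaying matrix. Its sampled part has finite rank;
    the rest has a small relative bound and is absorbed into the invertible operator of [v],
    uniformly near [z1]. *)
Lemma reduction u v M z1 K1 : 0 <= M -> good u M -> good v M -> asymptotic u v -> 0 <= K1 ->
  INV (opl (Lw v) z1) K1 -> exists n (c : 'I_n -> bool) (p : 'I_n -> R) (S : jet -> fld) (e : 'I_n -> fld) (r K2 : R),
  [/\ clinear S, forall l, isL2 (e l),
    forall J, Lw u J = fadd (S J) (fsum (index_enum 'I_n) (fun k => cf (ev c p k (j0 J)) (e k))),
    0 < r /\ 0 <= K2 & forall h, nc h <= r -> INV (opl S (z1 + h)) K2].
Proof.
move=> M0 gu gv as_uv K10 Hi; have [bu cu] := gu; have [bv cv] := gv.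
have [dl [K' [dl0 K'0 HK']]] := INV_open K eps K10.
have [Cb Cb0 hCb] := Bk_bound_unif K eps M0.
have cb : cont2 (bdiff u v) by move=> i k x; apply: cvgB; [exact: (@cont_Bk _ K eps _ cu)|exact: (@cont_Bk _ K eps _ cv)].
have hb i k x : `|bdiff u v i k x| <= 2 * Cb.
  by apply: (le_trans (ler_normB _ _)); have := hCb u bu i k x; have := hCb v bv i k x; lra.
(* This is the smallness asked by [INV_perturb]; adding 1 avoids a division by zero. *)
pose kap := (64 * (K' + 1))^-1.
have kap0 : 0 < kap by rewrite invr_gt0; lra.
have kK : 64 * (kap * K') <= 1.
  rewrite mulrA -[leRHS](_ : 64 * kap * (K' + 1) = 1); last first.
    by rewrite /kap mulrAC divff// gt_eqF//; lra.
  by apply: ler_wpM2l; lra.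
have c300 : 0 < 3 * (10 * 10) :> R by rewrite !mulr_gt0.
(* The constant of [sampling_error] is 3 (80 + 20) t^2 once [2 * Cb * l] and the tail of the
   coefficients are at most t, and t^2 <= t. *)
pose t := Num.min 1 (kap / (3 * (10 * 10))).
have t0 : 0 < t by rewrite lt_min ltr01; exact: divr_gt0.
have t1 : t <= 1 by rewrite ge_min lexx.
have tk : 3 * (10 * 10) * t <= kap by rewrite -(ler_pdivlMl _ _ c300) mulrC /t ge_min lexx orbT.
pose l := t / (1 + 4 * Cb); pose eta := t / (1 + 4 * M).
have c1 : 0 < 1 + 4 * Cb by lra.
have c2 : 0 < 1 + 4 * M by lra.
have l0 : 0 < l by rewrite divr_gt0.
have eta0 : 0 < eta by rewrite divr_gt0.
have [X HX] := as_uv eta eta0; pose m := (Num.truncn (X / l)).+1.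
have hm (x : R) : m%:R * l <= `|x| -> X <= `|x|.
  by apply: le_trans; rewrite -ler_pdivrMr// ltW// truncnS_gt.
have hd i k x : m%:R * l <= `|x| -> `|bdiff u v i k x| <= t.
  move=> /hm /HX[h1 h2]; apply: (le_trans (@Bk_close _ K eps M eta x x u v i k (ltW eta0) bu bv erefl h1 h2)).
  by rewrite /eta mulrA ler_pdivrMr// mulrC ler_pM2l//; lra.
pose Nop F := bmul (bdiff u v) (fadd F (cf (-1) (sampled l m F))).
have Na F G : Nop (fadd F G) = fadd (Nop F) (Nop G).
  by rewrite /Nop -bmul_fadd sampled_fadd cf_fadd fadd4.
have Nc z F : Nop (cf z F) = cf z (Nop F).
  by rewrite /Nop -bmul_cf ?bdiff_rot// cf_fadd sampled_cf (cf_comm (-1)).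
have Nb J : L2jet J -> isL2 (Nop (j0 J)) /\ n2 (Nop (j0 J)) <= kap * (n2 (j0 J) + n2 (j1 J)).
  move=> LJ; have [LN bN] := sampling_error l0 cb hb hd LJ; split => //.
  apply: (le_trans bN); apply: ler_wpM2r; first by rewrite addr_ge0// n2_ge0.
  have e1 : (2 * Cb) ^+ 2 * l ^+ 2 <= t ^+ 2.
    have q0 : 0 <= 2 * Cb * l by apply: mulr_ge0; [lra|exact: ltW].
    have q1 : 2 * Cb * l <= t by rewrite /l mulrA ler_pdivrMr// mulrC ler_pM2l//; lra.
    by rewrite -exprMn lerXn2r ?nnegrE// ltW.
  have e2 : t ^+ 2 <= t by rewrite expr2 ler_piMl// ltW.
  rewrite -(mulrA 80); move: ((2 * Cb) ^+ 2 * l ^+ 2) (t ^+ 2) e1 e2 tk => A B; clear; lra.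
pose S J := fadd (Lw v J) (Nop (j0 J)).
have clv := Lz_clinear K eps gv.
have clS : clinear S.
  split.
  - by move=> J J'; rewrite /S (cl_add clv) jadd0 Na fadd4.
  - by move=> z J; rewrite /S (cl_cj clv) cj0 Nc cf_fadd.
  - by move=> J LJ; apply: isL2_add; [exact: cl_L2|exact: (Nb J LJ).1].
pose A := [set: bool * 'I_(m + m)]%SET.
pose e (k : 'I_#|A|) := bmul (bdiff u v) (bump_field (enum_val k).1 (cell l (node (enum_val k).2))).
pose cn (k : 'I_#|A|) := (enum_val k).1; pose pn (k : 'I_#|A|) := (node (enum_val k).2)%:~R * l.
exists #|A|, cn, pn, S, e, dl, (4 * K').
split => //.
- by move=> k; exact: (bump_field_L2 _ _ _ cb hb).
- move=> J; rewrite (Lz_bdiff u v) /S; apply/funext => i; apply/funext => x; rewrite /fadd.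
  have -> : fsum (index_enum 'I_#|A|) (fun k => cf (ev cn pn k (j0 J)) (e k)) i x =
      bmul (bdiff u v) (sampled l m (j0 J)) i x.
    rewrite fsumE [RHS]/bmul.
    under [RHS]eq_bigr do rewrite sampled_sum mulr_sumr.
    rewrite [RHS]exchange_big/= [RHS](eq_bigl (fun p => p \in A)); last by move=> p; rewrite inE.
    rewrite [RHS]big_enum_val/=; apply: eq_bigr => k _.
    by rewrite /e -bmul_cf ?bdiff_rot.
  rewrite /Nop bmul_fadd cfN cf1 bmul_fscale /fadd /fscale; ring.
- by split => //; lra.
move=> h hr; have -> : opl S (z1 + h) = (fun J => fadd (opl (Lw v) (z1 + h) J) (Nop (j0 J))).
  by apply/funext => J; apply/funext => i; apply/funext => x; rewrite /opl /S /fadd; ring.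
apply: (INV_perturb (opl_clinear _ clv) K'0 (ltW kap0) kK Na Nc Nb).
apply: (HK' v M z1 _ gv _ Hi).
have dl00 := ltW dl0.
by rewrite opprD addrA subrr add0r -nc_sq normcN lerXn2r ?nnegrE ?nc_ge0.
Qed.

(** A Fredholm alternative: the a priori bound makes the determinant nonzero, which gives
    solvability. *)
Lemma fredholm u v M z (K1 K2 : R) : 0 <= M -> good u M -> good v M -> asymptotic u v -> 0 <= K1 ->
  INV (opl (Lw v) z) K1 -> Est (opl (Lw u) z) K2 -> exists2 K', 0 <= K' & INV (opl (Lw u) z) K'.
Proof.
move=> M0 gu gv as_uv K10 Hi hE.
have [n [c [p [S [e [r [K' [clS Le OpE [r0 K'0] Hd]]]]]]]] := reduction M0 gu gv as_uv K10 Hi.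
have Hz : INV (opl S z) K' by rewrite -[z]addr0; apply: Hd; rewrite Normc.normc0 ltW.
have /choice[W HW] : forall l, exists J, Sol (opl S z) (e l) J by move=> l; exact: sol_exists Hz (Le l).
have clu := Lz_clinear K eps gu.
have dt := redmx_det clu clS OpE HW hE.
exact: (redmx_INV clu clS Le OpE K'0 HW Hz dt).
Qed.

Lemma dichotomy u v M z1 K1 : 0 <= M -> good u M -> good v M -> asymptotic u v -> 0 <= K1 ->
  INV (opl (Lw v) z1) K1 ->
  (exists2 r, 0 < r & forall h, nc h <= r -> spectrum (linearization K eps u) (z1 + h)) \/
  (exists2 r, 0 < r & forall h, 0 < nc h <= r -> resolvent_set (linearization K eps u) (z1 + h)).
Proof.
move=> M0 gu gv as_uv K10 Hi.
have [n [c [p [S [e [r [K' [clS Le OpE [r0 K'0] Hd]]]]]]]] := reduction M0 gu gv as_uv K10 Hi.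
have [[r' r'0 H]|[r' r'0 H]] := isolated_or_not (Lz_clinear K eps gu) clS Le OpE r0 K'0 Hd; [left|right]; exists r' => // h hr.
  by move=> /(@res_good _ K eps u M _ gu)[C' _ I']; exact: (H h hr C').
by apply/(@res_good _ K eps u M _ gu); exact: H.
Qed.

End Instability.

(** * Persistence of unstable spectrum *)

Section Unstable.
Variables (R : realType) (K : klausmeier R) (eps : R).
Local Notation C := R[i].
Local Notation T := (kT K).
Local Notation nc := (@Normc.normc R).
Local Notation Lw := (Lz K eps).
Local Notation Lin u := (linearization K eps u).
Implicit Types (u v w : R -> R * R) (z h : C).

(** The constant is fixed before the profile [w] is known, so that it can be fed into a further
    transfer. *)
Lemma opl_est u M (K1 : R) : 0 <= M -> 0 <= K1 -> exists2 K2, 0 <= K2 & forall w z, good w M -> 0 <= complex.Re z ->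
  (forall J, L2jet J -> (q setT (j0 J) <= K1%:E * q setT (opl (Lw w) z J))%E) -> Est (opl (Lw w) z) K2.
Proof.
move=> M0 K10; have [Cc Cc0 hc] := cck_bound K eps; have [Cb Cb0 hCb] := Bk_bound_unif K eps M0.
have d2 : 0 <= 2 / dmin K by rewrite divr_ge0// ltW// dmin_gt0.
have c0 : 0 <= 1 + Cc ^+ 2 / dmin K + (8 * Cb + 0).
  by have : 0 <= Cc ^+ 2 / dmin K; [rewrite divr_ge0 ?sqr_ge0// ltW// dmin_gt0|lra].
exists (K1 + 2 / dmin K * ((1 + Cc ^+ 2 / dmin K + (8 * Cb + 0)) * K1 + 1)).
  by rewrite addr_ge0// mulr_ge0// addr_ge0// mulr_ge0.
move=> w z [bw cw] z0; rewrite -Lz_opl => H.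
apply: (@Est_j0 _ _ _ _ _ _ (dmin_gt0 K) (ddk_min K) (ddk_max K) (@cont_cck _ K eps) hc _ _ (@cont_Bk _ K eps _ cw) (hCb w bw)) => //.
by rewrite oppr0.
Qed.

Lemma large_imaginary u M : 0 <= M -> good u M -> exists X K2, forall z, 0 <= complex.Re z ->
  X <= `|complex.Im z| -> Est (opl (Lw u) z) K2.
Proof.
move=> M0 gu; have [bu cu] := gu; have [Cc Cc0 hc] := cck_bound K eps; have [Cb Cb0 hB] := Bk_bound K eps bu.
have [K2 _ H2] := opl_est u M0 ler01.
have [X HX] := @large_parameter _ _ _ _ _ _ (dmin_gt0 K) (ddk_min K) (ddk_max K) (fun=> erefl) (@cont_cck _ K eps) hc _ _ (@cont_Bk _ K eps _ cu) hB 0 (lexx 0).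
exists X, K2 => z z0 hz; apply: H2 => // J LJ; rewrite -Lz_opl; apply: HX => //; first by rewrite oppr0.
by right.
Qed.

Lemma nc_imag (t : R) : nc (0 +i* t)%C = `|t|.
Proof. by rewrite /= expr0n/= add0r sqrtr_sqr. Qed.

Lemma spectrum_closed u M z : good u M -> resolvent_set (Lin u) z ->
  exists2 dl, 0 < dl & forall z', zn (z - z') <= dl ^+ 2 -> resolvent_set (Lin u) z'.
Proof.
move=> gu /(@res_good _ K eps u M _ gu)[C1 C10 I1]; have [dl [K' [dl0 K'0 H]]] := INV_open K eps C10.
by exists dl => // z' hz; apply/(@res_good _ K eps u M _ gu); exists K' => //; exact: (H u M z).
Qed.

(* A vertical ray pointing away from the real axis meets the only exceptional point lam0 of the
   background at most at its origin; its last spectral point is isolated. *)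
Lemma isolated_unstable u v M (lam0 : R) : 0 <= M -> good u M -> good v M -> asymptotic u v ->
  (forall z, 0 < complex.Re z -> z <> lam0%:C%C -> exists2 K1, 0 <= K1 & INV (opl (Lw v) z) K1) ->
  spectrally_unstable (Lin u) -> exists z r, [/\ 0 < complex.Re z, 0 < r, spectrum (Lin u) z &
    forall h, 0 < nc h <= r -> resolvent_set (Lin u) (z + h)].
Proof.
move=> M0 gu gv as_uv hv [z sz z0].
have key y : spectrum (Lin u) y -> 0 < complex.Re y -> y <> lam0%:C%C -> exists z r, [/\ 0 < complex.Re z, 0 < r, spectrum (Lin u) z &
    forall h, 0 < nc h <= r -> resolvent_set (Lin u) (z + h)].
  case: y => a b sy /= a0 yl.
  (* The ray leaves the real axis, so its only point that may be real is its origin, which differs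
     from [lam0] by assumption. *)
  pose sg : R := if 0 <= b then 1 else -1; pose p (s : R) : C := (a +i* (b + sg * s))%C.
  have pl s : 0 <= s -> p s <> lam0%:C%C.
    move=> s0 [ea eb]; apply: yl; congr Complex => //.
    by move: eb; rewrite /sg; case: ifP => hb; [|move/negbT: hb; rewrite -ltNge]; lra.
  have psg s t : p (s + t) = p s + (0 +i* (sg * t))%C.
    by rewrite /p [RHS](_ : _ = ((a + 0) +i* (b + sg * s + sg * t))%C)// addr0 mulrDr addrA.
  have sg1 t : `|sg * t| = `|t| by rewrite normrM /sg; case: ifP; rewrite ?normrN normr1 mul1r.
  pose S : set R := [set s | 0 <= s /\ spectrum (Lin u) (p s)].
  have p0 : p 0 = (a +i* b)%C by rewrite /p mulr0 addr0.
  have S0 : S 0 by split; [exact: lexx|rewrite p0].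
  have [X [K2 HX]] := large_imaginary M0 gu.
  (* Far out on the ray the energy estimates give an a priori bound, which [fredholm] turns into
     invertibility. *)
  have Sub s : S s -> s <= `|X| + `|b|.
    move=> [s0 ss]; rewrite leNgt; apply/negP => lt; apply: ss; apply/(@res_good _ K eps u M _ gu).
    have [K1 K10 Hv] := hv (p s) a0 (pl s s0).
    apply: (fredholm M0 gu gv as_uv K10 Hv (K2 := K2)); apply: HX; first exact: ltW.
    rewrite /p /=; have := lerB_normD (sg * s) b; rewrite sg1 (ger0_norm s0) (addrC (sg * s)).
    by have := ler_norm X; lra.
  have hS : has_sup S by split; [exists 0|exists (`|X| + `|b|) => s /Sub].
  have supb s : S s -> s <= sup S by move=> Ss; exact: (sup_upper_bound hS).
  have s1 : 0 <= sup S by exact: supb.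
  have sp1 : spectrum (Lin u) (p (sup S)).
    move=> rs; have [dl dl0 H] := spectrum_closed gu rs.
    have [s Ss ls] := sup_adherent dl0 hS; apply: Ss.2; apply: H.
    have e : sup S = s + (sup S - s) by ring.
    rewrite {1}e psg addrAC subrr add0r -nc_sq nc_imag sg1.
    have h0 : 0 <= sup S - s by rewrite subr_ge0; exact: supb.
    have h1 : sup S - s <= dl by rewrite lerBlDr -lerBlDl ltW.
    by rewrite (ger0_norm h0); apply: lerXn2r; rewrite ?nnegrE; [exact: h0|exact: ltW|exact: h1].
  have [K1 K10 Hv] := hv (p (sup S)) a0 (pl _ s1).
  (* A full disc of spectrum around the last spectral point would continue the ray beyond the
     supremum. *)
  have [[r r0 H]|[r r0 H]] := dichotomy M0 gu gv as_uv K10 Hv; last by exists (p (sup S)), r.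
  have := supb (sup S + r); suff : S (sup S + r) by move=> Sr /(_ Sr); rewrite gerDl leNgt r0.
  split; first by rewrite addr_ge0// ltW.
  by rewrite psg; apply: H; rewrite nc_imag sg1 gtr0_norm.
have [ez|nz] := pselect (z = lam0%:C%C); last exact: key nz.
have [[r r0 H]|no] := pselect (exists2 r, 0 < r & forall h, 0 < nc h <= r -> resolvent_set (Lin u) (z + h)).
  by exists z, r.
have [h /andP[h0 hr] sh] : exists2 h, 0 < nc h <= complex.Re z / 2 & spectrum (Lin u) (z + h).
  apply: contrapT => nh; apply: no; exists (complex.Re z / 2); first by lra.
  by move=> h hh; apply: contrapT => sh; apply: nh; exists h.
have Reh : - nc h <= complex.Re h.
  have : `|complex.Re h| <= nc h.
    by case: (h) => x y /=; rewrite -sqrtr_sqr ler_wsqrtr// lerDl sqr_ge0.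
  by rewrite ler_norml => /andP[].
apply: (key (z + h)) => //.
  by case: (z) (h) z0 Reh hr => [a b] [c e] /=; lra.
move=> e; have h00 : h = 0 by apply: (addrI z); rewrite e -ez addr0.
by rewrite h00 Normc.normc0 ltxx in h0.
Qed.

Lemma close_mono (eta eta' r r' : R) w u : eta <= eta' -> r' <= r -> close K eta r w u -> close K eta' r' w u.
Proof.
move=> e1 e2 H x0; have [k hk] := H x0; exists k => x hx.
by have [h1 h2] := hk x (le_trans hx e2); split; [exact: le_trans h1 e1|exact: le_trans h2 e1].
Qed.

(* If w had no spectrum in the right half-plane, the maximum principle would propagate the resolvent
   bound from the boundary of a square around an isolated eigenvalue of u to its center. *)
Theorem unstable_close u v M (lam0 : R) : 0 <= M -> good u M -> good v M -> asymptotic u v ->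
  (forall z, 0 < complex.Re z -> z <> lam0%:C%C -> exists2 K1, 0 <= K1 & INV (opl (Lw v) z) K1) ->
  spectrally_unstable (Lin u) -> exists eta r, [/\ 0 < eta, 0 < r & forall w, good w M ->
    close K eta r w u -> close K eta r u w -> spectrally_unstable (Lin w)].
Proof.
move=> M0 gu gv as_uv hv us; have [[a b] [r0 [/= a0 r00 sz Hz]]] := isolated_unstable M0 gu gv as_uv hv us.
(* Half of [r0] keeps the punctured square among the regular points, and half of [a] keeps the
   square in the right half-plane. *)
pose rho := Num.min (r0 / 2) (a / 2).
have rho0 : 0 < rho by rewrite lt_min !divr_gt0.
have rho1 : rho <= r0 / 2 by rewrite ge_min lexx.
have rho2 : rho <= a / 2 by rewrite ge_min lexx orbT.
pose Sq : set (R * R) := `[a - rho, a + rho] `*` `[b - rho, b + rho].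
pose Q : set (R * R) := ([set a - rho] `*` `[b - rho, b + rho]) `|` ([set a + rho] `*` `[b - rho, b + rho]) `|`
  ((`[a - rho, a + rho] `*` [set b - rho]) `|` (`[a - rho, a + rho] `*` [set b + rho])).
have cSq : compact Sq by apply: compact_setX; exact: segment_compact.
have cQ : compact Q.
  by do 2 apply: compactU; apply: compact_setX; (exact: segment_compact || exact: compact_set1).
have QP x y : `|x| <= rho -> `|y| <= rho -> `|x| = rho \/ `|y| = rho -> Q (a + x, b + y).
  rewrite !ler_norml => /andP[x1 x2] /andP[y1 y2].
  have sgn (t : R) : `|t| = rho -> t = - rho \/ t = rho.
    by move=> <-; have [t0|t0] := leP 0 t; [right; rewrite ger0_norm|left; rewrite ltr0_norm// opprK].
  move=> [/sgn[->|->]|/sgn[->|->]]; rewrite /Q /=; [left; left|left; right|right; left|right; right];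
    split => //=; rewrite in_itv/=; apply/andP; split; lra.
have QR p : Q p -> resolvent_set (Lin u) (p.1 +i* p.2)%C.
  move=> Qp; have -> : (p.1 +i* p.2)%C = (a +i* b)%C + ((p.1 - a) +i* (p.2 - b))%C.
    by rewrite /GRing.add /=; congr Complex; rewrite -[RHS]/(_ + (_ - _)) addrCA subrr addr0.
  have [h1 h2 h3] : [/\ `|p.1 - a| <= rho, `|p.2 - b| <= rho & rho ^+ 2 <= (p.1 - a) ^+ 2 + (p.2 - b) ^+ 2].
    case: p Qp => x y; rewrite /Q /= !in_itv/= !ler_norml.
    have := sqr_ge0 (x - a); have := sqr_ge0 (y - b) => p1 p2.
    have e1 : (- rho) ^+ 2 = rho ^+ 2 by rewrite sqrrN.
    move=> [[[ex /andP[y1 y2]]|[ex /andP[y1 y2]]]|[[/andP[y1 y2] ex]|[/andP[y1 y2] ex]]]; rewrite ex.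
    - by rewrite (_ : a - rho - a = - rho) ?e1; [split; lra|ring].
    - by rewrite (_ : a + rho - a = rho); [split; lra|ring].
    - by rewrite (_ : b - rho - b = - rho) ?e1; [split; lra|ring].
    - by rewrite (_ : b + rho - b = rho); [split; lra|ring].
  apply: Hz; apply/andP; split.
    rewrite lt_neqAle nc_ge0 andbT eq_sym; apply/negP => /eqP n0.
    have := nc_sq ((p.1 - a) +i* (p.2 - b))%C; rewrite n0 expr0n /zn /= => e0.
    have : 0 < rho ^+ 2 by rewrite exprn_gt0.
    by rewrite -e0 in h3; move=> /lt_le_trans/(_ h3); rewrite ltxx.
  have n1 : nc ((p.1 - a) +i* (p.2 - b))%C <= `|p.1 - a| + `|p.2 - b|.
    rewrite -(@ler_pXn2r _ 2) ?nnegrE ?nc_ge0 ?addr_ge0// nc_sq /zn /= [leRHS]sqrrD !real_normK ?num_real//.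
    by have : 0 <= `|p.1 - a| * `|p.2 - b|; [rewrite mulr_ge0|lra].
  by apply: (le_trans n1); lra.
have [C1 C10 HC1] := compact_INV gu cQ QR.
(* Two transfers with constants fixed before [w]: from [u] to [w] on the boundary of the square, and
   back from [w] to [u] at its center. *)
have [e1 [r1 [K1 [e10 r10 K10 H1]]]] := INV_close K eps M0 C10.
have [K2 K20 H2] := opl_est u M0 K10.
have [e2 [r2 [K3 [e20 r20 K30 H3]]]] := INV_close K eps M0 K20.
exists (Num.min e1 e2), (Num.max r1 r2); split; [by rewrite lt_min e10|by rewrite lt_max r10|].
move=> w gw cwu cuw; apply: contrapT => nu.
have res z : 0 < complex.Re z -> resolvent_set (Lin w) z.
  by move=> z0; apply: contrapT => nz; apply: nu; exists z.
(* This bound depends on [w] and is not uniform; the maximum principle uses only that it exists. *)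
have [K4 K40 H4] : exists2 C, 0 <= C & forall p, Sq p -> INV (opl (Lw w) (p.1 +i* p.2)%C) C.
  by apply: (compact_INV gw cSq) => -[x y] [/=]; rewrite !in_itv/= => /andP[x1 _] _; apply: res => /=; lra.
have sumE x y : (a +i* b)%C + (x +i* y)%C = ((a + x) +i* (b + y))%C by [].
have clw := Lz_clinear K eps gw.
have Hsq x y : `|x| <= rho -> `|y| <= rho -> INV (opl (Lw w) ((a +i* b)%C + (x +i* y)%C)) K4.
  rewrite !ler_norml => /andP[x1 x2] /andP[y1 y2]; rewrite sumE; apply: (H4 (a + x, b + y)).
  by split; rewrite /= in_itv/=; apply/andP; split; lra.
have Hbd x y : `|x| <= rho -> `|y| <= rho -> `|x| = rho \/ `|y| = rho -> Est (opl (Lw w) ((a +i* b)%C + (x +i* y)%C)) K1.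
  move=> hx hy hb; rewrite sumE; have := H1 w u gw gu (close_mono _ _ cwu) ((a + x) +i* (b + y))%C (HC1 _ (QP x y hx hy hb)).
  by case; rewrite ?ge_min ?le_max ?lexx.
have I0 : INV (opl (Lw w) (a +i* b)%C) K4.
  by have := Hsq 0 0; rewrite normr0 addr0; apply; exact: ltW.
have E0 : Est (opl (Lw w) (a +i* b)%C) K2.
  apply: (H2 w _ gw); first exact: ltW a0.
  move=> J LJ; have LG := cl_L2 (opl_clinear (a +i* b)%C clw) LJ; have [L0 _ _] := jet_L2 LJ.
  rewrite (n2E L0) (n2E LG) -EFinM lee_fin.
  by apply: (max_principle clw rho0 K10 K40 Hsq Hbd LG); split; [exact: LJ|exact: aeW].
have I2 := Est_INV I0 E0.
apply: sz; apply/(@res_good _ K eps u M _ gu); exists K3; first exact: K30.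
apply: (H3 u w gu gw _ _ I2).
by apply: close_mono cuw; rewrite ?ge_min ?le_max ?lexx ?orbT.
Qed.

End Unstable.

(** * Periodic solutions near a multipulse and their spectral stability *)

Theorem corollary8p9 (R : realType) (K : klausmeier R)
  (z0 : R -> R * R) (v0 : R * R) (u0 : R -> R * R) (Psi : R -> R[i] * R[i])
  (Hprimary : primary_pulse K z0 v0 u0 Psi)
  (C eps0 eta : R) (Z V U : R -> R -> R * R) (lam0 : R -> R)
  (Hbranch : primary_branch K v0 u0 Psi C eps0 eta Z V U lam0)
  (eps : R) (eps_neq0 : eps != 0) (eps_small : `|eps| < eps0)
  (M N0 : nat) (b : nat -> R -> R * R) (theta : nat -> nat -> R -> R)
  (Hmulti : multipulse_family K eps (U eps) M N0 b theta)
  (ntilde : nat) (Hntilde : (N0 <= ntilde)%N)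
  (u z v : R -> R * R)
  (Hu : u = multipulse K M (U eps) b theta ntilde)
  (Hv : v = V eps)
  (Hz : H2line z) (Hsplit : forall x : R, u x = z x + v x)
  (chi : nat -> R -> R) (nchi : nat)
  (Hchi : forall n, (nchi <= n)%N -> periodic_cutoff K n (chi n)) :
  exists (N : nat) (a un : nat -> R -> R * R),
    (forall n, (N <= n)%N ->
      [/\ H2per (n%:R * kT K) (a n),
          H2per (n%:R * kT K) (un n) /\ stationary K eps (un n),
          forall x : R, - (n%:R / 2 * kT K) <= x < n%:R / 2 * kT K ->
            un n x = chi n x *: u x + (1 - chi n x) *: v x + a n x,
          strongly_spectrally_stable (linearization K eps u) ->
            strongly_spectrally_stable (linearization K eps (un n)) &
          spectrally_unstable (linearization K eps u) ->
            spectrally_unstable (linearization K eps (un n))])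
    /\ (fun n => H2per_norm (n%:R * kT K) (a n)) @ \oo --> (0 : R).
Proof.
have T0 := kT_gt0 K.
have he : 0 < `|eps| < eps0 by rewrite normr_gt0 eps_neq0.
have su : stationary K eps u by rewrite Hu; exact: mp_stationary Hmulti _ Hntilde.
have pv : periodic v (kT K) by rewrite Hv; have [] := pb_H2per Hbranch he.
have nd : Defs.nondegenerate K eps u by rewrite Hu; exact: mp_nondegenerate Hmulti _ Hntilde.
have [M1 [M10 gu1 gv1 as_uv]] := background_good su Hsplit Hz pv.
have [K00 K000 I0] := (@res_good _ K eps u M1 0 gu1).1 nd.
have I0' : INV (Lk K eps u 0 0) K00 by rewrite -[Lk _ _ _ _ _]/(Lk K eps u (complex.Re 0) (complex.Im 0)) Lz_opl.
have [N [kappa [a [un [M2 [van M20 gu2 H Hclose]]]]]] := periodic_solutions su Hsplit Hz pv K000 I0' Hchi.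
pose M3 := M1 + M2; have M30 : 0 <= M3 by exact: addr_ge0.
have good_le w (Ma Mb : R) : Ma <= Mb -> good w Ma -> good w Mb.
  by move=> le [bw cw]; split => // x; have [h1 h2] := bw x; split; [exact: le_trans le|exact: le_trans le].
have gu : good u M3 by apply: good_le gu1; rewrite /M3 lerDl.
have gv : good v M3 by apply: good_le gv1; rewrite /M3 lerDl.
have gn n : (N <= n)%N -> good (un n) M3.
  by move=> hn; have [_ _ _ _ g] := H n hn; apply: good_le g; rewrite /M3 lerDr.
(* In the right half-plane the primary pulse [U eps] has at most the spectral point [lam0 eps], and
   the background is a limit of its translates. *)
have hv lam : 0 < complex.Re lam -> lam <> (lam0 eps)%:C%C -> exists2 K1, 0 <= K1 & INV (opl (Lz K eps v) lam) K1.
  move=> lam_gt0 lam_neq.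
  have [M4 [M40 gU gV as_UV]] := background_good (pb_stationary Hbranch he)
    (pb_split Hbranch he) (pb_H2 Hbranch he) (proj1 (pb_H2per Hbranch he)).
  have [C1 C10 I1] : exists2 C1, 0 <= C1 & INV (opl (Lz K eps (U eps)) lam) C1.
    apply/(@res_good _ K eps (U eps) M4 lam gU); apply: contrapT => sz.
    by have [|//] := pb_spectrum Hbranch he sz; have := pb_eta_gt0 Hbranch; lra.
  have [e1 [r1 [K1 [e10 r10 K10 H1]]]] := INV_close K eps M40 C10.
  exists K1; [exact: K10|]; rewrite Hv; apply: (H1 _ (U eps) gV gU _ lam I1).
  by apply: background_close as_UV e10; rewrite -Hv.
have [Ns HNs] : exists Ns, forall n, (N <= n)%N -> (Ns <= n)%N -> strongly_spectrally_stable (linearization K eps u) ->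
    strongly_spectrally_stable (linearization K eps (un n)).
  (* The threshold for n has to be chosen ahead of the hypothesis on [u]; when that hypothesis
     fails, the implication is void. *)
  have [st|nst] := pselect (strongly_spectrally_stable (linearization K eps u)); last by exists 0%N => n _ _ /nst.
  have [e1 [r1 [e10 r10 H1]]] := stable_close M30 gu st.
  have [Ns HNs] := Hclose e1 r1 e10 (ltW r10); exists Ns => n hN hn _.
  by apply: H1; [exact: gn|have [] := HNs n hn].
have [Nu HNu] : exists Nu, forall n, (N <= n)%N -> (Nu <= n)%N -> spectrally_unstable (linearization K eps u) ->
    spectrally_unstable (linearization K eps (un n)).
  have [st|nst] := pselect (spectrally_unstable (linearization K eps u)); last by exists 0%N => n _ _ /nst.
  have [e1 [r1 [e10 r10 H1]]] := unstable_close M30 gu gv as_uv hv st.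
  have [Nu HNu] := Hclose e1 r1 e10 (ltW r10); exists Nu => n hN hn _.
  by have [h1 h2] := HNu n hn; apply: H1 => //; exact: gn.
exists (maxn N (maxn Ns Nu)), a, un; split.
  move=> n; rewrite !geq_max => /andP[hN /andP[hs hu]]; have [h1 h2 h3 _ _] := H n hN.
  by split; [exact: h1|exact: h2|exact: h3|exact: HNs|exact: HNu].
apply/cvgrPdist_le => e e0; have [N' HN'] := van e e0.
exists (maxn N N') => // n /=; rewrite geq_max => /andP[hN hn']; have [_ _ _ hk _] := H n hN.
by rewrite sub0r normrN ger0_norm ?sqrtr_ge0//; exact: le_trans hk (HN' n hn').
Qed.
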